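(* Let $I=[0,1]$ and assume that $k\in L^1(I)$ with $k\ge 0$ a.e., that $g\in C^1(\mathbb{R})$ with $g(0)=0$ and $g'(J)\ge 0$ for all $J\in\mathbb{R}$, and that $\alpha\in BV_{loc}\cap L^\infty([0,\infty);[0,1])$ (so $\alpha(t)\ge 0$). Let $(\rho_0,J_0)\in L^\infty(I)$ with $\int_I\rho_0\,dx=0$. Then there exists a unique function $(\rho,J):I\times[0,+\infty)\to\mathbb{R}^2$ which is a weak solution (in the sense defined in the context) of $$\partial_t\rho+\partial_xJ=0,\qquad \partial_tJ+\partial_x\rho=-2k(x)\alpha(t)g(J),\qquad x\in I,\ t\ge 0,$$ $$(\rho,J)(\cdot,0)=(\rho_0,J_0),\qquad J(0,t)=J(1,t)=0 .$$ Moreover: (Conservation of mass) $\int_I\rho(x,t)\,dx=0$ for all $t>0$. (Invariant domain) Set $f^\pm=\frac{\rho\pm J}{2}$, $f_0^\pm=\frac{\rho_0\pm J_0}{2}$, and $$M=\max\{\operatorname{ess\,sup}_I f_0^+,\operatorname{ess\,sup}_I f_0^-\},\qquad m=\min\{\operatorname{ess\,inf}_I f_0^+,\operatorname{ess\,inf}_I f_0^-\}.$$ Then $$m\le f^\pm(x,t)\le M,\qquad |J(x,t)|\le M-m\qquad\text{for a.e. }(x,t).$$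
   Context: Definition of weak solution. A weak solution of the initial-boundary value problem above is a function $(\rho,J):I\times[0,+\infty)\to\mathbb{R}^2$ such that: (a) the map $[0,\infty)\ni t\mapsto(\rho,J)(\cdot,t)\in L^\infty(I)\subset L^1(I)$ is continuous with respect to the $L^1(I)$ norm and satisfies $(\rho,J)(\cdot,0)=(\rho_0,J_0)$; (b) the first equation holds in the distributional sense in $[0,1]\times(0,\infty)$ (i.e. up to the boundary in $x$), that is, $$\int_0^\infty\int_0^1\{\rho\,\partial_t\phi+J\,\partial_x\phi\}\,dx\,dt=0$$ for all $\phi\in C^1([0,1]\times(0,\infty))$ with compact support in $[0,1]\times(0,\infty)$ (this encodes the boundary condition $J(0,t)=J(1,t)=0$); and the second equation holds in the distributional sense in $(0,1)\times(0,\infty)$, that is, $$\int_0^\infty\int_0^1\{J\,\partial_t\phi+\rho\,\partial_x\phi-2k(x)\alpha(t)g(J)\,\phi\}\,dx\,dt=0$$ for all $\phi\in C^1$ with compact support in $(0,1)\times(0,\infty)$. *)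

(* Defs.v *)
(* Functions on I = [0, 1], on [0, +oo[ and on I x [0, +oo[ are represented by
   functions on R and on R * R (space variable first, time variable second)
   whose values outside these sets are irrelevant.  Measurability is Borel
   measurability on the set concerned; every Lebesgue class has such a
   representative. *)
From HB Require Import structures.
From mathcomp Require Import all_boot all_order all_algebra.
From mathcomp Require Import all_classical all_reals all_analysis ess_sup_inf.

Set Implicit Arguments.
Unset Strict Implicit.
Unset Printing Implicit Defensive.

Import Order.TTheory GRing.Theory Num.Theory.
Import numFieldNormedType.Exports.

Local Open Scope classical_set_scope.
Local Open Scope ring_scope.

Notation leb := lebesgue_measure.

Definition I01 {R : realType} : set R := `[0, 1]%classic.
Definition Rge0 {R : realType} : set R := `[0, +oo[%classic.
Definition Rgt0 {R : realType} : set R := `]0, +oo[%classic.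

Lemma measurable_I01 (R : realType) :
  measurable (I01 : set (measurableTypeR R)).
Proof. exact: measurable_itv. Qed.

Definition lebI {R : realType} : set (measurableTypeR R) -> \bar R :=
  mrestr leb (@measurable_I01 R).
HB.instance Definition _ (R : realType) := Measure.on (@lebI R).

Definition Linfty_I {R : realType} (f : R -> R) : Prop :=
  measurable_fun I01 f /\ finite_norm lebI +oo%E f.

Definition C1_line {R : realType} (g : R -> R) : Prop :=
  (forall y, derivable g y 1) /\ continuous (derive1 g).

(* Elements of BV_loc are classes modulo equality almost everywhere: some
   representative has bounded (pointwise) variation on every [0, T]. *)
Definition BV_loc {R : realType} (alpha : R -> R) : Prop :=
  exists beta : R -> R,
    {ae leb, forall t, Rge0 t -> alpha t = beta t} /\
    forall T : R, 0 <= T -> bounded_variation 0 T beta.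

Definition partial_x {R : realType} (phi : R * R -> R) (p : R * R) : R :=
  derive1 (fun x => phi (x, p.2)) p.1.
Definition partial_t {R : realType} (phi : R * R -> R) (p : R * R) : R :=
  derive1 (fun t => phi (p.1, t)) p.2.

(* On a set that is not open, such as [0, 1] x ]0, +oo[, being C^1 means being
   the restriction of a C^1 function defined on an open neighbourhood. *)
Definition C1_on {R : realType} (Omega : set (R * R)) (phi : R * R -> R)
    : Prop :=
  exists U : set (R * R), [/\ open U, Omega `<=` U &
    forall p, U p ->
      [/\ derivable (fun x => phi (x, p.2)) p.1 1,
          derivable (fun t => phi (p.1, t)) p.2 1,
          {for p, continuous (partial_x phi)} &
          {for p, continuous (partial_t phi)}]].

(* The closure is taken in the plane; requiring it to be compact and contained
   in Omega amounts to compactness of the support relative to Omega. *)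
Definition compact_support_in {R : realType} (Omega : set (R * R))
    (phi : R * R -> R) : Prop :=
  let S := closure (Omega `&` [set p | phi p != 0]) in
  compact S /\ S `<=` Omega.

Definition test_function {R : realType} (Omega : set (R * R))
    (phi : R * R -> R) : Prop :=
  C1_on Omega phi /\ compact_support_in Omega phi.

(* Integrability over X x ]0, +oo[ is the requirement that the integral make
   sense. *)
Definition integrates_to_zero {R : realType} (X : set R) (h : R * R -> R)
    : Prop :=
  ((leb \x leb)%E).-integrable (X `*` Rgt0) (EFin \o h) /\
  (\int[leb]_(t in Rgt0) \int[leb]_(x in X) (h (x, t))%:E = 0)%E.

Definition L1_continuous {R : realType} (u : R * R -> R) : Prop :=
  forall s : R, 0 <= s ->
    (\int[leb]_(x in I01) `|u (x, t) - u (x, s)|%:E)%E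
      @[t --> within Rge0 (nbhs s)] --> 0%E.

(* The requirement of measurability in both variables is implicit in the double
   integrals. *)
Record weak_solution {R : realType} (k alpha g rho0 J0 : R -> R)
    (rho J : R * R -> R) : Prop := WeakSolution {
  ws_measurable :
    measurable_fun (I01 `*` Rge0) rho /\ measurable_fun (I01 `*` Rge0) J ;
  ws_Linfty : forall t, 0 <= t ->
    Linfty_I (fun x => rho (x, t)) /\ Linfty_I (fun x => J (x, t)) ;
  ws_continuous : L1_continuous rho /\ L1_continuous J ;
  ws_initial :
    {ae leb, forall x, I01 x -> rho (x, 0) = rho0 x /\ J (x, 0) = J0 x} ;
  ws_mass_eq : forall phi, test_function (I01 `*` Rgt0) phi ->
    integrates_to_zero I01
      (fun p => rho p * partial_t phi p + J p * partial_x phi p) ;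
  ws_momentum_eq : forall phi, test_function (`]0, 1[ `*` Rgt0) phi ->
    integrates_to_zero `]0, 1[
      (fun p => J p * partial_t phi p + rho p * partial_x phi p
                - 2 * k p.1 * alpha p.2 * g (J p) * phi p)
}.

(* Main.v *)
(* Put F(y, t) = f^+(y, t) for 0 <= y < 1 and F(y, t) = f^-(-y, t) for
   -1 <= y < 0, and extend F in y with period 2.  The boundary condition J = 0
   means that f^+ and f^- agree at 0 and 1, so that the problem becomes the
   single equation F_t + F_y = - K(y) alpha(t) gam(y, F(y) - F(-y)) on the
   circle, K being the even periodic extension of k.  In the Lagrangian
   variable z = y - t, H(z, t) = F(z + t, t) solves an integral equation in t
   alone, coupled only to its value at the reflected point -z - 2t.

   Existence: since K is integrable, its integrals over short windows are
   uniformly small, and Picard iteration converges in a norm weighted by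
   exp(-l t).  As g is nondecreasing with g 0 = 0, the source pulls H(z, t)
   and H(-z - 2t, t) towards each other, which keeps H between m and M.

   Uniqueness: as g is nondecreasing, the L^1 distance between two bounded
   solutions of the integral equation does not increase.  A weak solution that
   is bounded near a time satisfies the integral equation there.  A priori a
   weak solution is bounded only at each fixed time, but the times at which it
   satisfies a given bound form a closed set; by Baire's theorem one bound
   holds on a relatively open part of the set of singular times, and comparison
   with a bounded solution started there shows that it is empty. *)

Require Import Defs.
From HB Require Import structures.
From mathcomp Require Import all_boot all_order all_algebra.
From mathcomp Require Import all_classical all_reals all_analysis ess_sup_inf measurable_realfun.
From mathcomp Require Import ring lra.

Set Implicit Arguments.
Unset Strict Implicit.
Unset Printing Implicit Defensive.

Import Order.TTheory GRing.Theory Num.Theory.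
Import numFieldNormedType.Exports.

Local Open Scope classical_set_scope.
Local Open Scope ring_scope.

(** * Periodic functions *)

(** The obstacle throughout is that [k] is only integrable, so the source is unbounded. Time
    estimates are therefore made along characteristics, where the source is dominated by [K (z + s)]
    and a short time costs little, uniformly in [z]. In the L^1 comparison the difference of the two
    sources is odd under the reflection and has the sign of the difference of the two solutions at a
    point minus the same at its mirror image; pairing the two points gives dissipation. Since the
    equation only links two fixed times, the sign is frozen at the later one, and the resulting
    error is small per unit of time. A weak solution is tested with a travelling profile
    [eta (y - t)]. Its even part in [y] is admissible in the mass equation, which allows tests up to
    the boundary. Its odd part must be cut off for the momentum equation; the derivative of the
    cut-off is large, but the odd part vanishes at the boundary, and the product stays bounded on a
    shrinking layer. Conversely, the integral equation requires a test function to be differentiated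
    only along characteristics, so its unfolding need only be continuous across the points of
    reflection. *)

Section AlmostEverywhere.
Context d (T : measurableType d) (R : realType) (mu : {measure set T -> \bar R}).

Lemma ae_imply (P Q : T -> Prop) : (forall x, P x -> Q x) ->
  {ae mu, forall x, P x} -> {ae mu, forall x, Q x}.
Proof. by move=> PQ; apply: filterS. Qed.

Lemma ae_and (P Q : T -> Prop) :
  {ae mu, forall x, P x} -> {ae mu, forall x, Q x} ->
  {ae mu, forall x, P x /\ Q x}.
Proof. by move=> aP aQ; apply: filterI. Qed.

Lemma ae_all (P : T -> Prop) : (forall x, P x) -> {ae mu, forall x, P x}.
Proof. by move=> aP; apply: (ae_imply (P := fun=> True)); [|exact: filterT]. Qed.

End AlmostEverywhere.

(** * Lebesgue measure under translations and reflections of the line *)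

Section LineIsometry.
Context {R : realType}.
Implicit Types (s c x : R) (f : R -> \bar R).

Definition isom s c : R -> R := fun x => s * x + c.

Lemma measurable_isom s c : measurable_fun [set: R] (isom s c).
Proof. by apply: measurable_funD => //; exact: measurable_funM. Qed.

(** By uniqueness of Lebesgue measure it is enough to compare lengths of half-open intervals; for
    [s = -1] the preimage is closed at the other end, which leaves the length unchanged. *)
Lemma leb_isom s c (A : set R) : s = 1 \/ s = -1 -> measurable A ->
  leb (isom s c @^-1` A) = leb A.
Proof.
move=> s1 mA.
pose T := measurableTypeR R.
pose phi : T -> T := isom s c.
have mphi : measurable_fun [set: T] phi := measurable_isom s c.
pose mphi_mixin := isMeasurableFun.Build _ _ _ _ _ mphi.
pose mphi_pack : {mfun T >-> T} := HB.pack phi mphi_mixin.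
rewrite -[LHS]/(pushforward leb mphi_pack A).
symmetry; apply: lebesgue_measure_unique => // X [[a b]] _ <- /=.
rewrite /pushforward lebesgue_measure_itv/=.
case: s1 => s1.
- rewrite (_ : _ @^-1` _ = `]a - c, b - c]%classic); last first.
    by apply/seteqP; split=> x /=; rewrite ?in_itv/= /phi /isom ?s1 ?in_itv/=; lra.
  rewrite lebesgue_measure_itv/= !lte_fin ltrD2r.
  by case: ifP => // _; rewrite -!EFinB; congr EFin; ring.
- rewrite (_ : _ @^-1` _ = `[c - b, c - a[%classic); last first.
    by apply/seteqP; split=> x /=; rewrite ?in_itv/= /phi /isom ?s1 ?in_itv/=; lra.
  rewrite lebesgue_measure_itv/= !lte_fin ltrD2l ltrN2.
  by case: ifP => // _; rewrite -!EFinB; congr EFin; ring.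
Qed.

Lemma ge0_integral_isom s c f (D : set R) : s = 1 \/ s = -1 ->
  measurable D -> measurable_fun setT f -> (forall x, 0 <= f x)%E ->
  (\int[leb]_(x in D) f x = \int[leb]_(x in isom s c @^-1` D) f (isom s c x))%E.
Proof.
move=> s1 mD mf f0.
pose T := measurableTypeR R.
have mphi : measurable_fun [set: T] (isom s c : T -> T) := measurable_isom s c.
rewrite -(ge0_integral_pushforward mphi)//; last exact: measurable_funTS.
apply: eq_measure_integral => A mA _; rewrite /pushforward.
by symmetry; exact: leb_isom.
Qed.

Lemma ae_isom s c (Q : R -> Prop) : s = 1 \/ s = -1 ->
  {ae leb, forall x, Q x} -> {ae leb, forall x, Q (isom s c x)}.
Proof.
move=> s1 [N [mN N0 QN]]; exists (isom s c @^-1` N); split.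
- by rewrite -[X in measurable X]setTI; exact: measurable_isom.
- by rewrite leb_isom.
- by move=> x /= nQ; apply: QN.
Qed.

Lemma ae_shift c (Q : R -> Prop) :
  {ae leb, forall x, Q x} -> {ae leb, forall x, Q (x + c)}.
Proof.
move=> /(@ae_isom 1 c _ (or_introl erefl)); apply: ae_imply => x.
by rewrite /isom mul1r.
Qed.

Lemma ae_reflect c (Q : R -> Prop) :
  {ae leb, forall x, Q x} -> {ae leb, forall x, Q (c - x)}.
Proof.
move=> /(@ae_isom (-1) c _ (or_intror erefl)); apply: ae_imply => x.
by rewrite /isom mulN1r addrC.
Qed.

End LineIsometry.

Section Periodic.
Context {R : realType}.
Implicit Types (c x : R).

Definition period : set R := `[-1, 1[%classic.

Lemma measurable_period : measurable (period : set R).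
Proof. exact: measurable_itv. Qed.

Definition periodic2 (V : Type) (u : R -> V) := forall x, u (x + 2) = u x.

Lemma periodicz (V : Type) (u : R -> V) (j : int) x : periodic2 u ->
  u (x + 2 * j%:~R) = u x.
Proof.
move=> pu.
have pn n y : u (y + 2 * n%:R) = u y.
  elim: n => [|n IH]; first by rewrite mulr0 addr0.
  by rewrite -[RHS]IH -[RHS]pu; congr u; rewrite -natr1; ring.
case: j => n; first exact: pn.
rewrite NegzE mulrNz -(pn n.+1 (x + _)); congr u; ring.
Qed.

(** The representative modulo 2 in the fundamental domain [period]. Functions on the circle of
    length 2 are handled as periodic functions on the line. *)
Definition rep x : R := x - 2 * (Num.floor ((x + 1) / 2))%:~R.

Lemma rep_period x : period (rep x).
Proof.
rewrite /period/= in_itv/= /rep.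
have := floor_itv ((x + 1) / 2); rewrite intrD1 => /andP[h1 h2].
by apply/andP; split; lra.
Qed.

Lemma rep_id x : period x -> rep x = x.
Proof.
rewrite /period/= in_itv/= => /andP[x1 x2]; rewrite /rep.
rewrite (@floor_def _ _ 0) ?mulr0 ?subr0// intrD1.
by apply/andP; split; lra.
Qed.

Lemma rep_periodic : periodic2 rep.
Proof.
move=> x; rewrite /rep (_ : (x + 2 + 1) / 2 = (x + 1) / 2 + 1); last by field.
rewrite floorDrz; last exact: rpred1.
by rewrite floor1 intrD1; ring.
Qed.

Lemma rep_repN x : rep (- rep x) = rep (- x).
Proof.
rewrite {2}/rep opprB addrC.
by rewrite (periodicz _ _ rep_periodic).
Qed.

Lemma measurable_rep : measurable_fun [set: R] rep.
Proof.
apply: measurable_funB => //; apply: measurable_funM => //.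
apply: nondecreasing_measurable => // x y xy.
rewrite ler_int; apply: le_floor.
by rewrite ler_pM2r// lerD2r.
Qed.

(** After [c] is replaced by its representative [a] in [0, 2[, the translated window is [-1 + a, 1[
    followed by [1, 1 + a[; moving the second piece back by one period restores [period]. *)
Lemma ge0_integral_periodic_shift (u : R -> \bar R) c :
  measurable_fun setT u -> (forall x, 0 <= u x)%E -> periodic2 u ->
  (\int[leb]_(x in period) u (x + c)%R = \int[leb]_(x in period) u x)%E.
Proof.
move=> mu u0 pu.
pose a := rep (c - 1) + 1.
have [a0 a2] : 0 <= a /\ a < 2.
  have := rep_period (c - 1); rewrite /period/= in_itv/= /a => /andP[*].
  by split; lra.
have ua x : u (x + c) = u (x + a).
  rewrite /a /rep; set j := Num.floor _.
  rewrite -(periodicz (- j) (x + c) pu); congr u; rewrite mulrNz; ring.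
under eq_integral do rewrite ua.
have Iab (b : bool) (d : bool) (p q r : R) :
    (\int[leb]_(x in [set` Interval (BSide b p) (BSide d q)]) u (x + r)%R =
    \int[leb]_(x in [set` Interval (BSide b (p + r)%R) (BSide d (q + r)%R)]) u x)%E.
  rewrite (@ge0_integral_isom _ 1 r u)//; last by left.
  rewrite /isom; under [RHS]eq_integral do rewrite mul1r.
  congr (integral _ _ _); apply/seteqP; split => x /=; rewrite !itv_boundlr/=;
    move=> /andP[]; case: b; case: d; rewrite !bnd_simp => *; apply/andP; split; lra.
rewrite Iab.
have mI (b d : itv_bound R) : measurable [set` Interval b d] by [].
transitivity (\int[leb]_(x in `[(-1 + a)%R, 1%R[%classic `|` `[1%R, (1 + a)%R[%classic) u x)%E.
  congr (integral _ _ _); apply/seteqP; split => x /=; rewrite !in_itv/=.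
    move=> /andP[x1 x2]; case: (ltrP x 1) => x3; [left|right]; lra.
  by case; lra.
rewrite ge0_integral_setU//; last 2 first.
- exact: measurable_funTS.
- by apply/disj_setPS => x /=; rewrite !in_itv/=; lra.
transitivity (\int[leb]_(x in `[(-1)%R, (-1 + a)%R[%classic `|` `[(-1 + a)%R, 1%R[%classic) u x)%E;
    last first.
  congr (integral _ _ _); apply/seteqP; split => x /=; rewrite /period/= !in_itv/=.
    by case; lra.
  move=> /andP[x1 x2]; case: (ltrP x (-1 + a)) => x3; [left|right]; lra.
rewrite ge0_integral_setU//; last 2 first.
- exact: measurable_funTS.
- by apply/disj_setPS => x /=; rewrite !in_itv/=; lra.
rewrite addeC; congr (_ + _)%E.
transitivity (\int[leb]_(x in `[(-1)%R, (-1 + a)%R[) u (x + 2)%R)%E; last first.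
  by apply: eq_integral => x _; rewrite pu.
rewrite Iab (_ : -1 + 2 = 1); last by ring.
by rewrite (_ : -1 + a + 2 = 1 + a)//; ring.
Qed.

(** The shift reduces the claim to [c = 0], where the reflected window ]-1, 1] differs from [period]
    by end points only. *)
Lemma ge0_integral_periodic_reflect (u : R -> \bar R) c :
  measurable_fun setT u -> (forall x, 0 <= u x)%E -> periodic2 u ->
  (\int[leb]_(x in period) u (c - x)%R = \int[leb]_(x in period) u x)%E.
Proof.
move=> mu u0 pu.
have mv : measurable_fun setT (fun x => u (- x)).
  by apply: (measurableT_comp mu); exact: oppr_measurable.
transitivity (\int[leb]_(x in period) u (- x)%R)%E.
  rewrite -(@ge0_integral_periodic_shift (fun x => u (- x)) (- c))//.
    by apply: eq_integral => x _; congr u; ring.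
  by move=> x /=; rewrite opprD -[LHS]pu subrK.
rewrite (@ge0_integral_isom _ (-1) 0 _ _)//; last 2 first.
- by right.
- exact: measurable_period.
under eq_integral do rewrite /isom addr0 mulN1r opprK.
rewrite /period (_ : isom _ _ @^-1` _ = `]-1, 1]%classic); last first.
  by apply/seteqP; split => x /=; rewrite /isom !in_itv/=; lra.
rewrite integral_itv_obnd_cbnd; last exact: measurable_funTS.
by rewrite integral_itv_bndo_bndc//; exact: measurable_funTS.
Qed.

(** The translates of [period] by even integers cover the line, and [aen] collects their countably
    many exceptional null sets. *)
Lemma ae_periodic (Q : R -> Prop) : (forall x, Q (x + 2) <-> Q x) ->
  {ae leb, forall x, period x -> Q x} -> {ae leb, forall x, Q x}.
Proof.
move=> pQ /= ae.
have aen : {ae leb, forall x, forall n, (period (x + 2 * n%:R) -> Q (x + 2 * n%:R))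
   /\ (period (x - 2 * n%:R) -> Q (x - 2 * n%:R))}.
  apply/ae_foralln => n.
  have h1 := ae_shift (2 * n%:R) ae; have h2 := ae_shift (- (2 * n%:R)) ae.
  exact: (ae_and h1 h2).
move: aen; apply: ae_imply => x /= h.
have pQ' : periodic2 Q by move=> y; apply/propext/pQ.
have := rep_period x; rewrite /rep; set j := Num.floor _.
case: j => n.
  move=> px; rewrite -(periodicz (- (n : int)) x pQ') mulrNz mulrN.
  by case: (h n) => _; apply.
rewrite NegzE mulrNz mulrN opprK => px.
rewrite -(periodicz (n.+1 : int) x pQ').
by case: (h n.+1) => + _; apply.
Qed.

End Periodic.

(** * Periodic integrable kernels *)

Section RealIntegrable.
Context d (T : measurableType d) (R : realType) (mu : {measure set T -> \bar R}).
Variables (D : set T) (mD : measurable D).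
Implicit Types f g : T -> R.

Lemma int_scale c f : mu.-integrable D (EFin \o f) ->
  mu.-integrable D (EFin \o (fun x => c * f x)).
Proof. exact: integrableZl. Qed.

Lemma int_add f g : mu.-integrable D (EFin \o f) -> mu.-integrable D (EFin \o g) ->
  mu.-integrable D (EFin \o (fun x => f x + g x)).
Proof. exact: integrableD. Qed.

Lemma int_sub f g : mu.-integrable D (EFin \o f) -> mu.-integrable D (EFin \o g) ->
  mu.-integrable D (EFin \o (fun x => f x - g x)).
Proof. exact: integrableB. Qed.

Lemma int_opp f : mu.-integrable D (EFin \o f) ->
  mu.-integrable D (EFin \o (fun x => - f x)).
Proof. exact: integrableN. Qed.

Lemma int_norm f : mu.-integrable D (EFin \o f) ->
  mu.-integrable D (EFin \o (fun x => `|f x|)).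
Proof. exact: integrable_norm. Qed.

Lemma RintegralN f : mu.-integrable D (EFin \o f) ->
  \int[mu]_(x in D) (- f x) = - \int[mu]_(x in D) f x.
Proof.
move=> fi; rewrite -mulN1r -RintegralZl//.
by apply: eq_Rintegral => x _; rewrite mulN1r.
Qed.

Lemma Rintegral_abs_le f g : mu.-integrable D (EFin \o f) ->
  mu.-integrable D (EFin \o g) -> (forall x, D x -> `|f x| <= g x) ->
  `|\int[mu]_(x in D) f x| <= \int[mu]_(x in D) g x.
Proof.
move=> fi gi fg; apply: le_trans (le_normr_Rintegral mD fi) _.
by apply: le_Rintegral => //; exact: int_norm.
Qed.

End RealIntegrable.

Section IntervalIntegrals.
Context {R : realType}.
Implicit Types (f g : R -> R) (a b c : R).

Lemma dominated_integrable (D : set R) f g : measurable D ->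
  measurable_fun D f -> leb.-integrable D (EFin \o g) ->
  (forall x, D x -> `|f x| <= g x) -> leb.-integrable D (EFin \o f).
Proof.
move=> mD mf ig fg; apply: le_integrable ig => //; first exact/measurable_EFinP.
by move=> x Dx /=; rewrite lee_fin (le_trans (fg x Dx))// ler_norm.
Qed.

Lemma Rintegral_itv_chain f a b c : a <= b -> b <= c ->
  leb.-integrable `[a, c] (EFin \o f) ->
  \int[leb]_(x in `[a, c]) f x =
  \int[leb]_(x in `[a, b]) f x + \int[leb]_(x in `[b, c]) f x.
Proof.
move=> ab bc iF.
have := @Rintegral_itvB _ f (BLeft a) (BRight c) b iF.
rewrite !bnd_simp => /(_ ab bc) h.
rewrite -(Rintegral_itv_obnd_cbnd (r := b) (b := BRight c)); last first.
  by apply: integrableS iF => //; apply: subset_itvr; rewrite bnd_simp.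
by rewrite -h addrC subrK.
Qed.

Lemma Rintegral_itv_refl f a : \int[leb]_(x in `[a, a]) f x = 0.
Proof. by rewrite set_itv1 Rintegral_set1. Qed.

Lemma integrable_subitv f a b c d : a <= c -> d <= b ->
  leb.-integrable `[a, b] (EFin \o f) -> leb.-integrable `[c, d] (EFin \o f).
Proof.
move=> ac db; apply: integrableS => //.
by apply: subset_itv; rewrite bnd_simp.
Qed.

Lemma Rintegral_le_EFin f a b (C : R) : (forall x, 0 <= f x) ->
  measurable_fun setT f ->
  (\int[leb]_(x in `[a, b]) (f x)%:E <= C%:E)%E ->
  leb.-integrable `[a, b] (EFin \o f) /\ \int[leb]_(x in `[a, b]) f x <= C.
Proof.
move=> f0 mf fC.
have i0 : (0 <= \int[leb]_(x in `[a, b]) (f x)%:E)%E.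
  by apply: integral_ge0 => x _; rewrite lee_fin.
split.
  apply/integrableP; split; first exact/measurable_EFinP/measurable_funTS.
  under eq_integral do rewrite gee0_abs ?lee_fin//.
  by rewrite (le_lt_trans fC)// ltry.
rewrite /Rintegral -lee_fin fineK// ge0_fin_numE//.
by rewrite (le_lt_trans fC)// ltry.
Qed.

End IntervalIntegrals.

Section Kernel.
Context {R : realType}.

Record kernel (K : R -> R) : Prop := Kernel {
  kernel_meas : measurable_fun setT K ;
  kernel_ge0 : forall x, 0 <= K x ;
  kernel_periodic : periodic2 K ;
  kernel_even : forall x, K (- x) = K x ;
  kernel_int : leb.-integrable period (EFin \o K) }.

Variable K : R -> R.
Hypothesis kK : kernel K.

Let mK := kernel_meas kK.
Let K0 := kernel_ge0 kK.

Let measurable_excess (N : R) : measurable_fun setT (fun x => Num.max (K x - N) 0).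
Proof. by apply: measurable_maxr => //; exact: measurable_funB. Qed.

(** Dominated convergence: the excess of [K] over [n] tends to 0 pointwise and stays below [K]. *)
Lemma kernel_excess_small e : 0 < e -> exists2 N, 0 <= N &
  (\int[leb]_(x in period) (Num.max (K x - N) 0)%:E <= e%:E)%E.
Proof.
move=> e0.
have cvg0 : (\int[leb]_(x in period) (Num.max (K x - n%:R) 0)%:E)%E @[n --> \oo]
    --> (\int[leb]_(x in (period : set R)) (cst 0 x)%:E)%E.
  apply: (@dominated_cvg _ _ _ leb _ (@measurable_period R)
      (fun n x => (Num.max (K x - n%:R) 0)%:E) (fun x => (cst 0 x)%:E) (EFin \o K)).
  - move=> n; apply/measurable_EFinP.
    apply: measurable_funTS.
    exact: measurable_excess.
  - move=> x _; apply: cvg_near_cst; exists (Num.truncn (K x)).+1 => // n /= Kn.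
    congr EFin; apply/max_idPr; rewrite subr_le0.
    have := truncnS_gt (K x) => /ltW /le_trans; apply; by rewrite ler_nat.
  - by [].
  - exact: kernel_int kK.
  - move=> n x _; rewrite lee_fin ger0_norm; last by rewrite le_max lexx orbT.
    by rewrite ge_max K0 andbT gerBl.
rewrite integral0 in cvg0.
have /fine_cvgP[fin fcvg] := cvg0.
have /cvgr_le/(_ _ e0) h := fcvg.
have [N _ /(_ N)] := filterI fin h.
rewrite /= => /(_ (leqnn N)) [f1 f2]; exists N%:R => //.
by rewrite -(fineK f1) lee_fin.
Qed.

(** Uniform integrability: [K] is at most [N] plus its excess [W]. The constant contributes at most
    [N * d], the excess at most its integral over a period, wherever the window lies. *)
Lemma kernel_unif e : 0 < e -> exists2 d, 0 < d & forall z,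
  (\int[leb]_(x in `](z - d)%R, z]) (K x)%:E <= e%:E)%E.
Proof.
move=> e0; have [|N N0 hN] := @kernel_excess_small (e / 2); first by rewrite divr_gt0.
(* The bound 2 keeps the window inside one period; the other one gives [N * d <= e / 2], with
   [N + 1] to keep the denominator positive. *)
pose d := Num.min 2 (e / (2 * (N + 1))).
have N1 : 0 < N + 1 by lra.
have d0 : 0 < d by rewrite lt_min ltr0n/= divr_gt0// mulr_gt0.
exists d => // z.
pose W x := Num.max (K x - N) 0.
have W0 x : 0 <= W x by rewrite le_max lexx orbT.
have mW : measurable_fun setT W by exact: measurable_excess.
have KW x : K x <= N + W x by rewrite -lerBlDl le_max lexx.
have mI : measurable (`](z - d)%R, z]%classic : set R) by [].
apply: (@le_trans _ _ (\int[leb]_(x in `](z - d)%R, z]) (N%:E + (W x)%:E))%E).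
  apply: ge0_le_integral => //.
  - by move=> x _; rewrite lee_fin.
  - exact/measurable_EFinP/measurable_funTS.
  - by apply/emeasurable_funD => //; exact/measurable_EFinP/measurable_funTS.
  - by move=> x _; rewrite -EFinD lee_fin.
rewrite ge0_integralD//; last 2 first.
- by move=> x _; rewrite lee_fin.
- exact/measurable_EFinP/measurable_funTS.
rewrite integral_cst//= lebesgue_measure_itv/= lte_fin ltrBlDr ltrDl d0.
rewrite -EFinD opprB (addrC z) subrK -EFinM (splitr e) EFinD; apply: leeD.
  rewrite lee_fin; have : d <= e / (2 * (N + 1)) by rewrite ge_min lexx orbT.
  rewrite ler_pdivlMr ?mulr_gt0//; nra.
apply: le_trans hN.
apply: (@le_trans _ _ (\int[leb]_(x in `](z - 2)%R, z]) (W x)%:E)%E).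
  apply: ge0_subset_integral => //.
  - exact/measurable_EFinP/measurable_funTS.
  - by move=> x _; rewrite lee_fin.
  - by apply: subset_itvr; rewrite bnd_simp lerB// ge_min lexx.
(* The map [x -> z - 1 - x] carries [period] exactly onto ]z - 2, z]; a translation would close the
   window at the wrong end. *)
rewrite -(@ge0_integral_periodic_reflect _ (fun x => (W x)%:E) (z - 1)); last 3 first.
- exact/measurable_EFinP.
- by move=> x; rewrite lee_fin.
- by move=> x; rewrite /W (kernel_periodic kK).
rewrite (@ge0_integral_isom _ (-1) (z - 1) (fun x => (W x)%:E))//; last 2 first.
- by right.
- exact/measurable_EFinP.
rewrite (_ : isom _ _ @^-1` _ = period); last first.
  by apply/seteqP; split => x; rewrite /period/= /isom !in_itv/=; lra.
by under eq_integral do rewrite /isom mulN1r addrC.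
Qed.

Lemma kernel_window e d z a b : 0 < d ->
  (forall z, (\int[leb]_(x in `](z - d)%R, z]) (K x)%:E <= e%:E)%E) ->
  b - a <= d -> (\int[leb]_(s in `]a, b]) (K (z + s))%:E <= e%:E)%E.
Proof.
move=> d0 h abd.
apply: le_trans (h (z + b)).
rewrite (@ge0_integral_isom _ 1 z (fun x => (K x)%:E))//; last 2 first.
- by left.
- exact/measurable_EFinP.
under [leRHS]eq_integral do rewrite /isom mul1r addrC.
apply: ge0_subset_integral => //.
- rewrite -[X in measurable X]setTI; exact: measurable_isom.
- apply/measurable_EFinP/measurable_funTS.
  by apply: (measurableT_comp mK); exact: measurable_funD.
- by move=> x _; rewrite lee_fin.
- move=> x; rewrite /= /isom !in_itv/=; lra.
Qed.

(** The line to the left of [t] is cut into windows of length [d = 1 / l]. In the last one [K]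
    weighs at most [e / 2] and the exponential is at most [expR (l * t)]. By induction the earlier
    ones contribute at most [e * expR (l * (t - d))], and going back by [d] divides the exponential
    by Euler's number, hence by at least 2. *)
Lemma kernel_exp e : 0 < e -> exists2 l, 0 < l & forall z a t,
  (\int[leb]_(s in `[a, t]) (K (z + s) * expR (l * s))%:E <=
   (e * expR (l * t))%:E)%E.
Proof.
move=> e0; have [|d d0 hd] := @kernel_unif (e / 2); first by rewrite divr_gt0.
pose l := d^-1.
have l0 : 0 < l by rewrite invr_gt0.
exists l => // z a t.
have mKz : measurable_fun setT (fun s => K (z + s)).
  by apply: (measurableT_comp mK); exact: measurable_funD.
have mexp : measurable_fun setT (fun s : R => expR (l * s)).
  by apply: measurableT_comp => //; exact: measurable_funM.
have mKe : measurable_fun setT (fun s => (K (z + s) * expR (l * s))%:E).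
  by apply/measurable_EFinP; exact: measurable_funM.
have Ke0 s : (0 <= (K (z + s) * expR (l * s))%:E)%E.
  by rewrite lee_fin mulr_ge0// expR_ge0.
have half : 2 * expR (- 1 : R) <= 1.
  rewrite expRN ler_pdivrMr ?expR_gt0// mul1r.
  by rewrite (le_trans _ (expR_ge1Dx 1)).
have step n : forall t : R,
    (\int[leb]_(s in `](t - n%:R * d)%R, t]) (K (z + s) * expR (l * s))%:E <=
     (e * expR (l * t))%:E)%E.
  elim: n => [|n IH] u.
    rewrite mul0r subr0 set_itv_ge ?bnd_simp ?ltxx// integral_set0.
    by rewrite lee_fin mulr_ge0 ?expR_ge0// ltW.
  have nd : 0 <= n%:R * d by rewrite mulr_ge0// ltW.
  rewrite (_ : [set` _] = `](u - d - n%:R * d)%R, (u - d)%R] `|` `](u - d)%R, u]); last first.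
    apply/seteqP; split => s /=; rewrite !in_itv/= -natr1.
      by move=> /andP[s1 s2]; case: (lerP s (u - d)) => s3; [left|right]; lra.
    by case; lra.
  rewrite ge0_integral_setU//; last 2 first.
  - exact: measurable_funTS.
  - by apply/disj_setPS => x /=; rewrite !in_itv/=; lra.
  have -> : e * expR (l * u) = e / 2 * expR (l * u) + expR (l * u) * (e / 2) by field.
  rewrite EFinD; apply: leeD.
    apply: le_trans (IH (u - d)) _; rewrite lee_fin.
    rewrite mulrBr expRD (_ : l * d = 1) ?mulVf ?gt_eqF//.
    have : 0 <= e * expR (l * u) * (1 - 2 * expR (- 1)).
      by rewrite mulr_ge0 ?subr_ge0// mulr_ge0 ?expR_ge0// ltW.
    lra.
  apply: (@le_trans _ _ (\int[leb]_(s in `](u - d)%R, u])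
      ((expR (l * u))%:E * (K (z + s))%:E))%E).
    apply: ge0_le_integral => //.
    - exact: measurable_funTS.
    - by apply/measurable_EFinP/measurable_funM => //; exact: measurable_funTS.
    - move=> s /=; rewrite in_itv/= => /andP[_ su].
      rewrite -EFinM lee_fin mulrC ler_wpM2r// ler_expR.
      by rewrite ler_pM2l.
  rewrite ge0_integralZl//; last 2 first.
  - exact/measurable_EFinP/measurable_funTS.
  - by move=> s _; rewrite lee_fin.
  rewrite EFinM lee_pmul2l// ?lte_fin ?expR_gt0//.
  by apply: (kernel_window z d0 hd); rewrite opprB addrC subrK.
pose n := (Num.truncn ((t - a) / d)).+1.
apply: le_trans (step n t).
have an : t - n%:R * d < a.
  have := truncnS_gt ((t - a) / d); rewrite ltr_pdivrMr// -/n; lra.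
apply: ge0_subset_integral => //; first exact: measurable_funTS.
by apply: subset_itv; rewrite bnd_simp.
Qed.

Lemma kernel_shift_meas (z : R) : measurable_fun setT (fun s : R => K (z + s)).
Proof. by apply: (measurableT_comp mK); exact: measurable_funD. Qed.

Lemma kernel_expR e : 0 < e -> exists2 l, 0 < l & forall z a t,
  leb.-integrable `[a, t] (EFin \o (fun s => K (z + s) * expR (l * s))) /\
  \int[leb]_(s in `[a, t]) (K (z + s) * expR (l * s)) <= e * expR (l * t).
Proof.
move=> /kernel_exp[l l0 h]; exists l => // z a t.
apply: Rintegral_le_EFin (h z a t).
- by move=> s; rewrite mulr_ge0 ?expR_ge0.
- apply: measurable_funM; first exact: kernel_shift_meas.
  by apply: measurableT_comp => //; exact: measurable_funM.
Qed.

(** Local integrability is read off the weighted bound, since on [[a, t]] the weight is at least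
    [expR (l * a)]. *)
Lemma kernel_itv_integrable z a t :
  leb.-integrable `[a, t] (EFin \o (fun s => K (z + s))).
Proof.
have [l l0 /(_ z a t)[h _]] := @kernel_expR 1 ltr01.
apply: (@dominated_integrable _ _ _
    (fun s => expR (- (l * a)) * (K (z + s) * expR (l * s)))) => //.
- exact: measurable_funTS (kernel_shift_meas z).
- rewrite (_ : _ \o _ = (fun x => (expR (- (l * a)))%:E *
    ((EFin \o (fun s => K (z + s) * expR (l * s))%R) x))%E)//.
  exact: integrableZl.
- move=> s /=; rewrite in_itv/= => /andP[as_ _].
  rewrite ger0_norm// mulrCA ler_peMr// -expRD -expR0 ler_expR.
  by rewrite addrC subr_ge0 ler_pM2l.
Qed.

Lemma kernel_modulus e : 0 < e -> exists2 d, 0 < d & forall z a b,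
  b - a <= d -> \int[leb]_(s in `[a, b]) K (z + s) <= e.
Proof.
move=> /kernel_unif[d d0 h]; exists d => // z a b ab.
rewrite -(Rintegral_itv_obnd_cbnd (r := a) (b := BRight b)); last first.
  apply: integrableS (kernel_itv_integrable z a b) => //.
  by apply: subset_itvr; rewrite bnd_simp.
have hw := kernel_window z d0 h ab.
rewrite /Rintegral -lee_fin fineK// ge0_fin_numE.
  by rewrite (le_lt_trans hw)// ltry.
by apply: integral_ge0 => x _; rewrite lee_fin.
Qed.

End Kernel.

(** * The integral equation along characteristics *)

Section Source.
Context {R : realType}.
Implicit Types (g alpha K : R -> R) (H : R * R -> R) (p : R * R).

Record damping g : Prop := Damping {
  damping_meas : measurable_fun setT g ;
  damping_nd : forall a b, a <= b -> g a <= g b ;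
  damping0 : g 0 = 0 ;
  damping_lip : forall B, exists2 L, 0 <= L & forall a b,
    `|a| <= B -> `|b| <= B -> `|g a - g b| <= L * `|a - b| }.

Record weight alpha : Prop := Weight {
  weight_meas : measurable_fun setT alpha ;
  weight01 : forall t, 0 <= alpha t <= 1 }.

(* The source of the unfolded equation must be odd in y: on the half [-1, 0[ of
   the circle F is f^-, and w = F(y) - F(-y) is there -J. *)
Definition gam g (y w : R) := if 0 <= rep y then g w else - g (- w).

(* The reflection y -> -y at time t, read in the variable z = y - t. *)
Definition refl p : R * R := (- p.1 - 2 * p.2, p.2).

(** For [y = p.1 + p.2] in ]0, 1[ the argument of [gam] is [f^+ - f^- = J]. The factor 2 of the
    momentum equation has gone because [f^+] and [f^-] carry the factor 1/2. *)
Definition src K alpha g H p :=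
  K (p.1 + p.2) * alpha p.2 * gam g (p.1 + p.2) (H p - H (refl p)).

Lemma measurable_refl : measurable_fun setT refl.
Proof.
apply/measurable_fun_pairP; split; last exact: measurable_snd.
apply: measurable_funB; first by apply: measurable_funN; exact: measurable_fst.
by apply: measurable_funM => //; exact: measurable_snd.
Qed.

Lemma refl_refl p : refl (refl p) = p.
Proof. by case: p => z t; rewrite /refl/=; congr pair; ring. Qed.

Lemma measurable_sum12 : measurable_fun setT (fun p => p.1 + p.2).
Proof. by apply: measurable_funD; [exact: measurable_fst|exact: measurable_snd]. Qed.

Lemma measurable_src K alpha g H : measurable_fun setT K -> weight alpha ->
  damping g -> measurable_fun setT H -> measurable_fun setT (src K alpha g H).
Proof.
move=> mK wa dg mH.
have mR := measurableT_comp mH measurable_refl.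
have mD : measurable_fun setT (fun p => H p - H (refl p)) by exact: measurable_funB.
apply: measurable_funM.
  apply: measurable_funM; first exact: (measurableT_comp mK measurable_sum12).
  exact: (measurableT_comp (weight_meas wa) measurable_snd).
apply: measurable_fun_ifT.
- apply: measurable_fun_ler => //.
  exact: (measurableT_comp measurable_rep measurable_sum12).
- exact: (measurableT_comp (damping_meas dg) mD).
- apply: measurable_funN; apply: (measurableT_comp (damping_meas dg)).
  exact: measurable_funN.
Qed.

Lemma gam_lip g y B L a b :
  (forall a b, `|a| <= B -> `|b| <= B -> `|g a - g b| <= L * `|a - b|) ->
  `|a| <= B -> `|b| <= B -> `|gam g y a - gam g y b| <= L * `|a - b|.
Proof.
move=> lip aB bB; rewrite /gam; case: ifP => _; first exact: lip.
by rewrite -opprD normrN (le_trans (lip _ _ _ _)) ?normrN// -opprD normrN.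
Qed.

Lemma gam0 g y : damping g -> gam g y 0 = 0.
Proof. by move=> dg; rewrite /gam oppr0 damping0// oppr0 if_same. Qed.

Lemma gam_nd g y a b : damping g -> a <= b -> gam g y a <= gam g y b.
Proof.
move=> dg ab; rewrite /gam; case: ifP => _; first exact: damping_nd.
by rewrite lerN2 damping_nd// lerN2.
Qed.

Lemma src_lip K alpha g H H' B L p : (forall x, 0 <= K x) -> weight alpha ->
  (forall a b, `|a| <= B -> `|b| <= B -> `|g a - g b| <= L * `|a - b|) ->
  0 <= L -> `|H p - H (refl p)| <= B -> `|H' p - H' (refl p)| <= B ->
  `|src K alpha g H p - src K alpha g H' p| <=
  L * K (p.1 + p.2) * (`|H p - H' p| + `|H (refl p) - H' (refl p)|).
Proof.
move=> K0 wa lip L0 HB H'B; rewrite /src -mulrBr normrM.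
have /andP[a0 a1] := weight01 wa p.2.
have Ka0 : 0 <= K (p.1 + p.2) * alpha p.2 by rewrite mulr_ge0.
rewrite (ger0_norm Ka0) -mulrA mulrCA mulrA -mulrA.
apply: ler_pM => //.
  by rewrite ler_piMr.
apply: le_trans (gam_lip _ lip HB H'B) _.
rewrite ler_wpM2l// (_ : _ - _ = (H p - H' p) - (H (refl p) - H' (refl p))); last by ring.
exact: ler_normB.
Qed.

Lemma src_bound K alpha g H B L p : (forall x, 0 <= K x) -> weight alpha ->
  damping g -> 0 <= B ->
  (forall a b, `|a| <= B -> `|b| <= B -> `|g a - g b| <= L * `|a - b|) ->
  0 <= L -> `|H p - H (refl p)| <= B ->
  `|src K alpha g H p| <= L * B * K (p.1 + p.2).
Proof.
move=> K0 wa dg B0 lip L0 HB.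
have /andP[a0 a1] := weight01 wa p.2.
have Ka0 : 0 <= K (p.1 + p.2) * alpha p.2 by rewrite mulr_ge0.
rewrite /src normrM (ger0_norm Ka0) (mulrC (L * B)).
apply: ler_pM => //; first by rewrite ler_piMr.
rewrite -[X in `|X|]subr0 -(gam0 (p.1 + p.2) dg).
apply: le_trans (gam_lip _ lip HB _) _; first by rewrite normr0.
by rewrite subr0 ler_wpM2l.
Qed.

End Source.

Section ParametricIntegral.
Context {R : realType}.

(** The integral with a variable upper limit is rewritten over the whole line with an integrand set
    to zero outside the limits; Tonelli's theorem then gives the measurability of its positive and
    negative parts separately. *)
Lemma measurable_Rintegral_param (f : R * R -> R) (t0 : R) :
  measurable_fun setT f ->
  measurable_fun setT (fun p : R * R => \int[leb]_(s in `[t0, p.2]) f (p.1, s)).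
Proof.
move=> mf.
pose T := measurableTypeR R.
pose G (q : (T * T) * T) : \bar R :=
  (if t0 <= q.2 then if q.2 <= q.1.2 then f (q.1.1, q.2) else 0 else 0)%:E.
have mG : measurable_fun setT G.
  apply/measurable_EFinP; apply: measurable_fun_ifT => //.
    by apply: measurable_fun_ler => //; exact: measurable_snd.
  apply: measurable_fun_ifT => //.
    apply: measurable_fun_ler; first exact: measurable_snd.
    exact: measurableT_comp measurable_snd measurable_fst.
  apply: (measurableT_comp mf); apply/measurable_fun_pairP; split.
    exact: measurableT_comp measurable_fst measurable_fst.
  exact: measurable_snd.
have mGp : measurable_fun setT (G^\+)%E by exact: measurable_funepos.
have mGn : measurable_fun setT (G^\-)%E by exact: measurable_funeneg.
have Gp0 q : (0 <= (G^\+)%E q)%E by exact: funepos_ge0.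
have Gn0 q : (0 <= (G^\-)%E q)%E by exact: funeneg_ge0.
rewrite (_ : (fun p => _) =
    fine \o (fun p : T * T => fubini_F leb (G^\+)%E p - fubini_F leb (G^\-)%E p)%E).
  apply: measurableT_comp; first exact: fine_measurable.
  apply: emeasurable_funB; exact: measurable_fun_fubini_tonelli_F.
apply/funext => -[z t] /=; rewrite /Rintegral; congr fine.
rewrite integral_mkcond integralE; congr (_ - _)%E.
  apply: eq_integral => s _; rewrite !funeposE; congr maxe.
  rewrite patchE /G/= mem_setE in_itv/=.
  by case: (t0 <= s); case: (s <= t).
apply: eq_integral => s _; rewrite !funenegE; congr (maxe (- _)%E _).
rewrite patchE /G/= mem_setE in_itv/=.
by case: (t0 <= s); case: (s <= t).
Qed.

End ParametricIntegral.

Section Barrier.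
Context {R : realType}.

(* After the last time at which [h <= M], the function [h] decreases. *)
Lemma barrier (h f : R -> R) (t0 M : R) :
  (forall a b, t0 <= a -> a <= b -> leb.-integrable `[a, b] (EFin \o f)) ->
  (forall a b, t0 <= a -> a <= b -> h b = h a - \int[leb]_(s in `[a, b]) f s) ->
  (forall e, 0 < e -> exists2 d, 0 < d & forall a b, t0 <= a -> a <= b ->
     b - a <= d -> `|h b - h a| <= e) ->
  h t0 <= M -> (forall s, t0 <= s -> M < h s -> 0 <= f s) ->
  forall t, t0 <= t -> h t <= M.
Proof.
move=> fi hf hc h0 fM t t0t; rewrite leNgt; apply/negP => Mt.
pose S := [set s | t0 <= s <= t /\ h s <= M].
have S0 : S t0 by rewrite /S/= lexx t0t.
have hS : has_sup S by split; [exists t0|exists t => s [/andP[_ ->]]].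
pose tau := sup S.
have tau0 : t0 <= tau by exact: (ub_le_sup hS.2).
have taut : tau <= t by apply: ge_sup; [exists t0|move=> s [/andP[_ ->]]].
have htau : h tau <= M.
  apply/ler_addgt0Pr => e e0; have [d d0 hd] := hc e e0.
  have [s Ss ss] := sup_adherent d0 hS.
  have stau : s <= tau by exact: (ub_le_sup hS.2).
  have [/andP[t0s st] hsM] := Ss.
  have := hd s tau t0s stau; rewrite -/tau in ss.
  have -> : tau - s <= d by lra.
  by move=> /(_ isT); rewrite ler_norml => /andP[_]; lra.
have above s : tau < s -> s <= t -> M < h s.
  move=> taus st; rewrite ltNge; apply/negP => hs.
  have : s <= tau by apply: (ub_le_sup hS.2); split => //; rewrite st andbT; lra.
  by rewrite leNgt taus.
have : h t <= h tau.
  rewrite (hf tau t)// gerBl.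
  rewrite -(Rintegral_itv_obnd_cbnd (r := tau) (b := BRight t)).
    apply: Rintegral_ge0 => s /=; rewrite in_itv/= => /andP[s1 s2].
    by apply: fM; [lra|exact: above].
  apply: integrableS (fi tau t tau0 taut) => //.
  by apply: subset_itvr; rewrite bnd_simp.
by move=> /le_trans/(_ htau); rewrite leNgt Mt.
Qed.

End Barrier.

Section GeometricLimit.
Context {R : realType}.

(** Adding the tail [2 * A * 2^-1 ^+ i] makes the sequence nonincreasing and bounded below, which
    gives convergence and the upper bound; the lower bound is the same statement for [- u]. *)
Lemma geometric_limit (u : nat -> R) (A : R) : 0 <= A ->
  (forall i, `|u i.+1 - u i| <= A * 2^-1 ^+ i) ->
  cvgn u /\ forall i, `|limn u - u i| <= 2 * A * 2^-1 ^+ i.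
Proof.
move=> A0.
have half0 i : 0 <= 2^-1 ^+ i :> R by rewrite exprn_ge0.
have half (v : nat -> R) : (forall i, `|v i.+1 - v i| <= A * 2^-1 ^+ i) ->
    cvgn v /\ forall i, limn v <= v i + 2 * A * 2^-1 ^+ i.
  move=> hv; pose w i := v i + geometric (2 * A) (2^-1 : R) i.
  have g0 : geometric (2 * A) (2^-1 : R) @ \oo --> (0 : R).
    by apply: cvg_geometric; rewrite ger0_norm// invf_lt1// ltr1n.
  have wd : {homo w : i j / (i <= j)%N >-> (j <= i)}.
    apply/nonincreasing_seqP => i; rewrite /w/geometric/= exprS.
    by have := hv i; rewrite ler_norml => /andP[_]; lra.
  have vlow i : v 0%N - 2 * A + 2 * A * 2^-1 ^+ i <= v i.
    elim: i => [|i IH]; first by rewrite expr0; lra.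
    by have := hv i; rewrite ler_norml exprS => /andP[+ _]; lra.
  have cw : cvgn w.
    apply: nonincreasing_is_cvgn => //; exists (v 0%N - 2 * A) => _ [i _ <-].
    rewrite /w/geometric/=; apply: le_trans (_ : v i <= _).
      by apply: le_trans (vlow i); rewrite lerDl !mulr_ge0.
    by rewrite lerDl !mulr_ge0.
  have vw : v @ \oo --> limn w.
    rewrite -[limn w]subr0 (_ : v = w \- geometric (2 * A) (2^-1 : R)).
      exact: cvgB.
    by apply/funext => i; rewrite /w/= addrK.
  split; first by apply/cvg_ex; exists (limn w).
  by move=> i; rewrite (cvg_lim _ vw)//; exact: nonincreasing_cvgn_ge.
move=> hu; have [cu uu] := half _ hu; split => // i.
have [|_ /(_ i)] := half (fun i => - u i).
  by move=> j; rewrite -opprD normrN.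
rewrite limN// => h; have := uu i; rewrite ler_norml; lra.
Qed.

End GeometricLimit.

(** * Picard iteration with a truncated source *)

Section Existence.
Context {R : realType}.
Variables (K alpha g : R -> R).
Hypotheses (kK : kernel K) (wa : weight alpha) (dg : damping g).

(** The equation is imposed for every [z] and the bounds at every point, not almost everywhere: the
    solution is built pointwise in [z]. *)
Record mild (m M t0 : R) (H : R * R -> R) : Prop := Mild {
  mild_meas : measurable_fun setT H ;
  mild_bound : forall p, m <= H p <= M ;
  mild_periodic : forall z t, H (z + 2, t) = H (z, t) ;
  mild_eq : forall z t, t0 <= t -> H (z, t) =
    H (z, t0) - \int[leb]_(s in `[t0, t]) src K alpha g H (z, s) }.

Definition clamp (m M x : R) := Num.min M (Num.max m x).

Lemma clamp_itv m M x : m <= M -> m <= clamp m M x <= M.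
Proof.
by move=> mM; rewrite /clamp le_min mM/= le_max lexx/= ge_min lexx.
Qed.

Lemma clamp_id m M x : m <= x <= M -> clamp m M x = x.
Proof. by move=> /andP[mx xM]; rewrite /clamp max_r// min_r. Qed.

Lemma clamp_lip m M x y : m <= M -> `|clamp m M x - clamp m M y| <= `|x - y|.
Proof.
move=> mM; wlog yx : x y / y <= x => [W|].
  have [yx|/ltW xy] := leP y x; first exact: W.
  by rewrite distrC (distrC x); exact: W.
have h : 0 <= x - y by rewrite subr_ge0.
rewrite (ger0_norm h) ger0_norm.
  rewrite lerBlDr /clamp addr_minr le_min !ge_min lerDr h/= ge_max addr_maxr !le_max.
  by rewrite lerDr h subrK lexx !orbT.
rewrite subr_ge0 le_min !ge_min lexx/=.
by rewrite ge_max !le_max lexx/= yx !orbT.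
Qed.

Lemma measurable_clamp d (T : measurableType d) m M (f : T -> R) :
  measurable_fun setT f -> measurable_fun setT (fun x => clamp m M (f x)).
Proof.
by move=> mf; apply: measurable_minr => //; exact: measurable_maxr.
Qed.

Lemma clamp_diff m M x y : m <= M ->
  `|clamp m M x - clamp m M y| <= M - m.
Proof.
move=> mM; have := clamp_itv x mM; have := clamp_itv y mM.
by move=> /andP[? ?] /andP[? ?]; rewrite ler_norml; lra.
Qed.

(** Clamping makes the source bounded by a multiple of [K] and Lipschitz with one constant for all
    functions, so Picard iteration needs no a priori bound; the bound proved afterwards removes the
    clamp. *)
Let csrc m M (H : R * R -> R) := src K alpha g (fun p => clamp m M (H p)).

Let measurable_csrc m M (H : R * R -> R) : measurable_fun setT H -> measurable_fun setT (csrc m M H).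
Proof.
by move=> mH; apply: measurable_src (kernel_meas kK) wa dg _; exact: measurable_clamp.
Qed.

Lemma measurable_section1 (f : R * R -> R) z : measurable_fun setT f ->
  measurable_fun setT (fun s => f (z, s)).
Proof. by move=> mf; apply: (measurableT_comp mf); exact: measurable_pair1. Qed.

Lemma kernel_dominated_integrable (f : R * R -> R) C z a b :
  measurable_fun setT f -> (forall s, `|f (z, s)| <= C * K (z + s)) ->
  leb.-integrable `[a, b] (EFin \o (fun s => f (z, s))).
Proof.
move=> mf fK.
apply: (@dominated_integrable _ _ _ (fun s => C * K (z + s))) => //.
  by apply: measurable_funTS; exact: measurable_section1.
by apply: int_scale => //; exact: kernel_itv_integrable.
Qed.

Lemma kernel_dominated_modulus (f : R * R -> R) C e : 0 <= C ->
  measurable_fun setT f -> (forall z s, `|f (z, s)| <= C * K (z + s)) -> 0 < e ->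
  exists2 d, 0 < d & forall z a b, b - a <= d ->
    `|\int[leb]_(s in `[a, b]) f (z, s)| <= e.
Proof.
move=> C0 mf fK e0.
have [|d d0 hd] := @kernel_modulus _ _ kK (e / (C + 1)).
  by rewrite divr_gt0// ltr_wpDl.
exists d => // z a b ab.
have iK := kernel_itv_integrable kK z a b.
apply: le_trans (_ : \int[leb]_(s in `[a, b]) (C * K (z + s)) <= _).
  apply: Rintegral_abs_le => //.
    exact: (kernel_dominated_integrable _ _ mf (fK z)).
  exact: int_scale.
rewrite RintegralZl//; have := hd z a b ab.
rewrite ler_pdivlMr ?ltr_wpDl//; apply: le_trans.
have I0 : 0 <= \int[leb]_(s in `[a, b]) K (z + s).
  by apply: Rintegral_ge0 => s _; exact: kernel_ge0.
by rewrite mulrDr mulr1 mulrC lerDl.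
Qed.

Section Iteration.
Variables (m M t0 : R) (H0 : R -> R).
Hypotheses (mM : m <= M) (mH0 : measurable_fun setT H0).
Hypothesis pH0 : periodic2 H0.

Let Phi (H : R * R -> R) (p : R * R) :=
  H0 p.1 - \int[leb]_(s in `[t0, p.2]) csrc m M H (p.1, s).

Let measurable_Phi (H : R * R -> R) : measurable_fun setT H -> measurable_fun setT (Phi H).
Proof.
move=> mH; apply: measurable_funB.
  exact: (measurableT_comp mH0 measurable_fst).
by apply: measurable_Rintegral_param; exact: measurable_csrc.
Qed.

Let Lip : {L | 0 <= L & forall a b, `|a| <= M - m -> `|b| <= M - m ->
  `|g a - g b| <= L * `|a - b|}.
Proof. by apply: cid2; exact: damping_lip. Qed.
Let L := s2val Lip.
Let L0 : 0 <= L := s2valP Lip.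
Let lip := s2valP' Lip.

Let csrc_bound H p : `|csrc m M H p| <= L * (M - m) * K (p.1 + p.2).
Proof.
apply: src_bound => //; first exact: kernel_ge0.
- by rewrite subr_ge0.
- exact: clamp_diff.
Qed.

Let csrc_int (H : R * R -> R) z a b : measurable_fun setT H ->
  leb.-integrable `[a, b] (EFin \o (fun s => csrc m M H (z, s))).
Proof.
move=> mH; apply: (kernel_dominated_integrable (C := L * (M - m))).
  exact: measurable_csrc.
by move=> s; exact: csrc_bound.
Qed.

(** The constant [(4 * (L + 1))^-1] makes the Picard map halve distances: the source difference
    carries a factor [2 * L], and [L + 1] avoids a division by zero. *)
Let ell : {l | 0 < l & forall z a t,
  leb.-integrable `[a, t] (EFin \o (fun s => K (z + s) * expR (l * s))) /\
  \int[leb]_(s in `[a, t]) (K (z + s) * expR (l * s)) <=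
    (4 * (L + 1))^-1 * expR (l * t)}.
Proof.
by apply: cid2; apply: kernel_expR => //; rewrite invr_gt0 mulr_gt0// ltr_wpDl.
Qed.
Let l := s2val ell.
Let lK := s2valP' ell.

(** Reflection leaves the time unchanged, so the weight [expR (l * s)] bounds the difference at a
    point and at its mirror image alike; hence the factor 2 in the estimate. Clamping does not
    increase differences. *)
Let Phi_contract (H H' : R * R -> R) (A : R) : measurable_fun setT H -> measurable_fun setT H' ->
  (forall p, `|H p - H' p| <= A * expR (l * p.2)) ->
  forall p, `|Phi H p - Phi H' p| <= A / 2 * expR (l * p.2).
Proof.
move=> mH mH' HH' [z t] /=.
have A0 : 0 <= A.
  by have := le_trans (normr_ge0 _) (HH' (0, 0)); rewrite pmulr_lge0// expR_gt0.
have [iE IE] := lK z t0 t.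
rewrite /Phi/= (_ : _ - _ = - (\int[leb]_(s in `[t0, t]) csrc m M H (z, s) -
  \int[leb]_(s in `[t0, t]) csrc m M H' (z, s))); last by ring.
rewrite normrN -RintegralB//; [|exact: csrc_int|exact: csrc_int].
have iD : leb.-integrable `[t0, t]
    (EFin \o (fun s => csrc m M H (z, s) - csrc m M H' (z, s))).
  by apply: int_sub => //; exact: csrc_int.
apply: le_trans (_ : \int[leb]_(s in `[t0, t])
   (2 * A * L * (K (z + s) * expR (l * s))) <= _).
  apply: Rintegral_abs_le => //.
  - exact: int_scale.
  - move=> s _.
    apply: le_trans (src_lip (p := (z, s)) (kernel_ge0 kK) wa lip L0 _ _) _.
    + exact: clamp_diff.
    + exact: clamp_diff.
    have -> : 2 * A * L * (K (z + s) * expR (l * s)) =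
      L * K (z + s) * (A * expR (l * s) + A * expR (l * s)) by ring.
    apply: ler_wpM2l; first by rewrite mulr_ge0//; exact: kernel_ge0.
    apply: lerD; (apply: le_trans (clamp_lip _ _ mM) _).
      exact: (HH' (z, s)).
    exact: (HH' (refl (z, s))).
rewrite RintegralZl//.
apply: le_trans (ler_wpM2l _ IE) _; first by rewrite !mulr_ge0.
rewrite mulrA; apply: ler_wpM2r; first exact: expR_ge0.
rewrite ler_pdivrMr; last by rewrite mulr_gt0// ltr_wpDl.
have : 0 <= A * L by rewrite mulr_ge0.
nra.
Qed.

Let H_ i := iter i Phi (fun p => H0 p.1).

Let measurable_H_ i : measurable_fun setT (H_ i).
Proof.
elim: i => [|i IH]; first exact: (measurableT_comp mH0 measurable_fst).
exact: measurable_Phi.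
Qed.

(** The last factor inserts the weight into the bound on the first Picard increment, since
    [expR (l * (s - t0))] is at least 1 for [s >= t0]. *)
Let A0 := L * (M - m) * expR (- (l * t0)).

Let A0_ge0 : 0 <= A0.
Proof. by rewrite !mulr_ge0 ?expR_ge0// subr_ge0. Qed.

Let H_step i p : `|H_ i.+1 p - H_ i p| <= A0 * 2^-1 ^+ i * expR (l * p.2).
Proof.
elim: i p => [|i IH] p; last first.
  have := Phi_contract (measurable_H_ i.+1) (measurable_H_ i) IH p.
  by rewrite exprSr mulrA.
case: p => z t /=; rewrite expr0 mulr1 /Phi/= addrAC subrr add0r normrN.
have [iE IE] := lK z t0 t.
have iC := csrc_int z t0 t (measurable_H_ 0).
apply: le_trans (_ : \int[leb]_(s in `[t0, t])
   (A0 * (K (z + s) * expR (l * s))) <= _).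
  apply: Rintegral_abs_le => //.
  - exact: int_scale.
  - move=> s /=; rewrite in_itv/= => /andP[ts _].
    apply: le_trans (csrc_bound _ (z, s)) _.
    rewrite /A0 /= -(mulrA (L * _)); apply: ler_wpM2l.
      by rewrite mulr_ge0// subr_ge0.
    rewrite mulrCA -expRD ler_peMr ?(kernel_ge0 kK)//.
    by rewrite -expR0 ler_expR addrC subr_ge0 ler_wpM2l// ltW// (s2valP ell).
rewrite RintegralZl//; apply: ler_wpM2l => //; apply: le_trans IE _.
by rewrite ler_piMl ?expR_ge0// invf_le1 ?mulr_gt0 ?ltr_wpDl//; have := L0; lra.
Qed.

Let H p := limn (fun i => H_ i p).

Let H_limit p : cvgn (fun i => H_ i p) /\
  forall i, `|H p - H_ i p| <= 2 * (A0 * expR (l * p.2)) * 2^-1 ^+ i.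
Proof.
apply: geometric_limit; first by rewrite mulr_ge0// expR_ge0.
by move=> i; rewrite [leRHS]mulrAC; exact: H_step.
Qed.

Let measurable_H : measurable_fun setT H.
Proof.
apply: (measurable_fun_cvg (h := H_)) => // p _.
by have [] := H_limit p.
Qed.

(** Both sides are within [B / 2 * 2^-1 ^+ i] of [H_ i.+1 p], for every [i]. *)
Let H_fix p : Phi H p = H p.
Proof.
apply/eqP; rewrite -subr_eq0 -normr_le0; apply/ler_addgt0Pl => e e0; rewrite addr0.
pose B := 4 * (A0 * expR (l * p.2)).
have B0 : 0 <= B by rewrite mulr_ge0// mulr_ge0// expR_ge0.
have bnd i : `|Phi H p - H p| <= B * 2^-1 ^+ i.
  have c1 : `|Phi H p - H_ i.+1 p| <= B / 2 * 2^-1 ^+ i.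
    have := @Phi_contract H (H_ i) (2 * A0 * 2^-1 ^+ i) measurable_H (measurable_H_ i).
    move=> /(_ _ p) h; apply: le_trans (h _) _.
      by move=> q; have [_ /(_ i)] := H_limit q; rewrite mulrA mulrAC.
    have : 0 <= A0 * expR (l * p.2) * 2^-1 ^+ i.
      by rewrite mulr_ge0 ?exprn_ge0// mulr_ge0// expR_ge0.
    by rewrite /B; lra.
  have c2 : `|H_ i.+1 p - H p| <= B / 2 * 2^-1 ^+ i.
    rewrite distrC; have [_ /(_ i.+1)] := H_limit p; move=> /le_trans; apply.
    have : 0 <= B * 2^-1 ^+ i by rewrite mulr_ge0// exprn_ge0.
    by rewrite /B exprS; lra.
  apply: le_trans (ler_distD (H_ i.+1 p) _ _) _; lra.
have := @cvg_geometric R B (2^-1 : R).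
rewrite ger0_norm// invf_lt1// ltr1n => /(_ isT) /cvgr0_norm_le /(_ e e0) [N _ hN].
have := hN N (leqnn N); rewrite /geometric/= ger0_norm; last first.
  by rewrite mulr_ge0// exprn_ge0.
exact: le_trans (bnd N).
Qed.

Let H_init z : H (z, t0) = H0 z.
Proof. by rewrite -H_fix /Phi/= Rintegral_itv_refl subr0. Qed.

Let H_periodic z t : H (z + 2, t) = H (z, t).
Proof.
rewrite /H (_ : (fun i => H_ i (z + 2, t)) = (fun i => H_ i (z, t)))//.
apply/funext => i; elim: i z t => [|i IH] z t /=.
  exact: pH0.
rewrite /Phi/= pH0; congr (_ - _); apply: eq_Rintegral => s _.
rewrite /csrc /src /gam /refl/= !IH.
rewrite (_ : z + 2 + s = z + s + 2); last by ring.
rewrite (kernel_periodic kK) rep_periodic.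
congr (_ * _); rewrite -(IH (- (z + 2) - 2 * s)).
by rewrite (_ : - (z + 2) - 2 * s + 2 = - z - 2 * s)//; ring.
Qed.

Hypothesis H0mM : forall z, m <= H0 z <= M.

Let H_eq z a b : t0 <= a -> a <= b ->
  H (z, b) = H (z, a) -
    \int[leb]_(s in `[a, b]) csrc m M H (z, s).
Proof.
move=> ta ab; rewrite -(H_fix (z, b)) -(H_fix (z, a)) /Phi/=.
rewrite (Rintegral_itv_chain ta ab); first by ring.
exact: csrc_int.
Qed.

Let H_modulus z e : 0 < e -> exists2 d, 0 < d & forall a b, t0 <= a -> a <= b ->
  b - a <= d -> `|H (z, b) - H (z, a)| <= e.
Proof.
move=> e0; have [|||d d0 hd] := @kernel_dominated_modulus (csrc m M H) (L * (M - m)) e _ _ _ e0.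
- by rewrite mulr_ge0// subr_ge0.
- exact: measurable_csrc.
- by move=> y s; exact: csrc_bound.
exists d => // a b ta ab abd.
by rewrite (H_eq _ ta ab) addrAC subrr add0r normrN; exact: hd.
Qed.

(** Above [M] the clamped value is [M], the largest that the clamped mirror value can be, so the
    argument of the nondecreasing [gam] is nonnegative, and [gam] vanishes at 0. The case below [m]
    is symmetric. *)
Let csrc_sign z s (b : bool) :
  (if b then M < H (z, s) else H (z, s) < m) ->
  if b then 0 <= csrc m M H (z, s) else csrc m M H (z, s) <= 0.
Proof.
have /andP[w0 w1] := weight01 wa s.
have Kw : 0 <= K (z + s) * alpha s by rewrite mulr_ge0// (kernel_ge0 kK).
have /andP[c1 c2] := clamp_itv (H (refl (z, s))) mM.
case: b => h; rewrite /csrc /src.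
  apply: mulr_ge0 => //; rewrite -(gam0 (z + s) dg); apply: gam_nd => //.
  by rewrite {1}/clamp max_r ?(le_trans mM)// ?min_l ?subr_ge0// ltW.
rewrite -oppr_ge0 -mulrN; apply: mulr_ge0 => //.
rewrite oppr_ge0 -(gam0 (z + s) dg); apply: gam_nd => //.
have -> : clamp m M (H (z, s)) = m by rewrite /clamp max_l ?min_r// ltW.
by rewrite subr_le0.
Qed.

Let H_bound_ge z t : t0 <= t -> m <= H (z, t) <= M.
Proof.
move=> t0t; have /andP[h1 h2] := H0mM z; apply/andP; split; last first.
  apply: (@barrier _ (fun t => H (z, t)) (fun s => csrc m M H (z, s)) t0) => //.
  - by move=> a b _ _; exact: csrc_int.
  - by move=> a b; exact: H_eq.
  - by move=> e; exact: H_modulus.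
  - by rewrite H_init.
  - by move=> s _ /(@csrc_sign z s true).
rewrite -lerN2.
apply: (@barrier _ (fun t => - H (z, t)) (fun s => - csrc m M H (z, s)) t0) => //.
- by move=> a b _ _; apply: int_opp => //; exact: csrc_int.
- move=> a b ta ab; rewrite (H_eq _ ta ab) opprD opprK.
  by rewrite RintegralN ?opprK//; exact: csrc_int.
- move=> e e0; have [d d0 hd] := H_modulus z e0; exists d => // a b ta ab abd.
  by rewrite -opprD normrN; exact: hd.
- by rewrite H_init lerN2.
- move=> s _; rewrite ltrN2 => /(@csrc_sign z s false).
  by rewrite oppr_ge0.
Qed.

Let H_bound p : m <= H p <= M.
Proof.
case: p => z t; have [/H_bound_ge//|tt0] := leP t0 t.
(* Before [t0] the interval of integration is empty, so [H] equals its initial datum there. *)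
rewrite -H_fix /Phi/= set_itv_ge ?bnd_simp -?ltNge//.
by rewrite Rintegral_set0 subr0.
Qed.

(** The bounds on [H] turn the clamp into the identity, so the truncated equation is the true
    one. *)
Lemma mild_exists : exists2 H, mild m M t0 H & forall z, H (z, t0) = H0 z.
Proof.
exists H => //; split => // z t t0t.
rewrite (H_eq _ (lexx t0) t0t); congr (_ - _); apply: eq_Rintegral => s _.
by rewrite /csrc/src !clamp_id.
Qed.

End Iteration.

End Existence.

(** * Contraction in L^1 *)

Section SignedPeriodic.
Context {R : realType}.

Lemma integral_periodic_shift (u : R -> \bar R) c :
  measurable_fun setT u -> periodic2 u ->
  (\int[leb]_(x in period) u (x + c)%R = \int[leb]_(x in period) u x)%E.
Proof.
move=> mu pu; rewrite integralE [RHS]integralE; congr (_ - _)%E.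
  rewrite -[RHS](@ge0_integral_periodic_shift _ _ c)//;
    [by apply: eq_integral => x _; rewrite !funeposE|exact: measurable_funepos|by move=> x; rewrite !funeposE pu].
rewrite -[RHS](@ge0_integral_periodic_shift _ _ c)//;
  [by apply: eq_integral => x _; rewrite !funenegE|exact: measurable_funeneg|by move=> x; rewrite !funenegE pu].
Qed.

Lemma integral_periodic_reflect (u : R -> \bar R) c :
  measurable_fun setT u -> periodic2 u ->
  (\int[leb]_(x in period) u (c - x)%R = \int[leb]_(x in period) u x)%E.
Proof.
move=> mu pu; rewrite integralE [RHS]integralE; congr (_ - _)%E.
  rewrite -[RHS](@ge0_integral_periodic_reflect _ _ c)//;
    [by apply: eq_integral => x _; rewrite !funeposE|exact: measurable_funepos|by move=> x; rewrite !funeposE pu].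
rewrite -[RHS](@ge0_integral_periodic_reflect _ _ c)//;
  [by apply: eq_integral => x _; rewrite !funenegE|exact: measurable_funeneg|by move=> x; rewrite !funenegE pu].
Qed.

Lemma Rintegral_periodic_shift (u : R -> R) c :
  measurable_fun setT u -> periodic2 u ->
  \int[leb]_(x in period) u (x + c) = \int[leb]_(x in period) u x.
Proof.
move=> mu pu; rewrite /Rintegral; congr fine.
apply: (@integral_periodic_shift (EFin \o u)); first exact/measurable_EFinP.
by move=> x /=; rewrite pu.
Qed.

Lemma Rintegral_periodic_reflect (u : R -> R) c :
  measurable_fun setT u -> periodic2 u ->
  \int[leb]_(x in period) u (c - x) = \int[leb]_(x in period) u x.
Proof.
move=> mu pu; rewrite /Rintegral; congr fine.
apply: (@integral_periodic_reflect (EFin \o u)); first exact/measurable_EFinP.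
by move=> x /=; rewrite pu.
Qed.

End SignedPeriodic.

Section FubiniReal.
Context {R : realType}.
Let T := measurableTypeR R.

Lemma measurable_section2 (f : R * R -> R) (r : R) : measurable_fun setT f ->
  measurable_fun setT (fun z => f (z, r)).
Proof. by move=> mf; apply: (measurableT_comp mf); exact: measurable_pair2. Qed.

(** [f] is set to zero outside the rectangle and Fubini's theorem is applied in the plane;
    integrability of every section makes the inner integrals finite, so passing to real values loses
    nothing. *)
Lemma Rintegral_Fubini (D1 D2 : set R) (f : R * R -> R) :
  measurable D1 -> measurable D2 -> measurable_fun setT f ->
  (forall x, D1 x -> leb.-integrable D2 (EFin \o (fun y => f (x, y)))) ->
  (forall y, D2 y -> leb.-integrable D1 (EFin \o (fun x => f (x, y)))) ->
  (\int[leb]_(y in D2) \int[leb]_(x in D1) `|f (x, y)|%:E < +oo)%E ->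
  [/\ leb.-integrable D1 (EFin \o (fun x => \int[leb]_(y in D2) f (x, y))),
      leb.-integrable D2 (EFin \o (fun y => \int[leb]_(x in D1) f (x, y))),
      ((leb \x leb)%E).-integrable (D1 `*` D2) (EFin \o f) &
      \int[leb]_(x in D1) \int[leb]_(y in D2) f (x, y) =
      \int[leb]_(y in D2) \int[leb]_(x in D1) f (x, y)].
Proof.
move=> mD1 mD2 mf i1 i2 fin.
have mD : measurable (D1 `*` D2) by exact: measurableX.
pose F : T * T -> \bar R := (EFin \o f) \_ (D1 `*` D2).
have mF : measurable_fun setT F.
  by apply/(measurable_restrictT _ mD)/measurable_EFinP; exact: measurable_funTS.
have Fxy x y : F (x, y) = if (x \in D1) && (y \in D2) then (f (x, y))%:E else 0%E.
  by rewrite /F patchE in_setX.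
have F1 x : (\int[leb]_y F (x, y) =
    ((EFin \o (fun x => \int[leb]_(y in D2) f (x, y))%R) \_ D1) x)%E.
  rewrite patchE; case: ifP => xD1; last first.
    by under eq_integral do rewrite Fxy xD1/=; rewrite integral0.
  rewrite /= /Rintegral fineK; last first.
    by apply: integrable_fin_num => //; apply: i1; exact/set_mem.
  rewrite [RHS]integral_mkcond; apply: eq_integral => y _.
  by rewrite Fxy xD1 patchE.
have F2 y : (\int[leb]_x F (x, y) =
    ((EFin \o (fun y => \int[leb]_(x in D1) f (x, y))%R) \_ D2) y)%E.
  rewrite patchE; case: ifP => yD2; last first.
    by under eq_integral do rewrite Fxy yD2 andbF; rewrite integral0.
  rewrite /= /Rintegral fineK; last first.
    by apply: integrable_fin_num => //; apply: i2; exact/set_mem.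
  rewrite [RHS]integral_mkcond; apply: eq_integral => x _.
  by rewrite Fxy yD2 andbT patchE.
have iF : ((leb \x leb)%E).-integrable setT F.
  apply/integrable21ltyP; first exact: mF.
  apply: le_lt_trans fin.
  rewrite le_eqVlt; apply/orP; left; apply/eqP.
  rewrite [RHS]integral_mkcond; apply: eq_integral => y _; rewrite patchE.
  case: ifP => yD2; last first.
    by under eq_integral do rewrite Fxy yD2 andbF abse0; rewrite integral0.
  rewrite [RHS]integral_mkcond; apply: eq_integral => x _.
  by rewrite Fxy yD2 andbT patchE; case: ifP; rewrite //= normr0.
have eF1 := funext F1; have eF2 := funext F2.
split.
- by apply/integrable_mkcond => //; rewrite -eF1; exact: integrable_fubini_F.
- apply/integrable_mkcond => //; rewrite -eF2.
  apply/integrableP; split; first exact: measurable_fubini_G iF.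
  have fin' : (\int[leb]_y \int[leb]_x `|F (x, y)| < +oo)%E by apply/integrable21ltyP.
  apply: le_lt_trans fin'.
  apply: ge0_le_integral => //.
  - by apply: measurableT_comp => //; exact: measurable_fubini_G iF.
  - by apply: (@measurable_fun_fubini_tonelli_G _ _ _ _ _ leb (abse \o F)); [exact: measurableT_comp|move=> p; exact: abse_ge0].
  - by move=> y _; apply: le_abse_integral => //; exact: measurableT_comp.
- by apply/integrable_mkcond.
- rewrite /Rintegral; congr fine.
  rewrite [LHS]integral_mkcond [RHS]integral_mkcond.
  transitivity (\int[leb]_x \int[leb]_y F (x, y))%E.
    by apply: eq_integral => x _; rewrite F1.
  rewrite (Fubini iF).
  by apply: eq_integral => x _; rewrite F2.
Qed.

End FubiniReal.

Lemma leb_itv_lty (R : realType) b1 b2 (x y : R) :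
  (leb [set` Interval (BSide b1 x) (BSide b2 y)] < +oo)%E.
Proof. by rewrite lebesgue_measure_itv/=; case: ifP => _; rewrite ?ltry// -EFinB ltry. Qed.

Lemma int_cst (R : realType) (D : set R) (c : R) : measurable D -> (leb D < +oo)%E ->
  leb.-integrable D (EFin \o (cst c)).
Proof.
move=> mD Dfin; apply: measurable_bounded_integrable => //.
by exists `|c|; split; [exact: num_real|move=> x cx z _ /=; exact: ltW].
Qed.

Lemma fine_leb_itv (R : realType) (s t : R) : s <= t -> fine (leb `[s, t]) = t - s.
Proof.
rewrite lebesgue_measure_itv/= lte_fin le_eqVlt => /predU1P[->|->//].
by rewrite ltxx subrr.
Qed.

Section AlmostEverywhereRintegral.
Context {R : realType}.
Variables (D : set R) (mD : measurable D).

Lemma ae_eq_Rintegral (f h : R -> R) : measurable_fun setT f -> measurable_fun setT h ->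
  {ae leb, forall x, f x = h x} ->
  \int[leb]_(x in D) f x = \int[leb]_(x in D) h x.
Proof.
move=> mf mh fh; rewrite /Rintegral; congr fine; apply: ae_eq_integral => //.
- by apply: measurable_funTS; exact/measurable_EFinP.
- by apply: measurable_funTS; exact/measurable_EFinP.
- by move: fh; apply: ae_imply => x -> _.
Qed.

(** [f] is replaced by the minimum of [f] and [h], equal to it almost everywhere and below [h]
    everywhere. *)
Lemma ae_le_Rintegral (f h : R -> R) : leb.-integrable D (EFin \o f) ->
  leb.-integrable D (EFin \o h) -> {ae leb, forall x, f x <= h x} ->
  \int[leb]_(x in D) f x <= \int[leb]_(x in D) h x.
Proof.
move=> fi hi fh.
have mf : measurable_fun D f by apply/measurable_EFinP; exact: measurable_int fi.
have mh : measurable_fun D h by apply/measurable_EFinP; exact: measurable_int hi.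
have -> : \int[leb]_(x in D) f x = \int[leb]_(x in D) Num.min (f x) (h x).
  rewrite /Rintegral; congr fine; apply: ae_eq_integral => //.
  - exact/measurable_EFinP.
  - by apply/measurable_EFinP; exact: measurable_minr.
  - by move: fh; apply: ae_imply => x fh _; rewrite min_l.
apply: le_Rintegral => //.
  apply: (@dominated_integrable _ _ _ (fun x => `|f x| + `|h x|)) => //.
  - exact: measurable_minr.
  - by apply: int_add => //; exact: int_norm.
  - by move=> x _; rewrite /Num.min; case: ifP => _; rewrite ?lerDl ?lerDr.
by move=> x _; rewrite ge_min lexx orbT.
Qed.

End AlmostEverywhereRintegral.

Section SlowGrowth.
Context {R : realType}.

(** Pieces of length at most [d] are chained from [s] to [t], and the increments add up to at most a
    small multiple of [t - s]. This stands in for a differential inequality when [D] is not known to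
    be differentiable. *)
Lemma slow_growth (D : R -> R) (a b : R) :
  (forall e, 0 < e -> exists2 d, 0 < d & forall s t, a <= s -> s <= t -> t <= b ->
     t - s <= d -> D t - D s <= e * (t - s)) ->
  forall s t, a <= s -> s <= t -> t <= b -> D t <= D s.
Proof.
move=> hD s t sa st tb; apply/ler_addgt0Pr => e e0.
pose e' := e / (t - s + 1).
have ts1 : 0 < t - s + 1 by lra.
have e'0 : 0 < e' by rewrite divr_gt0.
have [d d0 hd] := hD e' e'0.
have step n : forall u, s <= u -> u <= t -> u - s <= n%:R * d -> D u - D s <= e' * (u - s).
  elim: n => [|n IH] u su ut.
    rewrite mul0r => us; have -> : u = s by lra.
    by rewrite !subrr mulr0.
  rewrite -natr1 mulrDl mul1r => us.
  have [usd|dus] := leP (u - s) d; first by apply: hd => //; lra.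
  have h1 := IH (u - d) _ _ _.
  have h2 := hd (u - d) u _ _ _ _.
  have : D (u - d) - D s <= e' * (u - d - s) by apply: h1; lra.
  have : D u - D (u - d) <= e' * (u - (u - d)) by apply: h2; lra.
  lra.
pose n := (Num.truncn ((t - s) / d)).+1.
have := step n t st (lexx t); have -> : t - s <= n%:R * d.
  by rewrite -ler_pdivrMr// ltW// truncnS_gt.
move=> /(_ isT) h.
have : e' * (t - s) <= e by rewrite /e' mulrAC ler_pdivrMr//; nra.
lra.
Qed.

End SlowGrowth.

(** * Sign inequalities behind the L^1 contraction *)

Section SignLemmas.
Context {R : realType}.

(** [del] and [dels] are the differences of two solutions at a point and at its mirror image at an
    intermediate time, [aa] and [aas] the same at the final time. If both pairs are ordered alike,
    the product has the good sign; otherwise [|del - dels| <= 2 * w], so [|nn| <= 2 * w * k], and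
    two signs differ by at most 2. *)
Lemma sign_pairing (del dels aa aas nn k w : R) : 0 <= k -> 0 <= w ->
  `|aa - del| <= w -> `|aas - dels| <= w ->
  `|nn| <= k * `|del - dels| -> (0 <= del - dels -> 0 <= nn) ->
  (del - dels <= 0 -> nn <= 0) ->
  - (Num.sg aa - Num.sg aas) * nn <= 4 * w * k.
Proof.
move=> k0 w0; rewrite !ler_norml => /andP[h1 h2] /andP[h3 h4] /andP[n1 n2] np nn0.
have K1 : aas <= aa -> - nn <= 2 * w * k.
  move=> h; have [d0|d0] := leP 0 (del - dels).
    by have := np d0; have : 0 <= w * k by [rewrite mulr_ge0]; lra.
  move: n1; rewrite (ltr0_norm d0); nra.
have K2 : aa <= aas -> nn <= 2 * w * k.
  move=> h; have [d0|d0] := leP (del - dels) 0.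
    by have := nn0 d0; have : 0 <= w * k by [rewrite mulr_ge0]; lra.
  move: n2; rewrite (gtr0_norm d0); nra.
have wk : 0 <= w * k by rewrite mulr_ge0.
clear np nn0 n1 n2 h1 h2 h3 h4.
have [/[dup] h /K2|/ltW/[dup] h /K1] := leP aa aas; move: h; clear K1 K2;
  case: (sgrP aa) => ha; case: (sgrP aas) => hb h hn; clear -wk hn ha hb h; lra.
Qed.

Lemma measurable_sg : measurable_fun setT (Num.sg : R -> R).
Proof.
apply: nondecreasing_measurable => // x y xy.
case: (sgrP x) => hx; case: (sgrP y) => hy; lra.
Qed.

Let sg1 (x : R) : `|Num.sg x| <= 1.
Proof. by rewrite normr_sg; case: (x != 0). Qed.

(** [Num.sg (dt z)] is a subgradient of the absolute value at [dt z], so [|ds z|] is at least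
    [|dt z| + Num.sg (dt z) * n z]. *)
Lemma L1_decrement (D : set R) (dt ds n : R -> R) : measurable D ->
  measurable_fun setT dt -> measurable_fun setT ds -> measurable_fun setT n ->
  leb.-integrable D (EFin \o dt) -> leb.-integrable D (EFin \o ds) ->
  leb.-integrable D (EFin \o n) ->
  {ae leb, forall z, ds z = dt z + n z} ->
  \int[leb]_(z in D) `|dt z| - \int[leb]_(z in D) `|ds z| <=
  \int[leb]_(z in D) (- Num.sg (dt z) * n z).
Proof.
move=> mD mdt mds mn it i_s iN h.
rewrite -RintegralB; [|exact: mD|exact: int_norm|exact: int_norm].
apply: ae_le_Rintegral => //.
- by apply: int_sub => //; exact: int_norm.
- apply: (@dominated_integrable _ _ _ (fun z => `|n z|)) => //.
  + apply: measurable_funTS; apply: measurable_funM => //.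
    by apply: measurable_funN; exact: measurableT_comp measurable_sg mdt.
  + exact: int_norm.
  + by move=> z _; rewrite normrM normrN ler_piMl.
move: h; apply: ae_imply => z ->.
have hx : Num.sg (dt z) * dt z = `|dt z| by rewrite [RHS]normrEsg.
have : Num.sg (dt z) * (dt z + n z) <= `|dt z + n z|.
  by apply: le_trans (ler_norm _) _; rewrite normrM ler_piMl.
by rewrite mulrDr hx mulNr; lra.
Qed.

(** The integral is averaged with its image under [z -> c - z]. As [n] is odd under this reflection,
    the two integrands add up to the quantity bounded in [sign_pairing], and averaging halves the
    constant 4. *)
Lemma reflect_pairing (c : R) (dt dr n k : R -> R) (w : R) : 0 <= w ->
  (forall z, 0 <= k z) -> measurable_fun setT dt -> measurable_fun setT n ->
  periodic2 dt -> periodic2 n ->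
  leb.-integrable period (EFin \o k) -> leb.-integrable period (EFin \o n) ->
  {ae leb, forall z, `|dt z - dr z| <= w} ->
  (forall z, n (c - z) = - n z) ->
  (forall z, `|n z| <= k z * `|dr z - dr (c - z)|) ->
  (forall z, 0 <= dr z - dr (c - z) -> 0 <= n z) ->
  (forall z, dr z - dr (c - z) <= 0 -> n z <= 0) ->
  \int[leb]_(z in period) (- Num.sg (dt z) * n z) <=
    2 * w * \int[leb]_(z in period) k z.
Proof.
move=> w0 k0 mdt mn pdt pn ik iN close nodd nk n0 n1.
have mper := @measurable_period R.
have msg : measurable_fun setT (fun z => Num.sg (dt z)) by exact: measurableT_comp measurable_sg mdt.
have i1 (s : R -> R) : measurable_fun setT s -> (forall z, `|s z| <= 1) ->
    leb.-integrable period (EFin \o (fun z => s z * n z)).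
  move=> ms s1; apply: (@dominated_integrable _ _ _ (fun z => `|n z|)) => //.
  - by apply: measurable_funTS; exact: measurable_funM.
  - exact: int_norm.
  - by move=> z _; rewrite normrM ler_piMl.
pose f z := - Num.sg (dt z) * n z.
have iF : leb.-integrable period (EFin \o f).
  by apply: i1 => [|z]; [exact: measurable_funN|rewrite normrN].
have mf : measurable_fun setT f by apply: measurable_funM => //; exact: measurable_funN.
have fc z : f (c - z) = Num.sg (dt (c - z)) * n z by rewrite /f nodd mulNr mulrN opprK.
have iFc : leb.-integrable period (EFin \o (fun z => f (c - z))).
  rewrite (_ : (fun z => f (c - z)) = (fun z => Num.sg (dt (c - z)) * n z)); last exact/funext.
  apply: i1 => [|z]; last exact: sg1.
  by apply: (measurableT_comp msg); exact: measurable_funB.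
have E : \int[leb]_(z in period) f (c - z) = \int[leb]_(z in period) f z.
  by apply: Rintegral_periodic_reflect => // z; rewrite /f pdt pn.
have : \int[leb]_(z in period) (f z + f (c - z)) <= \int[leb]_(z in period) (4 * w * k z).
  apply: ae_le_Rintegral => //.
  - exact: int_add.
  - exact: int_scale.
  have := ae_and close (ae_reflect c close); apply: ae_imply => z [h1 h2].
  rewrite fc /f -mulrDl.
  rewrite (_ : - _ + _ = - (Num.sg (dt z) - Num.sg (dt (c - z)))); last by ring.
  exact: (sign_pairing (k0 z) w0 h1 h2 (nk z) (n0 z) (n1 z)).
rewrite RintegralD// E RintegralZl// -/f; lra.
Qed.

End SignLemmas.

(** * The L^1 distance of two bounded solutions *)

Section Contraction.
Context {R : realType}.
Variables (K alpha g : R -> R).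
Hypotheses (kK : kernel K) (wa : weight alpha) (dg : damping g).

(** This is the form in which weak solutions satisfy the equation: the exceptional null set of [z]
    may depend on both times. *)
Definition amild (a b : R) (H : R * R -> R) :=
  forall s t, a <= s -> s <= t -> t <= b -> {ae leb, forall z, H (z, t) =
    H (z, s) - \int[leb]_(r in `[s, t]) src K alpha g H (z, r)}.

Record bounded_periodic (B : R) (H : R * R -> R) : Prop := BoundedPeriodic {
  bp_meas : measurable_fun setT H ;
  bp_bound : forall p, `|H p| <= B ;
  bp_periodic : forall z t, H (z + 2, t) = H (z, t) }.

(** [K] is even and [gam] is extended oddly. The convention of [gam] breaks the symmetry where
    [rep y] is 0 or -1, but such points are their own mirror images modulo 2, so [w] vanishes
    there. *)
Lemma src_odd (H : R * R -> R) p : (forall z t, H (z + 2, t) = H (z, t)) ->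
  src K alpha g H (refl p) = - src K alpha g H p.
Proof.
move=> pH; rewrite /src refl_refl; case: p => z r /=.
rewrite (_ : - z - 2 * r + r = - (z + r)); last by ring.
rewrite (kernel_even kK) -mulrN; congr (_ * _).
set y := z + r; set w := H (z, r) - _.
rewrite (_ : H (refl (z, r)) - H (z, r) = - w); last by rewrite opprB.
rewrite /gam -rep_repN.
have py := rep_period y.
have [y0|y0] := eqVneq (rep y) 0.
  have w0 : w = 0.
    rewrite /w /refl/= (_ : - z - 2 * r = z + 2 * (- Num.floor ((y + 1) / 2))%:~R + 2 * (- Num.floor ((y + 1) / 2))%:~R); last first.
      by move: y0; rewrite /rep mulrNz /y; lra.
    rewrite !(@periodicz _ _ (fun z => H (z, r)))// ?subrr//.
  by rewrite w0 !oppr0 (damping0 dg) !oppr0 !if_same oppr0.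
have [y1|y1] := eqVneq (rep y) (-1).
  have w0 : w = 0.
    rewrite /w /refl/= (_ : - z - 2 * r = z + 2 * (- Num.floor ((y + 1) / 2))%:~R + 2 * (- Num.floor ((y + 1) / 2))%:~R + 2); last first.
      by move: y1; rewrite /rep mulrNz /y; lra.
    by rewrite pH !(@periodicz _ _ (fun z => H (z, r)))// ?subrr//.
  by rewrite w0 !oppr0 (damping0 dg) !oppr0 !if_same oppr0.
have ry : rep (- rep y) = - rep y.
  apply: rep_id; move: py; rewrite /period/= !in_itv/= => /andP[? ?].
  move: y0 y1; rewrite !neq_lt => /orP[?|?] /orP[?|?]; lra.
rewrite ry oppr_ge0 opprK; case: (lerP 0 (rep y)) => h.
  by rewrite leNgt lt_neqAle eq_sym y0 h.
by rewrite ltW// opprK.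
Qed.

Section TwoSolutions.
Variables (a b B : R) (H H' : R * R -> R).
Hypotheses (bH : bounded_periodic B H) (bH' : bounded_periodic B H').
Hypotheses (aH : amild a b H) (aH' : amild a b H').

Let dlt p := H p - H' p.
Let nu p := src K alpha g H p - src K alpha g H' p.

Let B0 : 0 <= B. Proof. exact: le_trans (bp_bound bH (0, 0)). Qed.

Let diff_bound (G : R * R -> R) p q : bounded_periodic B G -> `|G p - G q| <= 2 * B.
Proof.
move=> bG; apply: le_trans (ler_normB _ _) _.
by have := bp_bound bG p; have := bp_bound bG q; lra.
Qed.

Variable L : R.
Hypothesis L0 : 0 <= L.
Hypothesis lip : forall a b, `|a| <= 2 * B -> `|b| <= 2 * B ->
  `|g a - g b| <= L * `|a - b|.

Let msrc (G : R * R -> R) : bounded_periodic B G -> measurable_fun setT (src K alpha g G).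
Proof. by move=> bG; apply: measurable_src (kernel_meas kK) wa dg (bp_meas bG). Qed.

Let srcC (G : R * R -> R) : bounded_periodic B G ->
  forall p, `|src K alpha g G p| <= L * (2 * B) * K (p.1 + p.2).
Proof.
move=> bG p; apply: src_bound => //; first exact: kernel_ge0.
- by rewrite mulr_ge0.
- exact: diff_bound.
Qed.

Let C := 2 * (L * (2 * B)).
Let C0 : 0 <= C. Proof. by rewrite !mulr_ge0. Qed.

Let mdlt : measurable_fun setT dlt.
Proof. by apply: measurable_funB; [exact: bp_meas bH|exact: bp_meas bH']. Qed.
Let mnu : measurable_fun setT nu.
Proof. by apply: measurable_funB; exact: msrc. Qed.

Let nuC p : `|nu p| <= C * K (p.1 + p.2).
Proof.
apply: le_trans (ler_normB _ _) _.
by have := srcC bH p; have := srcC bH' p; rewrite /C; lra.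
Qed.

Let pdlt z t : dlt (z + 2, t) = dlt (z, t).
Proof. by rewrite /dlt (bp_periodic bH) (bp_periodic bH'). Qed.

Let nu_odd p : nu (refl p) = - nu p.
Proof.
rewrite /nu !src_odd; [by rewrite opprB addrC opprK|exact: bp_periodic bH'|exact: bp_periodic bH].
Qed.

Let pnu z t : nu (z + 2, t) = nu (z, t).
Proof.
have ps (G : R * R -> R) : bounded_periodic B G ->
    src K alpha g G (z + 2, t) = src K alpha g G (z, t).
  move=> bG; rewrite /src /gam /refl/= (bp_periodic bG).
  rewrite (_ : z + 2 + t = z + t + 2); last by ring.
  rewrite (kernel_periodic kK) rep_periodic.
  rewrite (_ : G (- (z + 2) - 2 * t, t) = G (- z - 2 * t, t))//.
  by rewrite -(bp_periodic bG (- (z + 2) - 2 * t)); congr (G (_, _)); ring.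
by rewrite /nu !ps.
Qed.

Let amild_dlt s t : a <= s -> s <= t -> t <= b ->
  {ae leb, forall z, dlt (z, t) = dlt (z, s) - \int[leb]_(r in `[s, t]) nu (z, r)}.
Proof.
move=> sa st tb; have := ae_and (aH sa st tb) (aH' sa st tb).
apply: ae_imply => z [h h']; rewrite /dlt h h' /nu RintegralB//; first by ring.
- by apply: (@kernel_dominated_integrable _ _ kK _ (L * (2 * B)) _ _ _ (msrc bH)) => r; exact: srcC.
- by apply: (@kernel_dominated_integrable _ _ kK _ (L * (2 * B)) _ _ _ (msrc bH')) => r; exact: srcC.
Qed.

Definition Ldist (t : R) := \int[leb]_(z in period) `|dlt (z, t)|.

Let dlt_int r : leb.-integrable period (EFin \o (fun z => dlt (z, r))).
Proof.
apply: measurable_bounded_integrable.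
- exact: measurable_period.
- exact: leb_itv_lty.
- by apply: measurable_funTS; exact: measurable_section2.
exists (2 * B); split; first exact: num_real.
move=> x Bx z _ /=; apply: le_trans (ltW Bx).
apply: le_trans (ler_normB _ _) _.
by have := bp_bound bH (z, r); have := bp_bound bH' (z, r); lra.
Qed.

Let kappa := \int[leb]_(z in period) K z.

Let nu_int z s t : leb.-integrable `[s, t] (EFin \o (fun r => nu (z, r))).
Proof. by apply: (@kernel_dominated_integrable _ _ kK _ C _ _ _ mnu) => r; exact: nuC. Qed.

Lemma kernel_shift_period r : leb.-integrable period (EFin \o (fun z => K (z + r))).
Proof.
rewrite (_ : period = `[-1, 1[%classic)//.
have h : leb.-integrable `[-1, 1] (EFin \o (fun z => K (z + r))); last first.
  by apply: integrableS h => //; apply: subset_itvl; rewrite bnd_simp.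
rewrite (_ : (fun z => K (z + r)) = (fun z => K (r + z))); last first.
  by apply/funext => z; rewrite addrC.
exact: kernel_itv_integrable.
Qed.

Lemma Rintegral_kernel_shift r :
  \int[leb]_(z in period) K (z + r) = \int[leb]_(z in period) K z.
Proof.
by apply: Rintegral_periodic_shift; [exact: kernel_meas|exact: kernel_periodic].
Qed.

Lemma kernel_dominated_period (f : R * R -> R) c r : measurable_fun setT f ->
  (forall z, `|f (z, r)| <= c * K (z + r)) ->
  leb.-integrable period (EFin \o (fun z => f (z, r))).
Proof.
move=> mf fK; apply: (@dominated_integrable _ _ _ (fun z => c * K (z + r))) => //.
- exact: measurable_period.
- by apply: measurable_funTS; exact: measurable_section2.
- by apply: int_scale; [exact: measurable_period|exact: kernel_shift_period].
Qed.

(** Over a period the dominating function [K (z + r)] has the same integral for every [r], which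
    yields the finite double integral that Fubini's theorem asks for. *)
Lemma kernel_dominated_Fubini (f : R * R -> R) c s t : measurable_fun setT f ->
  (forall p, `|f p| <= c * K (p.1 + p.2)) ->
  [/\ leb.-integrable period (EFin \o (fun z => \int[leb]_(r in `[s, t]) f (z, r))),
      leb.-integrable `[s, t] (EFin \o (fun r => \int[leb]_(z in period) f (z, r))) &
      \int[leb]_(z in period) \int[leb]_(r in `[s, t]) f (z, r) =
      \int[leb]_(r in `[s, t]) \int[leb]_(z in period) f (z, r)].
Proof.
move=> mf fK.
have fi r : leb.-integrable period (EFin \o (fun z => f (z, r))).
  by apply: kernel_dominated_period mf _ => z; exact: fK.
have f1 z : period z -> leb.-integrable `[s, t] (EFin \o (fun r => f (z, r))).
  by move=> _; apply: (@kernel_dominated_integrable _ _ kK _ c _ _ _ mf) => r; exact: fK.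
have f3 : (\int[leb]_(r in `[s, t]) \int[leb]_(z in period) `|f (z, r)|%:E < +oo)%E.
  apply: (@le_lt_trans _ _ (\int[leb]_(r in `[s, t]) (cst (c * \int[leb]_(z in period) K z)%:E r))%E).
    apply: ge0_le_integral => //.
    + by move=> r _; apply: integral_ge0 => z _; rewrite lee_fin.
    + apply: measurable_funTS.
      rewrite (_ : (fun r => _) = fubini_G leb
         (fun p : measurableTypeR R * measurableTypeR R => ((`|f p| * \1_period p.1)%:E))).
        apply: measurable_fun_fubini_tonelli_G.
          apply/measurable_EFinP; apply: measurable_funM; first exact: measurableT_comp.
          apply: (measurableT_comp _ measurable_fst).
          by apply: measurable_indic; exact: measurable_period.
        by move=> p; rewrite lee_fin mulr_ge0.
      apply/funext => r; rewrite /fubini_G [LHS]integral_mkcond; apply: eq_integral => z _.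
      by rewrite patchE /= indicE; case: (z \in period); rewrite ?mulr1 ?mulr0.
    + move=> r _; have ni := int_norm (fi r).
      have nf : (\int[leb]_(z in period) `|f (z, r)|%:E)%E \is a fin_num.
        by apply: integrable_fin_num => //; exact: measurable_period.
      rewrite -(fineK nf) lee_fin.
      rewrite -(Rintegral_kernel_shift r) -RintegralZl//; [|exact: measurable_period|exact: kernel_shift_period].
      apply: le_Rintegral => //; first exact: measurable_period.
      by apply: int_scale; [exact: measurable_period|exact: kernel_shift_period].
  rewrite integral_cst//= lebesgue_measure_itv/=; case: ifP => _; last by rewrite mule0 ltry.
  by rewrite -EFinB -EFinM ltry.
have [? ? _ ?] := Rintegral_Fubini (@measurable_period R) (measurable_itv `[s, t]) mf f1
  (fun r _ => fi r) f3.
by [].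
Qed.

(** With the sign frozen at the final time [t], the growth is at most the time integral of the
    source difference against minus that sign. At each [r] the reflection pairing leaves only the
    error due to freezing, which is proportional to [w], a bound on the change of [dlt] between [r]
    and [t]. *)
Lemma Ldist_step e : 0 < e -> exists2 d, 0 < d & forall s t, a <= s -> s <= t ->
  t <= b -> t - s <= d -> Ldist t - Ldist s <= e * (t - s).
Proof.
move=> e0.
have kappa0 : 0 <= kappa by apply: Rintegral_ge0 => z _; exact: kernel_ge0.
(* Chosen so that the rate [2 * w * (L * kappa)] given by the pairing is at most [e]; the added 1
   keeps the denominator positive. *)
pose w := e / (2 * (L * kappa) + 1).
have Lk0 : 0 <= L * kappa by apply: mulr_ge0.
have Lk1 : 0 < 2 * (L * kappa) + 1 by lra.
have w0 : 0 < w by rewrite divr_gt0.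
have ew : w * (2 * (L * kappa) + 1) = e by rewrite /w mulfVK// gt_eqF.
have ew2 : 2 * w * (L * kappa) <= e by rewrite -ew; lra.
have [d d0 hd] := @kernel_dominated_modulus _ _ kK nu C w C0 mnu (fun z r => nuC (z, r)) w0.
exists d; first exact: d0.
move=> s t as_ st tb std.
pose f p := - Num.sg (dlt (p.1, t)) * nu p.
have sg1 x : `|Num.sg x| <= 1 :> R by rewrite normr_sg; case: (x != 0).
have mf : measurable_fun setT f.
  apply: measurable_funM; last exact: mnu.
  apply: measurable_funN; apply: (measurableT_comp measurable_sg).
  exact: (measurableT_comp (measurable_section2 t mdlt) measurable_fst).
have fC p : `|f p| <= C * K (p.1 + p.2).
  rewrite /f normrM normrN; apply: le_trans (nuC p).
  by rewrite ler_piMl.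
have [iN _ _] := kernel_dominated_Fubini s t mnu nuC.
have [iF iX FX] := kernel_dominated_Fubini s t mf fC.
have mN : measurable_fun setT (fun z => \int[leb]_(r in `[s, t]) nu (z, r)).
  exact: (measurable_section2 t (measurable_Rintegral_param s mnu)).
apply: le_trans (_ : \int[leb]_(r in `[s, t]) \int[leb]_(z in period) f (z, r) <= _).
  rewrite -FX.
  have -> : \int[leb]_(z in period) \int[leb]_(r in `[s, t]) f (z, r) =
      \int[leb]_(z in period) (- Num.sg (dlt (z, t)) * \int[leb]_(r in `[s, t]) nu (z, r)).
    apply: eq_Rintegral => z _; rewrite /f/= RintegralZl; first by [].
      exact: measurable_itv.
    exact: nu_int.
  rewrite /Ldist; apply: (@L1_decrement R period (fun z => dlt (z, t)) (fun z => dlt (z, s))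
    (fun z => \int[leb]_(r in `[s, t]) nu (z, r)) (@measurable_period R) _ _ mN _ _ iN).
  - exact: measurable_section2.
  - exact: measurable_section2.
  - exact: dlt_int.
  - exact: dlt_int.
  - have := amild_dlt as_ st tb; apply: ae_imply => z ->.
    by rewrite subrK.
have X r : r \in `[s, t] -> \int[leb]_(z in period) f (z, r) <= 2 * w * (L * kappa).
  rewrite in_itv/= => /andP[sr rt].
  (* At time [r] the mirror image of [z] is [- 2 * r - z]. *)
  pose c := - 2 * r.
  have reflE z : refl (z, r) = (c - z, r) by rewrite /refl/= /c; congr pair; ring.
  rewrite /kappa -(Rintegral_kernel_shift r) -RintegralZl; last first.
    - exact: kernel_shift_period.
    - exact: measurable_period.
  have Kw := mulr_ge0 (kernel_ge0 kK (_ + r)) (proj1 (andP (weight01 wa r))).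
  have dd z : dlt (z, r) - dlt (c - z, r) =
      (H (z, r) - H (refl (z, r))) - (H' (z, r) - H' (refl (z, r))).
    by rewrite reflE /dlt; ring.
  apply: (@reflect_pairing R c (fun z => dlt (z, t)) (fun z => dlt (z, r)) (fun z => nu (z, r))
    (fun z => L * K (z + r)) w).
  - exact: ltW.
  - by move=> z; apply: mulr_ge0; [exact: L0|exact: kernel_ge0].
  - exact: (measurable_section2 t mdlt).
  - exact: (measurable_section2 r mnu).
  - by move=> z; exact: pdlt.
  - by move=> z; exact: pnu.
  - by apply: int_scale; [exact: measurable_period|exact: kernel_shift_period].
  - by apply: (kernel_dominated_period mnu (c := C)) => z; exact: (nuC (z, r)).
  - have := amild_dlt (le_trans as_ sr) rt tb; apply: ae_imply => z ->.
    rewrite addrAC subrr add0r normrN; apply: hd.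
    by apply: le_trans std; rewrite lerB.
  - by move=> z; rewrite -reflE nu_odd.
  - move=> z; rewrite dd /nu /src/= -mulrBr normrM (ger0_norm (Kw z)).
    rewrite (mulrC L) -[leRHS]mulrA; apply: ler_pM.
    + exact: Kw.
    + exact: normr_ge0.
    + by rewrite ler_piMr; [|exact: kernel_ge0|case/andP: (weight01 wa r)].
    + by apply: gam_lip lip _ _; exact: diff_bound.
  - move=> z; rewrite dd subr_ge0 => h; rewrite /nu subr_ge0 /src/=.
    by apply: ler_wpM2l; [exact: Kw|exact: gam_nd].
  - move=> z; rewrite dd subr_le0 => h; rewrite /nu subr_le0 /src/=.
    by apply: ler_wpM2l; [exact: Kw|exact: gam_nd].
apply: le_trans (_ : \int[leb]_(r in `[s, t]) (cst (2 * w * (L * kappa)) r) <= _).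
  apply: le_Rintegral.
  - exact: measurable_itv.
  - exact: iX.
  - by apply: int_cst; [exact: measurable_itv|exact: leb_itv_lty].
  - by move=> r rst; apply: X.
rewrite Rintegral_cst; last exact: measurable_itv.
rewrite fine_leb_itv; last exact: st.
apply: ler_wpM2r; first by rewrite subr_ge0.
exact: ew2.
Qed.

Lemma Ldist_nonincreasing_lip s t : a <= s -> s <= t -> t <= b -> Ldist t <= Ldist s.
Proof. exact: slow_growth Ldist_step _ _. Qed.

End TwoSolutions.

Lemma Ldist_nonincreasing a b B H H' s t : bounded_periodic B H ->
  bounded_periodic B H' -> amild a b H -> amild a b H' ->
  a <= s -> s <= t -> t <= b -> Ldist H H' t <= Ldist H H' s.
Proof.
move=> bH bH' aH aH'; have [L L0 lip] := damping_lip dg (2 * B).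
exact: (Ldist_nonincreasing_lip bH bH' aH aH' L0 lip).
Qed.

End Contraction.

(** * Calculus *)

Section EpsilonDerivative.
Context {R : realType}.

Lemma is_derive_eps (f : R -> R) (x d : R) :
  (forall e, 0 < e -> exists2 del, 0 < del & forall h, `|h| < del ->
     `|f (x + h) - f x - d * h| <= e * `|h|) -> is_derive x 1 f d.
Proof.
move=> hf.
have cv : h^-1 *: ((f \o shift x) (h *: (1 : R)) - f x) @[h --> 0^'] --> d.
  apply/cvgrPdist_le => e e0; have [del del0 hd] := hf e e0.
  exists del => //= h; rewrite /ball_/= sub0r normrN => hdel h0.
  rewrite /shift/= /GRing.scale/= mulr1 (addrC h x).
  rewrite (_ : d - _ = - (h^-1 * (f (x + h) - f x - d * h))); last by field.
  by rewrite normrN normrM normfV ler_pdivrMl ?normr_gt0// (mulrC `|h|) hd.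
apply: DeriveDef; first by apply/cvg_ex; exists d.
exact: (cvg_lim _ cv).
Qed.

Lemma is_derive_epsP (f : R -> R) (x d : R) : is_derive x 1 f d ->
  forall e, 0 < e -> exists2 del, 0 < del & forall h, `|h| < del ->
     `|f (x + h) - f x - d * h| <= e * `|h|.
Proof.
move=> [df fd] e e0.
have : h^-1 *: ((f \o shift x) (h *: (1 : R)) - f x) @[h --> 0^'] --> d.
  by rewrite -fd; exact: df.
move=> /cvgrPdist_le /(_ e e0) [del /= del0 hd]; exists del => // h hdel.
have [->|h0] := eqVneq h 0; first by rewrite addr0 subrr mulr0 subrr normr0 mulr0.
have := hd h; rewrite /ball_/= sub0r normrN => /(_ hdel h0).
rewrite /shift/= /GRing.scale/= mulr1 (addrC h x) => h1.
rewrite (_ : f (x + h) - f x - d * h = (h^-1 * (f (x + h) - f x) - d) * h); last by field.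
by rewrite normrM ler_wpM2r// distrC.
Qed.

Lemma is_derive_quadratic (f : R -> R) (x d C : R) : 0 <= C ->
  (forall h, `|f (x + h) - f x - d * h| <= C * h ^+ 2) -> is_derive x 1 f d.
Proof.
move=> C0 hf; apply: is_derive_eps => e e0; exists (e / (C + 1)).
  by rewrite divr_gt0// ltr_wpDl.
move=> h; rewrite ltr_pdivlMr ?ltr_wpDl// => hd; apply: le_trans (hf h) _.
rewrite -real_normK ?num_real// expr2 mulrA; apply: ler_wpM2r => //.
by rewrite mulrC; apply: le_trans (ltW hd); rewrite mulrDr mulr1 lerDl.
Qed.

Lemma is_derive_continuous (f : R -> R) (x d : R) : is_derive x 1 f d ->
  {for x, continuous f}.
Proof. by move=> [df _]; apply: differentiable_continuous; apply/derivable1_diffP. Qed.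

End EpsilonDerivative.

Section ChainRule.
Context {R : realType}.

Lemma is_derive_comp (f h : R -> R) (x df dh : R) :
  is_derive x 1 h dh -> is_derive (h x) 1 f df ->
  is_derive x 1 (fun y => f (h y)) (df * dh).
Proof.
move=> hh ff.
by have := @is_derive1_comp _ f h x df dh ff hh.
Qed.

Lemma is_derive_affine (x c d : R) : is_derive x 1 (fun y => c * y + d) c.
Proof.
apply: (@is_derive_quadratic _ _ _ _ 0) => // h.
by rewrite (_ : _ - _ - _ = 0) ?normr0 ?mul0r//; ring.
Qed.

Lemma is_derive_mul (f h : R -> R) (x df dh : R) :
  is_derive x 1 f df -> is_derive x 1 h dh ->
  is_derive x 1 (fun y => f y * h y) (df * h x + f x * dh).
Proof.
move=> ff hh; have := @is_deriveM _ _ f h x 1 df dh ff hh.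
by rewrite /GRing.scale/= (addrC (df * _)) (mulrC df).
Qed.

Lemma is_derive_add (f h : R -> R) (x df dh : R) :
  is_derive x 1 f df -> is_derive x 1 h dh ->
  is_derive x 1 (fun y => f y + h y) (df + dh).
Proof. exact: is_deriveD. Qed.

Lemma is_derive_sub (f h : R -> R) (x df dh : R) :
  is_derive x 1 f df -> is_derive x 1 h dh ->
  is_derive x 1 (fun y => f y - h y) (df - dh).
Proof. exact: is_deriveB. Qed.

Lemma is_derive_scale (c : R) (f : R -> R) (x df : R) :
  is_derive x 1 f df -> is_derive x 1 (fun y => c * f y) (c * df).
Proof. exact: is_deriveZ. Qed.

Lemma is_derive_const (c x : R) : is_derive x 1 (fun=> c) 0.
Proof. exact: is_derive_cst. Qed.

Lemma FTC_everywhere (f df : R -> R) (a b : R) : a <= b -> continuous df ->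
  (forall x : R, is_derive x 1 f (df x)) ->
  \int[leb]_(x in `[a, b]) df x = f b - f a.
Proof.
rewrite le_eqVlt => /predU1P[->|ab] cdf hf; first by rewrite Rintegral_itv_refl subrr.
rewrite /Rintegral (@continuous_FTC2 _ df f a b)//.
- exact: continuous_subspaceT.
- split.
  + by move=> x _; case: (hf x).
  + by apply: cvg_at_right_filter; exact: is_derive_continuous (hf a).
  + by apply: cvg_at_left_filter; exact: is_derive_continuous (hf b).
- by move=> x _; rewrite derive1E; case: (hf x).
Qed.

End ChainRule.

(** * C^1 steps and admissible test functions *)

Section SmoothStep.
Context {R : realType}.
Implicit Type x : R.

Definition pos x : R := Num.max 0 x.

Lemma pos_le0 x : x <= 0 -> pos x = 0. Proof. by move=> x0; rewrite /pos max_l. Qed.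
Lemma pos_ge0 x : 0 <= x -> pos x = x. Proof. by move=> x0; rewrite /pos max_r. Qed.

(** The first-order expansion has an error of at most [h ^+ 2] whatever the signs of [x] and
    [x + h]. *)
Lemma is_derive_pos2 x : is_derive x 1 (fun y => pos y ^+ 2) (2 * pos x).
Proof.
apply: (@is_derive_quadratic _ _ _ _ 1) => // h; rewrite mul1r ler_norml.
have [x0|x0] := leP x 0; have [h0|h0] := leP (x + h) 0;
  rewrite ?(pos_le0 x0) ?(pos_ge0 (ltW x0)) ?(pos_le0 h0) ?(pos_ge0 (ltW h0)); nra.
Qed.

(* A C^1 function equal to 0 on ]-oo, 0] and to 1 on [1, +oo[. *)
Definition step x : R :=
  2 * pos x ^+ 2 - 4 * pos (x - 2^-1) ^+ 2 + 2 * pos (x - 1) ^+ 2.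
Definition dstep x : R := 4 * pos x - 8 * pos (x - 2^-1) + 4 * pos (x - 1).

Lemma is_derive_pos2_shift x c : is_derive x 1 (fun y => pos (y - c) ^+ 2) (2 * pos (x - c)).
Proof.
apply: is_derive_eps => e e0.
have [del del0 hd] := is_derive_epsP (is_derive_pos2 (x - c)) e0.
by exists del => // h /hd; rewrite (_ : x - c + h = x + h - c)//; ring.
Qed.

Lemma is_derive_step x : is_derive x 1 step (dstep x).
Proof.
have d1 := is_derive_pos2 x.
have d2 := is_derive_pos2_shift x 2^-1.
have d3 := is_derive_pos2_shift x 1.
have -> : dstep x = 2 * (2 * pos x) - 4 * (2 * pos (x - 2^-1)) + 2 * (2 * pos (x - 1)).
  by rewrite /dstep; ring.
exact: (is_derive_add (is_derive_sub (is_derive_scale 2 d1) (is_derive_scale 4 d2))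
  (is_derive_scale 2 d3)).
Qed.

Lemma continuous_pos : continuous (pos : R -> R).
Proof. by move=> x; apply: continuous_max => //; exact: cvg_cst. Qed.

Lemma continuous_dstep : continuous dstep.
Proof.
have c c0 : continuous (fun x : R => pos (x - c0)).
  move=> x; apply: (@continuous_comp _ _ _ (fun y : R => y - c0) pos); last exact: continuous_pos.
  by apply: cvgB; [exact: cvg_id|exact: cvg_cst].
move=> x; apply: cvgD; first apply: cvgB; apply: cvgM => //; try exact: cvg_cst.
- exact: continuous_pos.
- exact: c.
- exact: c.
Qed.

Lemma step_le0 x : x <= 0 -> step x = 0.
Proof. by move=> x0; rewrite /step !pos_le0; lra. Qed.

Lemma step_ge1 x : 1 <= x -> step x = 1.
Proof. by move=> x1; rewrite /step !pos_ge0; lra. Qed.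

Let cases x (P : R -> R -> R -> Prop) : 
  (x <= 0 -> P 0 0 0) -> (0 <= x -> x <= 2^-1 -> P x 0 0) ->
  (2^-1 <= x -> x <= 1 -> P x (x - 2^-1) 0) ->
  (1 <= x -> P x (x - 2^-1) (x - 1)) -> P (pos x) (pos (x - 2^-1)) (pos (x - 1)).
Proof.
move=> P1 P2 P3 P4; have [x0|x0] := leP x 0.
  by rewrite !pos_le0; [exact: P1|lra|lra|lra].
have [x1|x1] := leP x 2^-1.
  by rewrite (pos_ge0 (ltW x0)) !pos_le0; [apply: P2; lra|lra|lra].
have [x2|x2] := leP x 1.
  by rewrite (pos_ge0 (ltW x0)) pos_ge0 ?pos_le0; [apply: P3; lra|lra|lra].
by rewrite !pos_ge0; [apply: P4; lra|lra|lra|lra].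
Qed.

Lemma step01 x : 0 <= step x <= 1.
Proof.
rewrite /step; apply: (@cases x (fun a b c => 0 <= 2 * a ^+ 2 - 4 * b ^+ 2 + 2 * c ^+ 2 <= 1));
  move=> *; apply/andP; split; nra.
Qed.

Lemma dstep_bound x : 0 <= dstep x <= 2.
Proof.
rewrite /dstep; apply: (@cases x (fun a b c => 0 <= 4 * a - 8 * b + 4 * c <= 2));
  move=> *; apply/andP; split; lra.
Qed.

Lemma dstep_le0 x : x <= 0 -> dstep x = 0.
Proof. by move=> x0; rewrite /dstep !pos_le0; lra. Qed.

Lemma dstep_ge1 x : 1 <= x -> dstep x = 0.
Proof. by move=> x1; rewrite /dstep !pos_ge0; lra. Qed.

Lemma continuous_step : continuous step.
Proof. by move=> x; exact: is_derive_continuous (is_derive_step x). Qed.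

End SmoothStep.

Section RectangleTest.
Context {R : realType}.

(** The rectangle is closed, so it contains the closure of the support, and it is compact, so that
    closure is compact as well. *)
Lemma test_function_rect (Omega : set (R * R)) (phi phix phit : R * R -> R)
    (x0 x1 t0 t1 : R) :
  (forall p : R * R, is_derive p.1 1 (fun x => phi (x, p.2)) (phix p)) ->
  (forall p : R * R, is_derive p.2 1 (fun t => phi (p.1, t)) (phit p)) ->
  continuous phix -> continuous phit ->
  (forall p, Omega p -> phi p != 0 -> x0 <= p.1 <= x1 /\ t0 <= p.2 <= t1) ->
  (forall p, x0 <= p.1 <= x1 -> t0 <= p.2 <= t1 -> Omega p) ->
  [/\ test_function Omega phi, partial_x phi = phix & partial_t phi = phit].
Proof.
move=> dx dt cx ct supp sub.
have px : partial_x phi = phix.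
  by apply/funext => p; rewrite /partial_x derive1E; case: (dx p).
have pt : partial_t phi = phit.
  by apply/funext => p; rewrite /partial_t derive1E; case: (dt p).
split => //; split.
  exists setT; split => //; first exact: openT.
  move=> p _; split; [by case: (dx p)|by case: (dt p)|..].
    by rewrite px; exact: cx.
  by rewrite pt; exact: ct.
have cr : compact (`[x0, x1]%classic `*` `[t0, t1]%classic : set (R * R)).
  by apply: compact_setX; exact: segment_compact.
have clr : closed (`[x0, x1]%classic `*` `[t0, t1]%classic : set (R * R)).
  by apply: compact_closed.
have inr : closure (Omega `&` [set p | phi p != 0]) `<=`
    `[x0, x1]%classic `*` `[t0, t1]%classic.
  rewrite [X in _ `<=` X]((closure_id _).1 clr); apply: closureS => p [Op p0].
  by have [h1 h2] := supp p Op p0; split; rewrite /= in_itv.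
split; first exact: subclosed_compact (@closed_closure _ _) cr inr.
by move=> p /inr[] /=; rewrite !in_itv/=; exact: sub.
Qed.

End RectangleTest.

Section Fold.
Context {R : realType}.

Lemma integrable_in_period (f : R -> R) (D : set R) : measurable D -> D `<=` period ->
  leb.-integrable period (EFin \o f) -> leb.-integrable D (EFin \o f).
Proof. by move=> mD Dp; apply: integrableS => //; exact: measurable_period. Qed.

Lemma integrable_isom s c (f : R -> R) (D : set R) : s = 1 \/ s = -1 ->
  measurable D -> measurable_fun setT f -> leb.-integrable D (EFin \o f) ->
  leb.-integrable (isom s c @^-1` D) (EFin \o (f \o isom s c)).
Proof.
move=> s1 mD mf /integrableP[_ fi].
have mi := measurable_isom s c.
apply/integrableP; split.
  by apply/measurable_EFinP; apply: measurable_funTS; exact: measurableT_comp.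
have := @ge0_integral_isom _ s c (fun x => `|(f x)%:E|)%E D s1 mD.
move=> <- //; by apply: measurableT_comp => //; exact/measurable_EFinP.
Qed.

Lemma Rintegral_isom s c (f : R -> R) (D : set R) : s = 1 \/ s = -1 ->
  measurable D -> measurable_fun setT f ->
  \int[leb]_(x in D) f x = \int[leb]_(x in isom s c @^-1` D) f (isom s c x).
Proof.
move=> s1 mD mf; rewrite /Rintegral; congr fine.
have me : measurable_fun setT (EFin \o f) by exact/measurable_EFinP.
rewrite integralE [RHS]integralE; congr (_ - _)%E.
  rewrite (@ge0_integral_isom _ s c _ D s1 mD)//; last exact: measurable_funepos.
  by apply: eq_integral => x _; rewrite !funeposE.
rewrite (@ge0_integral_isom _ s c _ D s1 mD)//; last exact: measurable_funeneg.
by apply: eq_integral => x _; rewrite !funenegE.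
Qed.

Lemma Rintegral_cc_oo (a b : R) (f : R -> R) : leb.-integrable `[a, b] (EFin \o f) ->
  \int[leb]_(x in `[a, b]) f x = \int[leb]_(x in `]a, b[) f x.
Proof.
move=> iF; rewrite -(Rintegral_itv_obnd_cbnd (r := a) (b := BRight b)).
  rewrite -Rintegral_itv_bndo_bndc//.
  by apply: integrableS iF => //; apply: subset_itv; rewrite bnd_simp.
by apply: integrableS iF => //; apply: subset_itv; rewrite bnd_simp.
Qed.

Lemma integrable_fold (q : R -> R) : measurable_fun setT q ->
  leb.-integrable period (EFin \o q) ->
  leb.-integrable `]0, 1[ (EFin \o q) /\ leb.-integrable `]0, 1[ (EFin \o (fun x => q (- x))).
Proof.
move=> mq iq; split.
  by apply: integrable_in_period iq => // x; rewrite /period/= !in_itv/=; lra.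
have i1 : leb.-integrable `]-1, 0[ (EFin \o q).
  by apply: integrable_in_period iq => // x; rewrite /period/= !in_itv/=; lra.
have := @integrable_isom (-1) 0 q _ (or_intror erefl) _ mq i1.
rewrite (_ : isom _ _ @^-1` _ = `]0, 1[%classic).
  move=> /(_ (measurable_itv _)).
  by rewrite (_ : q \o isom (-1) 0 = (fun x => q (- x)))//; apply/funext => x; rewrite /isom/= mulN1r addr0.
by apply/seteqP; split => x /=; rewrite /isom !in_itv/=; lra.
Qed.

(** One half of the period carries [f^+] and the other [f^-], so this passes between integrals over
    the interval and over the circle. Reflection turns [-1, 0[ into ]0, 1]; end points carry no
    mass. *)
Lemma Rintegral_fold (q : R -> R) : measurable_fun setT q ->
  leb.-integrable period (EFin \o q) ->
  \int[leb]_(x in `]0, 1[) (q x + q (- x)) = \int[leb]_(x in period) q x.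
Proof.
move=> mq iq; have [i1 i2] := integrable_fold mq iq.
have ic : leb.-integrable `[0, 1[ (EFin \o q).
  by apply: integrable_in_period iq => // x; rewrite /period/= !in_itv/=; lra.
have im : leb.-integrable `[-1, 0[ (EFin \o q).
  by apply: integrable_in_period iq => // x; rewrite /period/= !in_itv/=; lra.
rewrite RintegralD//.
have perU : period = `[-1, 0[%classic `|` `[0, 1[%classic :> set R.
  by apply/seteqP; split => x; rewrite /period/= !in_itv/=;
    [move=> /andP[? ?]; case: (ltrP x 0) => ?; [left|right]|case]; lra.
rewrite perU Rintegral_setU//; last 2 first.
- by rewrite -perU.
- by apply/disj_setPS => x /=; rewrite !in_itv/=; lra.
rewrite addrC; congr (_ + _); last first.
  by apply: Rintegral_itv_obnd_cbnd; exact: i1.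
rewrite (@Rintegral_isom (-1) 0 q `[-1, 0[); [|by right|exact: measurable_itv|exact: mq].
rewrite (_ : isom _ _ @^-1` _ = `]0, 1]%classic); last first.
  by apply/seteqP; split => x /=; rewrite /isom !in_itv/=; lra.
rewrite Rintegral_itv_bndo_bndc; last exact: i2.
by apply: eq_Rintegral => x _; rewrite /isom mulN1r addr0.
Qed.

End Fold.

Section DominatedFubini.
Context {R : realType}.

Lemma dominated_Fubini (D : set R) (f : R * R -> R) (k : R -> R) (s t : R) :
  measurable D -> measurable_fun setT f -> leb.-integrable D (EFin \o k) ->
  (forall x r, D x -> `|f (x, r)| <= k x) ->
  [/\ forall r, leb.-integrable D (EFin \o (fun x => f (x, r))),
      leb.-integrable `[s, t] (EFin \o (fun r => \int[leb]_(x in D) f (x, r))) &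
      \int[leb]_(x in D) \int[leb]_(r in `[s, t]) f (x, r) =
      \int[leb]_(r in `[s, t]) \int[leb]_(x in D) f (x, r)].
Proof.
move=> mD mf ik fk.
have fi r : leb.-integrable D (EFin \o (fun x => f (x, r))).
  apply: (@dominated_integrable _ _ _ k) => //.
    by apply: measurable_funTS; exact: measurable_section2.
  by move=> x; exact: fk.
have f1 x : D x -> leb.-integrable `[s, t] (EFin \o (fun r => f (x, r))).
  move=> Dx; apply: (@dominated_integrable _ _ _ (cst (k x))) => //.
  - by apply: measurable_funTS; exact: measurable_section1.
  - by apply: int_cst => //; exact: leb_itv_lty.
  - by move=> r _; exact: fk.
have f3 : (\int[leb]_(r in `[s, t]) \int[leb]_(x in D) `|f (x, r)|%:E < +oo)%E.
  apply: (@le_lt_trans _ _ (\int[leb]_(r in `[s, t]) (cst (\int[leb]_(x in D) k x)%:E r))%E).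
    apply: ge0_le_integral => //.
    + by move=> r _; apply: integral_ge0 => z _; rewrite lee_fin.
    + apply: measurable_funTS.
      rewrite (_ : (fun r => _) = fubini_G leb
         (fun p : measurableTypeR R * measurableTypeR R => ((`|f p| * \1_D p.1)%:E))).
        apply: measurable_fun_fubini_tonelli_G.
          apply/measurable_EFinP; apply: measurable_funM; first exact: measurableT_comp.
          by apply: (measurableT_comp _ measurable_fst); exact: measurable_indic.
        by move=> p; rewrite lee_fin mulr_ge0.
      apply/funext => r; rewrite /fubini_G [LHS]integral_mkcond; apply: eq_integral => z _.
      by rewrite patchE /= indicE; case: (z \in D); rewrite ?mulr1 ?mulr0.
    + move=> r _; have ni := int_norm (fi r).
      have nf : (\int[leb]_(z in D) `|f (z, r)|%:E)%E \is a fin_num.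
        by apply: integrable_fin_num.
      rewrite -(fineK nf) lee_fin; apply: le_Rintegral => // x Dx; exact: fk.
  rewrite integral_cst//= lebesgue_measure_itv/=; case: ifP => _; last by rewrite mule0 ltry.
  by rewrite -EFinB -EFinM ltry.
by have [? ? _ ?] := Rintegral_Fubini mD (measurable_itv `[s, t]) mf f1 (fun r _ => fi r) f3.
Qed.

(** The weak formulation integrates over all positive times. Outside the window of the test function
    the integrand vanishes; inside, [h'] may replace [h] at each time because a null set of [x] does
    not count. *)
Lemma iterated_zero (X : set R) (h h' : R * R -> R) (s t : R) : measurable X -> 0 < s ->
  (forall r, 0 < r -> ~~ (s <= r <= t) -> forall x, X x -> h (x, r) = 0) ->
  (forall r, s <= r <= t -> {ae leb, forall x, X x -> h (x, r) = h' (x, r)}) ->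
  (forall r, s <= r <= t -> measurable_fun X (fun x => h (x, r))) ->
  (forall r, s <= r <= t -> leb.-integrable X (EFin \o (fun x => h' (x, r)))) ->
  (\int[leb]_(r in Rgt0) \int[leb]_(x in X) (h (x, r))%:E = 0)%E ->
  \int[leb]_(r in `[s, t]) \int[leb]_(x in X) h' (x, r) = 0.
Proof.
move=> mX s0 out inn mh ih' H0.
rewrite /Rintegral; transitivity (fine (\int[leb]_(r in Rgt0) \int[leb]_(x in X) (h (x, r))%:E)%E); last first.
  by rewrite H0.
congr fine.
rewrite [LHS]integral_mkcond [RHS]integral_mkcond; apply: eq_integral => r _.
rewrite !patchE mem_setE in_itv/= /Rgt0 mem_setE in_itv/= andbT.
case: ifP => rst.
  rewrite (lt_le_trans s0 (proj1 (andP rst))).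
  rewrite fineK; last by apply: integrable_fin_num => //; exact: ih'.
  apply: ae_eq_integral => //.
  - by apply: measurable_int (ih' r rst).
  - by apply/measurable_EFinP; exact: mh.
  - by have := inn r rst; apply: ae_imply => x hx Xx; rewrite /= hx.
case: ifP => // r0; rewrite integral0_eq// => x Xx.
by rewrite out// rst.
Qed.

End DominatedFubini.

(** * From weak equations in time to increments *)

Section TimeLocalization.
Context {R : realType}.

Lemma unit_diff (a b : R) : 0 <= a <= 1 -> 0 <= b <= 1 -> -1 <= a - b <= 1.
Proof. by move=> /andP[? ?] /andP[? ?]; apply/andP; split; lra. Qed.

Lemma localization_estimate (A A1 A2 I mt ms e e' ep C : R) : 0 <= C -> ep <= e' ->
  e' * (3 * C + 3) = e -> `|A - I| <= 3 * C * ep -> `|A2 - mt| <= e' ->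
  `|A1 - ms| <= e' -> A1 - A2 - A = 0 -> `|mt - (ms - I)| <= e.
Proof.
move=> C0 epe <- h1 h2 h3 h4; have : C * ep <= C * e' by exact: ler_wpM2l.
move: h1 h2 h3; rewrite !ler_norml => /andP[? ?] /andP[? ?] /andP[? ?] ?.
by apply/andP; split; lra.
Qed.

Variables (m q : R -> R) (p0 q0 C : R).
Hypothesis weak_mq : forall (th dth : R -> R) (s t : R), p0 < s -> t < q0 ->
  (forall x : R, is_derive x 1 th (dth x)) -> continuous dth ->
  (forall r, ~~ (s <= r <= t) -> th r = 0 /\ dth r = 0) ->
  \int[leb]_(r in `[s, t]) (m r * dth r - q r * th r) = 0.
Hypothesis mq : measurable_fun setT q.
Hypothesis mm : measurable_fun setT m.
Hypothesis qC : forall r, `|q r| <= C.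
Hypothesis mC : forall r, `|m r| <= C.

(** The test function is the difference of two C^1 ramps of width [ep] that begin at [s] and [t]. It
    approximates the indicator function of [[s], [t]], and its derivative averages [m] just after
    [s] and just after [t]. *)
Lemma time_localization (s t : R) : p0 < s -> s < t -> t < q0 ->
  (forall e, 0 < e -> exists2 d, 0 < d & forall r, s <= r -> r - s <= d -> `|m r - m s| <= e) ->
  (forall e, 0 < e -> exists2 d, 0 < d & forall r, t <= r -> r - t <= d -> `|m r - m t| <= e) ->
  m t = m s - \int[leb]_(r in `[s, t]) q r.
Proof.
move=> ps st tq cs ct.
have C0 : 0 <= C by exact: le_trans (qC 0).
apply/eqP; rewrite -subr_eq0 -normr_le0; apply/ler_addgt0Pl => e e0; rewrite addr0.
pose e' := e / (3 * C + 3).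
have C3 : 0 < 3 * C + 3 by lra.
have e'0 : 0 < e' by rewrite divr_gt0.
have ee : e' * (3 * C + 3) = e by rewrite /e' mulfVK// gt_eqF.
have [d1 d10 hd1] := cs e' e'0.
have [d2 d20 hd2] := ct e' e'0.
(* [d1] and [d2] control the averages of [m] and [e'] the error; [t - s] makes the first ramp end
   before the second begins, and [(q0 - t) / 2] keeps the support before [q0]. *)
pose ep := Num.min (Num.min d1 d2) (Num.min (Num.min e' (t - s)) ((q0 - t) / 2)).
have ep0 : 0 < ep by rewrite !lt_min d10 d20 e'0 subr_gt0 st/= divr_gt0// subr_gt0.
have [epd1 epd2 epe epts epq] : [/\ ep <= d1, ep <= d2, ep <= e', ep <= t - s & ep <= (q0 - t) / 2].
  by rewrite !ge_min !lexx !orbT.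
have epV : 0 < ep^-1 by rewrite invr_gt0.
clearbody ep.
pose ramp c x := step (ep^-1 * x + - (ep^-1 * c)).
pose dramp c x := ep^-1 * dstep (ep^-1 * x + - (ep^-1 * c)).
have drampE c x : is_derive (x : R) 1 (ramp c) (dramp c x).
  rewrite /dramp mulrC; apply: (is_derive_comp (h := fun x => ep^-1 * x + _)).
    exact: is_derive_affine.
  exact: is_derive_step.
have cdramp c : continuous (dramp c).
  move=> x; apply: cvgM; first exact: cvg_cst.
  apply: (@continuous_comp _ _ _ (fun x => ep^-1 * x + - (ep^-1 * c)) dstep); last exact: continuous_dstep.
  by apply: cvgD; [apply: cvgM; [exact: cvg_cst|exact: cvg_id]|exact: cvg_cst].
have arg c x : ep^-1 * x + - (ep^-1 * c) = ep^-1 * (x - c) by ring.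
have low c x : x <= c -> ramp c x = 0 /\ dramp c x = 0.
  move=> xc; have h : ep^-1 * (x - c) <= 0 by rewrite pmulr_rle0// subr_le0.
  by rewrite /ramp /dramp arg step_le0// dstep_le0// mulr0.
have high c x : c + ep <= x -> ramp c x = 1 /\ dramp c x = 0.
  move=> xc; have h : 1 <= ep^-1 * (x - c).
    by rewrite ler_pdivlMl// mulr1 lerBrDl.
  by rewrite /ramp /dramp arg step_ge1// dstep_ge1// mulr0.
have ramp01 c x : 0 <= ramp c x <= 1 by exact: step01.
have dramp0 c x : 0 <= dramp c x.
  apply: mulr_ge0; first exact: ltW.
  by case/andP: (dstep_bound (ep^-1 * x + - (ep^-1 * c))).
have tq' : t + ep < q0 by lra.
have cth : continuous (fun r => dramp s r - dramp t r).
  by move=> x; apply: cvgB; exact: cdramp.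
have oth r : ~~ (s <= r <= t + ep) -> ramp s r - ramp t r = 0 /\ dramp s r - dramp t r = 0.
  rewrite negb_and -!ltNge => /orP[h|h].
    have [-> ->] := low s r (ltW h); have [-> ->] := low t r (ltW (lt_trans h st)).
    by rewrite subrr.
  have [-> ->] := high t r (ltW h); have [|-> ->] := high s r; first by rewrite (le_trans _ (ltW h))// lerD2r ltW.
  by rewrite !subrr.
have := weak_mq ps tq' (fun x => is_derive_sub (drampE s x) (drampE t x)) cth oth.
have mD : measurable (`[s, t + ep]%classic : set R) by [].
have bint (f : R -> R) (c : R) a b : measurable_fun setT f -> (forall r, `|f r| <= c) ->
    leb.-integrable `[a, b] (EFin \o f).
  move=> mf fc; apply: (@dominated_integrable _ _ _ (cst c)) => //; first exact: measurable_funTS.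
  by apply: int_cst => //; exact: leb_itv_lty.
have mdr c : measurable_fun setT (dramp c) by exact: continuous_measurable_fun.
have mr c : measurable_fun setT (ramp c).
  apply: continuous_measurable_fun => x; exact: is_derive_continuous (drampE c x).
have drb c x : `|dramp c x| <= ep^-1 * 2.
  rewrite ger0_norm//; apply: ler_wpM2l; first exact: ltW.
  by case/andP: (dstep_bound (ep^-1 * x + - (ep^-1 * c))).
have imd c : leb.-integrable `[s, t + ep] (EFin \o (fun r => m r * dramp c r)).
  apply: (bint _ (C * (ep^-1 * 2))); first exact: measurable_funM.
  by move=> r; rewrite normrM; exact: ler_pM.
have iqr c a b : leb.-integrable `[a, b] (EFin \o (fun r => q r * ramp c r)).
  apply: (bint _ C); first exact: measurable_funM.
  move=> r; rewrite normrM; apply: le_trans (qC r); rewrite ler_piMr//.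
  by rewrite ger0_norm; case/andP: (ramp01 c r).
have idr c : leb.-integrable `[s, t + ep] (EFin \o dramp c).
  exact: (bint _ (ep^-1 * 2)).
pose u r := q r * (ramp s r - ramp t r).
have mu : measurable_fun setT u by apply: measurable_funM => //; exact: measurable_funB.
have uC r : `|u r| <= C.
  rewrite normrM; apply: le_trans (qC r); rewrite ler_piMr// ler_norml.
  exact: unit_diff.
have iu a b : leb.-integrable `[a, b] (EFin \o u) by exact: (bint _ C).
have iq a b : leb.-integrable `[a, b] (EFin \o q) by exact: (bint _ C).
rewrite (_ : \int[leb]_(r in _) _ = \int[leb]_(r in `[s, t + ep]) (m r * dramp s r)
   - \int[leb]_(r in `[s, t + ep]) (m r * dramp t r) - \int[leb]_(r in `[s, t + ep]) u r); last first.
  rewrite -RintegralB// -RintegralB//; last exact: int_sub.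
  by apply: eq_Rintegral => r _; rewrite /u; ring.
(* [dramp c] is nonnegative, of integral 1 and carried by [[c], [c + ep]], so integrating [m]
   against it gives an average of [m] just after [c]. *)
have conc c : s <= c -> c <= t -> (forall r, c <= r -> r - c <= ep -> `|m r - m c| <= e') ->
    `|\int[leb]_(r in `[s, t + ep]) (m r * dramp c r) - m c| <= e'.
  move=> sc ct' hc.
  have I1 : \int[leb]_(r in `[s, t + ep]) dramp c r = 1.
    rewrite (FTC_everywhere (f := ramp c))//; last by rewrite (le_trans (ltW st))// lerDl ltW.
    have [|-> _] := high c (t + ep); first by rewrite lerD2r.
    by have [-> _] := low c s sc; rewrite subr0.
  rewrite -[m c]mulr1 -I1 -RintegralZl// -RintegralB//; last exact: int_scale.
  rewrite -[leRHS]mulr1 -I1 -RintegralZl//.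
  apply: Rintegral_abs_le => //.
  - by apply: int_sub => //; exact: int_scale.
  - exact: int_scale.
  move=> r _; rewrite -mulrBl normrM (ger0_norm (dramp0 c r)).
  have [rc|rc] := leP r c; first by have [_ ->] := low c r rc; rewrite !mulr0.
  have [rc'|rc'] := leP (c + ep) r; first by have [_ ->] := high c r rc'; rewrite !mulr0.
  apply: ler_wpM2r; first exact: dramp0.
  by apply: hc; [exact: ltW|rewrite lerBlDl ltW].
have := conc s (lexx s) (ltW st) (fun r h1 h2 => hd1 r h1 (le_trans h2 epd1)).
have := conc t (ltW st) (lexx t) (fun r h1 h2 => hd2 r h1 (le_trans h2 epd2)).
have ucl a b : a <= b -> `|\int[leb]_(r in `[a, b]) (u r - q r)| <= C * (b - a).
  move=> ab; rewrite -(fine_leb_itv ab) -Rintegral_cst//; apply: Rintegral_abs_le => //.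
  - exact: int_sub.
  - by apply: int_cst => //; exact: leb_itv_lty.
  move=> r _ /=; rewrite /u -{2}[q r]mulr1 -mulrBr normrM; apply: le_trans (qC r).
  rewrite ler_piMr// ler_norml.
  have /andP[a1 a2] := ramp01 s r; have /andP[a3 a4] := ramp01 t r.
  have [rt|rt] := leP r t; first by have [-> _] := low t r rt; rewrite subr0; apply: unit_diff; rewrite ?ler01 ?lexx ?a1.
  have [|-> _] := high s r; first by rewrite (le_trans _ (ltW rt))// addrC -lerBrDr.
  by rewrite addrAC subrr; apply: unit_diff; rewrite ?ler01 ?lexx ?a3.
(* [u] and [q] agree on [[s + ep], [t]]. What is left are two transition layers and the integral of
   [q] over the last one, each at most [C * ep]; hence the factor 3. *)
have u1 : `|\int[leb]_(r in `[s, t + ep]) u r - \int[leb]_(r in `[s, t]) q r| <= 3 * C * ep.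
  have sep : s + ep <= t by rewrite addrC -lerBrDr.
  rewrite (@Rintegral_itv_chain _ _ s t (t + ep) (ltW st))//; last by rewrite lerDl ltW.
  have -> : \int[leb]_(r in `[t, t + ep]) u r =
     \int[leb]_(r in `[t, t + ep]) (u r - q r) + \int[leb]_(r in `[t, t + ep]) q r.
    by rewrite RintegralB// subrK.
  rewrite addrAC -RintegralB//.
  rewrite (@Rintegral_itv_chain _ _ s (s + ep) t)//; [|by rewrite lerDl ltW|exact: int_sub].
  have -> : \int[leb]_(r in `[s + ep, t]) (u r - q r) = 0.
    rewrite (_ : \int[leb]_(r in _) _ = \int[leb]_(r in `[s + ep, t]) (cst 0 r)).
      by rewrite Rintegral_cst// mul0r.
    apply: eq_Rintegral => r; rewrite inE/= in_itv/= => /andP[r1 r2].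
    by rewrite /u; have [-> _] := high s r r1; have [-> _] := low t r r2; rewrite subr0 mulr1 subrr.
  rewrite addr0.
  have h1 : `|\int[leb]_(r in `[s, s + ep]) (u r - q r)| <= C * ep.
    by have := ucl s (s + ep); rewrite addrAC subrr add0r; apply; rewrite lerDl ltW.
  have h2 : `|\int[leb]_(r in `[t, t + ep]) (u r - q r)| <= C * ep.
    by have := ucl t (t + ep); rewrite addrAC subrr add0r; apply; rewrite lerDl ltW.
  have h3 : `|\int[leb]_(r in `[t, t + ep]) q r| <= C * ep.
    have -> : C * ep = C * fine (leb `[t, t + ep]) by rewrite fine_leb_itv ?lerDl ?(ltW ep0)// addrAC subrr add0r.
    rewrite -Rintegral_cst//; apply: Rintegral_abs_le => //.
    by apply: int_cst => //; exact: leb_itv_lty.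
  apply: le_trans (ler_normD _ _) _.
  apply: le_trans (lerD h1 (le_trans (ler_normD _ _) (lerD h2 h3))) _.
  by rewrite le_eqVlt; apply/orP; left; apply/eqP; ring.
by move=> v1 v2 v3; exact: localization_estimate C0 epe ee u1 v1 v2 v3.
Qed.

End TimeLocalization.

(** * From weak solutions to the integral equation *)

Section Unfold.
Context {R : realType}.
Implicit Types rho J : R * R -> R.

Definition strip : set (R * R) := I01 `*` Rge0.

Lemma measurable_strip : measurable strip.
Proof. by apply: measurableX; [exact: measurable_I01|exact: measurable_itv]. Qed.

(** This is the function [F] on the circle. [rho] and [J] are set to zero off [strip], since nothing
    is known about the measurability of their values there. *)
Definition unf rho J (p : R * R) : R :=
  let r := rho \_ strip in let j := J \_ strip in
  if 0 <= rep p.1 then (r (rep p.1, p.2) + j (rep p.1, p.2)) / 2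
  else (r (- rep p.1, p.2) - j (- rep p.1, p.2)) / 2.

Lemma measurable_unf rho J : measurable_fun strip rho -> measurable_fun strip J ->
  measurable_fun setT (unf rho J).
Proof.
move=> mr mj.
have mr' : measurable_fun setT (rho \_ strip).
  by apply/(measurable_restrictT _ measurable_strip).
have mj' : measurable_fun setT (J \_ strip).
  by apply/(measurable_restrictT _ measurable_strip).
have mrep : measurable_fun setT (fun p : R * R => rep p.1).
  exact: (measurableT_comp measurable_rep measurable_fst).
have mP : measurable_fun setT (fun p : R * R => (rep p.1, p.2)).
  by apply/measurable_fun_pairP; split; [exact: mrep|exact: measurable_snd].
have mN : measurable_fun setT (fun p : R * R => (- rep p.1, p.2)).
  by apply/measurable_fun_pairP; split; [exact: measurable_funN|exact: measurable_snd].
apply: measurable_fun_ifT.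
- by apply: measurable_fun_ler.
- apply: measurable_funM => //; apply: measurable_funD.
    exact: (measurableT_comp mr' mP).
  exact: (measurableT_comp mj' mP).
- apply: measurable_funM => //; apply: measurable_funB.
    exact: (measurableT_comp mr' mN).
  exact: (measurableT_comp mj' mN).
Qed.

Lemma unf_periodic rho J y t : unf rho J (y + 2, t) = unf rho J (y, t).
Proof. by rewrite /unf /= rep_periodic. Qed.

Lemma unf_pos rho J x t : 0 <= x -> x < 1 -> 0 <= t ->
  unf rho J (x, t) = (rho (x, t) + J (x, t)) / 2.
Proof.
move=> x0 x1 t0; rewrite /unf/= rep_id; last by rewrite /period/= in_itv/=; lra.
rewrite x0 !patchE mem_set//.
by split; rewrite /= /I01 /Rge0/= in_itv/= ?andbT// x0 ltW.
Qed.

Lemma unf_neg rho J x t : 0 < x -> x <= 1 -> 0 <= t ->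
  unf rho J (- x, t) = (rho (x, t) - J (x, t)) / 2.
Proof.
move=> x0 x1 t0; rewrite /unf/= rep_id; last by rewrite /period/= in_itv/=; lra.
rewrite oppr_ge0 leNgt x0/= opprK !patchE mem_set//.
by split; rewrite /= /I01 /Rge0/= in_itv/= ?andbT// x1 ltW.
Qed.

Lemma unf_sum rho J x t : 0 < x -> x < 1 -> 0 <= t ->
  rho (x, t) = unf rho J (x, t) + unf rho J (- x, t) /\
  J (x, t) = unf rho J (x, t) - unf rho J (- x, t).
Proof.
by move=> x0 x1 t0; rewrite (unf_pos _ _ (ltW x0))// (unf_neg _ _ x0 (ltW x1))//; split; field.
Qed.

End Unfold.

Section PlaneFunctions.
Context {R : realType}.

Lemma measurable_sub12 (f : R -> R) : measurable_fun setT f ->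
  measurable_fun setT (fun p : R * R => f (p.1 - p.2)).
Proof.
move=> mf; apply: (measurableT_comp mf).
by apply: measurable_funB; [exact: measurable_fst|exact: measurable_snd].
Qed.

Lemma measurable_oppsub12 (f : R -> R) : measurable_fun setT f ->
  measurable_fun setT (fun p : R * R => f (- p.1 - p.2)).
Proof.
move=> mf; apply: (measurableT_comp mf).
apply: measurable_funB; last exact: measurable_snd.
by apply: measurable_funN; exact: measurable_fst.
Qed.

Lemma continuous_sub12 (f : R -> R) : continuous f ->
  continuous (fun p : R * R => f (p.1 - p.2)).
Proof.
move=> cf p; apply: (@continuous_comp _ _ _ (fun p : R * R => p.1 - p.2) f); last exact: cf.
by apply: cvgB; [exact: cvg_fst|exact: cvg_snd].
Qed.

Lemma continuous_oppsub12 (f : R -> R) : continuous f ->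
  continuous (fun p : R * R => f (- p.1 - p.2)).
Proof.
move=> cf p; apply: (@continuous_comp _ _ _ (fun p : R * R => - p.1 - p.2) f); last exact: cf.
by apply: cvgB; [apply: cvgN; exact: cvg_fst|exact: cvg_snd].
Qed.

Lemma continuous_fst_comp (f : R -> R) : continuous f ->
  continuous (fun p : R * R => f p.1).
Proof.
by move=> cf p; apply: (@continuous_comp _ _ _ fst f); [exact: cvg_fst|exact: cf].
Qed.

Lemma continuous_snd_comp (f : R -> R) : continuous f ->
  continuous (fun p : R * R => f p.2).
Proof.
by move=> cf p; apply: (@continuous_comp _ _ _ snd f); [exact: cvg_snd|exact: cf].
Qed.

Lemma continuousDr (T : topologicalType) (f h : T -> R) :
  continuous f -> continuous h -> continuous (fun x => f x + h x).
Proof. by move=> cf ch x; apply: cvgD; [exact: cf|exact: ch]. Qed.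

Lemma continuousBr (T : topologicalType) (f h : T -> R) :
  continuous f -> continuous h -> continuous (fun x => f x - h x).
Proof. by move=> cf ch x; apply: cvgB; [exact: cf|exact: ch]. Qed.

Lemma continuousMr (T : topologicalType) (f h : T -> R) :
  continuous f -> continuous h -> continuous (fun x => f x * h x).
Proof. by move=> cf ch x; apply: cvgM; [exact: cf|exact: ch]. Qed.

Lemma continuousNr (T : topologicalType) (f : T -> R) :
  continuous f -> continuous (fun x => - f x).
Proof. by move=> cf x; apply: cvgN; exact: cf. Qed.

Lemma continuous_scale (T : topologicalType) (c : R) (f : T -> R) :
  continuous f -> continuous (fun x => c * f x).
Proof. by move=> cf x; apply: cvgM; [exact: cvg_cst|exact: cf]. Qed.

Lemma is_derive_eq (f : R -> R) (x d d' : R) : is_derive x 1 f d -> d = d' ->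
  is_derive x 1 f d'.
Proof. by move=> h <-. Qed.

Lemma is_derive_sub_cst (f df : R -> R) (c x : R) : (forall y : R, is_derive y 1 f (df y)) ->
  is_derive x 1 (fun y => f (y - c)) (df (x - c)).
Proof.
move=> h; apply: is_derive_eps => e e0.
have [d d0 hd] := is_derive_epsP (h (x - c)) e0; exists d => // k kd.
by rewrite (_ : x + k - c = x - c + k); [exact: hd|ring].
Qed.

Lemma is_derive_cst_sub (f df : R -> R) (c x : R) : (forall y : R, is_derive y 1 f (df y)) ->
  is_derive x 1 (fun y => f (c - y)) (- df (c - x)).
Proof.
move=> h; apply: is_derive_eps => e e0.
have [d d0 hd] := is_derive_epsP (h (c - x)) e0; exists d => // k kd.
rewrite (_ : c - (x + k) = c - x + (- k)); last by ring.
by rewrite mulNr -mulrN -[`|k|]normrN; apply: hd; rewrite normrN.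
Qed.

Lemma is_derive_opp_sub (f df : R -> R) (c x : R) : (forall y : R, is_derive y 1 f (df y)) ->
  is_derive x 1 (fun y => f (- y - c)) (- df (- x - c)).
Proof.
move=> h; apply: is_derive_eps => e e0.
have [d d0 hd] := is_derive_epsP (h (- x - c)) e0; exists d => // k kd.
rewrite (_ : - (x + k) - c = - x - c + (- k)); last by ring.
by rewrite mulNr -mulrN -[`|k|]normrN; apply: hd; rewrite normrN.
Qed.

Lemma bounded_support (f : R -> R) (s t : R) : continuous f ->
  (forall r, ~~ (s <= r <= t) -> f r = 0) -> exists2 C, 0 <= C & forall r, `|f r| <= C.
Proof.
move=> cf f0; have [st|ts] := leP s t; last first.
  exists 0 => // r; rewrite f0 ?normr0// negb_and -!ltNge.
  by case: (ltP r s) => //= sr; rewrite (lt_le_trans ts sr).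
have cn : {within `[s, t], continuous (fun x => `|f x|)}.
  by apply: continuous_subspaceT => x; apply: cvg_norm; exact: cf.
have [c _ hc] := EVT_max st cn; exists `|f c| => // r.
have [rst|/f0->] := boolP (s <= r <= t); last by rewrite normr0.
by apply: hc; rewrite in_itv.
Qed.

Lemma measurable_Rintegral_section (D : set R) (f : R * R -> R) : measurable D ->
  measurable_fun setT f -> measurable_fun setT (fun r => \int[leb]_(x in D) f (x, r)).
Proof.
move=> mD mf.
pose T := measurableTypeR R.
pose G (p : T * T) : \bar R := (f p * \1_D p.1)%:E.
have mG : measurable_fun setT G.
  apply/measurable_EFinP; apply: measurable_funM => //.
  by apply: (measurableT_comp _ measurable_fst); exact: measurable_indic.
have mGp : measurable_fun setT (G^\+)%E by exact: measurable_funepos.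
have mGn : measurable_fun setT (G^\-)%E by exact: measurable_funeneg.
have Gp0 q : (0 <= (G^\+)%E q)%E by exact: funepos_ge0.
have Gn0 q : (0 <= (G^\-)%E q)%E by exact: funeneg_ge0.
rewrite (_ : (fun r => _) =
    fine \o (fun r : T => fubini_G leb (G^\+)%E r - fubini_G leb (G^\-)%E r)%E).
  apply: measurableT_comp; first exact: fine_measurable.
  apply: emeasurable_funB; exact: measurable_fun_fubini_tonelli_G.
apply/funext => r /=; rewrite /Rintegral; congr fine.
rewrite [LHS]integral_mkcond integralE; congr (_ - _)%E.
  apply: eq_integral => x _; rewrite !funeposE; congr maxe.
  by rewrite patchE /G/= indicE; case: (x \in D); rewrite ?mulr1 ?mulr0.
apply: eq_integral => x _; rewrite !funenegE; congr (maxe (- _)%E _).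
by rewrite patchE /G/= indicE; case: (x \in D); rewrite ?mulr1 ?mulr0.
Qed.

End PlaneFunctions.

Lemma ae_neq (R : realType) (c : R) : {ae leb, forall x : R, x <> c}.
Proof.
exists [set c]; split; [exact: measurable_set1|exact: lebesgue_measure_set1|].
by move=> x /= h; apply: contrapT.
Qed.

(** * Cut-off near the boundary points *)

Section CutOff.
Context {R : realType}.
Implicit Types (x : R) (n : nat).

Definition sin2 x : R := sin (pi * x) ^+ 2.

Lemma is_derive_sinpi x : is_derive x 1 (fun y => sin (pi * y)) (cos (pi * x) * pi).
Proof.
have dh : is_derive x 1 (fun y : R => pi * y) pi.
  have := is_derive_affine x (pi : R) 0.
  by rewrite (_ : (fun y => pi * y + 0) = (fun y => pi * y))//; apply/funext => y; rewrite addr0.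
exact: (is_derive_comp dh (is_derive_sin (pi * x))).
Qed.

(* [cutoff n] vanishes near the integers and tends to 1 elsewhere; it makes a
   test function of the momentum equation out of one that does not vanish at
   the boundary.  [layer n] is 1 where [cutoff n] is less than 1. *)
Definition cutoff n x : R := step (n%:R * sin2 x - 1).
Definition dcutoff n x : R :=
  dstep (n%:R * sin2 x - 1) * (n%:R * (2 * (sin (pi * x) * (cos (pi * x) * pi)))).
Definition layer n x : R := 1 - step (n%:R * sin2 x - 2).

Lemma is_derive_cutoff n x : is_derive x 1 (cutoff n) (dcutoff n x).
Proof.
apply: (is_derive_comp (h := fun y => n%:R * sin2 y - 1) (f := step)); last exact: is_derive_step.
have d := is_derive_mul (is_derive_sinpi x) (is_derive_sinpi x).
have d2 := is_derive_sub (is_derive_scale n%:R d) (is_derive_const 1 x).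
rewrite (_ : (fun y => n%:R * sin2 y - 1) =
  (fun y => n%:R * (sin (pi * y) * sin (pi * y)) - 1)); last first.
  by apply/funext => y; rewrite /sin2 expr2.
by apply: is_derive_eq d2 _; ring.
Qed.

Lemma continuous_sinpi : continuous (fun x => sin (pi * x)).
Proof. by move=> x; exact: is_derive_continuous (is_derive_sinpi x). Qed.

Lemma continuous_cospi : continuous (fun x => cos (pi * x)).
Proof.
move=> x; apply: (@continuous_comp _ _ _ (fun y => pi * y) cos); last exact: continuous_cos.
by apply: cvgM; [exact: cvg_cst|exact: cvg_id].
Qed.

Lemma continuous_arg n (c : R) : continuous (fun x => n%:R * sin2 x - c).
Proof.
apply: continuousBr; last by move=> x; exact: cvg_cst.
apply: continuous_scale; rewrite /sin2.
have -> : (fun x : R => sin (pi * x) ^+ 2) = (fun x => sin (pi * x) * sin (pi * x)).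
  by apply/funext => x; rewrite expr2.
by apply: continuousMr; exact: continuous_sinpi.
Qed.

Lemma continuous_dcutoff n : continuous (dcutoff n).
Proof.
apply: continuousMr.
  move=> x; apply: (@continuous_comp _ _ _ (fun x => n%:R * sin2 x - 1) dstep).
    exact: continuous_arg.
  exact: continuous_dstep.
do 2 apply: continuous_scale; apply: continuousMr; first exact: continuous_sinpi.
by apply: continuousMr; [exact: continuous_cospi|move=> x; exact: cvg_cst].
Qed.

Lemma continuous_cutoff n : continuous (cutoff n).
Proof. by move=> x; exact: is_derive_continuous (is_derive_cutoff n x). Qed.

Lemma continuous_layer n : continuous (layer n).
Proof.
apply: continuousBr; first by move=> x; exact: cvg_cst.
move=> x; apply: (@continuous_comp _ _ _ (fun x => n%:R * sin2 x - 2) step).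
  exact: continuous_arg.
exact: continuous_step.
Qed.

Lemma layer01 n x : 0 <= layer n x <= 1.
Proof. by rewrite /layer; have /andP[? ?] := step01 (n%:R * sin2 x - 2); apply/andP; split; lra. Qed.

Lemma cutoffN n x : cutoff n (- x) = cutoff n x.
Proof. by rewrite /cutoff /sin2 mulrN sinN sqrrN. Qed.

Lemma dcutoffN n x : dcutoff n (- x) = - dcutoff n x.
Proof. by rewrite /dcutoff /sin2 mulrN sinN cosN sqrrN; ring. Qed.

Lemma cutoff01 n x : `|cutoff n x| <= 1.
Proof. by have /andP[? ?] := step01 (n%:R * sin2 x - 1); rewrite ger0_norm. Qed.

Lemma dcutoff_bound n x : `|dcutoff n x| <= 2 * (n%:R * (2 * (1 * (1 * pi)))).
Proof.
have /andP[d0 d2] := dstep_bound (n%:R * sin2 x - 1).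
rewrite /dcutoff normrM (ger0_norm d0); apply: ler_pM => //.
rewrite normrM normr_nat; apply: ler_wpM2l => //.
rewrite normrM ger0_norm//; apply: ler_wpM2l => //.
rewrite normrM; apply: ler_pM => //; first exact: sin_max.
rewrite normrM (ger0_norm (pi_ge0 R)); apply: ler_wpM2r; first exact: pi_ge0.
exact: cos_max.
Qed.

(** The thresholds are arranged so that the transition of [cutoff n], where [n%:R * sin2 x] lies
    between 1 and 2, happens where [layer n] is 1. *)
Lemma cutoff_layer n x : `|1 - cutoff n x| <= layer n x.
Proof.
have /andP[c0 c1] := step01 (n%:R * sin2 x - 1).
rewrite /cutoff ger0_norm ?subr_ge0//.
have [h|h] := leP (n%:R * sin2 x) 2.
  by rewrite /layer (step_le0 (x := _ - 2)); lra.
have /andP[_ ?] := step01 (n%:R * sin2 x - 2).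
by rewrite (step_ge1 (x := _ - 1)); [rewrite /layer|]; lra.
Qed.

(** The derivative of the cut-off grows with [n], but multiplied by [sin (pi * x)] it contains
    [n%:R * sin2 x], at most 2 wherever it is nonzero. With [dstep <= 2] this gives
    [2 * (2 * 2 * pi) = 8 * pi]. *)
Lemma dcutoff_layer n x : `|sin (pi * x) * dcutoff n x| <= 8 * pi * layer n x.
Proof.
have [h|h] := leP (n%:R * sin2 x) 2; last first.
  rewrite /dcutoff (dstep_ge1 (x := _ - 1)); last by lra.
  rewrite mul0r mulr0 normr0; apply: mulr_ge0; last by case/andP: (layer01 n x).
  by rewrite mulr_ge0// pi_ge0.
rewrite /layer step_le0; last by lra.
rewrite subr0 mulr1 /dcutoff.
rewrite (_ : _ * _ = dstep (n%:R * sin2 x - 1) * ((2 * (n%:R * sin2 x) * pi) * cos (pi * x))); last first.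
  by rewrite /sin2; ring.
have n0 : 0 <= n%:R * sin2 x by rewrite mulr_ge0// /sin2 sqr_ge0.
have p0 := pi_ge0 R.
have /andP[d0 d2] := dstep_bound (n%:R * sin2 x - 1).
rewrite normrM (ger0_norm d0) normrM.
have A0 : 0 <= 2 * (n%:R * sin2 x) * pi by apply: mulr_ge0 => //; apply: mulr_ge0.
rewrite (ger0_norm A0).
have c1 : `|cos (pi * x)| <= 1 by exact: cos_max.
have A4 : 2 * (n%:R * sin2 x) * pi <= 4 * pi by apply: ler_wpM2r => //; lra.
apply: le_trans (_ : 2 * (4 * pi * 1) <= _); last by rewrite mulr1; lra.
by apply: ler_pM => //; [rewrite mulr_ge0|apply: ler_pM].
Qed.

Lemma cutoff_support n : exists2 d, 0 < d & forall x, 0 < x -> x < 1 ->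
  cutoff n x != 0 -> d <= x <= 1 - d.
Proof.
have c := @continuous_arg n 1.
have at0 (x0 : R) : sin (pi * x0) = 0 ->
    exists2 d, 0 < d & forall x, `|x - x0| < d -> cutoff n x = 0.
  move=> s0; have : n%:R * sin2 x0 - 1 < 0 by rewrite /sin2 s0 expr0n/= mulr0; lra.
  move=> /(cvgr_lt _ (c x0)) [d /= d0 hd]; exists d => // x xd.
  by apply: step_le0; apply: ltW; apply: hd; rewrite /ball_/= distrC.
have [|d1 d10 h1] := at0 0; first by rewrite mulr0 sin0.
have [|d2 d20 h2] := at0 1; first by rewrite mulr1 sinpi.
exists (Num.min d1 d2); first by rewrite lt_min d10.
move=> x x0 x1 cx; apply/andP; split; rewrite leNgt; apply/negP => xd.
  by move/eqP: cx; apply; apply: h1; rewrite subr0 gtr0_norm// (lt_le_trans xd)// ge_min lexx.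
move/eqP: cx; apply; apply: h2; rewrite distrC gtr0_norm ?subr_gt0//.
by have : Num.min d1 d2 <= d2 by [rewrite ge_min lexx orbT]; lra.
Qed.

(** Off the integers [sin2 x] is positive, and [layer n x] vanishes once [n%:R * sin2 x >= 3]; [k]
    dominates the integrands. *)
Lemma layer_cvg0 (k : R -> R) : measurable_fun setT k ->
  leb.-integrable period (EFin \o k) -> (forall x, 0 <= k x) ->
  \int[leb]_(x in period) (k x * layer n x) @[n --> \oo] --> (0 : R).
Proof.
move=> mk ik k0.
have ml n : measurable_fun setT (layer n).
  by apply: continuous_measurable_fun; exact: continuous_layer.
have key x : x <> 0 -> x <> -1 -> period x -> (k x * layer n x)%:E @[n --> \oo] --> 0%E.
  move=> x0 x1 px.
  have s0 : 0 < sin2 x.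
    rewrite /sin2 exprn_even_gt0//=.
    move: px x0 x1; rewrite /period/= in_itv/= => /andP[h1 h2] h3 h4.
    have [xp|xn|xe] := ltgtP 0 x; last by case: h3.
      by rewrite gt_eqF// sin_gt0_pi// mulr_gt0 ?pi_gt0//= -[ltRHS]mulr1 ltr_pM2l ?pi_gt0.
    rewrite lt_eqF// -oppr_gt0 -sinN sin_gt0_pi// -mulrN mulr_gt0 ?pi_gt0 ?oppr_gt0//=.
    rewrite -[ltRHS]mulr1 ltr_pM2l ?pi_gt0// ltrNl lt_neqAle h1 andbT.
    by apply/eqP => h; apply: h4.
  apply: cvg_near_cst; exists (Num.truncn (3 / sin2 x)).+1 => // n /= Nn.
  rewrite /layer step_ge1 ?subrr ?mulr0//.
  have : 3 / sin2 x < n%:R by apply: (lt_le_trans (truncnS_gt _)); rewrite ler_nat.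
  by rewrite ltr_pdivrMr// => h; lra.
have cvae : {ae leb, forall x, period x -> (k x * layer n x)%:E @[n --> \oo] --> (cst 0%E : R -> \bar R) x}.
  have : {ae leb, forall x : R, x <> 0 /\ x <> -1} by exact: ae_and (ae_neq 0) (ae_neq (-1)).
  by apply: ae_imply => x [x0 x1]; exact: key.
have bdae : {ae leb, forall x n, period x -> (`|(k x * layer n x)%:E| <= (EFin \o k) x)%E}.
  apply: ae_all => x n _ /=; rewrite lee_fin normrM (ger0_norm (k0 x)).
  have /andP[l0 l1] := layer01 n x.
  by rewrite (ger0_norm l0) ler_piMr.
have mf n : measurable_fun period (fun x => (k x * layer n x)%:E).
  by apply: measurable_funTS; apply/measurable_EFinP; apply: measurable_funM => //; exact: ml.
have [_ _] := @dominated_convergence _ _ _ leb _ (@measurable_period R) _ _ _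
  mf (measurable_cst _) cvae ik bdae.
rewrite /= integral0 => h.
rewrite /Rintegral.
by have /fine_cvg := h.
Qed.

End CutOff.

Section MeanValue.
Context {R : realType}.

Lemma mean_value (f df : R -> R) (x y : R) : x <= y ->
  (forall z : R, is_derive z 1 f (df z)) ->
  exists2 c, x <= c <= y & f y - f x = df c * (y - x).
Proof.
move=> xy h; have [|c cxy ->] := MVT_segment xy (fun z _ => h z).
  by apply: continuous_subspaceT => z; exact: is_derive_continuous (h z).
by exists c => //; move: cxy; rewrite in_itv.
Qed.

Lemma derivative_lipschitz (f df : R -> R) (C x y : R) :
  (forall z : R, is_derive z 1 f (df z)) -> (forall z, `|df z| <= C) ->
  `|f x - f y| <= C * `|x - y|.
Proof.
move=> h hC; wlog xy : x y / x <= y.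
  by move=> w; have [/w//|/ltW/w] := leP x y; rewrite distrC (distrC y).
have [c _ e] := mean_value xy h.
by rewrite distrC e (distrC x) normrM; exact: ler_wpM2r.
Qed.

End MeanValue.

Section IteratedLimit.
Context {R : realType}.

(** The error bound [w n] does not depend on time, so the double integrals of [q n] and [Q] differ
    by at most [t - s] times the integral of [w n]. *)
Lemma iterated_limit (D : set R) (q : nat -> R * R -> R) (Q : R * R -> R)
    (kq : nat -> R -> R) (kQ : R -> R) (w : nat -> R -> R) (s t : R) :
  s <= t -> measurable D ->
  (forall n, measurable_fun setT (q n)) -> measurable_fun setT Q ->
  (forall n, leb.-integrable D (EFin \o kq n)) -> leb.-integrable D (EFin \o kQ) ->
  (forall n, leb.-integrable D (EFin \o w n)) ->
  (forall n x r, D x -> `|q n (x, r)| <= kq n x) ->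
  (forall x r, D x -> `|Q (x, r)| <= kQ x) ->
  (forall n x r, D x -> `|q n (x, r) - Q (x, r)| <= w n x) ->
  (forall n, \int[leb]_(r in `[s, t]) \int[leb]_(x in D) q n (x, r) = 0) ->
  \int[leb]_(x in D) w n x @[n --> \oo] --> (0 : R) ->
  \int[leb]_(r in `[s, t]) \int[leb]_(x in D) Q (x, r) = 0.
Proof.
move=> st mD mq mQ ikq ikQ iw qk Qk qQ q0 w0.
have [iQ1 iQ2 _] := dominated_Fubini s t mD mQ ikQ Qk.
have ts0 : 0 <= t - s by rewrite subr_ge0.
have bound n : `|\int[leb]_(r in `[s, t]) \int[leb]_(x in D) Q (x, r)| <=
    (\int[leb]_(x in D) w n x) * (t - s).
  have [iq1 iq2 _] := dominated_Fubini s t mD (mq n) (ikq n) (qk n).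
  rewrite -normrN -[X in `|X|]add0r -[X in `|X - _|](q0 n) -RintegralB//.
  rewrite -(fine_leb_itv st) -Rintegral_cst//; apply: Rintegral_abs_le => //.
  - exact: int_sub.
  - by apply: int_cst => //; exact: leb_itv_lty.
  move=> r _ /=; rewrite -RintegralB//; apply: Rintegral_abs_le => //.
    exact: int_sub.
  by move=> x Dx; exact: qQ.
have lim : (\int[leb]_(x in D) w n x) * (t - s) @[n --> \oo] --> 0 * (t - s).
  by apply: cvgM => //; exact: cvg_cst.
apply/eqP; rewrite -normr_le0 -(mul0r (t - s)).
rewrite -(cvg_lim (@Rhausdorff R) lim); apply: limr_ge; first by apply/cvg_ex; exists (0 * (t - s)).
exact: nearW.
Qed.

(** [chi] is the cut-off. Where [chi] is 1 the terms in [d] cancel between the mass part and the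
    momentum part, and the halves in [e1] and [e2] combine into [e1]. The remainder carries
    [1 - chi] or [dchi]; the latter is large, but it comes with [e1 - e2], which is at most
    [C * sg]. *)
Lemma weak_error (f n0 d e1 e2 th dth chi dchi l k B C T P sg : R) :
  0 <= B -> 0 <= T -> `|f| <= B -> `|n0| <= k -> `|d| <= C ->
  `|e1| <= C -> `|e2| <= C -> `|e1 - e2| <= C * sg -> `|th| <= T -> `|dth| <= T ->
  `|1 - chi| <= l -> sg * `|dchi| <= P * l -> 0 <= P ->
  `|f * (- d * th + 2^-1 * (e1 + e2) * dth) +
    (f * (d * th * chi + 2^-1 * (e1 - e2) * (dth * chi + th * dchi)) -
     n0 * (2^-1 * (e1 - e2) * th * chi)) -
    (f * e1 * dth - n0 * (2^-1 * (e1 - e2) * th))| <=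
  C * T * (B * (2 + P) + 1) * ((1 + k) * l).
Proof.
move=> B0 T0 fB nk dC e1C e2C eC thT dthT chil dchil P0.
have k0 : 0 <= k by exact: le_trans nk.
have C0 : 0 <= C by exact: le_trans dC.
have l0 : 0 <= l by exact: le_trans chil.
have mono (x y a b : R) : `|x| <= a -> `|y| <= b -> `|x * y| <= a * b.
  by move=> xa yb; rewrite normrM; exact: ler_pM.
have hE : `|2^-1 * (e1 - e2)| <= C.
  rewrite normrM ger0_norm ?invr_ge0//.
  have := ler_normB e1 e2; lra.
rewrite (_ : _ - _ = (1 - chi) * - (f * (d * th) + f * (2^-1 * (e1 - e2) * dth) - n0 * (2^-1 * (e1 - e2) * th))
   + f * (th * (2^-1 * ((e1 - e2) * dchi)))); last by field.
have A1 := mono _ _ _ _ fB (mono _ _ _ _ dC thT).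
have A2 := mono _ _ _ _ fB (mono _ _ _ _ hE dthT).
have A3 := mono _ _ _ _ nk (mono _ _ _ _ hE thT).
have A4 : `|2^-1 * ((e1 - e2) * dchi)| <= C * (P * l).
  rewrite normrM ger0_norm ?invr_ge0// normrM.
  have h : `|e1 - e2| * `|dchi| <= C * (P * l).
    apply: le_trans (_ : C * sg * `|dchi| <= _); first exact: ler_wpM2r.
    by rewrite -mulrA; exact: ler_wpM2l.
  have h0 : 0 <= `|e1 - e2| * `|dchi| by rewrite mulr_ge0.
  lra.
have A5 := mono _ _ _ _ fB (mono _ _ _ _ thT A4).
have A6 : `|- (f * (d * th) + f * (2^-1 * (e1 - e2) * dth) - n0 * (2^-1 * (e1 - e2) * th))| <=
    B * (C * T) + B * (C * T) + k * (C * T).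
  rewrite normrN; apply: le_trans (ler_normB _ _) _; apply: lerD => //.
  by apply: le_trans (ler_normD _ _) _; exact: lerD.
apply: le_trans (ler_normD _ _) _.
apply: le_trans (lerD (mono _ _ _ _ chil A6) A5) _.
rewrite -subr_ge0 (_ : _ - _ = C * T * l * (k * (B * (2 + P)) + 1)); last by ring.
by rewrite !mulr_ge0// addr_ge0// mulr_ge0// mulr_ge0// addr_ge0.
Qed.

End IteratedLimit.

(** * Transport of the averages of a bounded weak solution *)

Section WeakTransport.
Context {R : realType}.
Variables (F nn : R * R -> R) (k : R -> R) (B p0 q0 : R).
Hypotheses (mF : measurable_fun setT F) (FB : forall p, `|F p| <= B).
Hypothesis Fper : forall y r, F (y + 2, r) = F (y, r).
Hypotheses (mnn : measurable_fun setT nn) (nnk : forall y r, `|nn (y, r)| <= k y).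
Hypothesis nnper : forall y r, nn (y + 2, r) = nn (y, r).
Hypothesis nnodd : forall y r, nn (- y, r) = - nn (y, r).
Hypotheses (mk : measurable_fun setT k) (ik : leb.-integrable period (EFin \o k)).

Hypothesis mass : forall (a ax at_ : R * R -> R) (s t : R), p0 < s -> t < q0 ->
  (forall p : R * R, is_derive p.1 1 (fun x => a (x, p.2)) (ax p)) ->
  (forall p : R * R, is_derive p.2 1 (fun r => a (p.1, r)) (at_ p)) ->
  continuous a -> continuous ax -> continuous at_ ->
  (forall x r, ~~ (s <= r <= t) -> [/\ a (x, r) = 0, ax (x, r) = 0 & at_ (x, r) = 0]) ->
  \int[leb]_(r in `[s, t]) \int[leb]_(x in `]0, 1[)
    ((F (x, r) + F (- x, r)) * at_ (x, r) + (F (x, r) - F (- x, r)) * ax (x, r)) = 0.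

Hypothesis momentum : forall (a ax at_ : R * R -> R) (s t d : R), p0 < s -> t < q0 -> 0 < d ->
  (forall p : R * R, is_derive p.1 1 (fun x => a (x, p.2)) (ax p)) ->
  (forall p : R * R, is_derive p.2 1 (fun r => a (p.1, r)) (at_ p)) ->
  continuous a -> continuous ax -> continuous at_ ->
  (forall x r, ~~ (s <= r <= t) -> [/\ a (x, r) = 0, ax (x, r) = 0 & at_ (x, r) = 0]) ->
  (forall x r, 0 < x -> x < 1 -> a (x, r) != 0 -> d <= x <= 1 - d) ->
  \int[leb]_(r in `[s, t]) \int[leb]_(x in `]0, 1[)
    ((F (x, r) - F (- x, r)) * at_ (x, r) + (F (x, r) + F (- x, r)) * ax (x, r) -
     2 * nn (x, r) * a (x, r)) = 0.

Variables (eta deta : R -> R) (C : R).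
Hypotheses (eta_der : forall z : R, is_derive z 1 eta (deta z)) (cdeta : continuous deta).
Hypotheses (eta_per : periodic2 eta) (etaC : forall z, `|eta z| <= C) (detaC : forall z, `|deta z| <= C).
Hypothesis eta_odd : forall y r, `|eta (y - r) - eta (- y - r)| <= C * `|sin (pi * y)|.

Let B0 : 0 <= B. Proof. exact: le_trans (FB (0, 0)). Qed.
Let C0 : 0 <= C. Proof. exact: le_trans (etaC 0). Qed.
Let k0 y : 0 <= k y. Proof. exact: le_trans (nnk y 0). Qed.
Let ceta : continuous eta. Proof. by move=> z; exact: is_derive_continuous (eta_der z). Qed.

Section TimeProfile.
Variables (th dth : R -> R) (s t : R).
Hypotheses (ps : p0 < s) (tq : t < q0).
Hypotheses (th_der : forall r : R, is_derive r 1 th (dth r)) (cdth : continuous dth).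
Hypothesis th_supp : forall r, ~~ (s <= r <= t) -> th r = 0 /\ dth r = 0.

Let cth : continuous th. Proof. by move=> z; exact: is_derive_continuous (th_der z). Qed.

(** Unfolded integrand of the mass equation, tested with [th] times the even part in [x] of
    [eta (x - r)]. Of the derivative along characteristics only the wave moving the wrong way,
    [eta (- x - r)], survives. *)
Let mass_density (p : R * R) := F p * (- deta (- p.1 - p.2) * th p.2 +
  2^-1 * (eta (p.1 - p.2) + eta (- p.1 - p.2)) * dth p.2).

Let even_der_x (p : R * R) : is_derive p.1 1
  (fun x => 2^-1 * (eta (x - p.2) + eta (- x - p.2)) * th p.2)
  (2^-1 * (deta (p.1 - p.2) - deta (- p.1 - p.2)) * th p.2).
Proof.
have h := is_derive_mul (is_derive_scale 2^-1
  (is_derive_add (is_derive_sub_cst p.2 p.1 eta_der) (is_derive_opp_sub p.2 p.1 eta_der)))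
  (is_derive_const (th p.2) p.1).
by apply: is_derive_eq h _; ring.
Qed.

Let even_der_t (p : R * R) : is_derive p.2 1
  (fun r => 2^-1 * (eta (p.1 - r) + eta (- p.1 - r)) * th r)
  (2^-1 * (- deta (p.1 - p.2) - deta (- p.1 - p.2)) * th p.2 +
   2^-1 * (eta (p.1 - p.2) + eta (- p.1 - p.2)) * dth p.2).
Proof.
have h := is_derive_mul (is_derive_scale 2^-1
  (is_derive_add (is_derive_cst_sub p.1 p.2 eta_der) (is_derive_cst_sub (- p.1) p.2 eta_der)))
  (th_der p.2).
by apply: is_derive_eq h _; ring.
Qed.

Let odd_der_x n (p : R * R) : is_derive p.1 1
  (fun x => 2^-1 * (eta (x - p.2) - eta (- x - p.2)) * cutoff n x * th p.2)
  ((2^-1 * (deta (p.1 - p.2) + deta (- p.1 - p.2)) * cutoff n p.1 +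
    2^-1 * (eta (p.1 - p.2) - eta (- p.1 - p.2)) * dcutoff n p.1) * th p.2).
Proof.
have h := is_derive_mul (is_derive_mul (is_derive_scale 2^-1
  (is_derive_sub (is_derive_sub_cst p.2 p.1 eta_der) (is_derive_opp_sub p.2 p.1 eta_der)))
  (is_derive_cutoff n p.1)) (is_derive_const (th p.2) p.1).
by apply: is_derive_eq h _; ring.
Qed.

Let odd_der_t n (p : R * R) : is_derive p.2 1
  (fun r => 2^-1 * (eta (p.1 - r) - eta (- p.1 - r)) * cutoff n p.1 * th r)
  (2^-1 * (- deta (p.1 - p.2) + deta (- p.1 - p.2)) * cutoff n p.1 * th p.2 +
   2^-1 * (eta (p.1 - p.2) - eta (- p.1 - p.2)) * cutoff n p.1 * dth p.2).
Proof.
have h := is_derive_mul (is_derive_mul (is_derive_scale 2^-1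
  (is_derive_sub (is_derive_cst_sub p.1 p.2 eta_der) (is_derive_cst_sub (- p.1) p.2 eta_der)))
  (is_derive_const (cutoff n p.1) p.2)) (th_der p.2).
by apply: is_derive_eq h _; ring.
Qed.

(** The same for the momentum equation and the odd part, cut off near the boundary. The wrong-way
    wave has the opposite sign and will cancel against the mass equation. The factor 2 of the source
    is absorbed by the unfolding, an odd source times an odd test being even. *)
Let momentum_density n (p : R * R) :=
  F p * (deta (- p.1 - p.2) * th p.2 * cutoff n p.1 +
    2^-1 * (eta (p.1 - p.2) - eta (- p.1 - p.2)) *
      (dth p.2 * cutoff n p.1 + th p.2 * dcutoff n p.1)) -
  nn p * (2^-1 * (eta (p.1 - p.2) - eta (- p.1 - p.2)) * th p.2 * cutoff n p.1).

Let meta1 : measurable_fun setT (fun p : R * R => eta (p.1 - p.2)).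
Proof. by apply: measurable_sub12; exact: continuous_measurable_fun. Qed.
Let meta2 : measurable_fun setT (fun p : R * R => eta (- p.1 - p.2)).
Proof. by apply: measurable_oppsub12; exact: continuous_measurable_fun. Qed.
Let mdeta2 : measurable_fun setT (fun p : R * R => deta (- p.1 - p.2)).
Proof. by apply: measurable_oppsub12; exact: continuous_measurable_fun. Qed.
Let mth : measurable_fun setT (fun p : R * R => th p.2).
Proof. by apply: measurableT_comp; [exact: continuous_measurable_fun|exact: measurable_snd]. Qed.
Let mdth : measurable_fun setT (fun p : R * R => dth p.2).
Proof. by apply: measurableT_comp; [exact: continuous_measurable_fun|exact: measurable_snd]. Qed.
Let mchi n : measurable_fun setT (fun p : R * R => cutoff n p.1).
Proof.
apply: (@measurableT_comp _ _ _ _ _ _ (cutoff n)); last exact: measurable_fst.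
by apply: continuous_measurable_fun; exact: continuous_cutoff.
Qed.
Let mdchi n : measurable_fun setT (fun p : R * R => dcutoff n p.1).
Proof.
apply: (@measurableT_comp _ _ _ _ _ _ (dcutoff n)); last exact: measurable_fst.
by apply: continuous_measurable_fun; exact: continuous_dcutoff.
Qed.

Let m_mass : measurable_fun setT mass_density.
Proof.
apply: measurable_funM => //; apply: measurable_funD.
  by apply: measurable_funM => //; apply: measurable_funN.
by apply: measurable_funM => //; apply: measurable_funM => //; exact: measurable_funD.
Qed.

Let m_momentum n : measurable_fun setT (momentum_density n).
Proof.
have me : measurable_fun setT (fun p : R * R => 2^-1 * (eta (p.1 - p.2) - eta (- p.1 - p.2))).
  by apply: measurable_funM => //; exact: measurable_funB.
apply: measurable_funB.
  apply: measurable_funM => //; apply: measurable_funD.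
    by apply: measurable_funM => //; exact: measurable_funM.
  apply: measurable_funM => //; apply: measurable_funD; exact: measurable_funM.
apply: measurable_funM => //; apply: measurable_funM => //; exact: measurable_funM.
Qed.

Variable T : R.
Hypotheses (thT : forall r, `|th r| <= T) (dthT : forall r, `|dth r| <= T).
Let T0 : 0 <= T. Proof. exact: le_trans (thT 0). Qed.

Let half_bounds x y : `|2^-1 * (eta x + eta y)| <= C /\ `|2^-1 * (eta x - eta y)| <= C.
Proof.
rewrite !normrM ger0_norm ?invr_ge0//.
have := ler_normD (eta x) (eta y); have := ler_normB (eta x) (eta y).
by have := etaC x; have := etaC y; split; lra.
Qed.

Let mass_bound x r : `|mass_density (x, r)| <= B * (C * T + C * T).
Proof.
rewrite normrM; apply: ler_pM => //; apply: le_trans (ler_normD _ _) _.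
apply: lerD; rewrite normrM; apply: ler_pM => //; first by rewrite normrN.
by have [] := half_bounds (x - r) (- x - r).
Qed.

Let momentum_bound n x r : `|momentum_density n (x, r)| <=
  B * (C * T * 1 + C * (T * 1 + T * (2 * (n%:R * (2 * (1 * (1 * pi))))))) + k x * (C * T).
Proof.
have [_ h] := half_bounds (x - r) (- x - r).
have c1 := cutoff01 n x; have c2 := dcutoff_bound n x.
apply: le_trans (ler_normB _ _) _; apply: lerD; rewrite normrM.
  apply: ler_pM => //; apply: le_trans (ler_normD _ _) _; apply: lerD; rewrite normrM; apply: ler_pM => //.
    by rewrite normrM; exact: ler_pM.
  by apply: le_trans (ler_normD _ _) _; apply: lerD; rewrite normrM; exact: ler_pM.
apply: ler_pM => //; rewrite normrM -[leRHS]mulr1; apply: ler_pM => //.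
by rewrite normrM; exact: ler_pM.
Qed.

Let mass_bound' x r : `|mass_density (x, r)| <= B * (C * T + C * T) + k x * (C * T).
Proof. by apply: le_trans (mass_bound x r) _; rewrite lerDl mulr_ge0// mulr_ge0. Qed.

Let pik c : leb.-integrable period (EFin \o (fun x => c + k x * (C * T))).
Proof.
have mp : measurable (period : set R) := @measurable_period R.
apply: int_add => //; first by apply: int_cst => //; exact: leb_itv_lty.
rewrite (_ : (fun x => _) = (fun x => (C * T) * k x)); last first.
  by apply/funext => x; rewrite mulrC.
exact: int_scale.
Qed.

Let momentum_section_integrable n r :
  leb.-integrable period (EFin \o (fun x => momentum_density n (x, r))).
Proof.
apply: dominated_integrable (pik _) _ => //; first exact: measurable_period.
by apply: measurable_funTS; exact: measurable_section2.
Qed.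

Let mass_section_integrable r :
  leb.-integrable period (EFin \o (fun x => mass_density (x, r))).
Proof.
apply: dominated_integrable (pik _) _ => //; first exact: measurable_period.
by apply: measurable_funTS; exact: measurable_section2.
Qed.

Let mass_zero : \int[leb]_(r in `[s, t]) \int[leb]_(x in period) mass_density (x, r) = 0.
Proof.
have c1 : continuous (fun p : R * R => 2^-1 * (eta (p.1 - p.2) + eta (- p.1 - p.2))).
  apply: continuous_scale; apply: continuousDr; first exact: continuous_sub12.
  exact: continuous_oppsub12.
have ct : continuous (fun p : R * R => th p.2) by exact: continuous_snd_comp.
have cdt : continuous (fun p : R * R => dth p.2) by exact: continuous_snd_comp.
have d1 : continuous (fun p : R * R => deta (p.1 - p.2)) by exact: continuous_sub12.
have d2 : continuous (fun p : R * R => deta (- p.1 - p.2)) by exact: continuous_oppsub12.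
rewrite -[RHS](@mass (fun p => 2^-1 * (eta (p.1 - p.2) + eta (- p.1 - p.2)) * th p.2)
  _ _ s t ps tq even_der_x even_der_t).
- apply: eq_Rintegral => r _; rewrite -Rintegral_fold.
  + by apply: eq_Rintegral => x _; rewrite /mass_density/= opprK; field.
  + exact: measurable_section2.
  + exact: mass_section_integrable.
- by apply: continuousMr.
- by apply: continuousMr => //; apply: continuous_scale; exact: continuousBr.
- apply: continuousDr; apply: continuousMr => //.
  by apply: continuous_scale; apply: continuousBr => //; exact: continuousNr.
- by move=> x r /th_supp[-> ->]; rewrite !mulr0 addr0.
Qed.

Let momentum_zero n :
  \int[leb]_(r in `[s, t]) \int[leb]_(x in period) momentum_density n (x, r) = 0.
Proof.
have c1 : continuous (fun p : R * R => 2^-1 * (eta (p.1 - p.2) - eta (- p.1 - p.2))).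
  apply: continuous_scale; apply: continuousBr; first exact: continuous_sub12.
  exact: continuous_oppsub12.
have ct : continuous (fun p : R * R => th p.2) by exact: continuous_snd_comp.
have cdt : continuous (fun p : R * R => dth p.2) by exact: continuous_snd_comp.
have cc : continuous (fun p : R * R => cutoff n p.1).
  by apply: continuous_fst_comp; exact: continuous_cutoff.
have cdc : continuous (fun p : R * R => dcutoff n p.1).
  by apply: continuous_fst_comp; exact: continuous_dcutoff.
have d1 : continuous (fun p : R * R => deta (p.1 - p.2)) by exact: continuous_sub12.
have d2 : continuous (fun p : R * R => deta (- p.1 - p.2)) by exact: continuous_oppsub12.
have [d d0 hd] := @cutoff_support R n.
rewrite -[RHS](@momentum (fun p => 2^-1 * (eta (p.1 - p.2) - eta (- p.1 - p.2)) * cutoff n p.1 * th p.2)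
  _ _ s t d ps tq d0 (odd_der_x n) (odd_der_t n)).
- apply: eq_Rintegral => r _; rewrite -Rintegral_fold.
  + apply: eq_Rintegral => x _; rewrite /momentum_density/= opprK cutoffN dcutoffN nnodd.
    by field.
  + exact: measurable_section2.
  + exact: momentum_section_integrable.
- by apply: continuousMr => //; exact: continuousMr.
- apply: continuousMr => //; apply: continuousDr; last exact: continuousMr.
  by apply: continuousMr => //; apply: continuous_scale; exact: continuousDr.
- apply: continuousDr; apply: continuousMr => //; apply: continuousMr => //.
  by apply: continuous_scale; apply: continuousDr => //; exact: continuousNr.
- by move=> x r /th_supp[-> ->]; rewrite !mulr0 addr0.
- by move=> x r x0 x1 /eqP ne; apply: hd => //; apply: contra_notN ne => /eqP->; rewrite mulr0 mul0r.
Qed.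

(** The sum of the two densities where the cut-off is identically 1. *)
Let target (p : R * R) := F p * eta (p.1 - p.2) * dth p.2 -
  nn p * (2^-1 * (eta (p.1 - p.2) - eta (- p.1 - p.2)) * th p.2).

Let m_target : measurable_fun setT target.
Proof.
apply: measurable_funB.
  by apply: measurable_funM => //; exact: measurable_funM.
apply: measurable_funM => //; apply: measurable_funM => //; apply: measurable_funM => //.
exact: measurable_funB.
Qed.

Let target_bound x r : `|target (x, r)| <= B * C * T + k x * (C * T).
Proof.
apply: le_trans (ler_normB _ _) _; apply: lerD; rewrite normrM.
  by apply: ler_pM => //; rewrite normrM; exact: ler_pM.
apply: ler_pM => //; rewrite normrM; apply: ler_pM => //.
by have [] := half_bounds (x - r) (- x - r).
Qed.

(** For every [n] the two weak equations annihilate the integral of the sum of the densities; by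
    [weak_error] the sum differs from [target] by at most [A * ((1 + k x) * layer n x)], whose
    integral tends to 0. *)
Let target_zero : s <= t -> \int[leb]_(r in `[s, t]) \int[leb]_(x in period) target (x, r) = 0.
Proof.
move=> st; have mp : measurable (period : set R) := @measurable_period R.
pose A := C * T * (B * (2 + 8 * pi) + 1).
have A0 : 0 <= A.
  by rewrite !mulr_ge0// addr_ge0// mulr_ge0// addr_ge0// mulr_ge0// pi_ge0.
have i1k : leb.-integrable period (EFin \o (fun x => 1 + k x)).
  by apply: int_add => //; apply: int_cst => //; exact: leb_itv_lty.
have il n : leb.-integrable period (EFin \o (fun x => (1 + k x) * layer n x)).
  apply: (@dominated_integrable _ _ _ (fun x => 1 + k x)) => //.
    apply: measurable_funTS; apply: measurable_funM; first exact: measurable_funD.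
    by apply: continuous_measurable_fun; exact: continuous_layer.
  move=> x _; have /andP[l0 l1] := layer01 n x.
  have k1 : 0 <= 1 + k x by rewrite addr_ge0.
  by rewrite normrM (ger0_norm l0) (ger0_norm k1) ler_piMr.
apply: (@iterated_limit _ period (fun n p => mass_density p + momentum_density n p) target
  (fun n x => (B * (C * T + C * T) + B * (C * T * 1 + C * (T * 1 + T * (2 * (n%:R * (2 * (1 * (1 * pi)))))))) + k x * (C * T))
  (fun x => B * C * T + k x * (C * T))
  (fun n x => A * ((1 + k x) * layer n x)) s t st mp).
- by move=> n; exact: measurable_funD.
- exact: m_target.
- by move=> n; exact: pik.
- exact: pik.
- by move=> n; exact: int_scale.
- move=> n x r _; rewrite -addrA; apply: le_trans (ler_normD _ _) _.
  by apply: lerD; [exact: mass_bound|exact: momentum_bound].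
- by move=> x r _; exact: target_bound.
- move=> n x r _; rewrite /mass_density/momentum_density/target/=.
  apply: (weak_error (sg := `|sin (pi * x)|)) => //.
  + exact: cutoff_layer.
  + by rewrite -normrM; exact: dcutoff_layer.
  + by rewrite mulr_ge0// pi_ge0.
- move=> n.
  have [m1 m2 _] := dominated_Fubini s t mp m_mass (pik _) (fun x r _ => mass_bound' x r).
  have [n1 n2 _] := dominated_Fubini s t mp (m_momentum n) (pik _) (fun x r _ => momentum_bound n x r).
  rewrite -[RHS]addr0 -{1}mass_zero -(momentum_zero n) -RintegralD//.
  by apply: eq_Rintegral => r _; rewrite RintegralD.
- rewrite (_ : (fun n => _) = (fun n => A * \int[leb]_(x in period) ((1 + k x) * layer n x))); last first.
    by apply/funext => n; rewrite RintegralZl.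
  rewrite -[X in _ --> X](mulr0 A); apply: cvgM; first exact: cvg_cst.
  apply: layer_cvg0 => //; first exact: measurable_funD.
  by move=> x; rewrite addr_ge0.
Qed.

Lemma weak_identity_bounded :
  \int[leb]_(r in `[s, t]) ((\int[leb]_(y in period) (F (y, r) * eta (y - r))) * dth r -
    (\int[leb]_(y in period) (nn (y, r) * eta (y - r))) * th r) = 0.
Proof.
have [st|ts] := leP s t; last first.
  by rewrite set_itv_ge ?Rintegral_set0// bnd_simp -ltNge.
have mp : measurable (period : set R) := @measurable_period R.
rewrite -[RHS](target_zero st); apply: eq_Rintegral => r _.
have bd (u : R -> R) c : measurable_fun setT u -> (forall x, `|u x| <= c + k x * (C * T)) ->
  leb.-integrable period (EFin \o u).
  by move=> mu uc; apply: dominated_integrable (pik c) _ => //; exact: measurable_funTS.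
have iFe : leb.-integrable period (EFin \o (fun y => F (y, r) * eta (y - r))).
  apply: (bd _ (B * C)).
    apply: measurable_funM; first exact: measurable_section2.
    exact: (measurable_section2 r meta1).
  move=> x; apply: (@le_trans _ _ (B * C)); last by rewrite lerDl mulr_ge0// mulr_ge0.
  by rewrite normrM; exact: ler_pM.
have ine (e : R -> R) : measurable_fun setT e -> (forall y, `|e y| <= C) ->
    leb.-integrable period (EFin \o (fun y => nn (y, r) * e y)).
  move=> me eC; apply: (@dominated_integrable _ _ _ (fun y => C * k y)) => //.
  - by apply: measurable_funTS; apply: measurable_funM => //; exact: measurable_section2.
  - exact: int_scale.
  - by move=> y _; rewrite normrM mulrC; exact: ler_pM.
have i1 := ine _ (measurable_section2 r meta1) (fun y => etaC (y - r)).
have i2 := ine _ (measurable_section2 r meta2) (fun y => etaC (- y - r)).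
(* Oddness of the source makes both halves of the antisymmetrised test function contribute equally,
   which removes the factor 1/2. *)
have e2 : \int[leb]_(y in period) (nn (y, r) * eta (- y - r)) =
    - \int[leb]_(y in period) (nn (y, r) * eta (y - r)).
  rewrite -RintegralN// -[LHS](@Rintegral_periodic_reflect _ _ 0).
  - by apply: eq_Rintegral => y _; rewrite sub0r nnodd opprK mulNr.
  - apply: measurable_funM; first exact: measurable_section2.
    exact: (measurable_section2 r meta2).
  - move=> y; rewrite nnper; congr (_ * _).
    by rewrite -(eta_per (- (y + 2) - r)); congr eta; ring.
rewrite (_ : \int[leb]_(x in period) target (x, r) =
  dth r * \int[leb]_(y in period) (F (y, r) * eta (y - r)) -
  (th r / 2) * (\int[leb]_(y in period) (nn (y, r) * eta (y - r)) -
              \int[leb]_(y in period) (nn (y, r) * eta (- y - r)))).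
  by rewrite e2; field.
rewrite -RintegralB// -!RintegralZl//; last exact: int_sub.
rewrite -RintegralB//; [|exact: int_scale|by apply: int_scale => //; exact: int_sub].
by apply: eq_Rintegral => y _; rewrite /target/=; field.
Qed.

End TimeProfile.

Lemma weak_identity (th dth : R -> R) (s t : R) : p0 < s -> t < q0 ->
  (forall x : R, is_derive x 1 th (dth x)) -> continuous dth ->
  (forall r, ~~ (s <= r <= t) -> th r = 0 /\ dth r = 0) ->
  \int[leb]_(r in `[s, t]) ((\int[leb]_(y in period) (F (y, r) * eta (y - r))) * dth r -
    (\int[leb]_(y in period) (nn (y, r) * eta (y - r))) * th r) = 0.
Proof.
move=> ps tq dT cdth supp.
have cth : continuous th by move=> x; exact: is_derive_continuous (dT x).
have [T1 T10 hT1] := bounded_support cth (fun r h => proj1 (supp r h)).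
have [T2 T20 hT2] := bounded_support cdth (fun r h => proj2 (supp r h)).
apply: (weak_identity_bounded ps tq dT cdth supp (T := T1 + T2)) => r.
  by apply: le_trans (hT1 r) _; rewrite lerDl.
by apply: le_trans (hT2 r) _; rewrite lerDr.
Qed.

(** [time_localization] is applied to the average [m] of [F] against the travelling profile. [m] is
    continuous from the right because [F] is so in L^1 and [eta] is Lipschitz. *)
Lemma transport_average (s t : R) : p0 < s -> s < t -> t < q0 ->
  (forall tau, p0 < tau -> tau < q0 -> forall e, 0 < e ->
    exists2 d, 0 < d & forall r, tau <= r -> r - tau <= d ->
      \int[leb]_(y in period) `|F (y, r) - F (y, tau)| <= e) ->
  \int[leb]_(y in period) (F (y, t) * eta (y - t)) =
  \int[leb]_(y in period) (F (y, s) * eta (y - s)) -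
  \int[leb]_(r in `[s, t]) \int[leb]_(y in period) (nn (y, r) * eta (y - r)).
Proof.
move=> ps st tq rc.
have mp : measurable (period : set R) := @measurable_period R.
have meta1 : measurable_fun setT (fun p : R * R => eta (p.1 - p.2)).
  by apply: measurable_sub12; exact: continuous_measurable_fun.
pose m r := \int[leb]_(y in period) (F (y, r) * eta (y - r)).
pose q r := \int[leb]_(y in period) (nn (y, r) * eta (y - r)).
have mFe : measurable_fun setT (fun p : R * R => F p * eta (p.1 - p.2)) by exact: measurable_funM.
have mne : measurable_fun setT (fun p : R * R => nn p * eta (p.1 - p.2)) by exact: measurable_funM.
have ic (c : R) : leb.-integrable period (EFin \o cst c).
  by apply: int_cst => //; exact: leb_itv_lty.
have len2 : fine (leb (period : set R)) = 2.
  by rewrite /period lebesgue_measure_itv/= ifT ?lte_fin//=; lra.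
have iFe r : leb.-integrable period (EFin \o (fun y => F (y, r) * eta (y - r))).
  apply: (@dominated_integrable _ _ _ (cst (B * C))) => //.
    by apply: measurable_funTS; exact: (measurable_section2 r mFe).
  by move=> y _; rewrite normrM; exact: ler_pM.
have iF r : leb.-integrable period (EFin \o (fun y => F (y, r))).
  apply: (@dominated_integrable _ _ _ (cst B)) => //.
  by apply: measurable_funTS; exact: (measurable_section2 r mF).
have cm tau : p0 < tau -> tau < q0 -> forall e, 0 < e ->
    exists2 d, 0 < d & forall r, tau <= r -> r - tau <= d -> `|m r - m tau| <= e.
  (* The increment of [m] splits into the change of [F], weighed by [eta], and the change of [eta],
     Lipschitz with constant [C]; the 2 in [2 * B * C] is the length of the period. *)
  move=> pt tq' e e0; pose e1 := e / (C + 2 * B * C + 1).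
  have D0 : 0 < C + 2 * B * C + 1 by rewrite ltr_wpDl// addr_ge0// !mulr_ge0.
  have e10 : 0 < e1 by exact: divr_gt0.
  have [d d0 hd] := rc tau pt tq' e1 e10.
  exists (Num.min d e1); first by rewrite lt_min d0.
  move=> r tr; rewrite le_min => /andP[rd re].
  have eta_lip : `|r - tau| <= e1 by rewrite ger0_norm ?subr_ge0.
  have lip y : `|eta (y - r) - eta (y - tau)| <= C * e1.
    apply: le_trans (derivative_lipschitz (y - r) (y - tau) eta_der detaC) _.
    apply: ler_wpM2l => //; apply: le_trans eta_lip.
    by rewrite -normrN; rewrite le_eqVlt; apply/orP; left; apply/eqP; congr `|_|; ring.
  have iab : leb.-integrable period (EFin \o (fun y => `|F (y, r) - F (y, tau)|)).
    by apply: int_norm; exact: int_sub.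
  have iCab : leb.-integrable period (EFin \o (fun y => C * `|F (y, r) - F (y, tau)|)).
    exact: int_scale.
  rewrite -RintegralB//.
  apply: (@le_trans _ _ (\int[leb]_(y in period) (C * `|F (y, r) - F (y, tau)| + B * (C * e1)))).
    apply: Rintegral_abs_le => //; first exact: int_sub.
      exact: int_add iCab (ic _).
    move=> y _.
    rewrite (_ : _ - _ = eta (y - r) * (F (y, r) - F (y, tau)) + F (y, tau) * (eta (y - r) - eta (y - tau))); last by ring.
    apply: le_trans (ler_normD _ _) _; apply: lerD; rewrite normrM; first exact: ler_wpM2r.
    exact: ler_pM.
  rewrite RintegralD//; last exact: ic.
  rewrite RintegralZl//.
  rewrite Rintegral_cst// len2.
  apply: (@le_trans _ _ (C * e1 + B * (C * e1) * 2)).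
    by rewrite lerD2r; apply: ler_wpM2l => //; exact: hd.
  rewrite -[leRHS](_ : e1 * (C + 2 * B * C + 1) = e); last by rewrite /e1 mulfVK// gt_eqF.
  by rewrite -subr_ge0 (_ : _ - _ = e1); [exact: ltW|ring].
pose kap := \int[leb]_(y in period) k y.
have kap0 : 0 <= kap by apply: Rintegral_ge0.
have mm : measurable_fun setT m by exact: (measurable_Rintegral_section mp mFe).
have mq : measurable_fun setT q by exact: (measurable_Rintegral_section mp mne).
have qb r : `|q r| <= B * C * 2 + C * kap.
  apply: (@le_trans _ _ (C * kap)); last by rewrite lerDr !mulr_ge0.
  rewrite -RintegralZl//; apply: Rintegral_abs_le => //.
  - apply: (@dominated_integrable _ _ _ (fun y => C * k y)) => //.
    + by apply: measurable_funTS; exact: (measurable_section2 r mne).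
    + exact: int_scale.
    + by move=> y _; rewrite normrM mulrC; exact: ler_pM.
  - exact: int_scale.
  - by move=> y _; rewrite normrM mulrC; exact: ler_pM.
have mb r : `|m r| <= B * C * 2 + C * kap.
  apply: (@le_trans _ _ (B * C * 2)); last by rewrite lerDl mulr_ge0.
  rewrite -len2 -Rintegral_cst//; apply: Rintegral_abs_le => //; first exact: ic.
  by move=> y _; rewrite normrM; exact: ler_pM.
apply: (time_localization _ mq mm qb mb ps st tq).
- by move=> th dth s' t'; exact: weak_identity.
- by apply: cm => //; exact: lt_trans st tq.
- by apply: cm => //; exact: lt_trans ps st.
Qed.

End WeakTransport.

(** * Test functions concentrating on arcs *)

Section ArcTests.
Context {R : realType}.
Implicit Types (x y z : R) (n : nat).

(* [bump x] is positive on the arc ]-1, x[ of the circle of length 2 and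
   nonpositive on the complementary arc, so [arc x n] tends to the indicator
   function of ]-1, x[. *)
Definition bump x z : R := cos (pi * (z - (x - 1) / 2)) - cos (pi * ((x + 1) / 2)).
Definition arc x n z : R := step (n%:R * bump x z).
Definition darc x n z : R :=
  dstep (n%:R * bump x z) * (n%:R * - (sin (pi * (z - (x - 1) / 2)) * pi)).

(** A difference of cosines as a product: one factor vanishes at the end -1 of the arc and the other
    at the end [x], which makes the sign evident. *)
Lemma bumpE x z : bump x z = 2 * (sin (pi * ((z + 1) / 2)) * sin (pi * ((x - z) / 2))).
Proof.
rewrite /bump (_ : pi * (z - (x - 1) / 2) = pi * ((z + 1) / 2) - pi * ((x - z) / 2)); last by field.
rewrite (_ : pi * ((x + 1) / 2) = pi * ((z + 1) / 2) + pi * ((x - z) / 2)); last by field.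
by rewrite cosB cosD; ring.
Qed.

Lemma sin_pihalf_gt0 x : 0 < x -> x < 2 -> 0 < sin (pi * (x / 2)).
Proof.
move=> x0 x2; apply: sin_gt0_pi; rewrite mulr_gt0 ?pi_gt0 ?divr_gt0//=.
by rewrite -[ltRHS]mulr1 ltr_pM2l ?pi_gt0// ltr_pdivrMr// mul1r.
Qed.

Lemma bump_gt0 x z : x < 1 -> -1 < z -> z < x -> 0 < bump x z.
Proof.
move=> x1 z1 zx; rewrite bumpE mulr_gt0// mulr_gt0// sin_pihalf_gt0//; lra.
Qed.

Lemma bump_le0 x z : -1 < x -> -1 <= z -> z < 1 -> x <= z -> bump x z <= 0.
Proof.
move=> x1 z1 z1' xz; rewrite bumpE pmulr_rle0//.
have s1 : 0 <= sin (pi * ((z + 1) / 2)).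
  have [->|zn] := eqVneq z (-1); first by rewrite addNr mul0r mulr0 sin0.
  by apply/ltW/sin_pihalf_gt0; [move: z1; rewrite le_eqVlt eq_sym (negbTE zn)/=|]; lra.
have s2 : sin (pi * ((x - z) / 2)) <= 0.
  have [->|zn] := eqVneq x z; first by rewrite subrr mul0r mulr0 sin0.
  rewrite (_ : pi * ((x - z) / 2) = - (pi * ((z - x) / 2))); last by field.
  rewrite sinN oppr_le0; apply/ltW/sin_pihalf_gt0; last by lra.
  by rewrite subr_gt0 lt_neqAle zn.
by rewrite mulr_ge0_le0.
Qed.

Lemma is_derive_arc x n z : is_derive z 1 (arc x n) (darc x n z).
Proof.
apply: (is_derive_comp (h := fun y => n%:R * bump x y) (f := step)); last exact: is_derive_step.
have dh : is_derive z 1 (fun y : R => pi * (y - (x - 1) / 2)) pi.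
  have := is_derive_affine z (pi : R) (- (pi * ((x - 1) / 2))).
  by rewrite (_ : (fun y => pi * y - _) = (fun y => pi * (y - (x - 1) / 2)))//; apply/funext => y; ring.
have d := is_derive_comp dh (is_derive_cos (pi * (z - (x - 1) / 2))).
have := is_derive_scale n%:R (is_derive_sub d (is_derive_const (cos (pi * ((x + 1) / 2))) z)).
by move=> h; apply: is_derive_eq h _; ring.
Qed.

Lemma continuous_bump x n : continuous (fun z => n%:R * bump x z).
Proof.
apply: continuous_scale; apply: continuousBr; last by move=> z; exact: cvg_cst.
move=> z; apply: (@continuous_comp _ _ _ (fun y => pi * (y - (x - 1) / 2)) cos); last exact: continuous_cos.
by apply: cvgM; [exact: cvg_cst|apply: cvgB; [exact: cvg_id|exact: cvg_cst]].
Qed.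

Lemma continuous_darc x n : continuous (darc x n).
Proof.
apply: continuousMr.
  move=> z; apply: (@continuous_comp _ _ _ (fun y => n%:R * bump x y) dstep); last exact: continuous_dstep.
  exact: continuous_bump.
apply: continuous_scale; apply: continuousNr; apply: continuousMr; last by move=> z; exact: cvg_cst.
move=> z; apply: (@continuous_comp _ _ _ (fun y => pi * (y - (x - 1) / 2)) sin); last exact: continuous_sin.
by apply: cvgM; [exact: cvg_cst|apply: cvgB; [exact: cvg_id|exact: cvg_cst]].
Qed.

Lemma arc_periodic x n : periodic2 (arc x n).
Proof.
move=> z; rewrite /arc /bump (_ : pi * (z + 2 - (x - 1) / 2) = pi * (z - (x - 1) / 2) + pi *+ 2); last by ring.
by rewrite cosD2pi.
Qed.

Lemma arc01 x n z : `|arc x n z| <= 1.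
Proof. by have /andP[? ?] := step01 (n%:R * bump x z); rewrite ger0_norm. Qed.

Lemma darc_bound x n z : `|darc x n z| <= 2 * (n%:R * (1 * pi)).
Proof.
have /andP[d0 d2] := dstep_bound (n%:R * bump x z).
rewrite /darc normrM (ger0_norm d0); apply: ler_pM => //.
rewrite normrM normr_nat; apply: ler_wpM2l => //.
rewrite normrN normrM (ger0_norm (pi_ge0 R)); apply: ler_wpM2r; first exact: pi_ge0.
exact: sin_max.
Qed.

Lemma step_lip x y : `|step x - step y| <= 2 * `|x - y|.
Proof.
apply: (derivative_lipschitz _ _ (@is_derive_step R)) => z.
by have /andP[? ?] := dstep_bound z; rewrite ger0_norm.
Qed.

(** The difference of the two bumps contains the factor [sin (pi * y)]: this vanishing at the
    integers compensates the derivative of the cut-off. In the constant, one 2 is the Lipschitz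
    constant of [step], the other comes from the product formula. *)
Lemma arc_odd x n y r : `|arc x n (y - r) - arc x n (- y - r)| <= 4 * n%:R * `|sin (pi * y)|.
Proof.
apply: le_trans (step_lip _ _) _; rewrite -mulrBr normrM normr_nat.
rewrite -mulrA -[4]/(2 * 2)%:R natrM -[2 * 2 * _]mulrA; apply: ler_wpM2l => //.
rewrite mulrCA; apply: ler_wpM2l => //.
rewrite (_ : bump x (y - r) - _ = 2 * (sin (pi * (r + (x - 1) / 2)) * sin (pi * y))).
  rewrite normrM ger0_norm//; apply: ler_wpM2l => //; rewrite normrM.
  by rewrite ler_piMl// sin_max.
rewrite /bump (_ : pi * (y - r - (x - 1) / 2) = pi * y - pi * (r + (x - 1) / 2)); last by ring.
rewrite (_ : pi * (- y - r - (x - 1) / 2) = - (pi * y + pi * (r + (x - 1) / 2))); last by ring.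
by rewrite cosN cosB cosD; ring.
Qed.

Lemma arc_cvg x z : -1 < x -> x < 1 -> period z ->
  arc x n z @[n --> \oo] --> (\1_`]-1, x[%classic z : R).
Proof.
move=> x1 x1'; rewrite /period/= in_itv/= => /andP[z1 z1'].
rewrite indicE; have [/andP[zn zx]|] := boolP ((-1 < z) && (z < x)).
  rewrite mem_set/=; last by rewrite in_itv/= zn.
  have b0 := bump_gt0 x1' zn zx.
  apply: cvg_near_cst; exists (Num.truncn (1 / bump x z)).+1 => // n /= Nn.
  apply: step_ge1; rewrite -ler_pdivrMr//; apply: ltW.
  by apply: (lt_le_trans (truncnS_gt _)); rewrite ler_nat.
move=> zx; rewrite memNset/=; last by rewrite in_itv/=; exact/negP.
apply: cvg_near_cst; apply: nearW => n; apply: step_le0.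
have b0 : bump x z <= 0.
  move: zx; rewrite negb_and -!leNgt => /orP[zn|xz]; last exact: bump_le0.
  have -> : z = -1 by apply/eqP; rewrite eq_le zn.
  by rewrite bumpE addNr mul0r mulr0 sin0 mul0r mulr0.
by rewrite mulr_ge0_le0.
Qed.

(** As [n] grows, the arc functions give a zero integral of [w] over every ]-1, x], and the
    primitive of an integrable function has that function as its derivative almost everywhere. *)
Lemma arc_test_ae0 (w : R -> R) : measurable_fun setT w ->
  leb.-integrable period (EFin \o w) ->
  (forall x n, -1 < x -> x < 1 -> \int[leb]_(z in period) (w z * arc x n z) = 0) ->
  {ae leb, forall z, period z -> w z = 0}.
Proof.
move=> mw iw w0.
have mp : measurable (period : set R) := @measurable_period R.
have F0 x : -1 < x -> x < 1 -> \int[leb]_(z in `]-1, x]) w z = 0.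
  move=> x1 x1'.
  have cae : {ae leb, forall z : R, period z -> (w z * arc x n z)%:E @[n --> \oo] --> (EFin \o (fun z => w z * \1_`]-1, x[%classic z)) z}.
    apply: ae_all => z pz /=; apply: cvg_EFin; first exact: nearW.
    by apply: cvgM; [exact: cvg_cst|exact: arc_cvg].
  pose aw z := `|w z|.
  have iaw : leb.-integrable period (EFin \o aw) by exact: int_norm.
  have bae : {ae leb, forall z n, period z -> (`|(w z * arc x n z)%:E| <= (EFin \o aw) z)%E}.
    by apply: ae_all => z n _ /=; rewrite lee_fin normrM ler_piMr// arc01.
  have mi : measurable_fun setT (fun z : R => w z * \1_`]-1, x[%classic z).
    by apply: measurable_funM => //; exact: measurable_indic.
  have marc n : measurable_fun setT (arc x n).
    by apply: continuous_measurable_fun => z; exact: is_derive_continuous (is_derive_arc x n z).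
  have mf n : measurable_fun period (fun z => (w z * arc x n z)%:E).
    by apply: measurable_funTS; apply/measurable_EFinP; apply: measurable_funM => //; exact: marc.
  have mi' : measurable_fun period (EFin \o (fun z : R => w z * \1_`]-1, x[%classic z)).
    by apply: measurable_funTS; exact/measurable_EFinP.
  have [_ _] := @dominated_convergence _ _ _ leb _ mp _ _ _ mf mi' cae iaw bae.
  move=> lim.
  have : \int[leb]_(z in period) (w z * arc x n z) @[n --> \oo] -->
      \int[leb]_(z in period) (w z * \1_`]-1, x[%classic z).
    apply: fine_cvg; rewrite fineK//; apply: integrable_fin_num => //.
    apply: (@dominated_integrable _ _ _ aw) => //; first exact: measurable_funTS.
    by move=> z _; rewrite normrM indicE ler_piMr// ger0_norm// lern1 leq_b1.
  rewrite (_ : (fun n => _) = (fun=> 0)); last by apply/funext => n; exact: w0.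
  move=> /(cvg_lim (@Rhausdorff R)); rewrite lim_cst// => /esym.
  have sub : `]-1, x[ `<=` (period : set R).
    by move=> z; rewrite /period/= !in_itv/= => /andP[h1 h2]; rewrite ltW// (lt_trans h2).
  rewrite (_ : \int[leb]_(z in period) _ = \int[leb]_(z in `]-1, x[) w z).
    by rewrite Rintegral_itv_bndo_bndc//; exact: integrableS iw.
  rewrite -[X in _ = \int[leb]_(z in X) _](setIidr sub) Rintegral_mkcondr.
  apply: eq_Rintegral => z _; rewrite indicE patchE.
  by case: (_ \in _); rewrite ?mulr1 ?mulr0.
pose f := w \_ period.
have fi : leb.-integrable setT (EFin \o f).
  apply/integrableP; split.
    by apply/measurable_EFinP; apply/(measurable_restrictT _ mp); exact: measurable_funTS.
  have /integrableP[_] := iw; rewrite integral_mkcond; congr (_ < _)%E.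
  by apply: eq_integral => z _; rewrite /f /= !patchE; case: ifP => //; rewrite normr0.
have fiS (a b : itv_bound R) : leb.-integrable [set` Interval a b] (EFin \o f).
  exact: integrableS fi.
have := @FTC1 _ f (BRight (-1)) (fun y => fiS _ _) (open_integrable_locally openT fi).
have nem : {ae leb, forall z : R, z <> -1} by exact: ae_neq.
move=> /(ae_and nem); apply: ae_imply => z [zn1 +] pz.
have [z1 z1'] : -1 < z /\ z < 1.
  move: pz; rewrite /period/= in_itv/= => /andP[z1 ->]; split => //.
  by rewrite lt_neqAle z1 andbT eq_sym; exact/eqP.
have z1b : ((BRight (-1) : itv_bound R) < BRight z)%O by rewrite bnd_simp.
move=> /(_ z1b)[_].
rewrite (_ : f z = w z); last by rewrite /f patchE mem_set.
move=> <-; rewrite derive1E (@near_eq_derive _ _ _ _ (cst 0)) ?derive_cst//.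
near=> y; have [y1 y1'] : -1 < y /\ y < 1.
  split; near: y; [exact: lt_nbhsr|exact: lt_nbhsl].
rewrite /cst -[RHS](F0 y y1 y1'); apply: eq_Rintegral => u; rewrite inE/= in_itv/= => /andP[u1 u2].
by rewrite /f patchE mem_set// /period/= in_itv/= ltW// (le_lt_trans u2).
Unshelve. all: by end_near. Qed.

End ArcTests.

(** * Borel sets of the plane and essential bounds *)

Section PlaneBorel.
Context {R : realType}.
Implicit Types (p : R * R) (U : set (R * R)).

Lemma plane_nbhsP p U : nbhs p U ->
  exists2 e, 0 < e & forall x y, `|x - p.1| < e -> `|y - p.2| < e -> U (x, y).
Proof.
move=> /nbhs_ballP[e /= e0 he]; exists e => // x y xe ye.
by apply: he; split; rewrite /ball/= distrC.
Qed.

Lemma nbhs_plane p U e : 0 < e ->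
  (forall x y, `|x - p.1| < e -> `|y - p.2| < e -> U (x, y)) -> nbhs p U.
Proof.
move=> e0 h; apply/nbhs_ballP; exists e => //= -[x y] [/=].
by rewrite /ball/= => xe ye; apply: h; rewrite distrC.
Qed.

Lemma grid_close (e i x p a : R) : 2 * i < e -> p - i < a -> a < p + i -> `|a - x| < i ->
  `|x - p| < e.
Proof. by rewrite !ltr_norml => ? ? ? /andP[? ?]; apply/andP; split; lra. Qed.

Lemma grid_near (i p a : R) : p - i < a -> a < p + i -> `|a - p| < i.
Proof. by rewrite ltr_norml => ? ?; apply/andP; split; lra. Qed.

(** Measurability in the plane refers to the product sigma-algebra, so an open set is written as the
    countable union of the boxes of rational centre and radius [1 / (n + 1)] that it contains; [V]
    is empty for the other boxes. *)
Lemma plane_open_measurable U : open U -> measurable U.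
Proof.
move=> oU; pose box (a b : rat) (n : nat) : set (R * R) :=
  ball (ratr a : R) n.+1%:R^-1 `*` ball (ratr b : R) n.+1%:R^-1.
pose V (a b : rat) (n : nat) := if pselect (box a b n `<=` U) then box a b n else set0.
have mV a b n : measurable (V a b n).
  rewrite /V; case: pselect => sub; last exact: measurable0.
  by apply: measurableX; exact: measurable_ball.
rewrite (_ : U = \bigcup_a \bigcup_b \bigcup_n V a b n).
  apply: bigcupT_measurable_rat => a; apply: bigcupT_measurable_rat => b.
  by apply: bigcupT_measurable => n; exact: mV.
apply/seteqP; split => [p Up|p [a _ [b _ [n _]]]]; last first.
  by rewrite /V; case: pselect => // sub /sub.
have [e e0 he] := plane_nbhsP (oU p Up : nbhs p U).
pose n := Num.truncn (2 / e).
have n0 : 0 < n.+1%:R^-1 :> R by rewrite invr_gt0.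
have ne : 2 * n.+1%:R^-1 < e by rewrite ltr_pdivrMr// mulrC -ltr_pdivrMr// truncnS_gt.
have [a] : exists a : rat, ratr a \in `](p.1 - n.+1%:R^-1), (p.1 + n.+1%:R^-1)[.
  by have [|a] := @rat_in_itvoo R (p.1 - n.+1%:R^-1) (p.1 + n.+1%:R^-1); [rewrite ltrBlDr -addrA ltrDl addr_gt0|exists a].
rewrite in_itv/= => /andP[a1 a2].
have [b] : exists b : rat, ratr b \in `](p.2 - n.+1%:R^-1), (p.2 + n.+1%:R^-1)[.
  by have [|b] := @rat_in_itvoo R (p.2 - n.+1%:R^-1) (p.2 + n.+1%:R^-1); [rewrite ltrBlDr -addrA ltrDl addr_gt0|exists b].
rewrite in_itv/= => /andP[b1 b2].
have sub : box a b n `<=` U.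
  move=> [x y] [/= hx hy].
  by apply: he; [exact: grid_close ne a1 a2 hx|exact: grid_close ne b1 b2 hy].
have Vp : V a b n p.
  rewrite /V; case: pselect => [s|/(_ sub)//].
  by split; [exact: grid_near a1 a2|exact: grid_near b1 b2].
by exists a => //; exists b => //; exists n.
Qed.

Lemma plane_continuous_measurable U (f : R * R -> R) : open U ->
  (forall p, U p -> {for p, continuous f}) -> measurable_fun U f.
Proof.
move=> oU cf; apply: (measurability _ (RGenOpens.measurableE R)).
move=> _ [_ [a [b ->] <-]]; apply: plane_open_measurable.
rewrite openE => p [Up fp]; apply: filterI; first exact: oU.
by apply: (cf p Up); apply: open_nbhs_nbhs; split => //; exact: interval_open.
Qed.

Lemma continuous_measurable_plane (f : R * R -> R) : continuous f -> measurable_fun setT f.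
Proof. by move=> cf; apply: plane_continuous_measurable; [exact: openT|move=> p _; exact: cf]. Qed.

End PlaneBorel.

Section UnitInterval.
Context {R : realType}.

Lemma ae_lebI (P : R -> Prop) :
  {ae lebI, forall x, P x} <-> {ae leb, forall x, I01 x -> P x}.
Proof.
have mI := @measurable_I01 R.
split => -[N [mN N0 PN]].
  exists (N `&` I01); split; [exact: measurableI|exact: N0|].
  move=> x /= nP; have Ix : I01 x by apply: contrapT => nI; apply: nP.
  by split => //; apply: PN => /= Px; apply: nP.
exists (N `|` ~` I01); split.
- by apply: measurableU => //; exact: measurableC.
- rewrite /lebI/= /mrestr setIUl setICl setU0; apply/eqP; rewrite eq_le measure_ge0 andbT.
  by rewrite -N0; apply: le_measure; rewrite ?inE//; exact: measurableI.
- move=> x /= nP; have [Ix|nI] := pselect (I01 x); last by right.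
  by left; apply: PN => /= h; apply: nP; exact: h.
Qed.

Lemma lebI_setT : lebI [set: R] = 1%E.
Proof. by rewrite /lebI/= /mrestr setTI lebesgue_measure_itv/= lte01 oppr0 adde0. Qed.

(** The norm of order +oo unfolds to an essential supremum because [lebI] has positive total
    mass. *)
Lemma Linfty_bound (f : R -> R) : Linfty_I f ->
  exists2 B, 0 <= B & {ae leb, forall x, I01 x -> `|f x| <= B}.
Proof.
move=> [_]; rewrite /finite_norm unlock /Lnorm.
case: ifPn => [_|]; last by rewrite /= lebI_setT lte01.
move=> fin.
have /ae_lebI h := ess_sup_ge (@lebI R) (abse \o (EFin \o f)).
exists (Num.max 0 (fine (ess_sup (@lebI R) (abse \o (EFin \o f))))); first by rewrite le_max lexx.
apply: ae_imply h => x /[apply] /=; move: fin.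
case: (ess_sup _ _) => [r||] //= _.
by rewrite lee_fin => h; rewrite le_max h orbT.
Qed.

Lemma Linfty_intro (f : R -> R) B : measurable_fun I01 f ->
  {ae leb, forall x, I01 x -> `|f x| <= B} -> Linfty_I f.
Proof.
move=> mf fB; split => //; rewrite /finite_norm unlock /Lnorm.
case: ifPn => [_|]; last by rewrite /= lebI_setT lte01.
apply: (@le_lt_trans _ _ B%:E); last exact: ltry.
apply/ess_supP/ae_lebI; apply: ae_imply fB => x /[apply] /=.
by rewrite lee_fin.
Qed.

Lemma ae_fold (P : R -> Prop) : {ae leb, forall x, period x -> P x} <->
  {ae leb, forall x, I01 x -> P x /\ P (- x)}.
Proof.
split => h.
  have n1 : {ae leb, forall x : R, x <> 1} by exact: ae_neq.
  have h' := ae_reflect 0 h.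
  have := ae_and n1 (ae_and h h'); apply: ae_imply => x [x1 [hx hx']].
  rewrite /I01/= in_itv/= => /andP[x0 x1'].
  have xl1 : x < 1 by rewrite lt_neqAle x1' andbT; exact/eqP.
  by split; [apply: hx|rewrite -sub0r; apply: hx']; rewrite /period/= in_itv/=; lra.
have := ae_and h (ae_reflect 0 h); apply: ae_imply => y [hy hy'].
rewrite /period/= in_itv/= => /andP[y0 y1]; have [yp|yn] := leP 0 y.
  by case: hy => //; rewrite /I01/= in_itv/= yp ltW.
have [|_] := hy'; first by rewrite /I01/= in_itv/=; lra.
by rewrite sub0r opprK.
Qed.

End UnitInterval.

Section AlmostEverywhereIntegrable.
Context {R : realType}.
Variables (D : set R) (mD : measurable D).

Lemma ae_eq_integrable (f h : R -> R) : measurable_fun D f ->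
  {ae leb, forall x, D x -> f x = h x} -> leb.-integrable D (EFin \o h) ->
  leb.-integrable D (EFin \o f).
Proof.
move=> mf fh ih; have mh := measurable_int _ ih; have /integrableP[_ fin] := ih.
apply/integrableP; split; first exact/measurable_EFinP.
rewrite (@ae_eq_integral _ _ _ leb D (fun x => `|(EFin \o h) x|%E))//.
- by apply: measurableT_comp => //; exact/measurable_EFinP.
- exact: measurableT_comp.
- by apply: ae_imply fh => x /[apply] /= ->.
Qed.

(** The clamped function is bounded everywhere and agrees with [f] almost everywhere. *)
Lemma ae_bounded_integrable (f : R -> R) B : (leb D < +oo)%E -> measurable_fun D f ->
  {ae leb, forall x, D x -> `|f x| <= B} -> leb.-integrable D (EFin \o f).
Proof.
move=> Dfin mf fB; have B0 : 0 <= Num.max 0 B by rewrite le_max lexx.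
have cB x : `|clamp (- Num.max 0 B) (Num.max 0 B) (f x)| <= Num.max 0 B.
  by rewrite ler_norml; apply: clamp_itv; rewrite -subr_ge0 opprK addr_ge0.
apply: (@ae_eq_integrable _ (fun x => clamp (- Num.max 0 B) (Num.max 0 B) (f x))) => //.
  apply: ae_imply fB => x /[apply] h; rewrite clamp_id// -ler_norml.
  by rewrite le_max h orbT.
apply: (@dominated_integrable _ _ _ (cst (Num.max 0 B))) => //; last exact: int_cst.
apply: measurable_minr; first exact: measurable_cst.
by apply: measurable_maxr; first exact: measurable_cst.
Qed.

End AlmostEverywhereIntegrable.

Section IntervalLemmas.
Context {R : realType}.

Lemma Rintegral_itv_mulr (f : R -> R) (s t c : R) : leb.-integrable `[s, t] (EFin \o f) ->
  \int[leb]_(r in `[s, t]) (f r * c) = (\int[leb]_(r in `[s, t]) f r) * c.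
Proof. by move=> fi; rewrite RintegralZr. Qed.

Lemma section_bound (f : R * R -> R) r : continuous f ->
  exists2 c, 0 <= c & forall x, I01 x -> `|f (x, r)| <= c.
Proof.
move=> cf; have cn : {within `[0, 1], continuous (fun x : R => `|f (x, r)|)}.
  apply: continuous_subspaceT => x; apply: cvg_norm.
  apply: (@continuous_comp _ _ _ (fun y : R => (y, r)) f); last exact: cf.
  exact: (cvg_pair cvg_id (cvg_cst r)).
have [c _ hc] := EVT_max ler01 cn; by exists `|f (c, r)|.
Qed.

Lemma measurable_oppfst (F : R * R -> R) : measurable_fun setT F ->
  measurable_fun setT (fun p : R * R => F (- p.1, p.2)).
Proof.
move=> mF; apply: (measurableT_comp mF); apply/measurable_fun_pairP; split; last exact: measurable_snd.
by apply: measurable_funN; exact: measurable_fst.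
Qed.

End IntervalLemmas.

Section Lagrangian.
Context {R : realType}.
Implicit Types F : R * R -> R.

Definition lag F (p : R * R) := F (p.1 + p.2, p.2).

Lemma measurable_lag F : measurable_fun setT F -> measurable_fun setT (lag F).
Proof.
move=> mF; apply: (measurableT_comp mF); apply/measurable_fun_pairP; split.
  exact: measurable_sum12.
exact: measurable_snd.
Qed.

Lemma lag_periodic F : (forall y r, F (y + 2, r) = F (y, r)) ->
  forall z r, lag F (z + 2, r) = lag F (z, r).
Proof. by move=> h z r; rewrite /lag/= addrAC h. Qed.

End Lagrangian.

Section ArcAverages.
Context {R : realType}.

Lemma moving_average (F : R * R -> R) (e : R -> R) r : measurable_fun setT F ->
  (forall y r, F (y + 2, r) = F (y, r)) -> measurable_fun setT e -> periodic2 e ->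
  \int[leb]_(y in period) (F (y, r) * e (y - r)) = \int[leb]_(z in period) (lag F (z, r) * e z).
Proof.
move=> mF Fper me eper; rewrite -[LHS](@Rintegral_periodic_shift _ _ r).
- by apply: eq_Rintegral => z _; rewrite /lag/= addrK.
- apply: measurable_funM; first exact: measurable_section2.
  exact: (measurable_section2 r (measurable_sub12 me)).
- by move=> y; rewrite Fper addrAC eper.
Qed.

Lemma integrable_mul_bounded (D : set R) (f e : R -> R) : measurable D ->
  measurable_fun setT f -> measurable_fun setT e -> (forall x, `|e x| <= 1) ->
  leb.-integrable D (EFin \o f) -> leb.-integrable D (EFin \o (fun x => f x * e x)).
Proof.
move=> mD mf me e1 fi; apply: (@dominated_integrable _ _ _ (fun x => `|f x|)) => //.
- by apply: measurable_funTS; exact: measurable_funM.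
- exact: int_norm.
- by move=> x _; rewrite normrM ler_piMr.
Qed.

Lemma Rintegral_combination (D : set R) (f1 f2 f3 : R -> R) : measurable D ->
  leb.-integrable D (EFin \o f1) -> leb.-integrable D (EFin \o f2) ->
  leb.-integrable D (EFin \o f3) ->
  \int[leb]_(x in D) f1 x = \int[leb]_(x in D) f2 x - \int[leb]_(x in D) f3 x ->
  \int[leb]_(x in D) (f1 x - f2 x + f3 x) = 0.
Proof.
move=> mD i1 i2 i3 e; rewrite RintegralD//; last exact: int_sub.
by rewrite RintegralB// e addrAC subrK subrr.
Qed.

Lemma transport_eq (x x' y y' z z' : R) : x = x' -> y = y' -> z = z' ->
  x = y - z -> x' = y' - z'.
Proof. by move=> -> -> ->. Qed.

Variables (K : R -> R) (S H : R * R -> R) (L B s t : R).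
Hypotheses (kK : kernel K) (mS : measurable_fun setT S).
Hypothesis Sper : forall z r, S (z + 2, r) = S (z, r).
Hypothesis SK : forall p, `|S p| <= L * K (p.1 + p.2).
Hypothesis bH : bounded_periodic B H.

(** By Fubini's theorem the defect [w] of the integral equation has zero integral against every arc
    function, hence vanishes almost everywhere. *)
Lemma arc_averages :
  (forall x n, -1 < x -> x < 1 ->
    \int[leb]_(z in period) (H (z, t) * arc x n z) =
    \int[leb]_(z in period) (H (z, s) * arc x n z) -
    \int[leb]_(r in `[s, t]) \int[leb]_(z in period) (S (z, r) * arc x n z)) ->
  {ae leb, forall z, H (z, t) = H (z, s) - \int[leb]_(r in `[s, t]) S (z, r)}.
Proof.
move=> av.
have mp : measurable (period : set (measurableTypeR R)) := @measurable_period R.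
pose SS z := \int[leb]_(r in `[s, t]) S (z, r).
pose w z := H (z, t) - H (z, s) + SS z.
have mSS : measurable_fun setT SS.
  exact: (measurable_section2 t (@measurable_Rintegral_param _ _ s mS)).
have mH r : measurable_fun setT (fun z => H (z, r)).
  by apply: measurable_section2; exact: bp_meas bH.
have iH r : leb.-integrable period (EFin \o (fun z => H (z, r))).
  apply: (@dominated_integrable _ _ _ (cst B)) => //.
  - exact: measurable_funTS.
  - by apply: int_cst => //; exact: leb_itv_lty.
  - by move=> z _; exact: bp_bound bH _.
have mw : measurable_fun setT w.
  by apply: measurable_funD => //; exact: measurable_funB.
have [iSS _ _] := kernel_dominated_Fubini kK s t mS SK.
have iw : leb.-integrable period (EFin \o w) by exact: (int_add mp (int_sub mp (iH t) (iH s)) iSS).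
have w0 : {ae leb, forall z, period z -> w z = 0}.
  apply: arc_test_ae0 => // x n x1 x1'.
  have marc : measurable_fun setT (arc x n).
    by apply: continuous_measurable_fun => z; exact: is_derive_continuous (is_derive_arc x n z).
  have i1 r := integrable_mul_bounded mp (mH r) marc (@arc01 _ x n) (iH r).
  have i3 := integrable_mul_bounded mp mSS marc (@arc01 _ x n) iSS.
  rewrite -[RHS](Rintegral_combination mp (i1 t) (i1 s) i3).
    by apply: eq_Rintegral => z _; rewrite /w; ring.
  rewrite av//; congr (_ - _).
  pose f p := S p * arc x n p.1.
  have mf : measurable_fun setT f.
    by apply: measurable_funM => //; exact: (measurableT_comp marc measurable_fst).
  have fK p : `|f p| <= L * K (p.1 + p.2).
    by rewrite normrM; apply: le_trans (SK p); rewrite ler_piMr// arc01.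
  have [_ _ f3] := kernel_dominated_Fubini kK s t mf fK.
  apply/esym; apply: (etrans _ f3); apply: eq_Rintegral => z _.
  have iS : leb.-integrable `[s, t] (EFin \o (fun r => S (z, r))).
    by apply: (@kernel_dominated_integrable _ _ kK _ L _ _ _ mS) => r; exact: SK.
  exact/esym/(Rintegral_itv_mulr (arc x n z) iS).
have SSper z : SS (z + 2) = SS z by apply: eq_Rintegral => r _; exact: Sper.
have wper z : w (z + 2) = 0 <-> w z = 0.
  rewrite (_ : w (z + 2) = w z)//; congr (_ - _ + _); last exact: SSper.
    exact: bp_periodic bH _ _.
  exact: bp_periodic bH _ _.
apply: ae_imply (ae_periodic wper w0) => z.
rewrite /w /SS => h; apply/eqP; rewrite -subr_eq0 -{}h; apply/eqP; ring.
Qed.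

End ArcAverages.

(** * The integral equation for locally bounded weak solutions *)

Section WeakToMild.
Context {R : realType}.
Variables (K alpha g rho0 J0 : R -> R) (rho J : R * R -> R).
Hypotheses (kK : kernel K) (wa : weight alpha) (dg : damping g).
Hypothesis ws : weak_solution K alpha g rho0 J0 rho J.

Let u := unf rho J.

Let mu : measurable_fun setT u.
Proof. by have [m1 m2] := ws_measurable ws; exact: measurable_unf. Qed.

Let msec t : 0 <= t -> measurable_fun I01 (fun x => rho (x, t)) /\ measurable_fun I01 (fun x => J (x, t)).
Proof. by move=> t0; have [[? _] [? _]] := ws_Linfty ws t0. Qed.

Lemma weak_section_bound t : 0 <= t -> exists2 B, 0 <= B &
  {ae leb, forall x, I01 x -> `|rho (x, t)| <= B /\ `|J (x, t)| <= B}.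
Proof.
move=> t0; have [lr lj] := ws_Linfty ws t0.
have [B1 B10 h1] := Linfty_bound lr; have [B2 B20 h2] := Linfty_bound lj.
exists (B1 + B2); first exact: addr_ge0.
apply: ae_imply (ae_and h1 h2) => x [k1 k2] Ix.
by split; [apply: le_trans (k1 Ix) _; rewrite lerDl|apply: le_trans (k2 Ix) _; rewrite lerDr].
Qed.

Lemma unf_section_bound t : 0 <= t -> exists2 B, 0 <= B & {ae leb, forall y, `|u (y, t)| <= B}.
Proof.
move=> t0; have [B B0 hB] := weak_section_bound t0; exists B => //.
apply: ae_periodic; first by move=> x; rewrite /u unf_periodic.
apply/ae_fold; have n0 : {ae leb, forall x : R, x <> 0} by exact: ae_neq.
have n1 : {ae leb, forall x : R, x <> 1} by exact: ae_neq.
apply: ae_imply (ae_and n0 (ae_and n1 hB)) => x [x0 [x1 h]] Ix; have [hr hj] := h Ix.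
move: Ix; rewrite /I01/= in_itv/= => /andP[x0' x1'].
have xp : 0 < x by rewrite lt_neqAle x0' eq_sym andbT; exact/eqP.
have xl : x < 1 by rewrite lt_neqAle x1' andbT; exact/eqP.
rewrite /u (unf_pos rho J x0' xl t0) (unf_neg rho J xp x1' t0) !normrM normfV (ger0_norm (ler0n _ 2)).
rewrite !ler_pdivrMr//; split.
  by apply: le_trans (ler_normD _ _) _; lra.
by apply: le_trans (ler_normB _ _) _; lra.
Qed.

Lemma unf_integrable t : 0 <= t -> leb.-integrable period (EFin \o (fun y => u (y, t))).
Proof.
move=> t0; have [B B0 hB] := unf_section_bound t0.
apply: (@ae_bounded_integrable _ _ (@measurable_period R) _ B); first exact: leb_itv_lty.
  by apply: measurable_funTS; exact: measurable_section2.
by apply: ae_imply hB.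
Qed.

Let section_integrable t : 0 <= t ->
  leb.-integrable I01 (EFin \o (fun x => rho (x, t))) /\
  leb.-integrable I01 (EFin \o (fun x => J (x, t))).
Proof.
move=> t0; have [B B0 hB] := weak_section_bound t0; have [mr mj] := msec t0.
have mI := @measurable_I01 R; have fI : (leb (I01 : set R) < +oo)%E by exact: leb_itv_lty.
split; apply: (ae_bounded_integrable mI (B := B) fI) => //.
  by apply: ae_imply hB => x /[apply] -[].
by apply: ae_imply hB => x /[apply] -[].
Qed.

Lemma L1_continuousP (v : R * R -> R) t : L1_continuous v -> 0 <= t -> forall e, 0 < e ->
  exists2 d, 0 < d & forall r, 0 <= r -> `|r - t| <= d ->
  (\int[leb]_(x in I01) `|v (x, r) - v (x, t)|%:E < e%:E)%E.
Proof.
move=> cv t0 e e0.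
have : nbhs (0%E : \bar R) [set y | (y < e%:E)%E].
  by apply: open_nbhs_nbhs; split; [exact: open_ereal_lt_ereal|rewrite /= lte_fin].
move=> /(cv t t0); rewrite /= nbhs_filterE => -[d /= d0 hd].
exists (d / 2); first exact: divr_gt0.
move=> r r0 rd; apply: hd; last by rewrite /Rge0/= in_itv/= r0.
by rewrite /ball_/= distrC (le_lt_trans rd)// ltr_pdivrMr// ltr_pMr// ltr1n.
Qed.

(** Over [x] and [- x], with increments [p] of [rho] and [q] of [J], the claim rests on
    [|p + q| / 2 + |p - q| / 2 <= |p| + |q|]. *)
Lemma unf_L1_continuous t : 0 <= t -> forall e, 0 < e -> exists2 d, 0 < d &
  forall r, 0 <= r -> `|r - t| <= d -> \int[leb]_(y in period) `|u (y, r) - u (y, t)| <= e.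
Proof.
move=> t0 e e0; have e20 : 0 < e / 2 by exact: divr_gt0.
have [cr cj] := ws_continuous ws.
have [d1 d10 h1] := L1_continuousP cr t0 e20.
have [d2 d20 h2] := L1_continuousP cj t0 e20.
exists (Num.min d1 d2); first by rewrite lt_min d10.
move=> r r0; rewrite le_min => /andP[/(h1 r r0) {}h1 /(h2 r r0) {}h2].
have mI := @measurable_I01 R.
have [ir ij] := section_integrable r0; have [ir' ij'] := section_integrable t0.
have iR := int_norm (int_sub mI ir ir'); have iJ := int_norm (int_sub mI ij ij').
have mp : measurable (period : set (measurableTypeR R)) := @measurable_period R.
have iu : leb.-integrable period (EFin \o (fun y => `|u (y, r) - u (y, t)|)).
  have i1 := int_sub mp (unf_integrable r0) (unf_integrable t0).
  by have i2 := int_norm i1.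
have mq : measurable_fun setT (fun y => `|u (y, r) - u (y, t)|).
  by apply: measurableT_comp => //; apply: measurable_funB; exact: measurable_section2.
have [f1 f2] := integrable_fold mq iu.
have {}h1 : \int[leb]_(x in I01) `|rho (x, r) - rho (x, t)| <= e / 2.
  by rewrite -lee_fin /Rintegral fineK; [exact: ltW|apply: integrable_fin_num].
have {}h2 : \int[leb]_(x in I01) `|J (x, r) - J (x, t)| <= e / 2.
  by rewrite -lee_fin /Rintegral fineK; [exact: ltW|apply: integrable_fin_num].
rewrite -Rintegral_fold// [e in _ <= e]splitr.
apply: le_trans (lerD h1 h2); rewrite -RintegralD// [leRHS]Rintegral_cc_oo; last exact: int_add.
apply: le_Rintegral => //; first exact: int_add.
  by apply: integrableS (int_add mI iR iJ) => //; apply: subset_itv; rewrite bnd_simp.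
move=> x /=; rewrite in_itv/= => /andP[x0 x1].
rewrite /u !(unf_pos rho J (ltW x0) x1)// !(unf_neg rho J x0 (ltW x1))//.
set a := rho (x, r); set a' := rho (x, t); set b := J (x, r); set b' := J (x, t).
rewrite (_ : (a + b) / 2 - (a' + b') / 2 = 2^-1 * ((a - a') + (b - b'))); last by field.
rewrite (_ : (a - b) / 2 - (a' - b') / 2 = 2^-1 * ((a - a') - (b - b'))); last by field.
rewrite !normrM normfV (ger0_norm (ler0n _ 2)).
by have := ler_normD (a - a') (b - b'); have := ler_normB (a - a') (b - b'); lra.
Qed.

Variables (B p0 q0 : R).
Hypotheses (B0 : 0 <= B) (p00 : 0 <= p0).
Hypothesis ub : forall r, p0 < r -> r < q0 -> {ae leb, forall y, `|u (y, r)| <= B}.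

(** The bound [ub] holds almost everywhere at each time; clamping makes it hold everywhere, and on
    ][p0], [q0][ changes [u] only on a null set at each time. *)
Let F p := clamp (- B) B (u p).
Let mF : measurable_fun setT F. Proof. by apply: measurable_clamp. Qed.
Let FB p : `|F p| <= B.
Proof. by rewrite ler_norml /F; apply: clamp_itv; rewrite -subr_ge0 opprK addr_ge0. Qed.
Let Fper y r : F (y + 2, r) = F (y, r). Proof. by rewrite /F /u unf_periodic. Qed.
Let Fu r : p0 < r -> r < q0 -> {ae leb, forall y, F (y, r) = u (y, r)}.
Proof.
move=> pr rq; apply: ae_imply (ub pr rq) => y; rewrite ler_norml => h.
by rewrite /F clamp_id.
Qed.

Lemma clamped_bounded_periodic : bounded_periodic B (lag F).
Proof.
split; [exact: measurable_lag|by move=> p; exact: FB|].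
by apply: lag_periodic; exact: Fper.
Qed.

(** The source in the space variable [y], where the reflection is simply [y -> - y]. *)
Let nn (p : R * R) := src K alpha g (lag F) (p.1 - p.2, p.2).

Let nnE x r : nn (x, r) = K x * alpha r * gam g x (F (x, r) - F (- x, r)).
Proof.
rewrite /nn /src /lag /refl/= subrK (_ : - (x - r) - 2 * r + r = - x)//; ring.
Qed.

Let srcper z r : src K alpha g (lag F) (z + 2, r) = src K alpha g (lag F) (z, r).
Proof.
rewrite /src /gam /refl/= (lag_periodic Fper).
rewrite (_ : z + 2 + r = z + r + 2); last by ring.
rewrite (kernel_periodic kK) rep_periodic.
by rewrite -(lag_periodic Fper (- (z + 2) - 2 * r)) (_ : - (z + 2) - 2 * r + 2 = - z - 2 * r)//; ring.
Qed.

Let nnper y r : nn (y + 2, r) = nn (y, r).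
Proof. by rewrite /nn/= addrAC srcper. Qed.

Let nnodd y r : nn (- y, r) = - nn (y, r).
Proof.
rewrite /nn/= -(src_odd alpha kK dg); last exact: lag_periodic.
by congr src; rewrite /refl/=; congr (_, _); ring.
Qed.

Let msrc : measurable_fun setT (src K alpha g (lag F)).
Proof. by apply: measurable_src (kernel_meas kK) wa dg _; exact: measurable_lag. Qed.

Let mnn : measurable_fun setT nn.
Proof.
apply: (measurableT_comp msrc); apply/measurable_fun_pairP; split; last exact: measurable_snd.
by apply: measurable_funB; [exact: measurable_fst|exact: measurable_snd].
Qed.

Let srcK : exists2 L, 0 <= L & forall p, `|src K alpha g (lag F) p| <= L * K (p.1 + p.2).
Proof.
have B20 : 0 <= 2 * B by rewrite mulr_ge0.
have [L L0 hL] := damping_lip dg (2 * B); exists (L * (2 * B)); first exact: mulr_ge0.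
move=> p; apply: src_bound => //; first exact: kernel_ge0.
apply: le_trans (ler_normB _ _) _; have := FB (p.1 + p.2, p.2).
have := FB ((refl p).1 + (refl p).2, (refl p).2); rewrite /lag; lra.
Qed.

Let Fsplit r : p0 < r -> r < q0 -> {ae leb, forall x, I01 x ->
  rho (x, r) = F (x, r) + F (- x, r) /\ J (x, r) = F (x, r) - F (- x, r)}.
Proof.
move=> pr rq; have r0 : 0 <= r by exact/ltW/(le_lt_trans p00).
have n0 : {ae leb, forall x : R, x <> 0} by exact: ae_neq.
have n1 : {ae leb, forall x : R, x <> 1} by exact: ae_neq.
have := ae_and (ae_and n0 n1) (ae_and (Fu pr rq) (ae_reflect 0 (Fu pr rq))).
apply: ae_imply => x [[x0 x1] [h1]]; rewrite sub0r => h2.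
rewrite /I01/= in_itv/= => /andP[x0' x1'].
have xp : 0 < x by rewrite lt_neqAle x0' eq_sym andbT; exact/eqP.
have xl : x < 1 by rewrite lt_neqAle x1' andbT; exact/eqP.
by rewrite h1 h2; exact: unf_sum.
Qed.

Let msection (f : R * R -> R) r : continuous f -> measurable_fun setT f ->
  measurable_fun I01 (fun x => f (x, r)).
Proof. by move=> cf mf; apply: measurable_funTS; exact: measurable_section2. Qed.

Let FFbound p q : `|F p + F q| <= 2 * B /\ `|F p - F q| <= 2 * B.
Proof.
have h1 := FB p; have h2 := FB q.
by split; [apply: le_trans (ler_normD _ _) _|apply: le_trans (ler_normB _ _) _]; lra.
Qed.

(** The test function need not vanish at [x = 0] or [x = 1]: its rectangle is [0, 1] x [[s], [t]].
    This is where the boundary condition on [J], encoded in the mass equation, enters the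
    unfolding. *)
Let mass (a ax at_ : R * R -> R) (s t : R) : p0 < s -> t < q0 ->
  (forall p : R * R, is_derive p.1 1 (fun x => a (x, p.2)) (ax p)) ->
  (forall p : R * R, is_derive p.2 1 (fun r => a (p.1, r)) (at_ p)) ->
  continuous a -> continuous ax -> continuous at_ ->
  (forall x r, ~~ (s <= r <= t) -> [/\ a (x, r) = 0, ax (x, r) = 0 & at_ (x, r) = 0]) ->
  \int[leb]_(r in `[s, t]) \int[leb]_(x in `]0, 1[)
    ((F (x, r) + F (- x, r)) * at_ (x, r) + (F (x, r) - F (- x, r)) * ax (x, r)) = 0.
Proof.
move=> ps tq dx dt ca cx ct supp.
have s0 : 0 < s by exact: le_lt_trans ps.
have mI := measurable_I01 (R := R).
have [||test px pt] := test_function_rect (Omega := I01 `*` Rgt0) (x0 := 0) (x1 := 1)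
    (t0 := s) (t1 := t) dx dt cx ct.
- move=> [x r] [/= Ix _] ne; split; first by move: Ix; rewrite /I01/= in_itv.
  by apply: contraT => /(supp x)[ax0 _ _]; rewrite ax0 eqxx in ne.
- move=> [x r] /= xI rI; split; rewrite /= /I01 /Rgt0/= in_itv//= andbT.
  by case/andP: rI => sr _; exact: lt_le_trans sr.
have [_ z0] := ws_mass_eq ws test; rewrite px pt in z0.
pose h' p := (F p + F (- p.1, p.2)) * at_ p + (F p - F (- p.1, p.2)) * ax p.
have [max mat] : measurable_fun setT ax /\ measurable_fun setT at_.
  by split; exact: continuous_measurable_plane.
have mFN := measurable_oppfst mF.
have mh' : measurable_fun setT h'.
  by apply: measurable_funD; apply: measurable_funM => //; [exact: measurable_funD|exact: measurable_funB].
have ih' r : leb.-integrable I01 (EFin \o (fun x => h' (x, r))).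
  have [c1 c10 hc1] := section_bound r ct; have [c2 c20 hc2] := section_bound r cx.
  apply: (@dominated_integrable _ _ _ (cst (2 * B * c1 + 2 * B * c2))) => //.
  - by apply: measurable_funTS; exact: measurable_section2.
  - by apply: int_cst => //; exact: leb_itv_lty.
  move=> x Ix; have [f1 f2] := FFbound (x, r) (- x, r).
  apply: le_trans (ler_normD _ _) _; rewrite !normrM.
  by apply: lerD; apply: ler_pM => //; [exact: hc1|exact: hc2].
transitivity (\int[leb]_(r in `[s, t]) \int[leb]_(x in I01) h' (x, r)).
  by apply: eq_Rintegral => r _; exact/esym/Rintegral_cc_oo/ih'.
apply: (@iterated_zero _ _ (fun p => rho p * at_ p + J p * ax p) h' s t mI s0 _ _ _ (fun r _ => ih' r) z0).
- by move=> r _ rst x _; have [_ -> ->] := supp x r rst; rewrite !mulr0 addr0.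
- move=> r /andP[sr rt]; apply: ae_imply (Fsplit (lt_le_trans ps sr) (le_lt_trans rt tq)).
  by move=> x /[apply] -[-> ->].
- move=> r /andP[sr _]; have r0 : 0 <= r by exact/ltW/(lt_le_trans s0).
  have [mr mj] := msec r0.
  by apply: measurable_funD; apply: measurable_funM => //; exact: msection.
Qed.

(** The rectangle [[d], [1 - d]] x [[s], [t]] stays inside the open slab, as the momentum equation
    requires. There [F (x, r) - F (- x, r)] is [J] for almost every [x], so [nn] is the true
    source. *)
Let momentum (a ax at_ : R * R -> R) (s t d : R) : p0 < s -> t < q0 -> 0 < d ->
  (forall p : R * R, is_derive p.1 1 (fun x => a (x, p.2)) (ax p)) ->
  (forall p : R * R, is_derive p.2 1 (fun r => a (p.1, r)) (at_ p)) ->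
  continuous a -> continuous ax -> continuous at_ ->
  (forall x r, ~~ (s <= r <= t) -> [/\ a (x, r) = 0, ax (x, r) = 0 & at_ (x, r) = 0]) ->
  (forall x r, 0 < x -> x < 1 -> a (x, r) != 0 -> d <= x <= 1 - d) ->
  \int[leb]_(r in `[s, t]) \int[leb]_(x in `]0, 1[)
    ((F (x, r) - F (- x, r)) * at_ (x, r) + (F (x, r) + F (- x, r)) * ax (x, r) -
     2 * nn (x, r) * a (x, r)) = 0.
Proof.
move=> ps tq d0 dx dt ca cx ct supp suppx.
have s0 : 0 < s by exact: le_lt_trans ps.
have mI : measurable (`]0, 1[%classic : set (measurableTypeR R)) by exact: measurable_itv.
have subI : `]0, 1[ `<=` (I01 : set R) by apply: subset_itv; rewrite bnd_simp.
have [||test px pt] := test_function_rect (Omega := `]0, 1[ `*` Rgt0) (x0 := d) (x1 := 1 - d)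
    (t0 := s) (t1 := t) dx dt cx ct.
- move=> [x r] [/=]; rewrite in_itv/= => /andP[x0 x1] _ ne; split; first exact: suppx ne.
  by apply: contraT => /(supp x)[ax0 _ _]; rewrite ax0 eqxx in ne.
- move=> [x r] /= /andP[xd xd'] rI; split; rewrite /= /Rgt0/= in_itv//= ?andbT.
    by rewrite (lt_le_trans d0 xd)/= (le_lt_trans xd')// ltrBlDr ltrDl.
  by case/andP: rI => sr _; exact: lt_le_trans sr.
have [_ z0] := ws_momentum_eq ws test; rewrite px pt in z0.
pose h' p := (F p - F (- p.1, p.2)) * at_ p + (F p + F (- p.1, p.2)) * ax p - 2 * nn p * a p.
have [max [mat ma]] : measurable_fun setT ax /\ measurable_fun setT at_ /\ measurable_fun setT a.
  by split; [|split]; exact: continuous_measurable_plane.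
have mFN := measurable_oppfst mF.
have mh' : measurable_fun setT h'.
  apply: measurable_funB.
    by apply: measurable_funD; apply: measurable_funM => //; [exact: measurable_funB|exact: measurable_funD].
  by apply: measurable_funM => //; exact: measurable_funM.
have [L L0 hL] := srcK.
have nnk y r : `|nn (y, r)| <= L * K y by have := hL (y - r, r); rewrite /nn/= subrK.
have iK : leb.-integrable `]0, 1[ (EFin \o K).
  apply: integrable_in_period (kernel_int kK) => //.
  by move=> x; rewrite /period/= !in_itv/=; lra.
have ih' r : leb.-integrable `]0, 1[ (EFin \o (fun x => h' (x, r))).
  have [c1 c10 hc1] := section_bound r ct; have [c2 c20 hc2] := section_bound r cx.
  have [c3 c30 hc3] := section_bound r ca.
  apply: (@dominated_integrable _ _ _ (fun x => (2 * B * c1 + 2 * B * c2) + 2 * L * c3 * K x)) => //.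
  - by apply: measurable_funTS; exact: measurable_section2.
  - by apply: int_add => //; [apply: int_cst => //; exact: leb_itv_lty|exact: int_scale].
  move=> x /subI Ix; have [f1 f2] := FFbound (x, r) (- x, r).
  apply: le_trans (ler_normB _ _) _; apply: lerD.
    apply: le_trans (ler_normD _ _) _; rewrite !normrM.
    by apply: lerD; apply: ler_pM => //; [exact: hc1|exact: hc2].
  rewrite normrM (_ : 2 * L * c3 * K x = 2 * (L * K x) * c3); last by ring.
  apply: ler_pM; [exact: normr_ge0|exact: normr_ge0| |exact: hc3].
  by rewrite normrM ger0_norm//; apply: ler_wpM2l => //; exact: nnk.
apply: (@iterated_zero _ _ (fun p => J p * at_ p + rho p * ax p - 2 * K p.1 * alpha p.2 * g (J p) * a p) h' s t mI s0 _ _ _ (fun r _ => ih' r) z0).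
- by move=> r _ rst x _; have [-> -> ->] := supp x r rst; rewrite !mulr0 addr0 subr0.
- move=> r /andP[sr rt]; apply: ae_imply (Fsplit (lt_le_trans ps sr) (le_lt_trans rt tq)).
  move=> x h xI; have [-> hj] := h (subI x xI); rewrite /h'/= nnE hj.
  have -> : gam g x (F (x, r) - F (- x, r)) = g (F (x, r) - F (- x, r)).
    move: xI; rewrite /= in_itv/= => /andP[x0 x1].
    by rewrite /gam rep_id ?ltW// /period/= in_itv/=; lra.
  by rewrite !mulrA.
- move=> r /andP[sr _]; have r0 : 0 <= r by exact/ltW/(lt_le_trans s0).
  have [mr mj] := msec r0; apply: (@measurable_funS _ _ _ _ I01) => //; first exact: measurable_I01.
  have mgJ : measurable_fun I01 (fun x => g (J (x, r))) by apply: measurableT_comp; [exact: damping_meas|].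
  have mK : measurable_fun I01 K by apply: measurable_funTS; exact: kernel_meas.
  apply: measurable_funB.
    by apply: measurable_funD; apply: measurable_funM => //; exact: msection.
  apply: measurable_funM; last exact: msection.
  have m2K : measurable_fun I01 (fun x => 2 * alpha r * K x).
    by apply: measurable_funM; [exact: measurable_cst|exact: mK].
  rewrite (_ : (fun x => _) = (fun x => 2 * alpha r * K x * g (J (x, r)))).
    by apply: measurable_funM; [exact: m2K|exact: mgJ].
  by apply/funext => x /=; congr (_ * _); rewrite mulrAC.
Qed.

(** Every arc function is an admissible profile, so [transport_average] gives the integral equation
    tested against arcs, and [arc_averages] removes the test. *)
Lemma weak_amild a b : p0 < a -> b < q0 -> amild K alpha g a b (lag F).
Proof.
move=> pa bq s t as_ st tb.
have [e|st'] := eqVneq s t.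
  by rewrite -e; apply: ae_all => z; rewrite Rintegral_itv_refl subr0.
have {}st' : s < t by rewrite lt_neqAle st'.
have ps : p0 < s by exact: lt_le_trans as_.
have tq : t < q0 by exact: le_lt_trans tb bq.
have [L L0 hL] := srcK.
have nnk y r : `|nn (y, r)| <= L * K y.
  by have := hL (y - r, r); rewrite /nn/= subrK.
have mp : measurable (period : set (measurableTypeR R)) := @measurable_period R.
have mLK : measurable_fun setT (fun y => L * K y).
  by apply: measurable_funM => //; exact: kernel_meas.
have iLK : leb.-integrable period (EFin \o (fun y => L * K y)).
  by apply: int_scale => //; exact: kernel_int.
have rc tau : p0 < tau -> tau < q0 -> forall e, 0 < e ->
    exists2 d, 0 < d & forall r, tau <= r -> r - tau <= d ->
      \int[leb]_(y in period) `|F (y, r) - F (y, tau)| <= e.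
  move=> pt tq' e e0; have t0 : 0 <= tau by exact/ltW/(le_lt_trans p00).
  have [d d0 hd] := unf_L1_continuous t0 e0; exists d => // r tr rd.
  have r0 : 0 <= r by exact: le_trans tr.
  apply: le_trans (hd r r0 _); last by rewrite ger0_norm ?subr_ge0.
  have iu := int_sub mp (unf_integrable r0) (unf_integrable t0).
  have ia := int_norm iu.
  apply: le_Rintegral => //; [|by move=> y _; apply: clamp_lip; rewrite -subr_ge0 opprK addr_ge0].
  apply: (@dominated_integrable _ _ _ (fun y => `|u (y, r) - u (y, tau)|)) => // [|y _]; last first.
    by rewrite normr_id; apply: clamp_lip; rewrite -subr_ge0 opprK addr_ge0.
  apply: measurable_funTS; apply: measurableT_comp => //.
  by apply: measurable_funB; exact: measurable_section2.
have bH := clamped_bounded_periodic.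
apply: (arc_averages kK msrc srcper hL bH) => x n x1 x1'.
(* One constant for three bounds: 1 for the arc function, the next term for its derivative, the last
   for [arc_odd]. *)
pose C : R := 1 + 2 * (n%:R * (1 * pi)) + 4 * n%:R.
have p0' := pi_ge0 R.
have c1 : 0 <= 2 * (n%:R * (1 * pi)) :> R by rewrite !mulr_ge0.
have c2 : 0 <= 4 * n%:R :> R by rewrite mulr_ge0.
have eC z : `|arc x n z| <= C by apply: le_trans (arc01 x n z) _; rewrite /C -addrA lerDl addr_ge0.
have dC z : `|darc x n z| <= C.
  by apply: le_trans (darc_bound x n z) _; rewrite /C -addrA addrCA lerDl addr_ge0.
have oC y r : `|arc x n (y - r) - arc x n (- y - r)| <= C * `|sin (pi * y)|.
  apply: le_trans (arc_odd x n y r) _; apply: ler_wpM2r => //.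
  by rewrite /C lerDr addr_ge0.
have := transport_average mF FB mnn nnk nnper nnodd mLK iLK mass momentum
  (@is_derive_arc _ x n) (@continuous_darc _ x n) (@arc_periodic _ x n) eC dC oC ps st' tq rc.
have marc : measurable_fun setT (arc x n).
  by apply: continuous_measurable_fun => z; exact: is_derive_continuous (is_derive_arc x n z).
have mvF r := moving_average r mF Fper marc (@arc_periodic _ x n).
have mvn r : \int[leb]_(y in period) (nn (y, r) * arc x n (y - r)) =
    \int[leb]_(z in period) (src K alpha g (lag F) (z, r) * arc x n z).
  rewrite (moving_average r mnn nnper marc (@arc_periodic _ x n)).
  by apply: eq_Rintegral => z _; rewrite /lag /nn/= addrK.
apply: transport_eq (mvF t) (mvF s) _.
by apply: eq_Rintegral => r _; exact: mvn.
Qed.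

End WeakToMild.

(** * From the integral equation to weak solutions *)

Section C1Plane.
Context {R : realType}.
Implicit Types (phi : R * R -> R) (p : R * R) (U : set (R * R)).

Lemma FTC_on (f df : R -> R) (a b : R) : a <= b ->
  (forall x, a <= x <= b -> is_derive x 1 f (df x) /\ {for x, continuous df}) ->
  \int[leb]_(x in `[a, b]) df x = f b - f a.
Proof.
rewrite le_eqVlt => /predU1P[->|ab] h; first by rewrite Rintegral_itv_refl subrr.
have ha := (h a); have hb := (h b); rewrite !lexx (ltW ab) /= in ha hb.
rewrite /Rintegral (@continuous_FTC2 _ df f a b)//.
- apply: continuous_in_subspaceT => x; rewrite inE/= in_itv/= => xab.
  exact: (h x xab).2.
- split.
  + move=> x; rewrite in_itv/= => /andP[ax xb].
    by case: (h x _) => [|[]//]; rewrite !ltW.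
  + by apply: cvg_at_right_filter; exact: is_derive_continuous (ha isT).1.
  + by apply: cvg_at_left_filter; exact: is_derive_continuous (hb isT).1.
- move=> x; rewrite in_itv/= => /andP[ax xb]; rewrite derive1E.
  by case: (h x _) => [|[]//]; rewrite !ltW.
Qed.

Lemma derivable_is_derive (f : R -> R) (x : R) : derivable f x 1 ->
  is_derive x 1 f (derive1 f x).
Proof. by move=> df; split => //; rewrite derive1E. Qed.

Lemma mean_value_on (f df : R -> R) (x y : R) :
  (forall z, Num.min x y <= z <= Num.max x y -> is_derive z 1 f (df z)) ->
  exists2 c, Num.min x y <= c <= Num.max x y & f y - f x = df c * (y - x).
Proof.
wlog xy : x y / x <= y.
  move=> w h; have /orP[xy|yx] := le_total x y; first exact: w.
  have [|c hc e] := w y x yx; first by rewrite minC maxC.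
  by exists c; [rewrite minC maxC|rewrite -opprB e; ring].
rewrite min_l// max_r// => h; have h' z : z \in `]x, y[ -> is_derive z 1 f (df z).
  by rewrite in_itv/= => /andP[? ?]; apply: h; rewrite !ltW.
have [|c cxy ->] := MVT_segment xy h'.
- apply: continuous_in_subspaceT => z; rewrite inE/= in_itv/= => /h.
  exact: is_derive_continuous.
- by exists c => //; move: cxy; rewrite in_itv.
Qed.

Definition C1_at phi p := [/\ derivable (fun x => phi (x, p.2)) p.1 1,
  derivable (fun t => phi (p.1, t)) p.2 1,
  {for p, continuous (partial_x phi)} & {for p, continuous (partial_t phi)}].

Section NearC1.
Variables (phi : R * R -> R) (p : R * R) (e0 : R).
Hypothesis e00 : 0 < e0.
Hypothesis C1 : forall x t, `|x - p.1| < e0 -> `|t - p.2| < e0 -> C1_at phi (x, t).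

Let C1p : C1_at phi p.
Proof. by rewrite [p]surjective_pairing; apply: C1; rewrite subrr normr0. Qed.

Let near_partial e : 0 < e -> exists2 d, 0 < d <= e0 & forall x t,
  `|x - p.1| < d -> `|t - p.2| < d -> `|partial_x phi (x, t) - partial_x phi p| < e.
Proof.
move=> e1; have [_ _ cx _] := C1p.
have : nbhs p [set q | `|partial_x phi q - partial_x phi p| < e].
  move/cvgrPdist_lt : cx => /(_ e e1).
  by apply: filterS => q /=; rewrite distrC.
move=> /plane_nbhsP[d d0 hd]; exists (Num.min d e0).
  by rewrite lt_min d0 e00 ge_min lexx orbT.
by move=> x t; rewrite !lt_min => /andP[xd _] /andP[td _]; exact: hd.
Qed.

Let increment e : 0 < e -> exists2 d, 0 < d & forall h k, `|h| < d -> `|k| < d ->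
  `|phi (p.1 + h, p.2 + k) - phi (p.1, p.2 + k) - partial_x phi p * h| <= e * `|h|.
Proof.
move=> e1; have [d /andP[d0 de] hd] := near_partial e1; exists d => // h k hd' kd.
have ht : `|p.2 + k - p.2| < d by rewrite addrAC subrr add0r.
have inside z : Num.min p.1 (p.1 + h) <= z <= Num.max p.1 (p.1 + h) -> `|z - p.1| < d.
  move=> /andP[z1 z2]; apply: le_lt_trans hd'; have [h0|h0] := leP 0 h.
    by move: z1 z2; rewrite min_l ?lerDl// max_r ?lerDl// (ger0_norm h0) => z1 z2; rewrite ger0_norm; lra.
  have h0' := ltW h0.
  by move: z1 z2; rewrite min_r ?gerDl// max_l ?gerDl// (ler0_norm h0') => z1 z2; rewrite ler0_norm; lra.
have [|c /inside hc e2] := @mean_value_on (fun x => phi (x, p.2 + k))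
    (fun x => partial_x phi (x, p.2 + k)) p.1 (p.1 + h).
  move=> z /inside hz; have [dx _ _ _] := C1 (lt_le_trans hz de) (lt_le_trans ht de).
  exact: derivable_is_derive dx.
rewrite e2 addrAC subrr add0r -mulrBl normrM; apply: ler_wpM2r => //.
exact/ltW/hd.
Qed.

(** The increment along the slanted line is split at [(p.1, p.2 + k)]. The mean value theorem and
    the continuity of [partial_x phi] treat the horizontal part, the derivative in [t] at [p] the
    vertical one. *)
Lemma is_derive_diagonal (sg : R) :
  is_derive p.2 1 (fun t => phi (p.1 + sg * (t - p.2), t)) (sg * partial_x phi p + partial_t phi p).
Proof.
have [_ dt _ _] := C1p.
apply: is_derive_eps => e e1.
have S0 : 0 < `|sg| + 1 by rewrite ltr_wpDl.
pose e2 := e / 2 / (`|sg| + 1).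
have e20 : 0 < e2 by rewrite !divr_gt0.
have dt' : is_derive p.2 1 (fun t => phi (p.1, t)) (partial_t phi p).
  exact: derivable_is_derive dt.
have e30 : 0 < e / 2 by rewrite divr_gt0.
have [d1 d10 h1] := increment e20; have [d2 d20 h2] := is_derive_epsP dt' e30.
exists (Num.min (d1 / (`|sg| + 1)) d2); first by rewrite lt_min d20 divr_gt0.
move=> k; rewrite lt_min ltr_pdivlMr// => /andP[k1 k2].
have kd1 : `|k| < d1 by apply: le_lt_trans k1; rewrite ler_peMr// lerDr.
have sk : `|sg * k| < d1.
  by apply: le_lt_trans k1; rewrite normrM mulrC; apply: ler_wpM2l => //; rewrite lerDl.
have := h1 _ _ sk kd1; have := h2 _ k2 => A2 A1.
rewrite (_ : _ - _ = (phi (p.1 + sg * k, p.2 + k) - phi (p.1, p.2 + k) - partial_x phi p * (sg * k)) +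
  (phi (p.1, p.2 + k) - phi (p.1, p.2) - partial_t phi p * k)); last first.
  by rewrite (_ : p.2 + k - p.2 = k) ?subrr ?mulr0 ?addr0; ring.
apply: le_trans (ler_normD _ _) _; rewrite [e in _ <= e * _]splitr mulrDl; apply: lerD A2.
apply: le_trans A1 _; rewrite normrM mulrA; apply: ler_wpM2r => //.
rewrite /e2 mulrAC ler_pdivrMr//; apply: ler_wpM2l; first exact: ltW.
by rewrite lerDl.
Qed.

Lemma C1_continuous : {for p, continuous phi}.
Proof.
have [_ dt _ _] := C1p.
have dt' : is_derive p.2 1 (fun t => phi (p.1, t)) (partial_t phi p).
  exact: derivable_is_derive dt.
have ct := is_derive_continuous dt'.
apply/cvgrPdist_le => e e1; have e20 : 0 < e / 2 by rewrite divr_gt0.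
have [d1 d10 h1] := increment (ltr01 : 0 < 1 :> R).
have D0 : 0 < `|partial_x phi p| + 1 by rewrite ltr_wpDl.
have [d2 /= d20 h2] : nbhs p.2 [set t | `|phi (p.1, p.2) - phi (p.1, t)| <= e / 2].
  by move/cvgrPdist_le : ct => /(_ _ e20).
apply: (@nbhs_plane _ _ _ (Num.min (Num.min d1 d2) (e / 2 / (`|partial_x phi p| + 1)))).
  by rewrite !lt_min d10 d20 !divr_gt0.
move=> x t; rewrite !lt_min => /andP[/andP[xd1 _] xe] /andP[/andP[td1 td2] _] /=.
have := h1 _ _ xd1 td1; rewrite mul1r !(addrC p.1) !(addrC p.2) !subrK => A1.
have A2 : `|phi (p.1, p.2) - phi (p.1, t)| <= e / 2 by apply: h2; rewrite /ball_/= distrC.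
have A3 : `|phi (x, t) - phi (p.1, t)| <= e / 2.
  rewrite -[X in `|X|](subrK (partial_x phi p * (x - p.1))).
  apply: le_trans (ler_normD _ _) _; rewrite normrM.
  apply: le_trans (lerD A1 (lexx _)) _.
  by move: xe; rewrite ltr_pdivlMr// mulrDr mulr1 addrC mulrC => /ltW.
rewrite [p in phi p - _]surjective_pairing [e in _ <= e]splitr.
rewrite (_ : _ - _ = (phi (p.1, p.2) - phi (p.1, t)) - (phi (x, t) - phi (p.1, t))); last by ring.
by apply: le_trans (ler_normB _ _) _; exact: lerD.
Qed.

End NearC1.

End C1Plane.

(** * Test functions on the closed slab *)

Section TestFunctions.
Context {R : realType}.

Definition slab : set (R * R) := I01 `*` Rgt0.

Variable phi : R * R -> R.
Hypothesis test : test_function slab phi.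

Lemma test_C1_near p : slab p -> exists2 e, 0 < e &
  forall x t, `|x - p.1| < e -> `|t - p.2| < e -> C1_at phi (x, t).
Proof.
have [[U [oU sU hU]] _] := test => /sU Up.
have [e e0 he] := plane_nbhsP (oU p Up : nbhs p U).
by exists e => // x t xe te; apply: hU; exact: he.
Qed.

Lemma test_C1 p : slab p -> C1_at phi p.
Proof.
move=> /test_C1_near[e e0 he]; rewrite [p]surjective_pairing.
by apply: he; rewrite subrr normr0.
Qed.

Lemma test_continuous p : slab p -> [/\ {for p, continuous phi},
  {for p, continuous (partial_x phi)} & {for p, continuous (partial_t phi)}].
Proof.
move=> sp; have [e e0 he] := test_C1_near sp; have [_ _ cx ct] := test_C1 sp.
by split => //; exact: C1_continuous he.
Qed.

Lemma test_diagonal p sg : slab p ->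
  is_derive p.2 1 (fun t => phi (p.1 + sg * (t - p.2), t)) (sg * partial_x phi p + partial_t phi p).
Proof. by move=> /test_C1_near[e e0 he]; exact: is_derive_diagonal he sg. Qed.

Lemma test_measurable : [/\ measurable_fun slab phi,
  measurable_fun slab (partial_x phi) & measurable_fun slab (partial_t phi)].
Proof.
have [[U [oU sU hU]] _] := test.
have cU p : U p -> [/\ {for p, continuous phi},
    {for p, continuous (partial_x phi)} & {for p, continuous (partial_t phi)}].
  move=> Up; have [_ _ cx ct] := hU p Up; split => //.
  have [e e0 he] := plane_nbhsP (oU p Up : nbhs p U).
  by apply: (C1_continuous e0) => x t xe te; apply: hU; exact: he.
have mU := plane_open_measurable oU.
split; apply: (measurable_funS mU sU); apply: plane_continuous_measurable => // p /cU[]//.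
Qed.

(** The times met by the compact support form a compact set avoiding 0. The margins [2 * s0] and
    [T - 1] leave room to conclude that the derivatives vanish too outside ][s0], [T][. *)
Lemma test_time_support : exists s0 T, [/\ 0 < s0, s0 < T & forall x t, I01 x ->
  0 < t -> t <= 2 * s0 \/ T <= t + 1 -> phi (x, t) = 0].
Proof.
have [_ [cS sS]] := test; move: cS sS; set S := closure _ => cS sS.
have SP x t : I01 x -> 0 < t -> ~ S (x, t) -> phi (x, t) = 0.
  move=> Ix t0 nS; apply/eqP; apply: contra_notT nS => ne; apply: subset_closure.
  by split => //; split => //; rewrite /Rgt0/= in_itv/= t0.
have cT : compact (snd @` S).
  apply: continuous_compact cS; apply: continuous_subspaceT => p; exact: cvg_snd.
have clT : closed (snd @` S) by apply: compact_closed.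
have [M [_ hM]] := compact_bounded cT.
have n0 : ~ (snd @` S) 0.
  by move=> [[x t] /sS[_]]; rewrite /Rgt0/= in_itv/= andbT => + t0; rewrite t0 ltxx.
have := (closed_openC clT : open _); rewrite openE => /(_ 0 n0) [d /= d0 hd].
exists (d / 4), (`|M| + d + 2); split; [lra|have := normr_ge0 M; lra|].
move=> x t Ix t0 h; apply: SP => // Sxt; have St : (snd @` S) t by exists (x, t).
case: h => h.
  have /hd : ball_ [eta Num.Def.normr] 0 d t by rewrite /ball_/= sub0r normrN gtr0_norm//; lra.
  by [].
have := hM (`|M| + d / 2); rewrite (le_lt_trans (ler_norm M)) ?ltrDl ?divr_gt0// => /(_ isT _ St) /=.
by rewrite gtr0_norm//; lra.
Qed.

(** At an end point of I only one-sided increments stay in I; they determine the derivative, which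
    exists because [phi] is C^1 on a neighbourhood. The increment [h] in space points inwards. *)
Lemma test_partial0 x t e : I01 x -> 0 < t -> 0 < e ->
  (forall x' t', I01 x' -> `|t' - t| < e -> phi (x', t') = 0) ->
  partial_x phi (x, t) = 0 /\ partial_t phi (x, t) = 0.
Proof.
move=> Ix t0 e0 z; have sp : slab (x, t) by split => //; rewrite /Rgt0/= in_itv/= t0.
have [dx dt _ _] := test_C1 sp.
have zt : phi (x, t) = 0 by apply: z => //; rewrite subrr normr0.
have dx' : is_derive x 1 (fun x => phi (x, t)) (partial_x phi (x, t)).
  exact: derivable_is_derive dx.
have dt' : is_derive t 1 (fun t => phi (x, t)) (partial_t phi (x, t)).
  exact: derivable_is_derive dt.
split; apply/eqP; rewrite -normr_le0; apply/ler_addgt0Pl => c c0; rewrite addr0.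
  have [d d0 hd] := is_derive_epsP dx' c0.
  pose h0 := Num.min (d / 2) (2^-1 : R).
  have [h00 h0d h02] : [/\ 0 < h0, h0 < d & h0 <= 2^-1].
    split; first by rewrite lt_min divr_gt0//= invr_gt0.
      by rewrite gt_min ltr_pdivrMr// ltr_pMr// ltr1n.
    by rewrite ge_min lexx orbT.
  pose h := if x <= 2^-1 then h0 else - h0.
  have nh : `|h| = h0 by rewrite /h; case: ifP; rewrite ?normrN gtr0_norm.
  have Ixh : I01 (x + h).
    move: Ix; rewrite /I01/= !in_itv/= /h => /andP[? ?].
    by case: (lerP x 2^-1) => ?; apply/andP; split; lra.
  have := hd h; rewrite nh => /(_ h0d).
  rewrite (z (x + h) t)// ?subrr ?normr0// zt subrr sub0r normrN normrM nh.
  by rewrite ler_pM2r.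
have [d d0 hd] := is_derive_epsP dt' c0.
pose h := Num.min (d / 2) (e / 2).
have [h0 hd' he] : [/\ 0 < h, h < d & h < e].
  split; first by rewrite lt_min !divr_gt0.
    by rewrite gt_min ltr_pdivrMr// ltr_pMr// ltr1n.
  by rewrite gt_min !ltr_pdivrMr// !ltr_pMr// ltr1n orbT.
have := hd h; rewrite gtr0_norm// => /(_ hd').
rewrite (z x (t + h))// ?zt ?subrr ?sub0r; last by rewrite addrAC subrr add0r gtr0_norm.
by rewrite normrN normrM (gtr0_norm h0) ler_pM2r.
Qed.

Lemma slab_bounded (f : R * R -> R) (s T : R) : 0 < s ->
  (forall p, slab p -> {for p, continuous f}) ->
  exists2 B, 0 <= B & forall x t, I01 x -> s <= t <= T -> `|f (x, t)| <= B.
Proof.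
move=> s0 cf; pose box : set (R * R) := `[0, 1]%classic `*` `[s, T]%classic.
have cbox : compact box by apply: compact_setX; exact: segment_compact.
have sbox : box `<=` slab.
  move=> [x t] [/= Ix]; rewrite in_itv/= => /andP[st _]; split => //.
  by rewrite /Rgt0/= in_itv/= andbT (lt_le_trans s0).
have cw : {within box, continuous f}.
  by apply: continuous_in_subspaceT => p; rewrite inE => /sbox; exact: cf.
have [M [_ hM]] := compact_bounded (continuous_compact cw cbox).
exists (`|M| + 1); first by rewrite addr_ge0.
move=> x t Ix st; apply: (hM (`|M| + 1)); first by rewrite (le_lt_trans (ler_norm M)) ?ltrDl.
by exists (x, t) => //; split => //=; rewrite in_itv.
Qed.

Lemma test_data : exists s0 T B, [/\ 0 < s0, s0 <= T, 0 <= B,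
  (forall x t, I01 x -> 0 < t -> ~~ (s0 < t < T) ->
     [/\ phi (x, t) = 0, partial_x phi (x, t) = 0 & partial_t phi (x, t) = 0]) &
  (forall x t, I01 x -> 0 < t ->
     [/\ `|phi (x, t)| <= B, `|partial_x phi (x, t)| <= B & `|partial_t phi (x, t)| <= B])].
Proof.
have [s0 [T [s00 sT z]]] := test_time_support.
have out x t : I01 x -> 0 < t -> ~~ (s0 < t < T) ->
    [/\ phi (x, t) = 0, partial_x phi (x, t) = 0 & partial_t phi (x, t) = 0].
  rewrite negb_and -!leNgt => Ix t0 st.
  have z0 : phi (x, t) = 0 by apply: z => //; case/orP: st => ?; [left|right]; lra.
  have [||-> ->] := @test_partial0 x t (Num.min (t / 2) (Num.min s0 2^-1)) Ix t0; last by [].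
    by rewrite !lt_min s00 divr_gt0//= invr_gt0.
  move=> x' t' Ix'; rewrite !lt_min => /and3P[h1 h2 h3].
  move: h1 h2 h3; rewrite !ltr_norml => /andP[h1 _] /andP[_ h2] /andP[h3 _].
  by apply: z => //; [lra|case/orP: st => ?; [left|right]; lra].
have [B1 B10 h1] := @slab_bounded phi s0 T s00 (fun p sp => let: And3 c _ _ := test_continuous sp in c).
have [B2 B20 h2] := @slab_bounded (partial_x phi) s0 T s00 (fun p sp => let: And3 _ c _ := test_continuous sp in c).
have [B3 B30 h3] := @slab_bounded (partial_t phi) s0 T s00 (fun p sp => let: And3 _ _ c := test_continuous sp in c).
exists s0, T, (B1 + B2 + B3); split => //; [exact: ltW|by rewrite !addr_ge0|].
move=> x t Ix t0; have [/andP[a1 a2]|no] := boolP (s0 < t < T); last first.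
  by have [-> -> ->] := out x t Ix t0 no; rewrite normr0 !addr_ge0.
have st : s0 <= t <= T by rewrite !ltW.
have := h1 x t Ix st; have := h2 x t Ix st; have := h3 x t Ix st.
move=> b3 b2 b1; split; [apply: (le_trans b1)|apply: (le_trans b2)|apply: (le_trans b3)].
- by rewrite -addrA lerDl addr_ge0.
- by rewrite addrAC lerDr addr_ge0.
- by rewrite lerDr addr_ge0.
Qed.

End TestFunctions.

(** * Integration along characteristics *)

Section Duhamel.
Context {R : realType}.

Lemma continuous_graph (f : R * R -> R) (x : R -> R) (t : R) : {for t, continuous x} ->
  {for (x t, t), continuous f} -> {for t, continuous (fun r => f (x r, r))}.
Proof.
move=> cx cf; apply: (@continuous_comp _ _ _ (fun r => (x r, r)) f); last exact: cf.
exact: (cvg_pair cx cvg_id).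
Qed.

Lemma continuous_line_combination (f h : R * R -> R) (sg c t : R) :
  {for (sg * t + c, t), continuous f} -> {for (sg * t + c, t), continuous h} ->
  {for t, continuous (fun r => sg * f (sg * r + c, r) + h (sg * r + c, r))}.
Proof.
have cl := is_derive_continuous (is_derive_affine t sg c).
move=> /(continuous_graph cl) cf /(continuous_graph cl) ch.
by apply: cvgD ch; apply: cvgM cf; exact: cvg_cst.
Qed.

Lemma bounded_itv_integrable (f : R -> R) (C a b : R) : measurable_fun setT f ->
  (forall x, `|f x| <= C) -> leb.-integrable `[a, b] (EFin \o f).
Proof.
move=> mf fC; apply: (@dominated_integrable _ _ _ (cst C)) => //.
  exact: measurable_funTS.
by apply: int_cst => //; exact: leb_itv_lty.
Qed.

Lemma duhamel (S p P : R -> R) (s T h0 C : R) : s <= T ->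
  measurable_fun setT S -> measurable_fun setT p -> leb.-integrable `[s, T] (EFin \o S) ->
  (forall t, `|p t| <= C) ->
  (forall r, s <= r <= T -> \int[leb]_(t in `[r, T]) p t = - P r) -> P s = 0 ->
  \int[leb]_(t in `[s, T]) ((h0 - \int[leb]_(r in `[s, t]) S r) * p t) =
  \int[leb]_(r in `[s, T]) (S r * P r).
Proof.
move=> sT mS mp iS pC hP Ps.
have mI : measurable (`[s, T]%classic : set (measurableTypeR R)) by exact: measurable_itv.
have C0 : 0 <= C by exact: le_trans (pC 0).
pose f (q : R * R) : R := if q.1 <= q.2 then S q.1 * p q.2 else 0.
have fE q : f q = if q.1 <= q.2 then S q.1 * p q.2 else 0 by [].
clearbody f.
have mf : measurable_fun setT f.
  rewrite (funext fE); apply: measurable_fun_ifT => //.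
    by apply: measurable_fun_ler; [exact: measurable_fst|exact: measurable_snd].
  apply: measurable_funM; first exact: (measurableT_comp mS measurable_fst).
  exact: (measurableT_comp mp measurable_snd).
have iCS : leb.-integrable `[s, T] (EFin \o (fun x => C * `|S x|)).
  by apply: int_scale => //; exact: int_norm.
have fk x r : `[s, T]%classic x -> `|f (x, r)| <= C * `|S x|.
  move=> _; rewrite fE/=; case: ifP => _; last by rewrite normr0 mulr_ge0.
  by rewrite normrM mulrC; exact: ler_wpM2r.
have [f1 f2 f3] := dominated_Fubini s T mI mf iCS fk.
have ip : leb.-integrable `[s, T] (EFin \o p) by exact: bounded_itv_integrable pC.
have inner t : `[s, T]%classic t ->
    \int[leb]_(x in `[s, T]) f (x, t) = (\int[leb]_(r in `[s, t]) S r) * p t.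
  rewrite /= in_itv/= => /andP[st tT].
  have iSt : leb.-integrable `[s, t] (EFin \o S) by exact: integrable_subitv iS.
  rewrite -(Rintegral_itv_mulr (p t) iSt).
  rewrite (_ : `[s, t]%classic = `[s, T]%classic `&` [set x | x <= t]); last first.
    apply/seteqP; split => x /=; rewrite !in_itv/=.
      by move=> /andP[-> xt]; split => //; rewrite (le_trans xt).
    by move=> [/andP[-> _] ->].
  rewrite Rintegral_mkcondr; apply: eq_Rintegral => x _.
  by rewrite fE patchE/= mem_setE.
have outer x : `[s, T]%classic x -> \int[leb]_(t in `[s, T]) f (x, t) = - (S x * P x).
  rewrite /= in_itv/= => /andP[sx xT].
  have ipx : leb.-integrable `[x, T] (EFin \o p) by exact: integrable_subitv ip.
  rewrite -mulrN -hP ?sx// mulrC -(Rintegral_itv_mulr (S x) ipx).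
  rewrite (_ : `[x, T]%classic = `[s, T]%classic `&` [set t | x <= t]); last first.
    apply/seteqP; split => t /=; rewrite !in_itv/=.
      by move=> /andP[xt ->]; rewrite (le_trans sx xt).
    by move=> [/andP[_ ->] ->].
  rewrite Rintegral_mkcondr; apply: eq_Rintegral => t _.
  by rewrite fE patchE/= mem_setE mulrC.
have i2 : leb.-integrable `[s, T] (EFin \o (fun t => (\int[leb]_(r in `[s, t]) S r) * p t)).
  by apply: (eq_integrable mI _ _ _ f2) => t; rewrite inE => tI /=; rewrite (inner t tI).
transitivity (\int[leb]_(t in `[s, T]) (h0 * p t - (\int[leb]_(r in `[s, t]) S r) * p t)).
  by apply: eq_Rintegral => t _; rewrite mulrBl.
rewrite (RintegralB mI (int_scale mI h0 ip) i2) (RintegralZl _ mI ip).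
rewrite hP ?lexx ?sT// Ps oppr0 mulr0 sub0r.
transitivity (- \int[leb]_(x in `[s, T]) \int[leb]_(t in `[s, T]) f (x, t)).
  congr (- _); rewrite f3; apply: eq_Rintegral => t; rewrite inE => tI.
  by rewrite inner.
have i3 : leb.-integrable `[s, T] (EFin \o (fun x => \int[leb]_(t in `[s, T]) f (x, t))).
  apply: (@dominated_integrable _ _ _ (fun x => C * `|S x| * (T - s)) mI).
  - apply: measurable_funTS.
    have mf' : measurable_fun setT (fun q : R * R => f (q.2, q.1)).
      by apply: (measurableT_comp mf); apply/measurable_fun_pairP; split; [exact: measurable_snd|exact: measurable_fst].
    exact: (measurable_Rintegral_section mI mf').
  - rewrite (_ : (fun x => _) = (fun x => (T - s) * (C * `|S x|))); last first.
      by apply/funext => x; rewrite mulrC.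
    exact: (int_scale mI).
  move=> x xI; rewrite -(fine_leb_itv sT) -(Rintegral_cst _ mI).
  have ic : leb.-integrable `[s, T] (EFin \o cst (C * `|S x|)).
    by apply: int_cst; [exact: mI|exact: leb_itv_lty].
  apply: (Rintegral_abs_le mI _ ic).
  + apply: (dominated_integrable mI _ ic).
    * by apply: measurable_funTS; exact: measurable_section1.
    * by move=> t _; exact: fk.
  + by move=> t _; exact: fk.
rewrite -(RintegralN mI i3).
by apply: eq_Rintegral => x; rewrite inE => xI; rewrite (outer x xI) opprK.
Qed.

End Duhamel.

Section UnfoldedTest.
Context {R : realType}.
Variables (phi : R * R -> R) (ep : R).
Hypothesis test : test_function slab phi.
Hypothesis ep1 : `|ep| <= 1.
(** This makes the unfolding continuous at the points of reflection: it holds trivially for [ep = 1]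
    and says that [phi] vanishes on the boundary for [ep = -1]. *)
Hypothesis edge : forall x t, x = 0 \/ x = 1 -> 0 < t -> ep * phi (x, t) = phi (x, t).

Let ph := phi \_ slab.
Let px := (partial_x phi) \_ slab.
Let pt := (partial_t phi) \_ slab.

(* The even (ep = 1, mass) or odd (ep = -1, momentum) periodic unfolding of the
   test function phi; [dpsi] is its derivative along the characteristics. *)
Definition psi (q : R * R) : R :=
  if 0 <= rep q.1 then ph (rep q.1, q.2) else ep * ph (- rep q.1, q.2).
Definition dpsi (q : R * R) : R :=
  if 0 <= rep q.1 then pt (rep q.1, q.2) + px (rep q.1, q.2)
  else ep * (pt (- rep q.1, q.2) - px (- rep q.1, q.2)).

Lemma measurable_slab : measurable (slab : set (R * R)).
Proof. by apply: measurableX; [exact: measurable_I01|exact: measurable_itv]. Qed.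

Let mrepP : measurable_fun setT (fun q : R * R => (rep q.1, q.2)).
Proof.
apply/measurable_fun_pairP; split; last exact: measurable_snd.
exact: (measurableT_comp measurable_rep measurable_fst).
Qed.

Let mrepN : measurable_fun setT (fun q : R * R => (- rep q.1, q.2)).
Proof.
apply/measurable_fun_pairP; split; last exact: measurable_snd.
by apply: measurable_funN; exact: (measurableT_comp measurable_rep measurable_fst).
Qed.

Let mrep0 : measurable_fun setT (fun q : R * R => 0 <= rep q.1).
Proof.
by apply: measurable_fun_ler => //; exact: (measurableT_comp measurable_rep measurable_fst).
Qed.

Let mph : [/\ measurable_fun setT ph, measurable_fun setT px & measurable_fun setT pt].
Proof.
have [m1 m2 m3] := test_measurable test.
by split; apply/(measurable_restrictT _ measurable_slab).
Qed.

Lemma measurable_psi : measurable_fun setT psi.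
Proof.
have [m1 m2 m3] := mph; apply: measurable_fun_ifT => //; first exact: (measurableT_comp m1 mrepP).
by apply: measurable_funM => //; exact: (measurableT_comp m1 mrepN).
Qed.

Lemma measurable_dpsi : measurable_fun setT dpsi.
Proof.
have [m1 m2 m3] := mph; apply: measurable_fun_ifT => //.
  by apply: measurable_funD; [exact: (measurableT_comp m3 mrepP)|exact: (measurableT_comp m2 mrepP)].
apply: measurable_funM => //; apply: measurable_funB; first exact: (measurableT_comp m3 mrepN).
exact: (measurableT_comp m2 mrepN).
Qed.

Lemma psi_periodic y t : psi (y + 2, t) = psi (y, t).
Proof. by rewrite /psi/= rep_periodic. Qed.

Lemma dpsi_periodic y t : dpsi (y + 2, t) = dpsi (y, t).
Proof. by rewrite /dpsi/= rep_periodic. Qed.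

Let in_slab (x t : R) : 0 <= x -> x <= 1 -> 0 < t -> (x, t) \in (slab : set (R * R)).
Proof.
move=> x0 x1 t0; apply: mem_set; split; rewrite /= /I01 /Rgt0/= in_itv/= ?x0//.
by rewrite t0.
Qed.

Let slabP (x t : R) : 0 <= x -> x <= 1 -> 0 < t -> slab (x, t).
Proof. by move=> x0 x1 t0; exact/set_mem/in_slab. Qed.

Let rep_cell (y : R) (k : int) : -1 <= y - 2 * k%:~R -> y - 2 * k%:~R < 1 -> rep y = y - 2 * k%:~R.
Proof.
move=> h1 h2; rewrite -(rep_id (x := y - 2 * k%:~R)) ?/period/= ?in_itv/= ?h1//.
rewrite -mulrN -mulrNz.
by rewrite (periodicz _ _ (@rep_periodic R)).
Qed.

(** The formula reaches the closed end of the cell: at distance 1 the representative jumps to -1,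
    where [edge] gives the same value. *)
Lemma psi_pos y t (k : int) : 0 < t -> 0 <= y - 2 * k%:~R -> y - 2 * k%:~R <= 1 ->
  psi (y, t) = phi (y - 2 * k%:~R, t).
Proof.
move=> t0 y0; rewrite le_eqVlt => /predU1P[y1|y1].
  have e : y - 2 * (k + 1)%:~R = -1 by rewrite intrD; lra.
  have ry : rep y = -1 by rewrite (@rep_cell y (k + 1)) e.
  rewrite /psi /= ry y1 /ph; rewrite ifF; last by rewrite lerNr oppr0 lt_geF.
  by rewrite opprK patchE in_slab// edge//; right.
rewrite /psi/= (@rep_cell y k)//; last by lra.
by rewrite y0 /ph patchE in_slab// ltW.
Qed.

Lemma psi_neg y t (k : int) : 0 < t -> -1 <= y - 2 * k%:~R -> y - 2 * k%:~R <= 0 ->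
  psi (y, t) = ep * phi (- (y - 2 * k%:~R), t).
Proof.
move=> t0 y0; rewrite le_eqVlt => /predU1P[y1|y1].
  have ry : rep y = 0 by rewrite (@rep_cell y k y0) y1.
  rewrite /psi /= ry y1.
  by rewrite lexx oppr0 edge//; [rewrite /ph patchE in_slab|left].
rewrite /psi/= (@rep_cell y k)//; last by lra.
by rewrite leNgt y1/= /ph patchE in_slab//; lra.
Qed.

Lemma dpsi_pos y t (k : int) : 0 < t -> 0 <= y - 2 * k%:~R -> y - 2 * k%:~R < 1 ->
  dpsi (y, t) = partial_t phi (y - 2 * k%:~R, t) + partial_x phi (y - 2 * k%:~R, t).
Proof.
move=> t0 y0 y1; rewrite /dpsi/= (@rep_cell y k)//; last by lra.
by rewrite y0 /pt /px !patchE in_slab// ltW.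
Qed.

Lemma dpsi_neg y t (k : int) : 0 < t -> -1 <= y - 2 * k%:~R -> y - 2 * k%:~R < 0 ->
  dpsi (y, t) = ep * (partial_t phi (- (y - 2 * k%:~R), t) - partial_x phi (- (y - 2 * k%:~R), t)).
Proof.
move=> t0 y0 y1; rewrite /dpsi/= (@rep_cell y k)//; last by lra.
by rewrite leNgt y1/= /pt /px !patchE in_slab//; lra.
Qed.

Lemma line_FTC (sg c a b : R) : 0 < a -> a <= b ->
  (forall t, a <= t <= b -> 0 <= sg * t + c <= 1) ->
  \int[leb]_(t in `[a, b]) (sg * partial_x phi (sg * t + c, t) + partial_t phi (sg * t + c, t)) =
  phi (sg * b + c, b) - phi (sg * a + c, a).
Proof.
move=> a0 ab inI.
apply: (@FTC_on _ (fun t => phi (sg * t + c, t)) _ _ _ ab) => t tab.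
have [x0 x1] := andP (inI t tab).
have sp : slab (sg * t + c, t) by apply: slabP => //; case/andP: tab => at_ _; exact: lt_le_trans at_.
split.
  have := test_diagonal test sg sp; rewrite /=.
  rewrite (_ : (fun t0 => phi (sg * t + c + sg * (t0 - t), t0)) = (fun t0 => phi (sg * t0 + c, t0)))//.
  by apply/funext => r; congr (phi (_, _)); ring.
have [_ cx ct] := test_continuous test sp.
exact: (continuous_line_combination cx ct).
Qed.

Let pline z := fun t => dpsi (z + t, t).

Let mpline z : measurable_fun setT (pline z).
Proof.
apply: (measurableT_comp measurable_dpsi); apply/measurable_fun_pairP; split.
  by apply: measurable_funD => //; exact: measurable_cst.
exact: measurable_id.
Qed.

Lemma Rintegral_itv_eq (p f : R -> R) a b : leb.-integrable `[a, b] (EFin \o p) ->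
  (forall t, a <= t -> t < b -> p t = f t) ->
  \int[leb]_(t in `[a, b]) p t = \int[leb]_(t in `[a, b]) f t.
Proof.
move=> ip pf.
have ip' : leb.-integrable `[a, b[ (EFin \o p).
  by apply: integrableS ip => //; apply: subset_itv; rewrite bnd_simp.
have if' : leb.-integrable `[a, b[ (EFin \o f).
  by apply: eq_integrable ip' => // t; rewrite inE/= in_itv/= => /andP[h1 h2] /=; rewrite pf.
rewrite -!Rintegral_itv_bndo_bndc//; apply: eq_Rintegral => t.
by rewrite inE/= in_itv/= => /andP[h1 h2]; exact: pf.
Qed.

Section Chain.
Variables (B z : R).
Hypothesis dB : forall q, `|dpsi q| <= B.

Let ipl a b : leb.-integrable `[a, b] (EFin \o pline z).
Proof. by apply: (bounded_itv_integrable (C := B)); [exact: mpline|move=> t; exact: dB]. Qed.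

Let cell_pos (k : int) a b : 0 < a -> a <= b -> 0 <= z + a - 2 * k%:~R -> z + b - 2 * k%:~R <= 1 ->
  \int[leb]_(t in `[a, b]) pline z t = psi (z + b, b) - psi (z + a, a).
Proof.
move=> a0 ab ha hb; have b0 : 0 < b by exact: lt_le_trans ab.
rewrite (Rintegral_itv_eq (f := fun t => 1 * partial_x phi (1 * t + (z - 2 * k%:~R), t) +
  partial_t phi (1 * t + (z - 2 * k%:~R), t)) (ipl a b)).
  rewrite line_FTC// => [|t /andP[at_ tb]]; last by rewrite mul1r; apply/andP; split; lra.
  rewrite (@psi_pos _ _ k)// ?(@psi_pos (z + a) _ k)//; [|lra|lra].
  by congr (phi (_, _) - phi (_, _)); ring.
move=> t at_ tb; rewrite /pline (@dpsi_pos _ _ k); [|exact: lt_le_trans at_|lra|lra].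
by rewrite !mul1r addrC (_ : t + (z - 2 * k%:~R) = z + t - 2 * k%:~R)//; ring.
Qed.

Let cell_neg (k : int) a b : 0 < a -> a <= b -> -1 <= z + a - 2 * k%:~R -> z + b - 2 * k%:~R <= 0 ->
  \int[leb]_(t in `[a, b]) pline z t = psi (z + b, b) - psi (z + a, a).
Proof.
move=> a0 ab ha hb; have b0 : 0 < b by exact: lt_le_trans ab.
pose f t := -1 * partial_x phi (-1 * t + (2 * k%:~R - z), t) +
  partial_t phi (-1 * t + (2 * k%:~R - z), t).
have hI t : a <= t <= b -> 0 <= -1 * t + (2 * k%:~R - z) <= 1.
  by move=> /andP[at_ tb]; apply/andP; split; lra.
rewrite (Rintegral_itv_eq (f := fun t => ep * f t) (ipl a b)).
  have fE := line_FTC a0 ab hI.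
  have if_ : leb.-integrable `[a, b] (EFin \o f).
    apply: continuous_compact_integrable; first exact: segment_compact.
    apply: continuous_in_subspaceT => t; rewrite inE/= in_itv/= => tab.
    have [x0 x1] := andP (hI t tab).
    have sp : slab (-1 * t + (2 * k%:~R - z), t).
      by apply: slabP => //; case/andP: tab => at_ _; exact: lt_le_trans at_.
    have [_ cx ct] := test_continuous test sp.
    exact: (continuous_line_combination cx ct).
  rewrite RintegralZl// fE (@psi_neg _ _ k)// ?(@psi_neg (z + a) _ k)//; [|lra|lra].
  by rewrite mulrBr; congr (_ * phi (_, _) - _ * phi (_, _)); ring.
move=> t at_ tb; rewrite /pline (@dpsi_neg _ _ k); [|exact: lt_le_trans at_|lra|lra].
rewrite /f (_ : - (z + t - 2 * k%:~R) = -1 * t + (2 * k%:~R - z)); last by ring.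
by congr (_ * _); ring.
Qed.

(** Cells have length 1 and characteristics speed 1, so within time 1 at most one cell boundary is
    crossed; [psi] has the same value from both sides there, and the two cell identities add up. *)
Let unit_step a b : 0 < a -> a <= b -> b - a <= 1 ->
  \int[leb]_(t in `[a, b]) pline z t = psi (z + b, b) - psi (z + a, a).
Proof.
move=> a0 ab ba1; pose k := Num.floor ((z + a + 1) / 2).
have repE : z + a - 2 * k%:~R = rep (z + a) by [].
have := rep_period (z + a); rewrite -repE /period/= in_itv/= => /andP[r1 r2].
have [r0|r0] := leP 0 (z + a - 2 * k%:~R).
  have [h|h] := leP (z + b - 2 * k%:~R) 1; first exact: (@cell_pos k).
  (* The time at which the characteristic reaches the right end of its cell. *)
  pose c := 1 + 2 * k%:~R - z.
  have [ac cb] : a <= c /\ c <= b by rewrite /c; split; lra.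
  have c0 : 0 < c by exact: lt_le_trans ac.
  rewrite (Rintegral_itv_chain ac cb (ipl a b)) (@cell_pos k)//; last by rewrite /c; lra.
  rewrite (@cell_neg (k + 1))//; [by rewrite addrC subrKA| |]; rewrite intrD /c; lra.
have [h|h] := leP (z + b - 2 * k%:~R) 0; first exact: (@cell_neg k).
pose c := 2 * k%:~R - z.
have [ac cb] : a <= c /\ c <= b by rewrite /c; split; lra.
have c0 : 0 < c by exact: lt_le_trans ac.
rewrite (Rintegral_itv_chain ac cb (ipl a b)) (@cell_neg k)//; last by rewrite /c; lra.
by rewrite (@cell_pos k)//; [by rewrite addrC subrKA| |]; rewrite /c; lra.
Qed.

Lemma psi_FTC a b : 0 < a -> a <= b ->
  \int[leb]_(t in `[a, b]) dpsi (z + t, t) = psi (z + b, b) - psi (z + a, a).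
Proof.
move=> a0 ab; have [n] : exists n : nat, b - a <= n%:R.
  by exists (Num.truncn (b - a)).+1; exact/ltW/truncnS_gt.
elim: n a a0 ab => [|n IH] a a0 ab h.
  by apply: unit_step => //; apply: le_trans h _; exact: ler01.
have [h1|h1] := leP (b - a) 1; first exact: unit_step.
have [a1 ab1] : a <= a + 1 /\ a + 1 <= b by split; lra.
rewrite (Rintegral_itv_chain a1 ab1 (ipl a b)).
rewrite (IH (a + 1))//; [|lra|by move: h; rewrite -natr1; lra].
by rewrite (@unit_step a (a + 1))//; [rewrite addrC subrKA|lra].
Qed.

End Chain.

Lemma psi_dpsi_data : exists s0 T B, [/\ 0 < s0, s0 <= T, 0 <= B,
  (forall y t, ~~ (s0 < t < T) -> psi (y, t) = 0 /\ dpsi (y, t) = 0) &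
  (forall x t, I01 x -> 0 < t -> ~~ (s0 < t < T) ->
     [/\ phi (x, t) = 0, partial_x phi (x, t) = 0 & partial_t phi (x, t) = 0])] /\
  (forall q, `|psi q| <= B /\ `|dpsi q| <= B).
Proof.
have [s0 [T [B [s00 sT B0 out bd]]]] := test_data test.
have hr x t : [/\ `|ph (x, t)| <= B, `|px (x, t)| <= B & `|pt (x, t)| <= B].
  rewrite /ph /px /pt !patchE; case: ifPn => [|_]; last by rewrite normr0.
  rewrite inE => -[/= Ix]; rewrite /Rgt0/= in_itv/= andbT => t0.
  exact: bd.
have h0 x t : ~~ (s0 < t < T) -> [/\ ph (x, t) = 0, px (x, t) = 0 & pt (x, t) = 0].
  move=> nt; rewrite /ph /px /pt !patchE; case: ifPn => [|_]; last by [].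
  rewrite inE => -[/= Ix]; rewrite /Rgt0/= in_itv/= andbT => t0.
  exact: out.
exists s0, T, (2 * B); split; first (split => //; first exact: mulr_ge0).
  move=> y t nt; rewrite /psi /dpsi/=.
  have [-> -> ->] := h0 (rep y) t nt; have [-> -> ->] := h0 (- rep y) t nt.
  by rewrite subrr addr0 mulr0 !if_same.
move=> [y t]; rewrite /psi /dpsi/=.
have [a1 a2 a3] := hr (rep y) t; have [b1 b2 b3] := hr (- rep y) t.
have BB : B + B <= 2 * B by rewrite mulr_natl mulr2n.
have B2 : B <= 2 * B by rewrite mulr_natl mulr2n lerDl.
have epl v : `|v| <= 2 * B -> `|ep * v| <= 2 * B.
  by move=> h; rewrite normrM; apply: le_trans h; rewrite ler_piMl.
case: ifP => _; split.
- exact: le_trans a1 B2.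
- exact: le_trans (le_trans (ler_normD _ _) (lerD a3 a2)) BB.
- by apply: epl; exact: le_trans b1 B2.
- by apply: epl; exact: le_trans (le_trans (ler_normB _ _) (lerD b3 b2)) BB.
Qed.

End UnfoldedTest.

Lemma kernel_itv_integrable_01 (R : realType) (K : R -> R) : kernel K ->
  leb.-integrable I01 (EFin \o K).
Proof.
move=> kK; have := kernel_itv_integrable kK 0 0 1.
by rewrite (_ : (fun s => K (0 + s)) = K)//; apply/funext => x; rewrite add0r.
Qed.

Lemma integrable_indic_itv (R : realType) (a b : R) :
  leb.-integrable setT (EFin \o \1_(`[a, b]%classic)).
Proof.
apply/integrableP; split; first by apply/measurable_EFinP; exact: measurable_indic.
rewrite (_ : (fun x => _) = (fun x => (\1_(`[a, b]%classic) x)%:E)); last first.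
  by apply/funext => x /=; rewrite ger0_norm// indicE.
by rewrite integral_indic// setIT; exact: leb_itv_lty.
Qed.

Lemma Rintegral_eq0 (R : realType) (D : set R) (f : R -> R) : (forall x, D x -> f x = 0) ->
  \int[leb]_(x in D) f x = 0.
Proof. by move=> f0; rewrite /Rintegral integral0_eq// => x Dx; rewrite f0. Qed.

Section UnfoldedIdentity.
Context {R : realType}.
Variables (K : R -> R) (H S : R * R -> R) (B L : R).
Hypotheses (kK : kernel K) (bH : bounded_periodic B H) (mS : measurable_fun setT S).
Hypothesis Sper : forall z r, S (z + 2, r) = S (z, r).
Hypothesis SK : forall p, `|S p| <= L * K (p.1 + p.2).
Hypothesis L0 : 0 <= L.
Hypothesis HS : forall z s t, 0 < s -> s <= t ->
  H (z, t) = H (z, s) - \int[leb]_(r in `[s, t]) S (z, r).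

(* Back from the Lagrangian variable z = y - t to y; inverse of [lag]. *)
Definition eul (G : R * R -> R) (p : R * R) := G (p.1 - p.2, p.2).

Lemma measurable_eul G : measurable_fun setT G -> measurable_fun setT (eul G).
Proof.
move=> mG; apply: (measurableT_comp mG); apply/measurable_fun_pairP; split; last exact: measurable_snd.
by apply: measurable_funB; [exact: measurable_fst|exact: measurable_snd].
Qed.

Lemma eul_periodic G : (forall z r, G (z + 2, r) = G (z, r)) ->
  forall y r, eul G (y + 2, r) = eul G (y, r).
Proof. by move=> h y r; rewrite /eul/= addrAC h. Qed.

Lemma eul_shift (G P : R * R -> R) t : measurable_fun setT G -> measurable_fun setT P ->
  (forall z r, G (z + 2, r) = G (z, r)) -> (forall z r, P (z + 2, r) = P (z, r)) ->
  \int[leb]_(y in period) (eul G (y, t) * P (y, t)) = \int[leb]_(z in period) (G (z, t) * P (z + t, t)).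
Proof.
move=> mG mP pG pP; rewrite -[LHS](@Rintegral_periodic_shift _ _ t).
- by apply: eq_Rintegral => z _; rewrite /eul/= addrK.
- apply: measurable_funM; apply: measurable_section2 => //; exact: measurable_eul.
- by move=> y; rewrite (eul_periodic pG) pP.
Qed.

Variables (phi : R * R -> R) (ep : R).
Hypothesis test : test_function slab phi.
Hypothesis ep1 : `|ep| <= 1.
Hypothesis edge : forall x t, x = 0 \/ x = 1 -> 0 < t -> ep * phi (x, t) = phi (x, t).

Let P := psi phi ep.
Let dP := dpsi phi ep.

(** Along each characteristic [duhamel] trades the derivative [dpsi] of the unfolded test function
    for the source; integration over the starting point [z] gives the identity on the circle. *)
Lemma unfolded_identity (s T C : R) : 0 < s -> s <= T ->
  (forall y t, ~~ (s < t < T) -> P (y, t) = 0 /\ dP (y, t) = 0) ->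
  (forall q, `|P q| <= C /\ `|dP q| <= C) ->
  \int[leb]_(t in `[s, T]) \int[leb]_(y in period) (eul H (y, t) * dP (y, t)) =
  \int[leb]_(t in `[s, T]) \int[leb]_(y in period) (eul S (y, t) * P (y, t)).
Proof.
move=> s0 sT out PC.
have mP : measurable_fun setT P by exact: measurable_psi.
have mdP : measurable_fun setT dP by exact: measurable_dpsi.
have C0 : 0 <= C by have [h _] := PC (0, 0); exact: le_trans h.
have mp : measurable (period : set R) := @measurable_period R.
have mH := bp_meas bH; have pH := bp_periodic bH.
have plag (G : R * R -> R) : measurable_fun setT G -> measurable_fun setT (lag G) by exact: measurable_lag.
transitivity (\int[leb]_(t in `[s, T]) \int[leb]_(z in period) (H (z, t) * lag dP (z, t))).
  by apply: eq_Rintegral => t _; rewrite eul_shift//; exact: dpsi_periodic.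
transitivity (\int[leb]_(t in `[s, T]) \int[leb]_(z in period) (S (z, t) * lag P (z, t))); last first.
  by apply: eq_Rintegral => t _; rewrite eul_shift//; exact: psi_periodic.
pose f p := H p * lag dP p; pose h p := S p * lag P p.
have mf : measurable_fun setT f by apply: measurable_funM => //; exact: plag.
have mh : measurable_fun setT h by apply: measurable_funM => //; exact: plag.
have fB x r : period x -> `|f (x, r)| <= cst (B * C) x.
  move=> _ /=; rewrite normrM; apply: ler_pM => //; first exact: (bp_bound bH).
  by have [_] := PC (x + r, r).
have hK p : `|h p| <= L * C * K (p.1 + p.2).
  rewrite normrM mulrAC; apply: ler_pM => //.
  by have [] := PC (p.1 + p.2, p.2).
have ic : leb.-integrable period (EFin \o cst (B * C)) by apply: int_cst => //; exact: leb_itv_lty.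
have [_ _ f3] := dominated_Fubini s T mp mf ic fB.
have [_ _ h3] := kernel_dominated_Fubini kK s T mh hK.
apply: etrans (esym f3) _; apply: etrans h3; apply: eq_Rintegral => z _.
have iS : leb.-integrable `[s, T] (EFin \o (fun r => S (z, r))).
  by apply: (@kernel_dominated_integrable _ _ kK _ L _ _ _ mS) => r; exact: SK.
have m1 : measurable_fun setT (fun r => S (z, r)) by exact: measurable_section1.
have m2 : measurable_fun setT (fun r => lag dP (z, r)).
  by apply: measurable_section1; exact: plag.
have b2 r : `|lag dP (z, r)| <= C by have [_] := PC (z + r, r).
have ftc r : s <= r <= T -> \int[leb]_(t in `[r, T]) lag dP (z, t) = - lag P (z, r).
  move=> /andP[sr rT].
  have e := psi_FTC test edge z (fun q => proj2 (PC q)) (lt_le_trans s0 sr) rT.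
  have [|h0 _] := out (z + T) T; first by rewrite ltxx andbF.
  by apply: (etrans e); rewrite -/P h0 sub0r.
have Ps : lag P (z, s) = 0 by have [|h0 _] := out (z + s) s; first by rewrite ltxx.
apply: etrans (duhamel (H (z, s)) sT m1 m2 iS b2 ftc Ps).
apply: eq_Rintegral => t; rewrite inE/= in_itv/= => /andP[st tT].
by rewrite /f -HS.
Qed.

Hypothesis Sodd : forall y t, eul S (- y, t) = - eul S (y, t).

Let eulSK y t : `|eul S (y, t)| <= L * K y.
Proof. by have := SK (y - t, t); rewrite /= subrK. Qed.

Lemma psi_fold x t : 0 < x -> x < 1 -> 0 < t ->
  [/\ P (x, t) = phi (x, t), P (- x, t) = ep * phi (x, t),
      dP (x, t) = partial_t phi (x, t) + partial_x phi (x, t) &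
      dP (- x, t) = ep * (partial_t phi (x, t) - partial_x phi (x, t))].
Proof.
move=> x0 x1 t0; rewrite /P /dP.
have e0 : x - 2 * (0 : int)%:~R = x by rewrite mulr0 subr0.
have e1 : - x - 2 * (0 : int)%:~R = - x by rewrite mulr0 subr0.
split.
- by rewrite (@psi_pos _ _ _ edge x t 0) ?e0 ?ltW.
- by rewrite (@psi_neg _ _ _ edge (- x) t 0) ?e1 ?opprK ?lerN2 ?oppr_le0 ?ltW.
- by rewrite (@dpsi_pos _ _ _ x t 0) ?e0 ?ltW.
- by rewrite (@dpsi_neg _ _ _ (- x) t 0) ?e1 ?opprK ?lerN2 ?oppr_lt0 ?ltW.
Qed.

(** This serves both weak equations. With [ep = 1] the source drops out and the mass equation
    remains; with [ep = -1] the factor [1 - ep = 2] produces the source of the momentum equation.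
    [X] is [0, 1] in the first case and ]0, 1[ in the second. *)
Lemma folded_identity (X : set R) (h : R * R -> R) : measurable X -> X `<=` I01 -> `]0, 1[ `<=` X ->
  (forall f : R -> R, leb.-integrable X (EFin \o f) ->
    \int[leb]_(x in X) f x = \int[leb]_(x in `]0, 1[) f x) ->
  (forall x t, X x -> 0 < t -> h (x, t) =
    eul H (x, t) * (partial_t phi (x, t) + partial_x phi (x, t)) +
    ep * eul H (- x, t) * (partial_t phi (x, t) - partial_x phi (x, t)) -
    (1 - ep) * eul S (x, t) * phi (x, t)) ->
  integrates_to_zero X h.
Proof.
move=> mX XI IX X01 hE.
have [s [T [C [[s0 sT C0 Pout out] PC]]]] := psi_dpsi_data test ep1.
have [s' [T' [D [_ _ D0 _ bd]]]] := test_data test.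
have mp : measurable (period : set R) := @measurable_period R.
have [mph mpx mpt] := test_measurable test.
(* Extension by zero gives functions that are measurable on the plane, with bounds valid at all
   times. *)
pose ph := phi \_ slab; pose px := (partial_x phi) \_ slab; pose pt := (partial_t phi) \_ slab.
have slabE x t (f : R * R -> R) : X x -> 0 < t -> (f \_ slab) (x, t) = f (x, t).
  move=> Xx t0; rewrite patchE mem_set//; split; first exact: XI.
  by rewrite /Rgt0/= in_itv/= t0.
have hat0 x t : X x -> ~~ (s < t < T) -> [/\ ph (x, t) = 0, px (x, t) = 0 & pt (x, t) = 0].
  move=> Xx nt; rewrite /ph /px /pt !patchE; case: ifPn => [|_]; last by [].
  rewrite inE => -[/= Ix]; rewrite /Rgt0/= in_itv/= andbT => t0.
  exact: out.
have hatD x t : X x -> [/\ `|ph (x, t)| <= D, `|px (x, t)| <= D & `|pt (x, t)| <= D].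
  move=> Xx; rewrite /ph /px /pt !patchE; case: ifPn => [|_]; last by rewrite normr0.
  rewrite inE => -[/= Ix]; rewrite /Rgt0/= in_itv/= andbT => t0.
  exact: bd.
have [m1 m2 m3] : [/\ measurable_fun setT ph, measurable_fun setT px & measurable_fun setT pt].
  by split; apply/(measurable_restrictT _ measurable_slab).
have hatE x t : X x -> 0 < t ->
    [/\ ph (x, t) = phi (x, t), px (x, t) = partial_x phi (x, t) & pt (x, t) = partial_t phi (x, t)].
  by move=> Xx t0; rewrite /ph /px /pt !slabE.
clearbody ph px pt.
pose hh p := eul H p * (pt p + px p) + ep * eul H (- p.1, p.2) * (pt p - px p) -
  (1 - ep) * eul S p * ph p.
have meH : measurable_fun setT (eul H) by apply: measurable_eul; exact: bp_meas bH.
have meS : measurable_fun setT (eul S) by exact: measurable_eul.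
have meN := measurable_oppfst meH.
have mhh : measurable_fun setT hh.
  apply: measurable_funB; first apply: measurable_funD.
  - by apply: measurable_funM => //; exact: measurable_funD.
  - by apply: measurable_funM; [exact: measurable_funM|exact: measurable_funB].
  - by apply: measurable_funM => //; exact: measurable_funM.
have BH p : `|eul H p| <= B by exact: bp_bound bH _.
have B0 : 0 <= B by exact: le_trans (BH (0, 0)).
have K0 := kernel_ge0 kK.
pose kk x := (B * (D + D) + B * (D + D)) + (2 * L * D) * K x.
have kk0 x : 0 <= kk x by rewrite addr_ge0// ?addr_ge0// !mulr_ge0// addr_ge0.
have hhk x t : X x -> `|hh (x, t)| <= kk x.
  move=> Xx; have [d1 d2 d3] := hatD x t Xx.
  apply: le_trans (ler_normB _ _) _; apply: lerD.
    apply: le_trans (ler_normD _ _) _; apply: lerD; rewrite normrM; apply: ler_pM => //.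
    - by apply: le_trans (ler_normD _ _) _; exact: lerD.
    - by rewrite normrM -[leRHS]mul1r; exact: ler_pM.
    - by apply: le_trans (ler_normB _ _) _; exact: lerD.
  rewrite normrM (_ : 2 * L * D * K x = 2 * (L * K x) * D); last by ring.
  apply: ler_pM => //; rewrite normrM; apply: ler_pM => //.
  by apply: le_trans (ler_normB _ _) _; rewrite normr1 -[2]/(1 + 1) lerD2l.
have iK1 : leb.-integrable I01 (EFin \o K).
  exact: (kernel_itv_integrable_01 kK).
have iK : leb.-integrable X (EFin \o K) by exact: (integrableS (@measurable_I01 R) mX XI iK1).
have Xfin : (leb X < +oo)%E.
  apply: (@le_lt_trans _ _ (leb (I01 : set R))); last exact: leb_itv_lty.
  by apply: le_measure; rewrite ?inE//; exact: measurable_I01.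
have ikk : leb.-integrable X (EFin \o kk).
  by apply: int_add => //; [exact: int_cst|exact: int_scale].
have hh0 x t : X x -> ~~ (s < t < T) -> hh (x, t) = 0.
  by move=> Xx /(hat0 x t Xx)[h1 h2 h3]; rewrite /hh h1 h2 h3 subrr addr0 !mulr0 addr0 subrr.
have hhE x t : X x -> 0 < t -> hh (x, t) = h (x, t).
  by move=> Xx t0; rewrite hE// /hh; have [-> -> ->] := hatE x t Xx t0.
have mpos : measurable (Rgt0 : set R) by exact: measurable_itv.
have i1 x : X x -> leb.-integrable Rgt0 (EFin \o (fun t => hh (x, t))).
  move=> Xx; have mx : measurable_fun setT (fun t => hh (x, t)) by exact: measurable_section1.
  have ist : leb.-integrable setT (EFin \o (fun t => kk x * \1_(`[s, T]%classic) t)).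
    by apply: int_scale => //; exact: integrable_indic_itv.
  apply: (@dominated_integrable _ _ _ (fun t => kk x * \1_(`[s, T]%classic) t)) => //.
  - exact: measurable_funTS.
  - exact: integrableS ist.
  - move=> t _; rewrite indicE; have [tI|nI] := boolP (t \in _); first by rewrite mulr1 hhk.
    rewrite hh0 ?normr0 ?mulr0//; apply: contra nI => /andP[h1 h2].
    by apply: mem_set; rewrite /= in_itv/= !ltW.
have i2 t : leb.-integrable X (EFin \o (fun x => hh (x, t))).
  apply: (@dominated_integrable _ _ _ kk) => //; last by move=> x; exact: hhk.
  by apply: measurable_funTS; exact: measurable_section2.
have i2n t := int_norm (i2 t).
have fin : (\int[leb]_(t in Rgt0) \int[leb]_(x in X) `|hh (x, t)|%:E < +oo)%E.
  pose ka := \int[leb]_(x in X) kk x.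
  have ka0 : 0 <= ka by apply: Rintegral_ge0 => x _; exact: kk0.
  have ist : leb.-integrable setT (EFin \o (fun t => ka * \1_(`[s, T]%classic) t)).
    by apply: int_scale => //; exact: integrable_indic_itv.
  have ist' : leb.-integrable Rgt0 (EFin \o (fun t => ka * \1_(`[s, T]%classic) t)).
    exact: integrableS ist.
  have /integrableP[_] := ist'.
  apply: le_lt_trans; apply: ge0_le_integral => //.
  - by move=> t _; apply: integral_ge0 => x _; rewrite lee_fin.
  - apply: measurable_funTS.
    rewrite (_ : (fun t => _) = EFin \o (fun t => \int[leb]_(x in X) `|hh (x, t)|)).
      apply/measurable_EFinP; apply: (measurable_Rintegral_section mX (f := fun p => `|hh p|)).
      exact: measurableT_comp.
    by apply/funext => t /=; rewrite /Rintegral fineK//; apply: integrable_fin_num => //; exact: i2n.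
  - apply: measurableT_comp => //; apply: measurable_funTS; apply/measurable_EFinP.
    by apply: measurable_funM => //; exact: measurable_indic.
  move=> t _.
  have -> : (\int[leb]_(x in X) `|hh (x, t)|%:E)%E = (\int[leb]_(x in X) `|hh (x, t)|)%:E.
    by rewrite /Rintegral fineK//; apply: integrable_fin_num => //; exact: i2n.
  rewrite lee_fin normrM (ger0_norm ka0) indicE ger0_norm//.
  have [tI|nI] := boolP (t \in _).
    by rewrite mulr1; apply: le_Rintegral => // x; exact: hhk.
  rewrite mulr0 Rintegral_eq0// => x Xx.
  rewrite hh0 ?normr0//; apply: contra nI => /andP[h1 h2].
  by apply: mem_set; rewrite /= in_itv/= !ltW.
have [_ _ i3 _] := Rintegral_Fubini mX mpos mhh i1 (fun t _ => i2 t) fin.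
split.
  apply: eq_integrable i3; first exact: measurableX.
  move=> -[x t]; rewrite inE /= => -[/= Xx].
  by rewrite /Rgt0/= in_itv/= andbT => t0; rewrite hhE.
pose G t := \int[leb]_(x in X) hh (x, t).
have mP : measurable_fun setT P by exact: measurable_psi.
have mdP : measurable_fun setT dP by exact: measurable_dpsi.
pose q1 p := eul H p * dP p; pose q2 p := eul S p * P p.
have mq1 : measurable_fun setT q1 by exact: measurable_funM.
have mq2 : measurable_fun setT q2 by exact: measurable_funM.
have q1C y t : period y -> `|q1 (y, t)| <= cst (B * C) y.
  by move=> _ /=; rewrite normrM; apply: ler_pM => //; have [] := PC (y, t).
have q2C y t : period y -> `|q2 (y, t)| <= L * C * K y.
  by move=> _ /=; rewrite normrM mulrAC; apply: ler_pM => //; have [] := PC (y, t).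
have iBC : leb.-integrable period (EFin \o cst (B * C)).
  by apply: int_cst => //; exact: leb_itv_lty.
have iLCK : leb.-integrable period (EFin \o (fun y => L * C * K y)).
  by apply: int_scale => //; exact: kernel_int kK.
have [q1i q1s _] := dominated_Fubini s T mp mq1 iBC q1C.
have [q2i q2s _] := dominated_Fubini s T mp mq2 iLCK q2C.
have GE t : s <= t -> G t = \int[leb]_(y in period) q1 (y, t) - \int[leb]_(y in period) q2 (y, t).
  move=> st; have t0 : 0 < t by exact: lt_le_trans st.
  have mq r : measurable_fun setT (fun y => q1 (y, r) - q2 (y, r)).
    by apply: measurable_funB; exact: measurable_section2.
  have iq r : leb.-integrable period (EFin \o (fun y => q1 (y, r) - q2 (y, r))).
    by apply: int_sub.
  rewrite /G X01// -RintegralB// -(Rintegral_fold (mq t) (iq t)).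
  apply: eq_Rintegral => x; rewrite inE => xI; have := xI; rewrite /= in_itv/= => /andP[x0 x1].
  have [e1 e2 e3 e4] := psi_fold x0 x1 t0; have [h1 h2 h3] := hatE x t (IX x xI) t0.
  by rewrite /q1 /q2 /hh/= e1 e2 e3 e4 h1 h2 h3 Sodd; ring.
have GI : \int[leb]_(t in `[s, T]) G t = 0.
  rewrite (_ : \int[leb]_(t in `[s, T]) G t = \int[leb]_(t in `[s, T])
    (\int[leb]_(y in period) q1 (y, t) - \int[leb]_(y in period) q2 (y, t))); last first.
    by apply: eq_Rintegral => t; rewrite inE/= in_itv/= => /andP[st _]; exact: GE.
  rewrite RintegralB//; apply/eqP; rewrite subr_eq0; apply/eqP.
  exact: unfolded_identity.
have iG : leb.-integrable `[s, T] (EFin \o G).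
  by have [_ f2 _] := dominated_Fubini s T mX mhh ikk (fun x t => hhk x t).
transitivity (\int[leb]_(t in `[s, T]) (G t)%:E)%E; last first.
  rewrite -[0%E]/((0 : R)%:E) -GI /Rintegral fineK//; exact: integrable_fin_num.
rewrite [LHS]integral_mkcond [RHS]integral_mkcond; apply: eq_integral => t _.
rewrite !patchE mem_setE in_itv/= /Rgt0 mem_setE in_itv/= andbT.
case: ifPn => [t0|nt]; last first.
  by rewrite ifF//; apply/negP => /andP[st _]; case/negP: nt; exact: lt_le_trans st.
have -> : (\int[leb]_(x in X) (h (x, t))%:E)%E = (G t)%:E.
  rewrite /G /Rintegral fineK; last by apply: integrable_fin_num => //; exact: i2.
  by apply: eq_integral => x; rewrite inE => Xx; rewrite hhE.
case: ifPn => // nt; rewrite /G Rintegral_eq0// => x Xx.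
by rewrite hh0//; apply: contra nt => /andP[? ?]; rewrite !ltW.
Qed.

End UnfoldedIdentity.

(** * Continuity of translations in L^1 *)

Section Translation.
Context {R : realType}.

Lemma Rintegral_subset_ge0 (A E : set (measurableTypeR R)) (u : R -> R) : measurable A -> measurable E ->
  A `<=` E -> (forall x, 0 <= u x) -> leb.-integrable E (EFin \o u) ->
  \int[leb]_(x in A) u x <= \int[leb]_(x in E) u x.
Proof.
move=> mA mE AE u0 iu; have iA : leb.-integrable A (EFin \o u) by exact: (integrableS mE mA AE iu).
rewrite /Rintegral; apply: fine_le; [by apply: integrable_fin_num|by apply: integrable_fin_num|].
apply: ge0_subset_integral => //; first by have := measurable_int _ iu.
by move=> x _; rewrite lee_fin.
Qed.

(** By contradiction: translations [c n] tending to 0 with integrals above [e] would violate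
    dominated convergence, the integrands being at most twice the maximum of [|g|] on [-2, 2]. *)
Lemma continuous_translation (g : R -> R) (e : R) : continuous g -> 0 < e ->
  exists2 d, 0 < d & forall c, `|c| <= d -> \int[leb]_(y in period) `|g (y + c) - g y| <= e.
Proof.
move=> cg e0; apply: contrapT => nd.
have mp : measurable (period : set (measurableTypeR R)) := @measurable_period R.
have /choice[c hc] : forall n : nat, exists c, `|c| <= n.+1%:R^-1 /\
    e < \int[leb]_(y in period) `|g (y + c) - g y|.
  move=> n; apply: contrapT => hn; apply: nd; exists n.+1%:R^-1; first by rewrite invr_gt0.
  by move=> c cn; rewrite leNgt; apply/negP => ec; apply: hn; exists c.
have cc : c n @[n --> \oo] --> 0.
  apply/cvgrPdist_le => d d0; exists (Num.truncn d^-1) => // n /= dn.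
  rewrite sub0r normrN; have [cn _] := hc n; apply: (le_trans cn).
  rewrite -[leRHS]invrK lef_pV2 ?posrE ?invr_gt0//.
  by apply: ltW; apply: (lt_le_trans (truncnS_gt _)); rewrite ler_nat ltnS.
have cn1 : {within `[-2, 2], continuous (fun x => `|g x|)}.
  by apply: continuous_subspaceT => x; apply: cvg_norm; exact: cg.
have [|x0 _ hx] := EVT_max _ cn1; first by lra.
pose D := `|g x0|.
have mg : measurable_fun setT g by exact: continuous_measurable_fun.
have mgc r : measurable_fun setT (fun y : R => g (y + r)).
  by apply: (measurableT_comp mg); apply: measurable_funD.
have mf n : measurable_fun period (fun y => `|g (y + c n) - g y|%:E).
  apply: measurable_funTS; apply/measurable_EFinP; apply: measurableT_comp => //.
  exact: measurable_funB.
have cae : {ae leb, forall y, period y -> `|g (y + c n) - g y|%:E @[n --> \oo] --> (cst 0%E : R -> \bar R) y}.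
  apply: ae_all => y _ /=; apply: cvg_EFin; first exact: nearW.
  rewrite -(normr0 R); apply: cvg_norm; rewrite -(subrr (g y)); apply: cvgB; last exact: cvg_cst.
  have cy : y + c n @[n --> \oo] --> y + 0 by apply: cvgD => //; exact: cvg_cst.
  rewrite addr0 in cy; by apply: continuous_cvg; [exact: cg|exact: cy].
pose D2 := 2 * D.
have ic : leb.-integrable period (EFin \o cst D2) by apply: int_cst => //; exact: leb_itv_lty.
pose w n y := `|g (y + c n) - g y|.
have bae : {ae leb, forall y n, period y -> (`|(w n y)%:E| <= (EFin \o cst D2) y)%E}.
  apply: ae_all => y n; rewrite /period/= in_itv/= => /andP[y1 y2].
  rewrite lee_fin /w normr_id; apply: le_trans (ler_normB _ _) _.
  have [+ _] := hc n; have n1 : n.+1%:R^-1 <= 1 :> R by rewrite invf_le1// ler1n.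
  move=> /le_trans/(_ n1); rewrite ler_norml => /andP[c1 c2].
  have h1 : `|g (y + c n)| <= D by apply: hx; rewrite in_itv/=; lra.
  have h2 : `|g y| <= D by apply: hx; rewrite in_itv/=; lra.
  by rewrite /D2 mulr2n mulrDl !mul1r; exact: lerD.
have [_ _] := @dominated_convergence _ _ _ leb _ mp _ _ _ mf (measurable_cst _) cae ic bae.
rewrite /= integral0 => lim.
have lim' : \int[leb]_(y in period) `|g (y + c n) - g y| @[n --> \oo] --> (0 : R).
  by have /fine_cvg := lim.
have : \forall n \near \oo, \int[leb]_(y in period) `|g (y + c n) - g y| < e.
  exact: (cvgr_lt _ lim').
move=> [N _ hN]; have := hN N (leqnn N); have [_ /lt_trans h] := hc N.
by move=> /h; rewrite ltxx.
Qed.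

(** [h] is approximated in L^1 by a continuous function on [-3, 3], an interval that contains
    [period] and its translates by at most 1. Each of the three errors is at most [e / 4]. *)
Lemma L1_translation (h : R -> R) (B e : R) : measurable_fun setT h -> (forall y, `|h y| <= B) ->
  0 < e -> exists2 d, 0 < d & forall c, `|c| <= d ->
    \int[leb]_(y in period) `|h (y + c) - h y| <= e.
Proof.
move=> mh hB e0.
have mp : measurable (period : set (measurableTypeR R)) := @measurable_period R.
pose E : set R := `[-3, 3]%classic.
have mE : measurable (E : set (measurableTypeR R)) by exact: measurable_itv.
have ih (D : set R) : measurable (D : set (measurableTypeR R)) -> (leb D < +oo)%E ->
    leb.-integrable D (EFin \o h).
  move=> mD Df; apply: (@dominated_integrable _ _ _ (cst B)) => //; first exact: measurable_funTS.
  exact: int_cst.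
have Efin : (leb E < +oo)%E by exact: leb_itv_lty.
have [gn [cgn ign lim]] := approximation_continuous_integrable mE Efin (ih E mE Efin).
have e4 : 0 < e / 4 by rewrite divr_gt0.
have [g [cg ig hg]] : exists g : R -> R, [/\ continuous g, leb.-integrable E (EFin \o g) &
    \int[leb]_(z in E) `|h z - g z| <= e / 4].
  have : nbhs (0%E : \bar R) [set y | (y < (e / 4)%:E)%E].
    by apply: open_nbhs_nbhs; split; [exact: open_ereal_lt_ereal|rewrite /= lte_fin].
  move=> /lim[N _ hN]; exists (gn N); split => //.
  have i1 := int_norm (int_sub mE (ih E mE Efin) (ign N)).
  rewrite -lee_fin /Rintegral fineK; last by apply: integrable_fin_num.
  exact: ltW (hN N (leqnn N)).
have [d d0 hd] := continuous_translation cg e4.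
exists (Num.min d 1); first by rewrite lt_min d0 ltr01.
move=> c; rewrite le_min => /andP[cd c1].
have mg : measurable_fun setT g by exact: continuous_measurable_fun.
pose u z := `|h z - g z|.
have mu : measurable_fun setT u by apply: measurableT_comp => //; exact: measurable_funB.
have iuE : leb.-integrable E (EFin \o u) by exact: (int_norm (int_sub mE (ih E mE Efin) ig)).
have u0 x : 0 <= u x by exact: normr_ge0.
pose D : set R := isom 1 (- c) @^-1` period.
have DE : D = `[-1 + c, 1 + c[%classic.
  by apply/seteqP; split => y; rewrite /D /isom /period/= !in_itv/= => /andP[? ?]; apply/andP; split; lra.
have mD : measurable (D : set (measurableTypeR R)) by rewrite DE; exact: measurable_itv.
have subD : D `<=` E.
  move=> y; rewrite DE /E/= !in_itv/= => /andP[y1 y2].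
  by move: c1; rewrite ler_norml => /andP[? ?]; apply/andP; split; lra.
have subp : period `<=` E by move=> y; rewrite /period /E/= !in_itv/= => /andP[? ?]; apply/andP; split; lra.
have preD : isom 1 c @^-1` D = period.
  by apply/seteqP; split => y; rewrite DE /isom /period/= !in_itv/= => /andP[? ?]; apply/andP; split; lra.
have iuD : leb.-integrable D (EFin \o u) by exact: (integrableS mE mD subD iuE).
have isomE : u \o isom 1 c = (fun y => u (y + c)) by apply/funext => y; rewrite /isom/= mul1r.
have iuc : leb.-integrable period (EFin \o (fun y => u (y + c))).
  by have := integrable_isom c (or_introl erefl) mD mu iuD; rewrite preD isomE.
have Iuc : \int[leb]_(y in period) u (y + c) <= e / 4.
  have := Rintegral_isom c (or_introl erefl) mD mu; rewrite preD => h1.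
  rewrite (_ : \int[leb]_(y in period) _ = \int[leb]_(x in D) u x).
    by apply: le_trans hg; exact: Rintegral_subset_ge0.
  by rewrite h1; apply: eq_Rintegral => y _; rewrite /isom mul1r.
have iup : leb.-integrable period (EFin \o u) by exact: (integrableS mE mp subp iuE).
have Iup : \int[leb]_(y in period) u y <= e / 4.
  by apply: le_trans hg; exact: Rintegral_subset_ge0.
have pfin : (leb (period : set R) < +oo)%E by exact: leb_itv_lty.
have igp : leb.-integrable period (EFin \o g) by exact: (integrableS mE mp subp ig).
have igD : leb.-integrable D (EFin \o g) by exact: (integrableS mE mD subD ig).
have igc : leb.-integrable period (EFin \o (fun y => g (y + c))).
  have := integrable_isom c (or_introl erefl) mD mg igD; rewrite preD.
  by rewrite (_ : g \o isom 1 c = (fun y => g (y + c)))//; apply/funext => y; rewrite /isom/= mul1r.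
have igg := int_norm (int_sub mp igc igp).
have mhc : measurable_fun setT (fun y : R => h (y + c)).
  by apply: (measurableT_comp mh); apply: measurable_funD.
have ihc : leb.-integrable period (EFin \o (fun y => h (y + c))).
  apply: (@dominated_integrable _ _ _ (cst B)) => //; first exact: measurable_funTS.
  exact: int_cst.
have ihh := int_norm (int_sub mp ihc (ih period mp pfin)).
have isum := int_add mp (int_add mp iuc igg) iup.
apply: (@le_trans _ _ (\int[leb]_(y in period) (u (y + c) + `|g (y + c) - g y| + u y))).
  apply: le_Rintegral => // y _; rewrite /u.
  rewrite (_ : h (y + c) - h y = (h (y + c) - g (y + c)) + (g (y + c) - g y) - (h y - g y)); last by ring.
  apply: le_trans (ler_normB _ _) _; rewrite lerD2r; exact: ler_normD.
rewrite RintegralD//; last exact: int_add.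
rewrite RintegralD//.
apply: (le_trans (lerD (lerD Iuc (hd c cd)) Iup)); lra.
Qed.

End Translation.

(** * Extension of momentum test functions by zero *)

Section ZeroExtension.
Context {R : realType}.

Definition open_slab : set (R * R) := `]0, 1[%classic `*` Rgt0.

Lemma open_slab_open : open open_slab.
Proof.
rewrite openE => -[x t] [/= hx ht]; exists (`]0, 1[%classic, Rgt0) => //; split => /=.
  by apply: open_nbhs_nbhs; split => //; exact: interval_open.
by apply: open_nbhs_nbhs; split => //; exact: interval_open. Qed.

Lemma open_slab_sub : open_slab `<=` slab.
Proof.
by move=> [x t] [/=]; rewrite in_itv/= => /andP[? ?] ?; split => //; rewrite /= /I01/= in_itv/= !ltW.
Qed.

Variables (phi : R * R -> R).
Hypothesis test : test_function open_slab phi.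

Definition zero_ext := phi \_ open_slab.

Lemma zero_ext_in p : open_slab p -> zero_ext p = phi p.
Proof. by move=> Op; rewrite /zero_ext patchE mem_set. Qed.

Let near_line_x (f h : R * R -> R) (p : R * R) : nbhs p [set q | f q = h q] ->
  \forall x \near p.1, f (x, p.2) = h (x, p.2).
Proof.
move=> /plane_nbhsP[e e0 he]; exists e => //= x xe.
by apply: he; rewrite ?subrr ?normr0// distrC.
Qed.

Let near_line_t (f h : R * R -> R) (p : R * R) : nbhs p [set q | f q = h q] ->
  \forall t \near p.2, f (p.1, t) = h (p.1, t).
Proof.
move=> /plane_nbhsP[e e0 he]; exists e => //= x xe.
by apply: he; rewrite ?subrr ?normr0// distrC.
Qed.

Lemma near_eq_partial (f h : R * R -> R) (p : R * R) : nbhs p [set q | f q = h q] ->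
  partial_x f p = partial_x h p /\ partial_t f p = partial_t h p.
Proof.
move=> fh; split.
  rewrite /partial_x !derive1E; apply: near_eq_derive; exact: near_line_x.
by rewrite /partial_t !derive1E; apply: near_eq_derive; exact: near_line_t.
Qed.

Lemma near_eq_C1 (f h : R * R -> R) (p : R * R) : nbhs p [set q | f q = h q] ->
  C1_at h p -> C1_at f p.
Proof.
move=> fh [dx dt cx ct].
have hf : nbhs p [set q | h q = f q] by apply: filterS fh => q /= ->.
have nn : \forall q \near p, partial_x f q = partial_x h q /\ partial_t f q = partial_t h q.
  have := nbhs_interior fh; apply: filterS => q; exact: near_eq_partial.
have [ex et] := near_eq_partial fh.
split.
- by apply: near_eq_derivable dx => //; exact: near_line_x hf.
- by apply: near_eq_derivable dt => //; exact: near_line_t hf.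
- rewrite /prop_for /continuous_at ex; apply: cvg_trans cx; apply: near_eq_cvg.
  by apply: filterS nn => q [].
- rewrite /prop_for /continuous_at et; apply: cvg_trans ct; apply: near_eq_cvg.
  by apply: filterS nn => q [].
Qed.

Lemma zero_ext_near p : open_slab p -> nbhs p [set q | zero_ext q = phi q].
Proof.
by move=> /open_slab_open; apply: filterS => q; exact: zero_ext_in.
Qed.

Lemma zero_ext_partial p : open_slab p ->
  partial_x zero_ext p = partial_x phi p /\ partial_t zero_ext p = partial_t phi p.
Proof. by move=> /zero_ext_near; exact: near_eq_partial. Qed.

(** The closure of the support lies in [open_slab], so every point outside has a neighbourhood that
    misses it, where the extension is zero. Hence the extension is C^1 on the whole plane. *)
Lemma zero_ext_test : test_function slab zero_ext.
Proof.
have [[U [oU sU hU]] [cS sS]] := test.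
have eqS : slab `&` [set p | zero_ext p != 0] = open_slab `&` [set p | phi p != 0].
  apply/seteqP; split => p /=.
    move=> [_]; rewrite /zero_ext patchE; case: ifPn; last by rewrite eqxx.
    by rewrite inE.
  by move=> [Op pn]; split; [exact: open_slab_sub|rewrite zero_ext_in].
split; last first.
  by rewrite /compact_support_in /= eqS; split => //; apply: subset_trans sS open_slab_sub.
exists setT; split => //; first exact: openT.
move=> p _; have [Op|nOp] := pselect (open_slab p).
  by apply: near_eq_C1 (zero_ext_near Op) _; apply: hU; exact: sU.
have nS : nbhs p (~` closure (open_slab `&` [set p | phi p != 0])).
  by apply: open_nbhs_nbhs; split; [exact/closed_openC/closed_closure|move=> /= /sS].
apply: (@near_eq_C1 _ (cst 0)).
  apply: filterS nS => q nq /=; rewrite /zero_ext patchE; case: ifPn => // /set_mem Oq.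
  by apply/eqP; apply: contra_notT nq => ne; apply: subset_closure.
have p0 : partial_x (cst 0 : R * R -> R) = cst 0.
  by apply/funext => q; rewrite /partial_x derive1_cst.
have t0 : partial_t (cst 0 : R * R -> R) = cst 0.
  by apply/funext => q; rewrite /partial_t derive1_cst.
split; [exact: derivable_cst|exact: derivable_cst|..].
  by rewrite p0; exact: cvg_cst.
by rewrite t0; exact: cvg_cst.
Qed.

Lemma zero_ext_edge x t : x = 0 \/ x = 1 -> 0 < t -> -1 * zero_ext (x, t) = zero_ext (x, t).
Proof.
move=> x01 _; suff -> : zero_ext (x, t) = 0 by rewrite mulr0.
rewrite /zero_ext patchE; case: ifPn => //; rewrite inE => -[/=]; rewrite in_itv/=.
by case: x01 => ->; rewrite ltxx ?andbF.
Qed.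

End ZeroExtension.

Lemma L1_continuous_intro (R : realType) (v : R * R -> R) :
  (forall s e, 0 <= s -> 0 < e -> exists2 d, 0 < d & forall t, 0 <= t -> `|t - s| <= d ->
    (\int[leb]_(x in I01) `|v (x, t) - v (x, s)|%:E <= e%:E)%E) -> L1_continuous v.
Proof.
move=> h s s0 A nA.
have /nbhs_ballP[e /= e0 eA] : nbhs (0 : R) (fun r => A r%:E) by exact: nA.
have e20 : 0 < e / 2 by exact: divr_gt0.
have [d d0 hd] := h s _ s0 e20.
exists d => //= t; rewrite /ball/= distrC => /ltW td; rewrite /Rge0/= in_itv/= andbT => t0.
have := hd t t0 td.
have : (0 <= \int[leb]_(x in I01) `|v (x, t) - v (x, s)|%:E)%E.
  by apply: integral_ge0 => x _; rewrite lee_fin.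
case: (integral _ _ _) => [r| |]//; rewrite !lee_fin => r0 re.
by apply: eA; rewrite /ball/= sub0r normrN ger0_norm//; apply: (le_lt_trans re); rewrite ltr_pdivrMr// mulr_natr mulr2n ltrDl.
Qed.

Lemma Rintegral_period_cst (R : realType) (c : R) : \int[leb]_(y in period) cst c y = 2 * c.
Proof.
rewrite Rintegral_cst; last exact: measurable_period.
have h : leb (period : set R) = 2%:E.
  apply: etrans (lebesgue_measure_itv _) _ => /=; rewrite lte_fin ifT; last by lra.
  by rewrite -EFinD; congr EFin; ring.
by apply: etrans (mulrC _ _); congr (c * _); exact: (congr1 fine h).
Qed.

(** * Weak solutions built from the integral equation *)

Section MildToWeak.
Context {R : realType}.
Variables (K alpha g : R -> R) (m M : R) (H : R * R -> R).
Hypotheses (kK : kernel K) (wa : weight alpha) (dg : damping g).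
Lemma mild_bounded_periodic t0 G : mild K alpha g m M t0 G -> bounded_periodic (`|m| + `|M|) G.
Proof.
move=> [mG bG pG _]; split => // p; have /andP[h1 h2] := bG p.
have := ler_norm M; have := lerNnormlW (lexx `|m|).
have := normr_ge0 m; have := normr_ge0 M; rewrite ler_norml.
by move=> *; apply/andP; split; lra.
Qed.

Lemma src_kernel_bound t0 G : mild K alpha g m M t0 G ->
  exists2 L, 0 <= L & forall p, `|src K alpha g G p| <= L * K (p.1 + p.2).
Proof.
move=> /mild_bounded_periodic bG; set B := `|m| + `|M|.
have B0 : 0 <= 2 * B by rewrite mulr_ge0// addr_ge0.
have [L L0 hL] := damping_lip dg (2 * B); exists (L * (2 * B)); first exact: mulr_ge0.
move=> p; apply: src_bound => //; first exact: kernel_ge0.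
apply: le_trans (ler_normB _ _) _.
by rewrite mulr_natl mulr2n; apply: lerD; exact: (bp_bound bG).
Qed.

Lemma src_periodic G : (forall z t, G (z + 2, t) = G (z, t)) ->
  forall z t, src K alpha g G (z + 2, t) = src K alpha g G (z, t).
Proof.
move=> pG z r; rewrite /src /gam /refl/= pG.
rewrite (_ : z + 2 + r = z + r + 2); last by ring.
rewrite (kernel_periodic kK) rep_periodic.
by rewrite -(pG (- (z + 2) - 2 * r)) (_ : - (z + 2) - 2 * r + 2 = - z - 2 * r)//; ring.
Qed.

Lemma mild_chain t0 G z s t : mild K alpha g m M t0 G -> t0 <= s -> s <= t ->
  G (z, t) = G (z, s) - \int[leb]_(r in `[s, t]) src K alpha g G (z, r).
Proof.
move=> mG s0 st; have [L L0 SK] := src_kernel_bound mG.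
have mS := measurable_src (kernel_meas kK) wa dg (mild_meas mG).
have i : leb.-integrable `[t0, t] (EFin \o (fun r => src K alpha g G (z, r))).
  by apply: (@kernel_dominated_integrable _ _ kK _ L _ _ _ mS) => r; exact: SK.
rewrite (mild_eq mG _ s0) (mild_eq mG _ (le_trans s0 st)).
by rewrite (Rintegral_itv_chain s0 st i) opprD addrA.
Qed.

Lemma mild_modulus t0 G e : mild K alpha g m M t0 G -> 0 < e ->
  exists2 d, 0 < d & forall z s t, t0 <= s -> t0 <= t ->
  `|t - s| <= d -> `|G (z, t) - G (z, s)| <= e.
Proof.
move=> mG e0; have [L L0 SK] := src_kernel_bound mG.
have mS := measurable_src (kernel_meas kK) wa dg (mild_meas mG).
have [|d d0 hd] := @kernel_dominated_modulus _ _ kK _ L e L0 mS _ e0.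
  by move=> z s; exact: SK.
exists d => // z s t s0 t1; wlog st : s t s0 t1 / s <= t => [W td|].
  have [st|/ltW ts] := leP s t; first exact: W.
  by rewrite distrC; apply: W => //; rewrite distrC.
rewrite ger0_norm ?subr_ge0// => td.
by rewrite (mild_chain z mG s0 st) addrAC subrr sub0r normrN; exact: hd.
Qed.

Hypothesis mH : mild K alpha g m M 0 H.

Let S := src K alpha g H.

Let bH : bounded_periodic (`|m| + `|M|) H. Proof. exact: mild_bounded_periodic mH. Qed.
Let mS : measurable_fun setT S.
Proof. by apply: measurable_src (kernel_meas kK) wa dg _; exact: bp_meas bH. Qed.
Let Sper z t : S (z + 2, t) = S (z, t).
Proof. by apply: src_periodic; exact: bp_periodic bH. Qed.

Let Srefl z t : S (- z - 2 * t, t) = - S (z, t).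
Proof. exact: (src_odd alpha kK dg (z, t) (bp_periodic bH)). Qed.

Let Sodd y t : eul S (- y, t) = - eul S (y, t).
Proof. by rewrite /eul/= -Srefl; congr (S (_, _)); ring. Qed.

Let mE : measurable_fun setT (eul H). Proof. by apply: measurable_eul; exact: bp_meas bH. Qed.
Let pE y t : eul H (y + 2, t) = eul H (y, t).
Proof. by apply: eul_periodic; exact: bp_periodic bH. Qed.
Let bE p : `|eul H p| <= `|m| + `|M|. Proof. exact: bp_bound bH _. Qed.

Let pfin : (leb (period : set R) < +oo)%E. Proof. exact: leb_itv_lty. Qed.
Let mp : measurable (period : set (measurableTypeR R)). Proof. exact: measurable_period. Qed.

Lemma bounded_integrable_period (f : R -> R) B : measurable_fun setT f -> (forall x, `|f x| <= B) ->
  leb.-integrable period (EFin \o f).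
Proof.
move=> mf fB; apply: (@dominated_integrable _ _ _ (cst B)) => //; first exact: measurable_funTS.
exact: int_cst.
Qed.

(** The increment is a change of time at a fixed Lagrangian point, small uniformly in space, plus a
    translation by [s - t] of the bounded function [H] at time [s], small in L^1. *)
Lemma eul_L1_continuous s e : 0 <= s -> 0 < e -> exists2 d, 0 < d & forall t, 0 <= t -> `|t - s| <= d ->
  \int[leb]_(y in period) `|eul H (y, t) - eul H (y, s)| <= e.
Proof.
move=> s0 e0; have e4 : 0 < e / 4 by rewrite divr_gt0.
have [d1 d10 hd1] := mild_modulus mH e4.
have msec : measurable_fun setT (fun y => H (y, s)) by apply: measurable_section2; exact: bp_meas bH.
have [d2 d20 hd2] := L1_translation msec (fun y => bp_bound bH (y, s)) e4.
exists (Num.min d1 d2); first by rewrite lt_min d10.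
move=> t t0; rewrite le_min => /andP[ts1 ts2].
pose tr y := `|H (y - s + (s - t), s) - H (y - s, s)|.
pose tr' z := `|H (z + (s - t), s) - H (z, s)|.
have mtr' : measurable_fun setT tr'.
  apply: measurableT_comp => //; apply: measurable_funB => //.
  by apply: (measurableT_comp msec); apply: measurable_funD.
have ptr' : periodic2 tr'.
  by move=> z; rewrite /tr' (addrAC z) !(bp_periodic bH).
have trE : \int[leb]_(y in period) tr y <= e / 4.
  rewrite (_ : \int[leb]_(y in period) tr y = \int[leb]_(z in period) tr' z); last first.
    exact: (Rintegral_periodic_shift (- s) mtr' ptr').
  by apply: hd2; rewrite distrC.
have mtr : measurable_fun setT tr.
  by apply: (measurableT_comp mtr'); apply: measurable_funD.
have trB y : `|tr y| <= (`|m| + `|M|) + (`|m| + `|M|).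
  rewrite normr_id; apply: le_trans (ler_normB _ _) _; apply: lerD; exact: bp_bound bH _.
have itr := bounded_integrable_period mtr trB.
have ie4 : leb.-integrable period (EFin \o cst (e / 4)) by exact: int_cst.
have isum := int_add mp ie4 itr.
have il : leb.-integrable period (EFin \o (fun y => `|eul H (y, t) - eul H (y, s)|)).
  apply: (bounded_integrable_period (B := (`|m| + `|M|) + (`|m| + `|M|))).
    apply: measurableT_comp => //; apply: measurable_funB; exact: measurable_section2.
  by move=> x; rewrite normr_id; apply: le_trans (ler_normB _ _) _; apply: lerD.
apply: (@le_trans _ _ (\int[leb]_(y in period) (cst (e / 4) y + tr y))).
  apply: le_Rintegral => // y _; rewrite /eul/=.
  rewrite (_ : _ - _ = (H (y - t, t) - H (y - t, s)) + (H (y - t, s) - H (y - s, s))); last by ring.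
  apply: le_trans (ler_normD _ _) _; apply: lerD; first exact: hd1.
  by rewrite /tr (_ : y - s + (s - t) = y - t)//; ring.
rewrite RintegralD//.
rewrite Rintegral_period_cst; move: (\int[leb]_(x in period) tr x) trE => c ce; lra.
Qed.

Definition mild_rho p := eul H p + eul H (- p.1, p.2).
Definition mild_J p := eul H p - eul H (- p.1, p.2).

Let fold_L1 (v : R * R -> R) : measurable_fun setT v ->
  (forall p q, `|v p - v q| <= `|eul H p - eul H q| +
     `|eul H (- p.1, p.2) - eul H (- q.1, q.2)|) -> L1_continuous v.
Proof.
move=> mv hv; apply: L1_continuous_intro => s e s0 e0.
have [d d0 hd] := eul_L1_continuous s0 e0; exists d => // t t0 ts.
pose w y := `|eul H (y, t) - eul H (y, s)|.
have mw : measurable_fun setT w.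
  by apply: measurableT_comp => //; apply: measurable_funB; exact: measurable_section2.
have wB x : `|w x| <= (`|m| + `|M|) + (`|m| + `|M|).
  by rewrite normr_id; apply: le_trans (ler_normB _ _) _; apply: lerD.
have iw := bounded_integrable_period mw wB.
have := hd t t0 ts; rewrite -/w -(Rintegral_fold mw iw) => le.
have Ifin : (leb (I01 : set R) < +oo)%E by exact: leb_itv_lty.
have mI := @measurable_I01 R.
pose ww x := w x + w (- x).
have mww : measurable_fun setT ww by apply: measurable_funD => //; exact: measurableT_comp.
have iww : leb.-integrable I01 (EFin \o ww).
  apply: (@dominated_integrable _ _ _
    (cst (((`|m| + `|M|) + (`|m| + `|M|)) + ((`|m| + `|M|) + (`|m| + `|M|))))) => //.
  - exact: measurable_funTS.
  - exact: int_cst.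
  - by move=> x _; apply: le_trans (ler_normD _ _) _; exact: lerD.
apply: (@le_trans _ _ (\int[leb]_(x in I01) (ww x)%:E)%E).
  apply: ge0_le_integral => //.
  - apply: measurable_funTS; apply/measurable_EFinP; apply: measurableT_comp => //.
    by apply: measurable_funB; exact: measurable_section2.
  - by apply: measurable_funTS; exact/measurable_EFinP.
  - by move=> x _; rewrite lee_fin; exact: hv.
rewrite -(fineK (integrable_fin_num mI iww)) lee_fin.
by apply: le_trans le; rewrite -(Rintegral_cc_oo iww).
Qed.

Let measurable_mild_rho : measurable_fun setT mild_rho.
Proof. by apply: measurable_funD => //; exact: measurable_oppfst. Qed.
Let measurable_mild_J : measurable_fun setT mild_J.
Proof. by apply: measurable_funB => //; exact: measurable_oppfst. Qed.

Let eulS x t : 0 <= x -> x < 1 -> eul S (x, t) = K x * alpha t * g (mild_J (x, t)).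
Proof.
move=> x0 x1; rewrite /eul /S /src /refl/= subrK /gam rep_id; last by rewrite /period/= in_itv/=; lra.
by rewrite x0 /mild_J /eul/=; rewrite (_ : - (x - t) - 2 * t = - x - t)//; ring.
Qed.

(** The mass is the integral of [H] over the circle, and the source integrates to zero there because
    it is odd under the reflection. *)
Lemma mild_mass t : 0 <= t -> (\int[leb]_(x in I01) (mild_rho (x, t))%:E =
  \int[leb]_(x in I01) (mild_rho (x, 0))%:E)%E.
Proof.
have key r : (\int[leb]_(x in I01) (mild_rho (x, r))%:E = (\int[leb]_(z in period) H (z, r))%:E)%E.
  pose q y := eul H (y, r).
  have mq : measurable_fun setT q by exact: measurable_section2.
  have iq := bounded_integrable_period mq (fun y => bE (y, r)).
  have e1 := Rintegral_fold mq iq.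
  have Ifin : (leb (I01 : set R) < +oo)%E by exact: leb_itv_lty.
  have ir : leb.-integrable I01 (EFin \o (fun x => mild_rho (x, r))).
    apply: (@dominated_integrable _ _ _ (cst ((`|m| + `|M|) + (`|m| + `|M|)))).
    - exact: measurable_I01.
    - by apply: measurable_funTS; exact: measurable_section2.
    - by apply: int_cst => //; exact: measurable_I01.
    - by move=> x _; apply: le_trans (ler_normD _ _) _; exact: lerD.
  rewrite -(fineK (integrable_fin_num (@measurable_I01 R) ir)); congr EFin.
  apply: etrans (Rintegral_cc_oo ir) _; apply: etrans e1 _.
  have pq : periodic2 q by move=> y; exact: pE.
  apply: etrans (esym (Rintegral_periodic_shift r mq pq)) _.
  by apply: eq_Rintegral => z _; rewrite /q /eul/= addrK.
move=> t0; rewrite !key; congr EFin.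
have [L L0 SK] := src_kernel_bound mH.
have [S1 _ S3] := kernel_dominated_Fubini kK 0 t mS SK.
have i0 := bounded_integrable_period (measurable_section2 0 (bp_meas bH)) (fun y => bp_bound bH (y, 0)).
have S0 : \int[leb]_(z in period) \int[leb]_(r in `[0, t]) S (z, r) = 0.
  apply: etrans S3 _; apply: Rintegral_eq0 => r _.
  have mSr : measurable_fun setT (fun z => S (z, r)) by exact: measurable_section2.
  have iSr : leb.-integrable period (EFin \o (fun z => S (z, r))).
    by apply: (kernel_dominated_period kK (c := L) mS) => z; exact: SK.
  have := Rintegral_periodic_reflect (- 2 * r) mSr (fun z => Sper z r).
  have -> : \int[leb]_(x in period) S (- 2 * r - x, r) = - \int[leb]_(x in period) S (x, r).
    rewrite -RintegralN//; apply: eq_Rintegral => x _; rewrite -Srefl.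
    by congr (S (_, _)); ring.
  by move=> h; lra.
transitivity (\int[leb]_(z in period) (H (z, 0) - \int[leb]_(r in `[0, t]) S (z, r))).
  apply: eq_Rintegral => z _; exact: (mild_chain z mH (lexx 0) t0).
apply: etrans (RintegralB mp i0 S1) _; by rewrite S0; exact: subr0.
Qed.

Variables rho0 J0 : R -> R.
Hypothesis init : {ae leb, forall x, I01 x -> mild_rho (x, 0) = rho0 x /\ mild_J (x, 0) = J0 x}.

Theorem mild_weak : weak_solution K alpha g rho0 J0 mild_rho mild_J.
Proof.
have [L L0 SK] := src_kernel_bound mH.
have HS z s t : 0 < s -> s <= t -> H (z, t) = H (z, s) - \int[leb]_(r in `[s, t]) S (z, r).
  by move=> /ltW; exact: mild_chain mH.
have Linf (v : R * R -> R) : measurable_fun setT v ->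
    (forall p, `|v p| <= (`|m| + `|M|) + (`|m| + `|M|)) -> forall t, Linfty_I (fun x => v (x, t)).
  move=> mv bv t; apply: (Linfty_intro (B := (`|m| + `|M|) + (`|m| + `|M|))).
    by apply: measurable_funTS; exact: measurable_section2.
  by apply: ae_all => x _; exact: bv.
split.
- by split; exact: measurable_funTS.
- move=> t _; split; apply: Linf => // p.
    by apply: le_trans (ler_normD _ _) _; exact: lerD.
  by apply: le_trans (ler_normB _ _) _; exact: lerD.
- split; apply: fold_L1 => // p q.
    rewrite /mild_rho (_ : _ - _ = (eul H p - eul H q) + (eul H (- p.1, p.2) - eul H (- q.1, q.2))).
      exact: ler_normD.
    by ring.
  rewrite /mild_J (_ : _ - _ = (eul H p - eul H q) - (eul H (- p.1, p.2) - eul H (- q.1, q.2))).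
    exact: ler_normB.
  by ring.
- exact: init.
- move=> phi test; apply: (@folded_identity _ K H S _ L kK bH mS Sper SK L0 HS phi 1 test) => //.
  + by rewrite normr1.
  + by move=> x t _ _; rewrite mul1r.
  + exact: measurable_I01.
  + by move=> x; rewrite /I01/= !in_itv/= => /andP[? ?]; rewrite !ltW.
  + by move=> f; exact: Rintegral_cc_oo.
  + by move=> x t _ _; rewrite /mild_rho /mild_J/=; ring.
move=> phi test.
(* Extended by zero, a momentum test function vanishes on the boundary of the slab, so its odd
   unfolding is continuous. *)
apply: (@folded_identity _ K H S _ L kK bH mS Sper SK L0 HS (zero_ext phi) (-1) (zero_ext_test test)) => //.
- by rewrite normrN normr1.
- by move=> x t; exact: zero_ext_edge.
- by move=> x; rewrite /I01/= !in_itv/= => /andP[? ?]; rewrite !ltW.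
move=> x t xI t0; have Op : open_slab (x, t) by split => //=; rewrite /Rgt0/= in_itv/= t0.
have [-> ->] := zero_ext_partial phi Op; rewrite (zero_ext_in phi Op).
move: xI; rewrite /= in_itv/= => /andP[x0 x1].
by rewrite (eulS t (ltW x0) x1) /mild_rho /mild_J/=; ring.
Qed.

End MildToWeak.

(** * Boundedness of weak solutions and uniqueness *)

Section LocalBoundedness.
Context {R : realType}.
(** [P B t] stands for the bound [B] at time [t], for almost every space variable. [P_reach]
    abstracts the comparison with a bounded solution started at [a]: the bound at [a] persists as
    long as the weak solution is locally bounded. *)
Variable P : R -> R -> Prop.
Hypothesis P_mono : forall B B' t, B <= B' -> P B t -> P B' t.
Hypothesis P_ex : forall t, 0 <= t -> exists B, P B t.
Hypothesis P_closed : forall B t, 0 <= t ->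
  (forall d, 0 < d -> exists r, [/\ 0 <= r, `|r - t| <= d & P B r]) -> P B t.
Hypothesis P_reach : forall a b B, 0 <= a -> P B a ->
  (forall p q, a < p -> q < b -> exists B', forall r, p <= r -> r <= q -> P B' r) ->
  forall t, a <= t -> t < b -> P B t.

Let sing t := 0 <= t /\ forall d B, 0 < d -> exists r, [/\ 0 <= r, `|r - t| < d & ~ P B r].

Let sing_closed t : 0 <= t -> (forall d, 0 < d -> exists r, `|r - t| < d /\ sing r) -> sing t.
Proof.
move=> t0 h; split => // d B d0; have d20 : 0 < d / 2 by exact: divr_gt0.
have [r [rt [r0 /(_ _ B d20)[q [q0 qr nP]]]]] := h _ d20.
exists q; split => //; rewrite (_ : q - t = (q - r) + (r - t)); last by ring.
by apply: le_lt_trans (ler_normD _ _) _; lra.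
Qed.

(** Each time of the segment has a neighbourhood with its own bound; compactness, used along the
    filter [pinfty_nbhs] of large constants, yields one bound for all. *)
Let segment_bounded p q : 0 <= p -> (forall t, p <= t -> t <= q -> ~ sing t) ->
  exists B, forall t, p <= t -> t <= q -> P B t.
Proof.
move=> p0 ns.
have nc := (iffLR (compact_near_coveringP _)) (@segment_compact R p q).
have [|B [_ hB]] := nc R (pinfty_nbhs R) (fun B t => 0 <= t -> P B t) _.
  move=> x; rewrite /= in_itv/= => /andP[px xq].
  have x0 : 0 <= x by exact: le_trans px.
  have [d [B [d0 dB]]] : exists d B, 0 < d /\ forall r, 0 <= r -> `|r - x| < d -> P B r.
    apply: contrapT => nd; apply: (ns x px xq); split => // d B d0; apply: contrapT => nr.
    apply: nd; exists d, B; split => // r r0 rx; apply: contrapT => nP.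
    by apply: nr; exists r.
  exists (ball x d, [set B' | B < B']).
    split; first exact: nbhsx_ballx.
    by exists B; split => //; exact: num_real.
  move=> [x' B'] [/= xx' BB'] x'0; apply: (P_mono (ltW BB')); apply: dB => //.
  by rewrite distrC.
exists (B + 1) => t pt tq; apply: hB => /=; first by rewrite ltrDl.
  by rewrite in_itv/= pt.
exact: le_trans pt.
Qed.

(** The supremum of the times that satisfy [Q]; closedness under limits from the left makes it
    satisfy [Q] as well. *)
Let last_point (Q : R -> Prop) p t : p <= t -> Q p ->
  (forall x, p <= x -> (forall d, 0 < d -> exists r, [/\ p <= r, r <= x, x - d < r & Q r]) -> Q x) ->
  exists x, [/\ p <= x, x <= t, Q x & forall y, x < y -> y <= t -> ~ Q y].
Proof.
move=> pt Qp cQ; pose E := [set x | p <= x <= t /\ Q x].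
have hE : has_sup E.
  split; first by exists p; rewrite /E/= lexx pt.
  by exists t => x [/andP[_ xt] _].
have px : p <= sup E by apply: ub_le_sup; [exact: hE.2|rewrite /E/= lexx pt].
exists (sup E); split => //.
- by apply: ge_sup; [exact: hE.1|move=> x [/andP[_ xt] _]].
- apply: cQ => // d d0; have [r [/andP[pr rt] Qr] rd] := sup_adherent d0 hE.
  exists r; split => //; apply: ub_le_sup; [exact: hE.2|].
  by split => //; rewrite pr.
- move=> y xy yt Qy; suff : y <= sup E by rewrite leNgt xy.
  apply: ub_le_sup; [exact: hE.2|split => //].
  by rewrite yt andbT (le_trans px)// ltW.
Qed.

(** Let [x <= t] be the last time that carries the bound [A] and is either [a] or singular. No
    singular time remains between [x] and [t], so the solution is locally bounded there and
    [P_reach] carries the bound from [x] to [t]. *)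
Let propagate a b A : 0 <= a -> P A a -> (forall t, a <= t -> t < b -> sing t -> P A t) ->
  forall t, a <= t -> t < b -> P A t.
Proof.
move=> a0 PA h t at_ tb.
have [|x xp nx|x [ax xt [Px sx] nx]] := @last_point (fun x => P A x /\ (x = a \/ sing x)) a t at_.
- by split => //; left.
- have Pax : P A x.
    apply: P_closed; first exact: le_trans xp.
    move=> d d0; have [r [ar rx xd [Pr _]]] := nx d d0; exists r; split => //.
      exact: le_trans ar.
    by rewrite ler_norml; apply/andP; split; lra.
  split => //; have [->|xa] := eqVneq x a; [by left|right].
  have ax : a < x by rewrite lt_neqAle eq_sym xa.
  apply: sing_closed; first exact: le_trans xp.
  move=> d d0; have [|r [ar rx xd [_ sr]]] := nx (Num.min d (x - a)).
    by rewrite lt_min d0 subr_gt0.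
  exists r; split.
    have : x - d < r by apply: le_lt_trans xd; rewrite lerD2l lerN2 ge_min lexx.
    by move=> ?; rewrite ltr_norml; apply/andP; split; lra.
  case: sr => // ra; move: xd; rewrite ra ltNge; case/negP.
  rewrite lerBrDr -lerBrDl.
  by rewrite ge_min lexx orbT.
have x0 : 0 <= x by exact: le_trans ax.
have [xt'|tx] := ltP x t; last by rewrite (_ : t = x)//; apply/eqP; rewrite eq_le tx xt.
have nst y : x < y -> y <= t -> ~ sing y.
  move=> xy yt sy; apply: (nx y xy yt); split; last by right.
  by apply: h => //; [exact/ltW/(le_lt_trans ax)|exact: le_lt_trans tb].
(* [P_reach] stops short of the right end and needs room beyond [t]; there is some, since [t] is not
   singular and the singular times form a closed set. *)
have [d d0 hd] : exists2 d, 0 < d & forall y, t <= y -> y < t + d -> ~ sing y.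
  apply: contrapT => nd; apply: (nst t xt' (lexx _)).
  apply: sing_closed; first exact: le_trans at_.
  move=> d d0; apply: contrapT => nr; apply: nd; exists d => // y ty yd sy.
  by apply: nr; exists y; split => //; rewrite ger0_norm; lra.
apply: (@P_reach x (t + d) A x0 Px) => // [p q xp qd|]; last by rewrite ltrDl.
apply: segment_bounded; first exact: le_trans (ltW xp).
move=> y py yq; have xy : x < y by exact: lt_le_trans py.
have [yt|ty] := leP y t; first exact: nst.
by apply: hd; [exact: ltW|exact: le_lt_trans qd].
Qed.

(* The singular times form a closed set, covered by the closed sets on which
   the bound [n] holds; Baire's theorem makes one bound hold on a relatively
   open part of it, and [propagate] extends that bound to a neighbourhood. *)
Let sing_uniform t : sing t -> exists c d (n : nat), [/\ sing c, 0 < d &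
  forall r, sing r -> `|r - c| < d -> P n%:R r].
Proof.
move=> st; apply: contrapT => nu.
have step (x : nat * R * R) : exists y : R * R, sing x.1.2 -> 0 < x.2 ->
    [/\ sing y.1, 0 < y.2, x.1.2 - x.2 <= y.1 - y.2, y.1 + y.2 <= x.1.2 + x.2 &
     forall r, 0 <= r -> `|r - y.1| <= y.2 -> ~ P x.1.1%:R r].
  case: x => -[n c] d /=.
  have [[sc d0]|nh] := pselect (sing c /\ 0 < d); last by exists (0, 0) => ? ?; case: nh.
  have [r [sr rc nP]] : exists r, [/\ sing r, `|r - c| < d & ~ P n%:R r].
    apply: contrapT => nr; apply: nu; exists c, d, n; split => // r sr rc.
    by apply: contrapT => nP; apply: nr; exists r.
  have [e e0 he] : exists2 e, 0 < e & forall q, 0 <= q -> `|q - r| <= e -> ~ P n%:R q.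
    apply: contrapT => ne; apply: nP; apply: P_closed; first by case: sr.
    move=> e e0; apply: contrapT => nq; apply: ne; exists e => // q q0 qr Pq.
    by apply: nq; exists q.
  have m0 : 0 < Num.min e (d - `|r - c|) by rewrite lt_min e0 subr_gt0.
  have m1 : Num.min e (d - `|r - c|) <= d - `|r - c| by rewrite ge_min lexx orbT.
  have m2 : Num.min e (d - `|r - c|) <= e by rewrite ge_min lexx.
  exists (r, Num.min e (d - `|r - c|)) => _ _ /=; split => //.
  - by have := ler_norm (- (r - c)); rewrite normrN; lra.
  - by have := ler_norm (r - c); lra.
  - by move=> q q0 qr; apply: he => //; exact: le_trans m2.
have [f hf] := choice step.
pose z := fix z n : R * R := if n is n'.+1 then f (n', (z n').1, (z n').2) else (t, 1).
have zi n : sing (z n).1 /\ 0 < (z n).2.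
  by elim: n => [|n [h1 h2]] /=; [split; [exact: st|exact: ltr01]|have [] := hf (n, (z n).1, (z n).2) h1 h2].
have zS n : [/\ (z n).1 - (z n).2 <= (z n.+1).1 - (z n.+1).2,
     (z n.+1).1 + (z n.+1).2 <= (z n).1 + (z n).2 &
     forall r, 0 <= r -> `|r - (z n.+1).1| <= (z n.+1).2 -> ~ P n%:R r].
  by have [h1 h2] := zi n; have [] := hf (n, (z n).1, (z n).2) h1 h2.
clearbody z.
(* The nested intervals on which the successive integer bounds fail have a common point; truncating
   the left ends at 0 keeps it a nonnegative time, where [P_ex] supplies a bound. *)
pose lo n := Num.max 0 ((z n).1 - (z n).2); pose up n := (z n).1 + (z n).2.
have lou n : lo n <= up n.
  have [[c0 _] d0] := zi n; rewrite ge_max /up addr_ge0 ?(ltW d0)//=.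
  by apply: lerD => //; rewrite lerNl (le_trans _ (ltW d0))// oppr_le0 ltW.
have lo_nd n k : lo n <= lo (n + k)%N.
  elim: k => [|k IH]; first by rewrite addn0.
  rewrite addnS; apply: le_trans IH _; have [h _ _] := zS (n + k)%N.
  by rewrite /lo ge_max le_max lexx/= le_max h orbT.
have up_ni n k : up (n + k)%N <= up n.
  elim: k => [|k IH]; first by rewrite addn0.
  by rewrite addnS; apply: le_trans IH; have [_ h _] := zS (n + k)%N.
have lo_up i j : lo i <= up j.
  have [ij|ji] := leqP i j.
    by rewrite -(subnKC ij); apply: le_trans (lo_nd i (j - i)%N) _.
  by rewrite -(subnKC (ltnW ji)); apply: le_trans (lou _) _.
have hs : has_sup (range lo).
  split; first by exists (lo 0), 0%N.
  by exists (up 0%N) => _ [n _ <-]; exact: lo_up.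
pose x := sup (range lo).
have lox n : lo n <= x by apply: ub_le_sup; [exact: hs.2|exists n].
have xup n : x <= up n.
  by apply: ge_sup; [exact: hs.1|move=> _ [i _ <-]; exact: lo_up].
have x0 : 0 <= x by apply: le_trans (lox 0%N); rewrite le_max lexx.
have [B PB] := P_ex x0.
pose N := Num.truncn B; have [_ _ /(_ x x0)] := zS N.+1.
apply; last by apply: P_mono PB; exact/ltW/truncnS_gt.
rewrite ler_norml; apply/andP; split.
  by have := lox N.+2; rewrite /lo ge_max => /andP[_]; lra.
by have := xup N.+2; rewrite /up; lra.
Qed.

(** A singular time would yield a singular [c] with one bound [n] at all singular times near it.
    From [p], where some bound [B] holds, the larger of the two propagates over [[p], [c + d][, a
    neighbourhood of [c] in the half-line, so [c] is not singular. *)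
Lemma bounded_on_segments q : exists B, forall t, 0 <= t -> t <= q -> P B t.
Proof.
apply: (@segment_bounded 0 q (lexx _)) => t _ _ /sing_uniform[c [d [n [sc d0 hn]]]].
have [c0 hc] := sc; pose p := Num.max 0 (c - d / 2).
have p0 : 0 <= p by rewrite le_max lexx.
have pc : c - d / 2 <= p by rewrite le_max lexx orbT.
have [B PB] := P_ex p0; pose A := Num.max n%:R B.
have nA : n%:R <= A by rewrite le_max lexx.
have BA : B <= A by rewrite le_max lexx orbT.
have d2 : 0 < d / 2 by exact: divr_gt0.
have PA : forall r, p <= r -> r < c + d -> P A r.
  apply: propagate => //; first exact: P_mono PB.
  move=> r pr rc sr; apply: (P_mono nA); apply: hn => //.
  by rewrite ltr_norml; apply/andP; split; lra.
have [r [r0 rc nP]] := hc _ A d2; apply: nP; move: rc; rewrite ltr_norml => /andP[? ?].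
by apply: PA; [rewrite /p ge_max r0/=; lra|lra].
Qed.

End LocalBoundedness.

Lemma Rintegral_norm_le0 (R : realType) (D : set (measurableTypeR R)) (f : R -> R) : measurable D ->
  leb.-integrable D (EFin \o f) -> \int[leb]_(x in D) `|f x| <= 0 ->
  {ae leb, forall x, D x -> f x = 0}.
Proof.
move=> mD fi f0.
have fn := int_norm fi.
have : (\int[leb]_(x in D) `|(EFin \o f) x| = 0)%E.
  apply/eqP; rewrite eq_le integral_ge0// andbT.
  rewrite -(fineK (integrable_fin_num mD fn)) lee_fin; exact: f0.
have mf := measurable_int _ fi.
move=> /(ae_eq_integral_abs leb mD mf).
by apply: ae_imply => x h Dx; have := h Dx => -[].
Qed.

Section WeakSections.
Context {R : realType}.
Variables (K alpha g rho0 J0 : R -> R) (rho J : R * R -> R).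
Hypothesis ws : weak_solution K alpha g rho0 J0 rho J.

Let u := unf rho J.

Let mu : measurable_fun setT u.
Proof. by have [m1 m2] := ws_measurable ws; exact: measurable_unf. Qed.

Let mp : measurable (period : set (measurableTypeR R)). Proof. exact: measurable_period. Qed.

(** The excess of [|u|] over [B] at time [t] is dominated by [|u (y, r) - u (y, t)|] for every [r]
    with the bound, so its integral is below every positive number. *)
Lemma unf_bound_closed B t : 0 <= t ->
  (forall d, 0 < d -> exists r, [/\ 0 <= r, `|r - t| <= d & {ae leb, forall y, `|u (y, r)| <= B}]) ->
  {ae leb, forall y, `|u (y, t)| <= B}.
Proof.
move=> t0 h; pose w y := Num.max (`|u (y, t)| - B) 0.
have w0 y : 0 <= w y by rewrite le_max lexx orbT.
have mut r : measurable_fun setT (fun y => u (y, r)) by exact: measurable_section2.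
have mw : measurable_fun setT w.
  apply: measurable_maxr => //; apply: measurable_funB => //; exact: measurableT_comp.
have it := unf_integrable ws t0.
have iw : leb.-integrable period (EFin \o w).
  apply: (@dominated_integrable _ _ _ (fun y => `|u (y, t)| + `|B|)) => //.
  - exact: measurable_funTS.
  - by apply: int_add => //; [exact: int_norm|apply: int_cst => //; exact: leb_itv_lty].
  - move=> y _; rewrite ger0_norm// ge_max addr_ge0// andbT lerD2l.
    by rewrite -normrN ler_norm.
have : {ae leb, forall y, period y -> w y = 0}.
  apply: Rintegral_norm_le0 => //; apply/ler_addgt0Pr => e e0; rewrite add0r.
  have [d d0 hd] := unf_L1_continuous ws t0 e0.
  have [r [r0 rt ub]] := h d d0; apply: le_trans (hd r r0 rt).
  have ir := unf_integrable ws r0.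
  have iwn := int_norm iw; have id := int_norm (int_sub mp ir it).
  apply: (ae_le_Rintegral mp iwn id); apply: ae_imply ub => y uB.
  rewrite ger0_norm// ge_max normr_ge0 andbT lerBlDr distrC.
  have := ler_normD (u (y, t) - u (y, r)) (u (y, r)).
  by rewrite subrK => /le_trans; apply; rewrite lerD2l.
move=> hw; apply: ae_periodic; first by move=> x; rewrite /u unf_periodic.
apply: ae_imply hw => y /[apply] wy; rewrite -subr_le0 -wy.
by rewrite le_max lexx.
Qed.

End WeakSections.

(** * Comparison of a weak solution with a bounded one *)

Section Comparison.
Context {R : realType}.
Variables (K alpha g rho0 J0 : R -> R) (rho J : R * R -> R).
Hypotheses (kK : kernel K) (wa : weight alpha) (dg : damping g).
Hypothesis ws : weak_solution K alpha g rho0 J0 rho J.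

Let u := unf rho J.

Let mu : measurable_fun setT u.
Proof. by have [m1 m2] := ws_measurable ws; exact: measurable_unf. Qed.
Let uper y t : u (y + 2, t) = u (y, t). Proof. exact: unf_periodic. Qed.

Let mp : measurable (period : set (measurableTypeR R)). Proof. exact: measurable_period. Qed.
Let pfin : (leb (period : set R) < +oo)%E. Proof. exact: leb_itv_lty. Qed.

Variables (a b m M : R) (H : R * R -> R).
Hypothesis a0 : 0 <= a.
Hypothesis mH : mild K alpha g m M a H.
Hypothesis init : {ae leb, forall z, lag u (z, a) = H (z, a)}.
Hypothesis lb : forall p q, a < p -> q < b -> exists B, forall r, p <= r -> r <= q ->
  {ae leb, forall y, `|u (y, r)| <= B}.

Let bH : bounded_periodic (`|m| + `|M|) H. Proof. exact: mild_bounded_periodic mH. Qed.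

Let D r := \int[leb]_(z in period) `|lag u (z, r) - H (z, r)|.

Let mlag r : measurable_fun setT (fun z => lag u (z, r)).
Proof. by apply: measurable_section2; exact: measurable_lag. Qed.
Let mHr r : measurable_fun setT (fun z => H (z, r)).
Proof. by apply: measurable_section2; exact: bp_meas bH. Qed.
Let mD r : measurable_fun setT (fun z => `|lag u (z, r) - H (z, r)|).
Proof. by apply: measurableT_comp => //; exact: measurable_funB. Qed.

Let lag_int r : 0 <= r -> leb.-integrable period (EFin \o (fun z => lag u (z, r))).
Proof.
move=> r0; have [B B0 hB] := unf_section_bound ws r0.
apply: (@ae_bounded_integrable _ _ mp _ B pfin); first exact: measurable_funTS.
by apply: ae_imply (ae_shift r hB).
Qed.

Let H_int r : leb.-integrable period (EFin \o (fun z => H (z, r))).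
Proof. by apply: bounded_integrable_period => // z; exact: bp_bound bH _. Qed.

Let mild_amild c t : a <= c -> amild K alpha g c t H.
Proof.
move=> ac s r cs sr rt; apply: ae_all => z.
exact: (mild_chain kK wa dg z mH (le_trans ac cs) sr).
Qed.

(** On [[c], [t]] the weak solution is bounded, so its clamped version satisfies the integral
    equation and the contraction applies; [p] and [q] leave room on both sides inside ][a], [b][. *)
Let D_nonincreasing c t : a < c -> c <= t -> t < b -> D t <= D c.
Proof.
move=> ac ct tb; pose p := (a + c) / 2; pose q := (t + b) / 2.
have [ap pc tq qb] : [/\ a < p, p < c, t < q & q < b] by rewrite /p /q; split; lra.
have [B' hB'] := lb ap qb; clearbody p q.
pose B := Num.max B' (`|m| + `|M|).
have B0 : 0 <= B by rewrite le_max addr_ge0 ?orbT.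
have ub r : p < r -> r < q -> {ae leb, forall y, `|u (y, r)| <= B}.
  move=> /ltW pr /ltW rq; apply: ae_imply (hB' r pr rq) => y h.
  by rewrite le_max h.
have p0 : 0 <= p by exact: le_trans (ltW ap).
pose F p := clamp (- B) B (u p).
have aF : amild K alpha g c t (lag F) by exact: (weak_amild kK wa dg ws B0 p0 ub pc tq).
have bF : bounded_periodic B (lag F) by exact: (clamped_bounded_periodic ws B0).
have bH' : bounded_periodic B H.
  split; [exact: bp_meas bH| |exact: bp_periodic bH].
  by move=> x; apply: le_trans (bp_bound bH x) _; rewrite le_max lexx orbT.
have aH : amild K alpha g c t H := mild_amild (ltW ac).
have DE r : c <= r -> r <= t -> Ldist (lag F) H r = D r.
  move=> cr rt; apply: ae_eq_Rintegral => //.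
    apply: measurableT_comp => //; apply: measurable_funB => //.
    by apply: measurable_section2; exact: bp_meas bF.
  have pr : p < r by exact: lt_le_trans cr.
  have rq : r < q by exact: le_lt_trans tq.
  apply: ae_imply (ae_shift r (ub r pr rq)) => z; rewrite ler_norml => h.
  by rewrite /lag /F clamp_id.
rewrite -(DE t ct (lexx _)) -(DE c (lexx _) ct).
exact: (Ldist_nonincreasing kK wa dg bF bH' aF aH (lexx _) ct (lexx _)).
Qed.

(** No uniform bound is available just after [a], so continuity is used instead: of [u] in L^1, of
    the translations of the bounded datum (the Lagrangian variable moves with time), and of [H]
    uniformly. The errors are [e / 4], [e / 4] and twice [e / 8]. *)
Let D_small t e : a < t -> 0 < e -> exists c, [/\ a < c, c <= t & D c <= e].
Proof.
move=> at_ e0; have e4 : 0 < e / 4 by exact: divr_gt0.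
have e8 : 0 < e / 8 by exact: divr_gt0.
have [d1 d10 h1] := unf_L1_continuous ws a0 e4.
have [B B0 hB] := unf_section_bound ws a0.
pose F y := clamp (- B) B (u (y, a)).
have mF : measurable_fun setT F.
  by apply: measurable_clamp; exact: measurable_section2.
have FB y : `|F y| <= B.
  by rewrite ler_norml /F; apply: clamp_itv; rewrite -subr_ge0 opprK addr_ge0.
have Fper y : F (y + 2) = F y by rewrite /F uper.
have Fu : {ae leb, forall y, F y = u (y, a)}.
  by apply: ae_imply hB => y; rewrite ler_norml => h; rewrite /F clamp_id.
clearbody F.
have [d2 d20 h2] := L1_translation mF FB e4.
have [d3 d30 h3] := mild_modulus kK wa dg mH e8.
pose d := Num.min (Num.min d1 d2) (Num.min d3 (t - a)).
have d0 : 0 < d by rewrite !lt_min d10 d20 d30 subr_gt0.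
have [dd1 dd2 dd3 dt] : [/\ d <= d1, d <= d2, d <= d3 & d <= t - a].
  by rewrite /d; split; rewrite !ge_min lexx ?orbT.
exists (a + d); split; [by rewrite ltrDl|by rewrite -lerBrDl|].
clearbody d; set c := a + d.
have ca : c - a = d by rewrite /c addrAC subrr add0r.
have nca : `|c - a| = d by rewrite ca ger0_norm ?ltW.
have c0 : 0 <= c by rewrite addr_ge0// ltW.
pose w1 z := `|u (z + c, c) - u (z + c, a)|.
pose w2 z := `|F (z + c) - F (z + a)|.
have e1 : \int[leb]_(z in period) w1 z <= e / 4.
  have mv : measurable_fun setT (fun y => `|u (y, c) - u (y, a)|).
    by apply: measurableT_comp => //; apply: measurable_funB; exact: measurable_section2.
  have pv : periodic2 (fun y => `|u (y, c) - u (y, a)|) by move=> y; rewrite !uper.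
  apply: le_trans (h1 c c0 _); last by rewrite nca.
  by rewrite (Rintegral_periodic_shift c mv pv).
have i1 : leb.-integrable period (EFin \o w1).
  apply: int_norm; apply: int_sub => //; first exact: lag_int.
  apply: (@ae_bounded_integrable _ _ mp _ B pfin).
    by apply: measurable_funTS; apply: (measurableT_comp (measurable_section2 a mu)); apply: measurable_funD.
  by apply: ae_imply (ae_shift c hB).
have mFs r : measurable_fun setT (fun z : R => F (z + r)).
  by apply: (measurableT_comp mF); apply: measurable_funD.
have mw2 : measurable_fun setT w2.
  by apply: measurableT_comp => //; exact: measurable_funB.
have e2 : \int[leb]_(z in period) w2 z <= e / 4.
  have pw2 : periodic2 w2 by move=> y; rewrite /w2 !(addrAC _ 2) !Fper.
  have := h2 (c - a); rewrite nca => /(_ dd2); apply: le_trans.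
  rewrite -(Rintegral_periodic_shift (- a) mw2 pw2).
  have -> // : (fun x => w2 (x - a)) = (fun y => `|F (y + (c - a)) - F y|).
  by apply/funext => y; rewrite /w2 subrK -addrA (addrC (- a)).
have i2 : leb.-integrable period (EFin \o w2).
  apply: (bounded_integrable_period (B := B + B)) => // z.
  by rewrite normr_id; apply: le_trans (ler_normB _ _) _; exact: lerD.
have i3 : leb.-integrable period (EFin \o cst (e / 8)) by exact: int_cst.
have iD := int_norm (int_sub mp (lag_int c0) (H_int c)).
have i12 := int_add mp i1 i2; have i123 := int_add mp i12 i3.
apply: (@le_trans _ _ (\int[leb]_(z in period) (w1 z + w2 z + cst (e / 8) z))).
  apply: (ae_le_Rintegral mp iD i123).
  apply: ae_imply (ae_and init (ae_and (ae_shift a Fu) (ae_shift c Fu))) => z [].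
  rewrite /lag/= => ia [Fa Fc].
  rewrite (_ : u (z + c, c) - H (z, c) = (u (z + c, c) - u (z + c, a)) +
      (F (z + c) - F (z + a)) - (H (z, c) - H (z, a))); last by rewrite Fa Fc ia; ring.
  apply: le_trans (ler_normB _ _) _; apply: lerD; first exact: ler_normD.
  by apply: h3; rewrite ?nca// ltW// /c ltrDl.
rewrite (RintegralD mp i12 i3) (RintegralD mp i1 i2) Rintegral_period_cst.
apply: (le_trans (lerD (lerD e1 e2) (lexx _))).
rewrite (_ : _ + _ = e - e / 4); last by field.
by rewrite lerBlDr lerDl ltW.
Qed.

(** The distance does not increase after any [c > a], and it is arbitrarily small for suitable
    [c]. *)
Lemma mild_match t : a <= t -> t < b -> {ae leb, forall z, lag u (z, t) = H (z, t)}.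
Proof.
rewrite le_eqVlt => /predU1P[<-//|at_] tb.
have t0 : 0 <= t by apply: (le_trans a0); exact: ltW.
have D0 : D t <= 0.
  apply/ler_addgt0Pr => e e0; rewrite add0r; have [c [ac ct]] := D_small at_ e0.
  by apply: le_trans; exact: D_nonincreasing.
have := Rintegral_norm_le0 mp (int_sub mp (lag_int t0) (H_int t)) D0.
move=> h; apply: ae_periodic.
  by move=> z; rewrite (lag_periodic (F := u))// (bp_periodic bH).
by apply: ae_imply h => z /[apply] /eqP; rewrite subr_eq0 => /eqP.
Qed.

End Comparison.

Section Uniqueness.
Context {R : realType}.
Variables (K alpha g rho0 J0 : R -> R) (rho J : R * R -> R).
Hypotheses (kK : kernel K) (wa : weight alpha) (dg : damping g).
Hypothesis ws : weak_solution K alpha g rho0 J0 rho J.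

Let u := unf rho J.

(** The solution of the integral equation started at [a] from the clamped value of [u] stays in
    [[- B], [B]], and the comparison identifies it with the weak solution before [b]. A negative [B]
    makes the hypothesis absurd. *)
Let bound_reach a b B : 0 <= a -> {ae leb, forall y, `|u (y, a)| <= B} ->
  (forall p q, a < p -> q < b -> exists B', forall r, p <= r -> r <= q ->
    {ae leb, forall y, `|u (y, r)| <= B'}) ->
  forall t, a <= t -> t < b -> {ae leb, forall y, `|u (y, t)| <= B}.
Proof.
move=> a0 uB lb t at_ tb; have [B0|Bneg] := leP 0 B; last first.
  apply: ae_imply uB => y /(le_trans (normr_ge0 _)) B0.
  by have := le_lt_trans B0 Bneg; rewrite ltxx.
have mu : measurable_fun setT u by have [m1 m2] := ws_measurable ws; exact: measurable_unf.
have BB : - B <= B by rewrite -subr_ge0 opprK addr_ge0.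
pose H0 z := clamp (- B) B (lag u (z, a)).
have mH0 : measurable_fun setT H0.
  by apply: measurable_clamp; apply: measurable_section2; exact: measurable_lag.
have pH0 : periodic2 H0.
  by move=> z; rewrite /H0 lag_periodic// => y r; exact: unf_periodic.
have H0B z : - B <= H0 z <= B by exact: clamp_itv.
have [H mH HH0] := mild_exists kK wa dg a BB mH0 pH0 H0B.
have init : {ae leb, forall z, lag u (z, a) = H (z, a)}.
  apply: ae_imply (ae_shift a uB) => z; rewrite ler_norml => h.
  by rewrite HH0 /H0 clamp_id.
have := mild_match kK wa dg ws a0 mH init lb at_ tb.
move=> /(ae_shift (- t)); apply: ae_imply => y; rewrite /lag/= subrK /u => ->.
by rewrite ler_norml; exact: mild_bound mH _.
Qed.

Lemma weak_bounded q : exists B, forall t, 0 <= t -> t <= q -> {ae leb, forall y, `|u (y, t)| <= B}.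
Proof.
apply: (@bounded_on_segments _ (fun B t => {ae leb, forall y, `|u (y, t)| <= B})).
- by move=> B B' t BB'; apply: ae_imply => y /le_trans; exact.
- by move=> t t0; have [B _ hB] := unf_section_bound ws t0; exists B.
- exact: unf_bound_closed ws.
- exact: bound_reach.
Qed.

Lemma weak_unique m M H : mild K alpha g m M 0 H ->
  {ae leb, forall y, u (y, 0) = H (y, 0)} ->
  forall t, 0 <= t -> {ae leb, forall x, I01 x ->
    rho (x, t) = mild_rho H (x, t) /\ J (x, t) = mild_J H (x, t)}.
Proof.
move=> mH init t t0.
have init' : {ae leb, forall z, lag u (z, 0) = H (z, 0)}.
  by apply: ae_imply init => z; rewrite /lag/= addr0.
have lb p q : 0 < p -> q < t + 1 -> exists B, forall r, p <= r -> r <= q ->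
    {ae leb, forall y, `|u (y, r)| <= B}.
  move=> p0 _; have [B hB] := weak_bounded q; exists B => r pr; apply: hB.
  exact: le_trans (ltW p0) pr.
have tt1 : t < t + 1 by rewrite ltrDl.
have := mild_match kK wa dg ws (lexx _) mH init' lb t0 tt1.
move=> /(ae_shift (- t)) h.
have n0 : {ae leb, forall x : R, x <> 0} by exact: ae_neq.
have n1 : {ae leb, forall x : R, x <> 1} by exact: ae_neq.
apply: ae_imply (ae_and (ae_and n0 n1) (ae_and h (ae_reflect 0 h))) => x [[x0 x1]].
rewrite /lag/= sub0r !subrK => -[e1 e2]; rewrite /I01/= in_itv/= => /andP[x0' x1'].
have [||-> ->] := @unf_sum _ rho J x t _ _ t0.
- by rewrite lt_neqAle x0' andbT eq_sym; apply/eqP.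
- by rewrite lt_neqAle x1' andbT; apply/eqP.
by rewrite e1 e2 /mild_rho /mild_J /eul.
Qed.

End Uniqueness.

(** * Data defined almost everywhere *)

Section ProductAlmostEverywhere.
Context {R : realType}.

Lemma ae_product_fst (P : R -> Prop) : {ae leb, forall x, P x} ->
  {ae (leb \x leb)%E, forall p, P p.1}.
Proof.
move=> [N [mN N0 PN]]; exists (N `*` setT); split.
- exact: measurableX.
- apply: etrans (product_measure1E leb leb mN (@measurableT _ _)) _.
  by apply: etrans (congr1 (fun c => c * _)%E N0) _; exact: mul0e.
- by move=> p /= nP; split => //; apply: PN.
Qed.

Lemma ae_product_snd (P : R -> Prop) : {ae leb, forall x, P x} ->
  {ae (leb \x leb)%E, forall p, P p.2}.
Proof.
move=> [N [mN N0 PN]]; exists (setT `*` N); split.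
- exact: measurableX.
- apply: etrans (product_measure1E leb leb (@measurableT _ _) mN) _.
  by apply: etrans (congr1 (fun c => _ * c)%E N0) _; exact: mule0.
- by move=> p /= nP; split => //; apply: PN.
Qed.

Let mpos : measurable (Rgt0 : set (measurableTypeR R)). Proof. exact: measurable_itv. Qed.

Lemma iterated_integral (X : set (measurableTypeR R)) (h : R * R -> R) : measurable X ->
  ((leb \x leb)%E).-integrable (X `*` Rgt0) (EFin \o h) ->
  (\int[leb]_(t in Rgt0) \int[leb]_(x in X) (h (x, t))%:E =
   \int[(leb \x leb)%E]_(p in X `*` Rgt0) (h p)%:E)%E.
Proof.
move=> mX ih; have mD : measurable (X `*` Rgt0 : set (measurableTypeR R * measurableTypeR R)).
  exact: measurableX.
pose F := (EFin \o h) \_ (X `*` Rgt0).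
have iF : ((leb \x leb)%E).-integrable setT F by exact: (iffLR (integrable_mkcond _ mD)) ih.
rewrite [RHS]integral_mkcond -/F -(integral21_prod_meas1 iF) [LHS]integral_mkcond.
apply: eq_integral => t _; rewrite patchE; case: ifPn => tR.
  rewrite integral_mkcond; apply: eq_integral => x _.
  by rewrite /F !patchE in_setX tR andbT.
apply/esym/integral0_eq => x _.
by rewrite /F patchE in_setX (negbTE tR) andbF.
Qed.

Lemma integrates_to_zero_ae (X : set (measurableTypeR R)) (h h' : R * R -> R) : measurable X ->
  measurable_fun (X `*` Rgt0) h' ->
  {ae (leb \x leb)%E, forall p, (X `*` Rgt0) p -> h p = h' p} ->
  integrates_to_zero X h -> integrates_to_zero X h'.
Proof.
move=> mX mh' hh [ih zh].
have mD : measurable (X `*` Rgt0 : set (measurableTypeR R * measurableTypeR R)).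
  exact: measurableX.
have mh := measurable_int _ ih; have /integrableP[_ fin] := ih.
have mE : measurable_fun (X `*` Rgt0) (EFin \o h') by exact/measurable_EFinP.
have ih' : ((leb \x leb)%E).-integrable (X `*` Rgt0) (EFin \o h').
  apply/integrableP; split => //; apply: le_lt_trans fin; rewrite le_eqVlt; apply/orP; left.
  apply/eqP; apply: ae_eq_integral => //; [exact: measurableT_comp|exact: measurableT_comp|].
  by apply: ae_imply hh => p e /e /= ->.
split; first exact: ih'.
rewrite (iterated_integral mX ih') -zh (iterated_integral mX ih).
apply: ae_eq_integral => //.
by apply: ae_imply hh => p e /e /= ->.
Qed.

(** [k] and [alpha] enter only the momentum equation; a null set of [x] times the line, and the line
    times a null set of [t], are null in the plane. *)
Lemma weak_solution_ae (k k' alpha alpha' g rho0 J0 : R -> R) (rho J : R * R -> R) :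
  measurable_fun I01 k -> measurable_fun I01 k' ->
  measurable_fun Rge0 alpha -> measurable_fun Rge0 alpha' -> measurable_fun setT g ->
  {ae leb, forall x, I01 x -> k x = k' x} ->
  {ae leb, forall t, Rge0 t -> alpha t = alpha' t} ->
  weak_solution k alpha g rho0 J0 rho J -> weak_solution k' alpha' g rho0 J0 rho J.
Proof.
move=> mk mk' ma ma' mg kk aa ws; have [[mr mj] Li cont init mass mom] := ws.
split; [by split|exact: Li|exact: cont|exact: init|exact: mass|move=> phi test].
pose h p := J p * partial_t phi p + rho p * partial_x phi p - 2 * k p.1 * alpha p.2 * g (J p) * phi p.
have mX : measurable (`]0, 1[%classic : set (measurableTypeR R)) by exact: measurable_itv.
have sub01 (x : R) : `]0, 1[%classic x -> I01 x :> Prop.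
  by rewrite /I01/= !in_itv/= => /andP[? ?]; rewrite !ltW.
have sub0 (t : R) : Rgt0 t -> Rge0 t :> Prop.
  by rewrite /Rgt0 /Rge0/= !in_itv/= !andbT => /ltW.
have mD : measurable (`]0, 1[%classic `*` Rgt0 : set (measurableTypeR R * measurableTypeR R)).
  exact: measurableX.
have comp1 (f : R -> R) : measurable_fun I01 f -> measurable_fun (open_slab : set (R * R)) (fun p : R * R => f p.1).
  move=> mf; apply: (measurable_comp (F := I01)) => //; first exact: measurable_I01.
  - by move=> _ [[x t] [/= /sub01 Ix _] <-].
  - by apply: measurable_funTS; exact: measurable_fst.
have comp2 (f : R -> R) : measurable_fun Rge0 f -> measurable_fun (open_slab : set (R * R)) (fun p : R * R => f p.2).
  move=> mf; apply: (measurable_comp (F := Rge0)) => //; first exact: measurable_itv.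
  - by move=> _ [[x t] [_ /= /sub0 It] <-].
  - by apply: measurable_funTS; exact: measurable_snd.
have mJ : measurable_fun (open_slab : set (R * R)) J.
  apply: measurable_funS mj; first by apply: measurableX; exact: measurable_itv.
  by move=> [x t] [/= /sub01 ? /sub0 ?].
have mphi : measurable_fun (open_slab : set (R * R)) phi.
  have [m1 _ _] := test_measurable (zero_ext_test test).
  have m2 : measurable_fun (open_slab : set (R * R)) (zero_ext phi).
    apply: measurable_funS m1; first exact: measurable_slab.
    exact: open_slab_sub.
  apply: eq_measurable_fun m2 => p; rewrite inE => Op; exact: zero_ext_in.
have mgJ : measurable_fun (open_slab : set (R * R)) (fun p => g (J p)).
  exact: (measurableT_comp mg).
pose w (k : R -> R) (alpha : R -> R) p := 2 * k p.1 * alpha p.2 * g (J p) * phi p.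
have mw q b : measurable_fun I01 q -> measurable_fun Rge0 b ->
    measurable_fun (open_slab : set (R * R)) (w q b).
  move=> mq mb; apply: measurable_funM => //; apply: measurable_funM => //.
  apply: measurable_funM; last exact: comp2.
  by apply: measurable_funM => //; exact: comp1.
have mh : measurable_fun (open_slab : set (R * R)) h.
  by have [ih _] := mom phi test; have := measurable_int _ ih; move/measurable_EFinP.
apply: (integrates_to_zero_ae mX _ _ (mom phi test)).
  rewrite (_ : (fun p => _) = (fun p => h p + (w k alpha p - w k' alpha' p))).
    by apply: measurable_funD => //; apply: measurable_funB; exact: mw.
  by apply/funext => p; rewrite /h /w; ring.
apply: ae_imply (ae_and (ae_product_fst kk) (ae_product_snd aa)) => -[x t] [/= ek ea] [/= Xx t0].
by rewrite ek ?ea//; [exact: sub0|exact: sub01].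
Qed.

End ProductAlmostEverywhere.

(** * Data with the required properties at every point *)

Section CleanData.
Context {R : realType}.

(** The even 2-periodic extension. When [k] is nonnegative almost everywhere, the maximum with 0
    alters it on a null set only and makes nonnegativity hold everywhere. *)
Definition unfold_kernel (k : R -> R) (y : R) := Num.max 0 ((k \_ I01) `|rep y|).

(** Reflection commutes with [rep] except where [rep y] is -1, a point that is its own mirror image
    modulo 2. *)
Lemma abs_rep_opp (y : R) : `|rep (- y)| = `|rep y|.
Proof.
have := rep_period y; rewrite -rep_repN /period/= in_itv/= le_eqVlt => /andP[/predU1P[e _|y1 y2]].
  by rewrite -e opprK (_ : rep 1 = -1) // -[1 in LHS](addrNK 2) rep_periodic rep_id ?/period/= ?in_itv/=; lra.
by rewrite rep_id ?normrN// /period/= in_itv/= lerN2 ltrNl y1 ltW.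
Qed.

Lemma unfold_kernelE (k : R -> R) x : I01 x -> 0 <= k x -> unfold_kernel k x = k x.
Proof.
move=> Ix k0; have := Ix; rewrite /I01/= in_itv/= => /andP[x0 x1].
have e : `|rep x| = x.
  move: x1; rewrite le_eqVlt => /predU1P[->|x1].
    have := abs_rep_opp 1; rewrite rep_id ?normrN1//.
    by rewrite /period/= in_itv/=; lra.
  by rewrite rep_id ?ger0_norm// /period/= in_itv/=; lra.
by rewrite /unfold_kernel e patchE mem_set// max_r.
Qed.

Lemma unfold_kernel_kernel (k : R -> R) : leb.-integrable I01 (EFin \o k) -> kernel (unfold_kernel k).
Proof.
move=> ik; have mI := @measurable_I01 R.
have mk : measurable_fun setT (k \_ I01).
  by apply/(measurable_restrictT _ mI)/measurable_EFinP; exact: measurable_int ik.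
have mK : measurable_fun setT (unfold_kernel k).
  apply: measurable_maxr => //; apply: (measurableT_comp mk); apply: measurableT_comp => //.
  exact: measurable_rep.
have iT : leb.-integrable setT (EFin \o (k \_ I01)).
  rewrite (_ : EFin \o _ = (EFin \o k) \_ I01); first exact: (iffLR (integrable_mkcond _ mI)) ik.
  by apply/funext => x; rewrite /= !patchE; case: ifP.
have iN := integrable_isom 0 (or_intror (erefl (-1 : R))) (@measurableT _ (measurableTypeR R)) mk iT.
rewrite preimage_setT in iN.
split => //.
- by move=> x; rewrite le_max lexx.
- by move=> x; rewrite /unfold_kernel rep_periodic.
- by move=> x; rewrite /unfold_kernel abs_rep_opp.
have mp : measurable (period : set (measurableTypeR R)) := @measurable_period R.
have i2 := int_add (@measurableT _ (measurableTypeR R)) (int_norm iT) (int_norm iN).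
apply: (@dominated_integrable _ _ _ (fun x => `|(k \_ I01) x| + `|((k \_ I01) \o isom (-1) 0) x|)) => //.
- exact: measurable_funTS.
- by apply: (integrableS (@measurableT _ (measurableTypeR R)) mp _ i2).
move=> x px; rewrite /unfold_kernel rep_id// ger0_norm ?le_max ?lexx// ge_max addr_ge0//=.
rewrite /isom mulN1r addr0; have [x0|x0] := leP 0 x.
  by rewrite (ger0_norm x0) (le_trans (ler_norm _))// lerDl.
by rewrite (ltr0_norm x0) (le_trans (ler_norm _))// lerDr.
Qed.

Lemma clamp_weight (alpha : R -> R) : measurable_fun Rge0 alpha ->
  weight (fun t => clamp 0 1 ((alpha \_ Rge0) t)).
Proof.
move=> ma; split; last by move=> t; exact: clamp_itv.
by apply: measurable_clamp; apply/(measurable_restrictT _ (measurable_itv _)).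
Qed.

(** Both properties follow from the mean value theorem; the Lipschitz constant is the maximum of the
    continuous derivative on [[- B], [B]]. For negative [B] there is nothing to compare. *)
Lemma C1_damping (g : R -> R) : C1_line g -> g 0 = 0 -> (forall y, 0 <= derive1 g y) -> damping g.
Proof.
move=> [dg cg] g0 g'0; have dd (y : R) : is_derive y 1 g (derive1 g y) by exact: derivable_is_derive.
split => //.
- by apply: continuous_measurable_fun => y; exact: is_derive_continuous (dd y).
- move=> a b ab; have [c _ e] := mean_value ab dd.
  by rewrite -subr_ge0 e mulr_ge0// subr_ge0.
move=> B; have [B0|B0] := leP (- B) B; last first.
  exists 0 => // a b aB; have := le_trans (normr_ge0 _) aB.
  by move=> h; exfalso; lra.
have [|c _ hc] := @EVT_max R (derive1 g) (- B) B B0.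
  by apply: continuous_subspaceT => x; exact: cg.
exists (derive1 g c) => // a b aB bB.
wlog ab : a b aB bB / a <= b => [W|].
  have [ab|/ltW ba] := leP a b; first exact: W.
  by rewrite distrC (distrC a); exact: W.
have [x /andP[ax xb] e] := mean_value ab dd.
rewrite distrC (distrC a) e normrM (ger0_norm (g'0 x)); apply: ler_wpM2r => //.
apply: hc; rewrite in_itv/=; move: aB bB; rewrite !ler_norml => /andP[a1 _] /andP[_ b1].
by rewrite (le_trans a1 ax) (le_trans xb b1).
Qed.

(** The essential bounds are finite, as [f] is essentially bounded and I has positive measure; as
    real numbers they can serve in the clamps. *)
Lemma ess_bounds (f : R -> R) (B : R) : {ae leb, forall x, I01 x -> `|f x| <= B} ->
  exists i s, [/\ ess_inf lebI (EFin \o f) = i%:E, ess_sup lebI (EFin \o f) = s%:E, i <= s &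
    {ae leb, forall x, I01 x -> i <= f x <= s}].
Proof.
move=> fB; have mu0 : (0 < @lebI R setT)%E by rewrite lebI_setT lte01.
have up : {ae lebI, forall x, ((f x)%:E <= B%:E)%E}.
  apply/ae_lebI; apply: ae_imply fB => x /[apply]; rewrite ler_norml => /andP[_ h].
  by rewrite lee_fin.
have lo : {ae lebI, forall x, ((- B)%:E <= (f x)%:E)%E}.
  apply/ae_lebI; apply: ae_imply fB => x /[apply]; rewrite ler_norml => /andP[h _].
  by rewrite lee_fin.
have s1 : (ess_sup lebI (EFin \o f) <= B%:E)%E by apply/ess_supP.
have s2 : ((- B)%:E <= ess_sup lebI (EFin \o f))%E by exact: ess_sup_gee.
have i1 : ((- B)%:E <= ess_inf lebI (EFin \o f))%E by apply/ess_infP.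
have i2 : (ess_inf lebI (EFin \o f) <= ess_sup lebI (EFin \o f))%E.
  by apply: ess_sup_gee => //; exact: ess_inf_le.
have sge := ess_sup_ge lebI (EFin \o f); have ile := ess_inf_le lebI (EFin \o f).
case: (ess_sup lebI (EFin \o f)) s1 s2 i2 sge => [s| |]// s1 s2.
case: (ess_inf lebI (EFin \o f)) i1 ile => [i| |]// i1 ile i2 sge.
exists i, s; split => //.
apply/ae_lebI; apply: ae_imply (ae_and ile sge) => x [] /=; rewrite !lee_fin => -> ->.
by [].
Qed.

End CleanData.

Section InitialData.
Context {R : realType}.
Variables (rho0 J0 : R -> R).

Let fp0 x := (rho0 x + J0 x) / 2.
Let fm0 x := (rho0 x - J0 x) / 2.

(* The unfolding of the initial data, whose time variable is a dummy. *)
Definition unf0 (y : R) := unf (fun p => rho0 p.1) (fun p => J0 p.1) (y, 0).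

Lemma measurable_unf0 : measurable_fun I01 rho0 -> measurable_fun I01 J0 ->
  measurable_fun setT unf0.
Proof.
move=> mr mj; apply: measurable_section2.
have comp (f : R -> R) : measurable_fun I01 f -> measurable_fun strip (fun p : R * R => f p.1).
  move=> mf; apply: (measurable_comp (F := I01)) => //; first exact: measurable_I01.
  - by move=> _ [[x t] [/= Ix _] <-].
  - by apply: measurable_funTS; exact: measurable_fst.
by apply: measurable_unf; exact: comp.
Qed.

Lemma ae_unit (P : R -> Prop) : (forall x, 0 < x -> x < 1 -> P x) -> {ae leb, forall x, I01 x -> P x}.
Proof.
move=> h; have n0 : {ae leb, forall x : R, x <> 0} by exact: ae_neq.
have n1 : {ae leb, forall x : R, x <> 1} by exact: ae_neq.
apply: ae_imply (ae_and n0 n1) => x [/eqP x0 /eqP x1].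
rewrite /I01/= in_itv/= => /andP[x0' x1']; apply: h.
  by rewrite lt_neqAle eq_sym x0.
by rewrite lt_neqAle x1.
Qed.

Lemma unf0_range (m M : R) :
  {ae leb, forall x, I01 x -> m <= fp0 x <= M} -> {ae leb, forall x, I01 x -> m <= fm0 x <= M} ->
  {ae leb, forall y, m <= unf0 y <= M}.
Proof.
move=> hp hm; apply: ae_periodic; first by move=> y; rewrite /unf0 unf_periodic.
have u (x : R) : 0 < x -> x < 1 -> unf0 x = fp0 x /\ unf0 (- x) = fm0 x.
  by move=> x0 x1; rewrite /unf0 (unf_pos _ _ (ltW x0) x1 (lexx _)) (unf_neg _ _ x0 (ltW x1) (lexx _)).
apply/ae_fold; apply: ae_imply (ae_and (ae_unit u) (ae_and hp hm)) => x [h1 [h2 h3]] Ix.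
by have [-> ->] := h1 Ix; split; [exact: h2|exact: h3].
Qed.

Lemma weak_initial (k alpha g : R -> R) (rho J : R * R -> R) :
  weak_solution k alpha g rho0 J0 rho J -> {ae leb, forall y, unf rho J (y, 0) = unf0 y}.
Proof.
move=> ws; apply: ae_periodic; first by move=> y; rewrite /unf0 !unf_periodic.
have u (x : R) : 0 < x -> x < 1 ->
  [/\ unf0 x = fp0 x, unf0 (- x) = fm0 x, unf rho J (x, 0) = (rho (x, 0) + J (x, 0)) / 2 &
      unf rho J (- x, 0) = (rho (x, 0) - J (x, 0)) / 2].
  by move=> x0 x1; rewrite /unf0 !(unf_pos _ _ (ltW x0) x1 (lexx _)) !(unf_neg _ _ x0 (ltW x1) (lexx _)).
apply/ae_fold; apply: ae_imply (ae_and (ae_unit u) (ws_initial ws)) => x [h1 h2] Ix.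
by have [-> -> -> ->] := h1 Ix; have [-> ->] := h2 Ix.
Qed.

Lemma mild_initial (H : R * R -> R) : {ae leb, forall y, H (y, 0) = unf0 y} ->
  {ae leb, forall x, I01 x -> mild_rho H (x, 0) = rho0 x /\ mild_J H (x, 0) = J0 x}.
Proof.
move=> h; have u (x : R) : 0 < x -> x < 1 ->
    rho0 x = unf0 x + unf0 (- x) /\ J0 x = unf0 x - unf0 (- x).
  by move=> x0 x1; rewrite /unf0 (unf_pos _ _ (ltW x0) x1 (lexx _)) (unf_neg _ _ x0 (ltW x1) (lexx _)); split; field.
apply: ae_imply (ae_and (ae_unit u) (ae_and h (ae_reflect 0 h))) => x [h1].
rewrite sub0r => -[e1 e2] Ix; have [-> ->] := h1 Ix.
by rewrite /mild_rho /mild_J /eul/= !subr0 e1 e2.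
Qed.

Lemma unf_periodic0 : periodic2 unf0.
Proof. by move=> y; rewrite /unf0 unf_periodic. Qed.

End InitialData.

Theorem theorem1p1 (R : realType) (k g alpha rho0 J0 : R -> R)
    (k_L1 : leb.-integrable I01 (EFin \o k))
    (k_ge0 : {ae leb, forall x, I01 x -> 0 <= k x})
    (g_C1 : C1_line g) (g0 : g 0 = 0) (g'_ge0 : forall y, 0 <= derive1 g y)
    (alpha_meas : measurable_fun Rge0 alpha)
    (alpha_01 : {ae leb, forall t, Rge0 t -> 0 <= alpha t <= 1})
    (alpha_BV : BV_loc alpha)
    (rho0_Linfty : Linfty_I rho0) (J0_Linfty : Linfty_I J0)
    (rho0_mass : (\int[leb]_(x in I01) (rho0 x)%:E = 0)%E) :
  exists rho J : R * R -> R,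
    weak_solution k alpha g rho0 J0 rho J /\
    (forall rho' J' : R * R -> R, weak_solution k alpha g rho0 J0 rho' J' ->
      forall t, 0 <= t -> {ae leb, forall x, I01 x ->
        rho' (x, t) = rho (x, t) /\ J' (x, t) = J (x, t)}) /\
    (forall t, 0 < t -> (\int[leb]_(x in I01) (rho (x, t))%:E = 0)%E) /\
    (let fp p := (rho p + J p) / 2 in
     let fm p := (rho p - J p) / 2 in
     let fp0 x := (rho0 x + J0 x) / 2 in
     let fm0 x := (rho0 x - J0 x) / 2 in
     let M := maxe (ess_sup lebI (EFin \o fp0)) (ess_sup lebI (EFin \o fm0)) in
     let m := mine (ess_inf lebI (EFin \o fp0)) (ess_inf lebI (EFin \o fm0)) in
     {ae (leb \x leb)%E, forall p, (I01 `*` Rge0) p ->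
       [/\ (m <= (fp p)%:E <= M)%E, (m <= (fm p)%:E <= M)%E &
           (`|J p|%:E <= M - m)%E]}).
Proof.
pose fp0 x := (rho0 x + J0 x) / 2; pose fm0 x := (rho0 x - J0 x) / 2.
have [mr mj] : measurable_fun I01 rho0 /\ measurable_fun I01 J0.
  by split; [case: rho0_Linfty|case: J0_Linfty].
have [B1 _ hB1] := Linfty_bound rho0_Linfty; have [B2 _ hB2] := Linfty_bound J0_Linfty.
have half (x y : R) : `|x| <= B1 -> `|y| <= B2 ->
    `|(x + y) / 2| <= (B1 + B2) / 2 /\ `|(x - y) / 2| <= (B1 + B2) / 2.
  move=> hx hy; have := ler_normD x y; have := ler_normB x y.
  rewrite !normrM normfV (ger0_norm (ler0n _ 2)) => h1 h2.
  by split; apply: ler_wpM2r; rewrite ?invr_ge0// ; apply: le_trans (lerD hx hy).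
have bp : {ae leb, forall x, I01 x -> `|fp0 x| <= (B1 + B2) / 2}.
  apply: ae_imply (ae_and hB1 hB2) => x [h1 h2] Ix.
  by have [] := half _ _ (h1 Ix) (h2 Ix).
have bm : {ae leb, forall x, I01 x -> `|fm0 x| <= (B1 + B2) / 2}.
  apply: ae_imply (ae_and hB1 hB2) => x [h1 h2] Ix.
  by have [] := half _ _ (h1 Ix) (h2 Ix).
have [ip [sp [eip esp isp hp]]] := ess_bounds bp.
have [im [sm [eim esm ism hm]]] := ess_bounds bm.
pose m := Num.min ip im; pose M := Num.max sp sm.
have mM : m <= M by rewrite /m /M ge_min le_max isp.
have hp' : {ae leb, forall x, I01 x -> m <= fp0 x <= M}.
  apply: ae_imply hp => x /[apply] /andP[h1 h2].
  by rewrite /m /M ge_min h1 le_max h2.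
have hm' : {ae leb, forall x, I01 x -> m <= fm0 x <= M}.
  apply: ae_imply hm => x /[apply] /andP[h1 h2].
  by rewrite /m /M ge_min h1 le_max h2 !orbT.
have range0 := unf0_range hp' hm'.
(* Representatives that satisfy the hypotheses at every point replace [k] and [alpha];
   [weak_solution_ae] transfers weak solutions in both directions. *)
pose K := unfold_kernel k; pose A := fun t => clamp 0 1 ((alpha \_ Rge0) t).
have kK : kernel K := unfold_kernel_kernel k_L1.
have wA : weight A := clamp_weight alpha_meas.
have dg : damping g := C1_damping g_C1 g0 g'_ge0.
have kE : {ae leb, forall x, I01 x -> k x = K x}.
  by apply: ae_imply k_ge0 => x h Ix; rewrite /K unfold_kernelE// h.
have aE : {ae leb, forall t, Rge0 t -> alpha t = A t}.
  by apply: ae_imply alpha_01 => t h It; rewrite /A patchE mem_set// clamp_id// h.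
have mk : measurable_fun I01 k by apply/measurable_EFinP; exact: measurable_int k_L1.
have mK : measurable_fun I01 K by apply: measurable_funTS; exact: kernel_meas kK.
have mA : measurable_fun Rge0 A by apply: measurable_funTS; exact: weight_meas wA.
have mg := damping_meas dg.
have mu0 := measurable_unf0 mr mj.
(* By [range0], clamping changes the unfolded datum on a null set only, and it makes the bounds hold
   everywhere. *)
have H0m : measurable_fun setT (fun y => clamp m M (unf0 rho0 J0 y)) by exact: measurable_clamp.
have H0p : periodic2 (fun y => clamp m M (unf0 rho0 J0 y)) by move=> y; rewrite unf_periodic0.
have [H mH HH0] := mild_exists kK wA dg 0 mM H0m H0p (fun y => clamp_itv _ mM).
have init : {ae leb, forall y, H (y, 0) = unf0 rho0 J0 y}.
  by apply: ae_imply range0 => y h; rewrite HH0 clamp_id.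
have i0 := mild_initial init.
exists (mild_rho H), (mild_J H); split; [|split; [|split]].
- apply: (weak_solution_ae mK mk mA alpha_meas mg _ _ (mild_weak kK wA dg mH i0)).
    by apply: ae_imply kE => x h /h ->.
  by apply: ae_imply aE => x h /h ->.
- move=> rho' J' ws t t0; have ws' := weak_solution_ae mk mK alpha_meas mA mg kE aE ws.
  apply: (weak_unique kK wA dg ws' mH) => //.
  by apply: ae_imply (ae_and init (weak_initial ws)) => y [-> ->].
- move=> t /ltW t0; rewrite (mild_mass kK wA dg mH t0) -[RHS]rho0_mass.
  have mrr : measurable_fun setT (mild_rho H).
    apply: measurable_funD; last apply: measurable_oppfst; exact: measurable_eul (mild_meas mH).
  apply: ae_eq_integral.
  + exact: measurable_I01.
  + by apply: measurable_funTS; apply/measurable_EFinP; exact: measurable_section2.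
  + exact/measurable_EFinP.
  + by apply: ae_imply i0 => x h /h[-> _].
(* The bounds hold at every point, hence almost everywhere; [J] is a difference of two values
   between [m] and [M]. *)
move=> fp fm fp0' fm0' M' m'; apply: ae_all => -[x t] _.
have -> : M' = M%:E by rewrite /M' esp esm /M EFin_max.
have -> : m' = m%:E by rewrite /m' eip eim /m EFin_min.
have -> : fp (x, t) = eul H (x, t) by rewrite /fp /mild_rho /mild_J/=; field.
have -> : fm (x, t) = eul H (- x, t) by rewrite /fm /mild_rho /mild_J/=; field.
have bp' := mild_bound mH (x - t, t); have bm' := mild_bound mH (- x - t, t).
have -> : (M%:E - m%:E = (M - m)%:E)%E by [].
rewrite !lee_fin; split; [exact: bp'|exact: bm'|].
move: bp' bm' => /andP[+ +] /andP[+ +].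
rewrite /mild_J /eul/= ler_norml; move: (H _) (H _) => x1 x2 h1 h2 h3 h4.
by apply/andP; split; clear - h1 h2 h3 h4; lra.
Qed.
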